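(* Let $X$ and $Y$ be i.i.d.\ $\mathbb{Z}$-processes taking values in Polish spaces $\mathcal{A}$ and $\mathcal{B}$ respectively, with equal entropy. Then they are topo-finitarily isomorphic: there is a shift-equivariant measurable map $\phi:\mathcal{A}^\mathbb{Z}\to\mathcal{B}^\mathbb{Z}$ which restricts to a homeomorphism between sets of full measure and such that $\phi(X)$ has the distribution of $Y$.
   Context: The entropy of an i.i.d.\ process is its Kolmogorov–Sinai entropy (which equals the Shannon entropy of one coordinate when this is finite and is infinite otherwise, in particular infinite for non-atomic marginals). Sets of full measure refer to the laws of $X$ and $Y$ respectively. *)

(* Defs.v *)
From HB Require Import structures.
From mathcomp Require Import all_boot all_order all_algebra.
From mathcomp Require Import all_classical all_reals all_analysis.
Set Implicit Arguments.
Unset Strict Implicit.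
Unset Printing Implicit Defensive.
Import Order.TTheory GRing.Theory Num.Theory.
Local Open Scope classical_set_scope.
Local Open Scope ring_scope.

Definition polish (R : realType) (T : ptopologicalType) : Prop :=
  (exists d : T -> T -> R,
    [/\ (forall x y, 0 <= d x y) /\ (forall x y, d x y = 0 <-> x = y),
        (forall x y, d x y = d y x),
        (forall x y z, d x z <= d x y + d y z),
        (forall U : set T, open U <->
           (forall x, U x -> exists2 e : R, 0 < e & [set y | d x y < e] `<=` U)) &
        (forall u : nat -> T,
           (forall e : R, 0 < e -> exists N : nat, forall m n : nat,
              (N <= m)%N -> (N <= n)%N -> d (u m) (u n) < e) ->
           exists l : T, u @ \oo --> l)])
  /\ (exists D : set T, countable D /\ closure D = setT).

Definition borelT (T : ptopologicalType) := g_sigma_algebraType (@open T).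

Definition seqsp (A : ptopologicalType) := {ptws int -> A}.

Definition cyl_gen (A : ptopologicalType) : set (set (seqsp A)) :=
  [set C | exists (i : int) (B : set (borelT A)),
      measurable B /\ C = [set x : seqsp A | B (x i)]].

Definition seqT (A : ptopologicalType) := g_sigma_algebraType (@cyl_gen A).

Definition zshift (A : Type) (x : int -> A) : int -> A := fun n => x (n + 1).

Definition iid_law (R : realType) (A : ptopologicalType)
  (p : probability (borelT A) R) (mu : probability (seqT A) R) : Prop :=
  forall (s : seq int) (Bs : int -> set (borelT A)),
    uniq s -> (forall i, measurable (Bs i)) ->
    mu [set x : seqT A | forall i, i \in s -> Bs i (x i)] =
    (\prod_(i <- s) p (Bs i))%E.

Definition atoms (R : realType) (A : ptopologicalType)
  (p : probability (borelT A) R) : set (borelT A) :=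
  [set a | (0 < p [set a])%E].

(** Shannon entropy of the marginal (natural log): the sum of
    -p{a} log p{a} over atoms if p is purely atomic, +oo otherwise
    (a measure with a non-atomic part has infinite Shannon entropy). *)
Definition entropy (R : realType) (A : ptopologicalType)
  (p : probability (borelT A) R) : \bar R :=
  if pselect ((\esum_(a in atoms p) p [set a])%E = 1%E)
  then (\esum_(a in atoms p)
          (- (fine (p [set a]) * ln (fine (p [set a]))))%:E)%E
  else +oo%E.

(** Kolmogorov--Sinai entropy of the i.i.d. process with marginal [p]
    (equal to the Shannon entropy of one coordinate). *)
Definition iid_entropy (R : realType) (A : ptopologicalType)
  (p : probability (borelT A) R) : \bar R := entropy p.

(* Main.v *)
Require Import Defs.
From HB Require Import structures.
From mathcomp Require Import all_boot all_order all_algebra.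
From mathcomp Require Import all_classical all_reals all_analysis.
From mathcomp Require Import zify ring lra.
From mathcomp Require finmap.
Set Implicit Arguments.
Unset Strict Implicit.
Unset Printing Implicit Defensive.
Import Order.TTheory GRing.Theory Num.Theory.
Local Open Scope ring_scope.

(** The proof is a Keane--Smorodinsky marker-and-filler argument, with letters
    refined level by level.

    Letters are infinite bit strings, seen at level [r] through their first [r]
    bits, and an i.i.d. law is the function [P] giving the probability of each
    bit prefix.  Two such laws with a non-overlapping marker word of the same
    length and probability have the same law of marker positions; cutting at
    long marker-free stretches yields a hierarchy of blocks, and conditionally on
    the positions the names of the blocks (the fillers) are independent on either
    side.  At stage [j] the fillers of the two sides are coupled block by block,
    refining the product of the couplings of stage [j - 1].  The side [odd j] is
    seen at a level whose entropy rate lies between the rates used so far on the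
    other side and the common entropy; an extremal coupling then has so few edges
    that most names on that side have a single partner, so they determine the
    coarser name of the other side.  A symbol decoded at some stage stays decoded,
    which makes the limit maps continuous and mutually inverse on sets of full
    measure.

    Laws of equal entropy need not share a marker probability: for a set [V] of
    letters of mass [c], the marker [V U ... U] of length [k + 1] has probability
    [c * (1 - c) ^ k], and for large [k] the same value is attained at a mass so
    small that independent bits of the two required masses, completed by further
    independent bits, have the prescribed entropy.  That source is isomorphic to
    both.

    A Polish alphabet is coded by membership in balls around a dense sequence,
    with radii chosen so that the spheres are null; off the spheres the code is a
    homeomorphism onto a Borel set, and the entropies of the finite codes increase
    to the entropy of the marginal. *)

(** * Sums and finite words *)

Section SeqSums.
Context {R : numDomainType} {T : eqType}.
Implicit Types (s : seq T) (F : T -> R).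

Lemma ler_sum_seq s (F G : T -> R) : {in s, forall x, F x <= G x} ->
  \sum_(x <- s) F x <= \sum_(x <- s) G x.
Proof. by move=> h; rewrite big_seq [leRHS]big_seq; exact: ler_sum. Qed.

Lemma sumr_ge0_seq s F : {in s, forall x, 0 <= F x} -> 0 <= \sum_(x <- s) F x.
Proof. by move=> h; rewrite big_seq sumr_ge0. Qed.

Lemma ler_sum_mem s F x : x \in s -> {in s, forall y, 0 <= F y} -> F x <= \sum_(y <- s) F y.
Proof.
move=> xs F0; rewrite (big_rem x)//= lerDl sumr_ge0_seq// => y /mem_rem; exact: F0.
Qed.

Lemma sumr_gt0_seq s F x : x \in s -> {in s, forall y, 0 <= F y} -> 0 < F x ->
  0 < \sum_(y <- s) F y.
Proof. by move=> xs F0 Fx; apply: lt_le_trans Fx (ler_sum_mem xs F0). Qed.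

Lemma ltr_sum_mem s F x y : uniq s -> x \in s -> y \in s -> x != y ->
  {in s, forall z, 0 <= F z} -> 0 < F y -> F x < \sum_(z <- s) F z.
Proof.
move=> us xs ys xy F0 Fy; rewrite (big_rem x)//= ltrDl.
apply: (@sumr_gt0_seq _ _ y) => //; last by move=> z /mem_rem; exact: F0.
by rewrite mem_rem_uniq// inE eq_sym xy.
Qed.

Lemma sum_pred1_seq s F x : uniq s -> x \in s -> \sum_(y <- s) (y == x)%:R * F y = F x.
Proof.
move=> us xs; rewrite (big_rem x)//= eqxx mul1r big_seq big1 ?addr0// => y.
by rewrite mem_rem_uniq// inE => /andP[/negbTE -> _]; rewrite mul0r.
Qed.

Lemma sum_indicator_uniq_le s (p : pred T) (E : bool) : uniq s ->
  {in s &, forall x y, p x -> p y -> x = y} -> {in s, forall x, p x -> E} ->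
  \sum_(x <- s) (p x)%:R <= E%:R :> R.
Proof.
move=> us p_uniq pE; have [/hasP[x xs px]|/hasPn np] := boolP (has p s); last first.
  by rewrite big_seq big1// => x /np /negbTE ->.
rewrite (pE x xs px) -[leRHS](sum_pred1_seq (fun=> 1) us xs); apply: ler_sum_seq => y ys.
by rewrite mulr1 ler_nat; case: (boolP (p y)) => // py; rewrite (p_uniq y x)// eqxx.
Qed.

End SeqSums.

Section Words.
Context {R : numDomainType} {I : Type} {T : eqType}.
Implicit Types (sp : I -> seq T) (m : I -> T -> R) (s : seq I) (w : seq T).

Fixpoint words sp s : seq (seq T) :=
  if s is i :: s' then [seq a :: w | a <- sp i, w <- words sp s'] else [:: [::]].

Fixpoint word_wt m s w : R :=
  match s, w with
  | i :: s', a :: w' => m i a * word_wt m s' w'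
  | [::], [::] => 1
  | _, _ => 0
  end.

Lemma big_words_cons sp i s (F : seq T -> R) :
  \sum_(w <- words sp (i :: s)) F w =
  \sum_(a <- sp i) \sum_(w <- words sp s) F (a :: w).
Proof. by rewrite /= big_allpairs_dep. Qed.

Lemma size_in_words sp s w : w \in words sp s -> size w = size s.
Proof.
elim: s w => [|i s IH] w /=; first by rewrite inE => /eqP ->.
by case/allpairsP => -[a v] /= [_ hv ->]; rewrite /= (IH _ hv).
Qed.

Lemma in_words_cons sp i s a w :
  (a :: w \in words sp (i :: s)) = (a \in sp i) && (w \in words sp s).
Proof.
apply/allpairsP/andP => [[[a' w'] /= [ha hw [-> ->]]]//|[ha hw]].
by exists (a, w).
Qed.

Lemma words_uniq sp s : (forall i, uniq (sp i)) -> uniq (words sp s).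
Proof.
move=> hu; elim: s => //= i s IH.
by apply: allpairs_uniq => // -[a w] [a' w'] _ _ /= [-> ->].
Qed.

Lemma in_words_cat sp s1 s2 w1 w2 : size w1 = size s1 ->
  (w1 ++ w2 \in words sp (s1 ++ s2)) = (w1 \in words sp s1) && (w2 \in words sp s2).
Proof.
elim: s1 w1 => [|i s IH] [|a w1] //= [hs].
by rewrite -/(words sp (i :: (s ++ s2))) -/(words sp (i :: s)) !in_words_cons IH // andbA.
Qed.

Lemma big_words_cat sp s1 s2 (F : seq T -> R) :
  \sum_(w <- words sp (s1 ++ s2)) F w =
  \sum_(w1 <- words sp s1) \sum_(w2 <- words sp s2) F (w1 ++ w2).
Proof.
elim: s1 F => [|i s IH] F; first by rewrite /= big_seq1.
rewrite cat_cons !big_words_cons; apply: eq_bigr => a _.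
by rewrite IH.
Qed.

Lemma word_wt_cat m s1 s2 w1 w2 : size w1 = size s1 ->
  word_wt m (s1 ++ s2) (w1 ++ w2) = word_wt m s1 w1 * word_wt m s2 w2.
Proof.
elim: s1 w1 => [|i s IH] [|a w1] //=; first by rewrite mul1r.
by move=> [hs]; rewrite IH // mulrA.
Qed.

Lemma word_wt_ge0 m s w : (forall i a, 0 <= m i a) -> 0 <= word_wt m s w.
Proof.
move=> m0; elim: s w => [|i s IH] [|a w] //=; exact: mulr_ge0.
Qed.

Lemma word_wt_gt0 sp m s w : (forall i a, a \in sp i -> 0 < m i a) ->
  w \in words sp s -> 0 < word_wt m s w.
Proof.
move=> m0; elim: s w => [|i s IH] [|a w] //; first by move=> /size_in_words.
by rewrite in_words_cons => /andP[ha hw]; rewrite /= mulr_gt0 ?m0 ?IH.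
Qed.

Lemma sum_word_wt sp m s : (forall i, \sum_(a <- sp i) m i a = 1) ->
  \sum_(w <- words sp s) word_wt m s w = 1.
Proof.
move=> m1; elim: s => [|i s IH]; first by rewrite /= big_seq1.
rewrite big_words_cons -[RHS](m1 i); apply: eq_bigr => a _ /=.
by rewrite -mulr_sumr IH mulr1.
Qed.

Lemma sum_word_wt_cat sp m s1 s2 (F G : seq T -> R) :
  \sum_(w1 <- words sp s1) \sum_(w2 <- words sp s2)
     word_wt m (s1 ++ s2) (w1 ++ w2) * (F w1 * G w2) =
  (\sum_(w <- words sp s1) word_wt m s1 w * F w) *
  (\sum_(w <- words sp s2) word_wt m s2 w * G w).
Proof.
rewrite mulr_suml [LHS]big_seq [RHS]big_seq; apply: eq_bigr => w1 h1.
rewrite mulr_sumr; apply: eq_bigr => w2 _.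
by rewrite word_wt_cat ?(size_in_words h1) //; rewrite mulrACA.
Qed.

End Words.

Lemma size_words (I : Type) (T : eqType) (sp : I -> seq T) s :
  size (words sp s) = (\prod_(i <- s) size (sp i))%N.
Proof.
elim: s => [|i s IH]; first by rewrite big_nil.
by rewrite /= size_allpairs IH big_cons.
Qed.

Section MapWord.
Context {R : numDomainType} {I : Type} {T T' : eqType}.
Variables (sp : I -> seq T) (m : I -> T -> R) (sp' : I -> seq T') (m' : I -> T' -> R).
Variable f : I -> T -> T'.

Fixpoint map_word (s : seq I) (w : seq T) : seq T' :=
  match s, w with
  | i :: s', a :: w' => f i a :: map_word s' w'
  | _, _ => [::]
  end.

Lemma map_word_in s w : (forall i a, a \in sp i -> f i a \in sp' i) ->
  w \in words sp s -> map_word s w \in words sp' s.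
Proof.
move=> h; elim: s w => [|i s IH] [|a w] //; first by move=> /size_in_words.
by rewrite in_words_cons => /andP[ha hw]; rewrite [map_word _ _]/= in_words_cons h // IH.
Qed.

Lemma sum_map_word s (F : seq T' -> R) :
  (forall i (G : T' -> R), \sum_(a <- sp i) m i a * G (f i a) =
     \sum_(a <- sp' i) m' i a * G a) ->
  \sum_(w <- words sp s) word_wt m s w * F (map_word s w) =
  \sum_(w <- words sp' s) word_wt m' s w * F w.
Proof.
move=> f_push; elim: s F => [|i s IH] F; first by rewrite /= !big_seq1.
rewrite !big_words_cons /=.
pose G a' := \sum_(w <- words sp' s) word_wt m' s w * F (a' :: w).
transitivity (\sum_(a <- sp i) m i a * G (f i a)).
  apply: eq_bigr => a _; rewrite /G -(IH (fun w => F (f i a :: w))) mulr_sumr.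
  by apply: eq_bigr => w _; rewrite mulrA.
rewrite f_push; apply: eq_bigr => a _; rewrite /G mulr_sumr.
by apply: eq_bigr => w _; rewrite mulrA.
Qed.

End MapWord.

Lemma take_mkseq (T : Type) (f : nat -> T) r r' : (r' <= r)%N -> take r' (mkseq f r) = mkseq f r'.
Proof. by move=> /minn_idPl h; rewrite /mkseq -map_take take_iota h. Qed.

Lemma mkseq_eq_nth (T : Type) (f g : nat -> T) r k :
  mkseq f r = mkseq g r -> (k < r)%N -> f k = g k.
Proof. by move=> h hk; rewrite -(nth_mkseq (f 0%N) f hk) h nth_mkseq. Qed.

Lemma mkseq_eq_le (T : Type) (f g : nat -> T) r r' : (r <= r')%N ->
  mkseq f r' = mkseq g r' -> mkseq f r = mkseq g r.
Proof. by move=> h e; rewrite -(take_mkseq f h) e take_mkseq. Qed.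

Lemma map_take_id (T : eqType) r (w : seq (seq T)) :
  all (fun a => size a == r) w -> map (take r) w = w.
Proof. by move=> /allP h; apply: map_id_in => a /h /eqP <-; exact: take_size. Qed.

Lemma eq_in_mkseq (T : Type) (f g : nat -> T) r : (forall k, (k < r)%N -> f k = g k) ->
  mkseq f r = mkseq g r.
Proof. by move=> h; apply/eq_in_map => k; rewrite mem_iota => /h. Qed.

(** * Couplings with few ambiguous points *)

Lemma exists_left_kernel (F : fieldType) m n (A : 'M[F]_(m, n)) : (n < m)%N ->
  exists2 z : 'rV_m, z != 0 & z *m A = 0.
Proof.
move=> ltnm; exists (nz_row (kermx A)); last by apply/sub_kermxP; exact: nz_row_sub.
by rewrite nz_row_eq0 -mxrank_eq0 mxrank_ker subn_eq0 -ltnNge (leq_ltn_trans (rank_leq_col A)).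
Qed.

Section SparseCoupling.
Context {R : realFieldType} (U V : finType).
Implicit Types (c f : U -> V -> R) (E : {set U * V}).

Definition coupling_support c : {set U * V} := [set e | c e.1 e.2 != 0].

Definition edge_weight E (z : 'rV[R]_#|E|) u v : R := \sum_(e < #|E| | enum_val e == (u, v)) z 0 e.

Lemma edge_weight_enum_val E z (e : 'I_#|E|) :
  edge_weight z (enum_val e).1 (enum_val e).2 = z 0 e.
Proof.
rewrite /edge_weight (eq_bigl (pred1 e)) ?big_pred1_eq// => e' /=.
by rewrite -surjective_pairing (inj_eq enum_val_inj).
Qed.

Lemma edge_weight_neq0 E (z : 'rV[R]_#|E|) u v : edge_weight z u v != 0 -> (u, v) \in E.
Proof.
apply: contra_neqT => h; rewrite /edge_weight big_pred0// => e.
by apply/negP => /eqP he; move: h; rewrite -he enum_valP.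
Qed.

Lemma sum_edge_weight_row E (z : 'rV[R]_#|E|) u :
  \sum_v edge_weight z u v = \sum_e z 0 e * ((enum_val e).1 == u)%:R.
Proof.
rewrite /edge_weight (exchange_big_dep xpredT)//=; apply: eq_bigr => e _.
case: (enum_val e) => a b /=; have [->|ne] := eqVneq a u.
  rewrite (eq_bigl (pred1 b)) ?big_pred1_eq ?mulr1// => v /=.
  by rewrite xpair_eqE eqxx /= eq_sym.
by rewrite big_pred0 ?mulr0// => v; rewrite xpair_eqE (negbTE ne).
Qed.

Lemma sum_edge_weight_col E (z : 'rV[R]_#|E|) v :
  \sum_u edge_weight z u v = \sum_e z 0 e * ((enum_val e).2 == v)%:R.
Proof.
rewrite /edge_weight (exchange_big_dep xpredT)//=; apply: eq_bigr => e _.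
case: (enum_val e) => a b /=; have [->|ne] := eqVneq b v.
  rewrite (eq_bigl (pred1 a)) ?big_pred1_eq ?mulr1// => u /=.
  by rewrite xpair_eqE eqxx /= andbT eq_sym.
by rewrite big_pred0 ?mulr0// => u; rewrite xpair_eqE (negbTE ne) andbF.
Qed.

Definition incidence E : 'M[R]_(#|E|, #|{: U + V}|) :=
  \matrix_(e, k) match enum_val k with
    | inl u => ((enum_val e).1 == u)%:R
    | inr v => ((enum_val e).2 == v)%:R
    end.

(* More edges than vertices: the kernel of the incidence matrix is nontrivial. *)
Lemma exists_zero_marginals E : (#|U| + #|V| < #|E|)%N ->
  exists f, [/\ forall u v, f u v != 0 -> (u, v) \in E,
    exists u v, f u v < 0, forall u, \sum_v f u v = 0 & forall v, \sum_u f u v = 0].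
Proof.
rewrite -card_sum => /(exists_left_kernel (incidence E)) [z z0 zA].
have row0 u : \sum_v edge_weight z u v = 0.
  have := congr1 (fun y : 'rV_ _ => y 0 (enum_rank (inl u))) zA.
  rewrite !mxE sum_edge_weight_row => zAu.
  by rewrite -[RHS]zAu; apply: eq_bigr => e _; rewrite mxE enum_rankK.
have col0 v : \sum_u edge_weight z u v = 0.
  have := congr1 (fun y : 'rV_ _ => y 0 (enum_rank (inr v))) zA.
  rewrite !mxE sum_edge_weight_col => zAu.
  by rewrite -[RHS]zAu; apply: eq_bigr => e _; rewrite mxE enum_rankK.
exists (edge_weight z); split=> //; first exact: edge_weight_neq0.
have [e ze] := rV0Pn _ z0; apply: contrapT => nneg.
have f_ge0 u v : 0 <= edge_weight z u v.
  by rewrite leNgt; apply/negP => ?; apply: nneg; exists u, v.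
have := row0 (enum_val e).1; rewrite (bigD1 (enum_val e).2)//= => /eqP.
rewrite paddr_eq0//; last by apply: sumr_ge0.
by rewrite edge_weight_enum_val (negbTE ze).
Qed.

(* Adding a multiple of a signed function with zero marginals keeps the marginals;
   the largest multiple that keeps the coupling nonnegative kills an edge. *)
Lemma remove_edge c : (forall u v, 0 <= c u v) -> (#|U| + #|V| < #|coupling_support c|)%N ->
  exists c', [/\ forall u v, 0 <= c' u v, coupling_support c' \proper coupling_support c,
    forall u, \sum_v c' u v = \sum_v c u v & forall v, \sum_u c' u v = \sum_u c u v].
Proof.
move=> c0 /exists_zero_marginals [f [fE [u0 [v0 f0]] frow fcol]].
pose ratio (e : U * V) := c e.1 e.2 / - f e.1 e.2.
case: (@Order.TotalTheory.arg_minP _ _ _ (u0, v0) (fun e => f e.1 e.2 < 0) ratio f0)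
  => -[u1 v1] /= f1 ratio_min.
set t := ratio (u1, v1) in ratio_min.
have t0 : 0 <= t by rewrite /t /ratio /= divr_ge0 ?oppr_ge0 ?(ltW f1).
exists (fun u v => c u v + t * f u v); split.
- move=> u v; case: (ltP (f u v) 0) => hf; last by apply: addr_ge0 => //; apply: mulr_ge0.
  have := ratio_min (u, v) hf; rewrite {1}/ratio /= ler_pdivlMr ?oppr_gt0//.
  by rewrite mulrN -subr_ge0 opprK.
- apply/properP; split.
    apply/fintype.subsetP => -[u v]; rewrite !inE /=; apply: contra => /eqP cuv.
    rewrite cuv add0r; have [->|/fE] := eqVneq (f u v) 0; first by rewrite mulr0.
    by rewrite inE /= cuv eqxx.
  exists (u1, v1); first by apply: fE; rewrite lt_eqF.
  by rewrite inE negbK /= /t /ratio /= invrN mulrN mulNr divfK ?subrr// lt_eqF.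
- by move=> u; rewrite big_split /= -mulr_sumr frow mulr0 addr0.
- by move=> v; rewrite big_split /= -mulr_sumr fcol mulr0 addr0.
Qed.

Lemma exists_sparse_coupling c : (forall u v, 0 <= c u v) ->
  exists c', [/\ forall u v, 0 <= c' u v, coupling_support c' \subset coupling_support c,
    forall u, \sum_v c' u v = \sum_v c u v, forall v, \sum_u c' u v = \sum_u c u v &
    (#|coupling_support c'| <= #|U| + #|V|)%N].
Proof.
have [n] := ubnP #|coupling_support c|; elim: n c => // n IH c; rewrite ltnS => cn c0.
have [sparse|dense] := leqP #|coupling_support c| (#|U| + #|V|); first by exists c.
have [c1 [c1_ge0 c1c c1row c1col]] := remove_edge c0 dense.
have [||c' [c'_ge0 c'c c'row c'col c'_sparse]] := IH c1 => //.
  exact: leq_trans (proper_card c1c) cn.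
exists c'; split=> // [|u|v]; first exact: fintype.subset_trans c'c (proper_sub c1c).
  by rewrite c'row.
by rewrite c'col.
Qed.

Lemma card_coupling_support c :
  #|coupling_support c| = (\sum_u #|[set v | c u v != 0%R]|)%N.
Proof.
rewrite -sum1_card (partition_big fst xpredT)//=; apply: eq_bigr => u _.
rewrite -sum1_card (reindex (fun v => (u, v))) /=; last first.
  by exists snd => [v//|[a b]]; rewrite !inE /= => /andP[_ /eqP ->].
by apply: eq_bigl => v; rewrite !inE /= eqxx andbT.
Qed.

Lemma card_branching_le c : (#|coupling_support c| <= #|U| + #|V|)%N ->
  (forall u, exists v, c u v != 0) ->
  (#|[set u | (1 < #|[set v | c u v != 0%R]|)%N]| <= #|V|)%N.
Proof.
move=> sparse cu; set B := [set u | _]; rewrite -(leq_add2l #|U|); apply: leq_trans sparse.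
have -> : #|B| = (\sum_u (u \in B))%N.
  by rewrite -sum1_card big_mkcond /=; apply: eq_bigr => u _; case: (u \in B).
rewrite card_coupling_support -[#|U|]sum1_card -big_split /=.
apply: leq_sum => u _; rewrite inE; case: ltnP => // _.
by have [v cuv] := cu u; rewrite card_gt0; apply/set0Pn; exists v; rewrite inE.
Qed.

End SparseCoupling.

Section Labels.
Context {R : realFieldType} {L : choiceType}.

Definition labels (T : eqType) (W : seq T) (la : T -> L) : seq L := undup (map la W).

Lemma labels_mem (T : eqType) (W : seq T) (la : T -> L) w : w \in W -> la w \in labels W la.
Proof. by move=> wW; rewrite mem_undup map_f. Qed.

Lemma labelsP (T : eqType) (W : seq T) (la : T -> L) (u : seq_sub (labels W la)) :
  exists2 w, w \in W & la w = val u.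
Proof. by have := valP u; rewrite mem_undup => /mapP[w wW ->]; exists w. Qed.

Lemma sum_by_label (T : eqType) (W : seq T) (la : T -> L) (F : T -> R) :
  \sum_(w <- W) F w = \sum_(u : seq_sub (labels W la)) \sum_(w <- W | la w == val u) F w.
Proof.
rewrite (exchange_big_dep xpredT)//= [LHS]big_seq [RHS]big_seq; apply: eq_bigr => w wW.
by rewrite (eq_bigl (pred1 (SeqSub (labels_mem la wW)))) ?big_pred1_eq.
Qed.

Definition label_mass (T : eqType) (W : seq T) (a : T -> R) (la : T -> L) l :=
  \sum_(w <- W | la w == l) a w.

Lemma label_mass_gt0 (T : eqType) (W : seq T) (a : T -> R) (la : T -> L)
  (u : seq_sub (labels W la)) : {in W, forall w, 0 < a w} -> 0 < label_mass W a la (val u).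
Proof.
move=> a0; have [w wW <-] := labelsP u; rewrite /label_mass big_mkcond /=.
apply: (@sumr_gt0_seq _ _ _ _ w) => //; last by rewrite eqxx a0.
by move=> y yW /=; case: ifP => // _; exact: ltW (a0 y yW).
Qed.

Definition ambiguous (T : eqType) (W : seq T) (la : T -> L) (g : L -> L -> R) l : bool :=
  has (fun w => has (fun w' => [&& la w != la w', 0 < g l (la w) & 0 < g l (la w')]) W) W.

Context {T1 T2 : eqType}.

Definition joint_mass (W1 : seq T1) (W2 : seq T2) a b (la : T1 -> L) (lb : T2 -> L)
    (G : T1 -> T2 -> R) l l' : R :=
  \sum_(w <- W1 | la w == l) \sum_(w' <- W2 | lb w' == l') a w * b w' * G w w'.

Definition label_density (W1 : seq T1) (W2 : seq T2) (a : T1 -> R) (b : T2 -> R)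
    (la : T1 -> L) (lb : T2 -> L)
    (c : seq_sub (labels W1 la) -> seq_sub (labels W2 lb) -> R) (l l' : L) : R :=
  if insub l is Some u then
    if insub l' is Some v then c u v / (label_mass W1 a la l * label_mass W2 b lb l') else 0
  else 0.

End Labels.

Section LabelDensity.
Context {R : realFieldType} {L : choiceType} {T1 T2 : eqType}.
Variables (W1 : seq T1) (W2 : seq T2) (a : T1 -> R) (b : T2 -> R) (la : T1 -> L) (lb : T2 -> L).
Hypothesis a_gt0 : {in W1, forall w, 0 < a w}.
Hypothesis b_gt0 : {in W2, forall w, 0 < b w}.
Local Notation U := (seq_sub (labels W1 la)).
Local Notation V := (seq_sub (labels W2 lb)).
Local Notation A := (label_mass W1 a la).
Local Notation B := (label_mass W2 b lb).

Lemma joint_mass_ge0 (G : T1 -> T2 -> R) l l' : (forall w w', 0 <= G w w') ->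
  0 <= joint_mass W1 W2 a b la lb G l l'.
Proof.
move=> G0; rewrite /joint_mass big_seq_cond sumr_ge0// => w /andP[wW _].
rewrite big_seq_cond sumr_ge0// => w' /andP[wW' _].
by rewrite !mulr_ge0 ?G0 ?ltW ?a_gt0 ?b_gt0.
Qed.

Lemma sum_joint_mass (G : T1 -> T2 -> R) l :
  {in W1, forall w, \sum_(w' <- W2) b w' * G w w' = 1} ->
  \sum_(v : V) joint_mass W1 W2 a b la lb G l (val v) = A l.
Proof.
move=> G1; rewrite exchange_big /= [LHS]big_seq_cond [RHS]big_seq_cond.
apply: eq_bigr => w /andP[wW _].
rewrite -(sum_by_label _ lb (fun w' => a w * b w' * G w w')) -[RHS]mulr1 -(G1 _ wW) mulr_sumr.
by apply: eq_bigr => w' _; rewrite mulrA.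
Qed.

Lemma joint_mass_neq0 (G : T1 -> T2 -> R) w w' : w \in W1 -> w' \in W2 ->
  {in W1 &, forall w1 w2, la w1 = la w2 -> {in W2, forall y, G w1 y = G w2 y}} ->
  {in W2 &, forall w1 w2, lb w1 = lb w2 -> {in W1, forall x, G x w1 = G x w2}} ->
  joint_mass W1 W2 a b la lb G (la w) (lb w') != 0 -> G w w' != 0.
Proof.
move=> wW wW' G_la G_lb; apply: contra_neq => Gww'.
rewrite /joint_mass big_seq_cond big1// => x /andP[xW /eqP xw].
rewrite big_seq_cond big1// => y /andP[yW /eqP yw].
by rewrite (G_la x w)// (G_lb y w')// Gww' mulr0.
Qed.

Section Coupling.
Variable c : U -> V -> R.
Hypothesis c_ge0 : forall u v, 0 <= c u v.
Hypothesis c_row : forall u, \sum_v c u v = A (val u).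
Local Notation g := (label_density a b c).

Lemma label_densityE (u : U) (v : V) : g (val u) (val v) = c u v / (A (val u) * B (val v)).
Proof. by rewrite /label_density !valK. Qed.

Lemma label_density_ge0 l l' : 0 <= g l l'.
Proof.
rewrite /label_density; case: insubP => // u _ <-; case: insubP => // v _ <-.
by rewrite divr_ge0// mulr_ge0// ltW// label_mass_gt0.
Qed.

Lemma label_density_gt0 (u : U) (v : V) : (0 < g (val u) (val v)) = (c u v != 0).
Proof.
rewrite label_densityE pmulr_lgt0; first by rewrite lt_neqAle c_ge0 andbT eq_sym.
by rewrite invr_gt0 mulr_gt0// label_mass_gt0.
Qed.

Lemma sum_label_density w : w \in W1 -> \sum_(w' <- W2) b w' * g (la w) (lb w') = 1.
Proof.
move=> wW; pose u : U := SeqSub (labels_mem la wW); rewrite -[la w]/(val u).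
have Au : A (val u) != 0 by rewrite gt_eqF// label_mass_gt0.
rewrite (sum_by_label _ lb) (eq_bigr (fun v => c u v / A (val u))).
  by rewrite -mulr_suml c_row divff.
move=> v _; rewrite (eq_bigr (fun w' => b w' * g (val u) (val v))); last by move=> w' /eqP ->.
rewrite -mulr_suml -/(B (val v)) label_densityE.
by field; rewrite Au gt_eqF// label_mass_gt0.
Qed.

Lemma size_ambiguous_le : (#|coupling_support c| <= #|{: U}| + #|{: V}|)%N ->
  (size (labels [seq w <- W1 | ambiguous W2 lb g (la w)] la) <= size (labels W2 lb))%N.
Proof.
move=> c_sparse; rewrite -[leqRHS](card_seq_sub (undup_uniq _)).
have c_neq0 u : exists v, c u v != 0.
  apply: contrapT => h; have : \sum_v c u v = 0.
    by apply: big1 => v _; apply/eqP; apply: contrapT => /negP hv; apply: h; exists v.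
  by rewrite c_row => /eqP; rewrite gt_eqF// label_mass_gt0.
apply: leq_trans (card_branching_le c_sparse c_neq0).
rewrite [leqRHS]cardE -[leqRHS](size_map val); apply: uniq_leq_size; first exact: undup_uniq.
move=> l; rewrite mem_undup => /mapP[w]; rewrite mem_filter => /andP[amb wW] ->.
rewrite -[la w]/(val (SeqSub (labels_mem la wW))) map_f// mem_enum inE.
have /hasP[w1 w1W /hasP[w2 w2W /and3P[ne]]] := amb.
rewrite -[la w]/(val (SeqSub (labels_mem la wW))) -[lb w1]/(val (SeqSub (labels_mem lb w1W))).
rewrite -[lb w2]/(val (SeqSub (labels_mem lb w2W))) !label_density_gt0.
set u := SeqSub _; set v1 := SeqSub _; set v2 := SeqSub _ => c1 c2.
have <- : #|[set v1; v2]| = 2%N by rewrite cards2 -val_eqE /= ne.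
by apply: subset_leq_card; apply/fintype.subsetP => v; rewrite !inE => /orP[]/eqP->.
Qed.

End Coupling.
End LabelDensity.

Lemma label_density_swap (R : realFieldType) (L : choiceType) (T1 T2 : eqType) (W1 : seq T1)
  (W2 : seq T2) (a : T1 -> R) (b : T2 -> R) (la : T1 -> L) (lb : T2 -> L)
  (c : seq_sub (labels W1 la) -> seq_sub (labels W2 lb) -> R) l l' :
  label_density a b c l l' = label_density b a (fun v u => c u v) l' l.
Proof.
rewrite /label_density mulrC; case: insub => [u|]; last by case: insub.
by case: insub.
Qed.

Lemma joint_mass_swap (R : realFieldType) (L : choiceType) (T1 T2 : eqType) (W1 : seq T1)
  (W2 : seq T2) (a : T1 -> R) (b : T2 -> R) (la : T1 -> L) (lb : T2 -> L) G l l' :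
  joint_mass W1 W2 a b la lb G l l' = joint_mass W2 W1 b a lb la (fun w' w => G w w') l' l.
Proof.
rewrite /joint_mass exchange_big /=; apply: eq_bigr => w' _; apply: eq_bigr => w _.
by rewrite (mulrC (a w)).
Qed.

Lemma card_coupling_support_swap (R : realFieldType) (U V : finType) (c : U -> V -> R) :
  #|coupling_support (fun v u => c u v)| = #|coupling_support c|.
Proof.
rewrite !card_coupling_support.
under eq_bigr do rewrite -sum1_card; under [RHS]eq_bigr do rewrite -sum1_card.
rewrite (exchange_big_dep xpredT)//=; apply: eq_bigr => u _; apply: eq_bigl => v.
by rewrite !inE.
Qed.

(* A density that depends on the words only through their labels can be replaced by one with
   the same marginals whose support has at most as many edges as there are labels. *)
Lemma exists_sparse_label_density (R : realFieldType) (L : choiceType) (T1 T2 : eqType)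
  (W1 : seq T1) (W2 : seq T2) (a : T1 -> R) (b : T2 -> R) (la : T1 -> L) (lb : T2 -> L)
  (G : T1 -> T2 -> R) :
  {in W1, forall w, 0 < a w} -> {in W2, forall w, 0 < b w} -> (forall w w', 0 <= G w w') ->
  {in W1 &, forall w1 w2, la w1 = la w2 -> {in W2, forall w', G w1 w' = G w2 w'}} ->
  {in W2 &, forall w1 w2, lb w1 = lb w2 -> {in W1, forall w, G w w1 = G w w2}} ->
  {in W1, forall w, \sum_(w' <- W2) b w' * G w w' = 1} ->
  {in W2, forall w', \sum_(w <- W1) a w * G w w' = 1} ->
  exists g : L -> L -> R,
  [/\ forall l l', 0 <= g l l',
      {in W1 & W2, forall w w', 0 < g (la w) (lb w') -> 0 < G w w'},
      {in W1, forall w, \sum_(w' <- W2) b w' * g (la w) (lb w') = 1},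
      {in W2, forall w', \sum_(w <- W1) a w * g (la w) (lb w') = 1} &
      (size (labels [seq w <- W1 | ambiguous W2 lb g (la w)] la) <= size (labels W2 lb))%N /\
      (size (labels [seq w <- W2 | ambiguous W1 la (fun l l' => g l' l) (lb w)] lb)
         <= size (labels W1 la))%N].
Proof.
move=> a0 b0 G0 G_la G_lb G1 G2.
pose c (u : seq_sub (labels W1 la)) (v : seq_sub (labels W2 lb)) :=
  joint_mass W1 W2 a b la lb G (val u) (val v).
have c0 u v : 0 <= c u v by exact: joint_mass_ge0.
have [c' [c'0 c'c c'row c'col c'_sparse]] := exists_sparse_coupling c0.
have row u : \sum_v c' u v = label_mass W1 a la (val u) by rewrite c'row sum_joint_mass.
have col v : \sum_u c' u v = label_mass W2 b lb (val v).
  rewrite c'col; under eq_bigr do rewrite /c joint_mass_swap.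
  by rewrite sum_joint_mass.
have swapE : label_density b a (fun v u => c' u v) = fun l l' => label_density a b c' l' l.
  by apply/funext => l; apply/funext => l'; rewrite -label_density_swap.
exists (label_density a b c'); split.
- exact: label_density_ge0.
- move=> w w' wW w'W; set v := SeqSub (labels_mem lb w'W); set u := SeqSub (labels_mem la wW).
  rewrite -[la w]/(val u) -[lb w']/(val v) label_density_gt0// => c'uv.
  rewrite lt_neqAle eq_sym G0 andbT; apply: (joint_mass_neq0 (a := a) (b := b)) G_la G_lb _ => //.
  by have /fintype.subsetP/(_ (u, v)) := c'c; rewrite !inE; apply.
- by move=> w wW; exact: sum_label_density.
- move=> w' w'W; under eq_bigr do rewrite label_density_swap.
  exact: sum_label_density.
split; first exact: size_ambiguous_le.
by rewrite -swapE; apply: size_ambiguous_le => //; rewrite card_coupling_support_swap addnC.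
Qed.

(** * Refining sequences of couplings *)

Fixpoint segments (N : nat) (s : seq nat) : seq (seq nat) :=
  if s is n :: s' then
    if (N < n)%N then [:: n] :: segments N s' else
    if segments N s' is t :: ts then (n :: t) :: ts else [:: [:: n]]
  else [::].

Lemma flatten_segments N s : flatten (segments N s) = s.
Proof.
elim: s => //= n s IH; case: ifP => _ /=; first by rewrite IH.
by case: (segments N s) IH => [|t ts] /= <-.
Qed.

Lemma segments_cat_cons N s ss1 t ss2 : segments N s = ss1 ++ t :: ss2 ->
  s = flatten ss1 ++ t ++ flatten ss2.
Proof. by move=> h; rewrite -(flatten_segments N s) h flatten_cat. Qed.

Section Segmentwise.
Context {T : eqType} {L : Type} (f : seq nat -> seq T -> L).

Fixpoint segmentwise (ss : seq (seq nat)) (w : seq T) : seq L :=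
  if ss is s :: ss' then f s (take (size s) w) :: segmentwise ss' (drop (size s) w) else [::].

Lemma size_segmentwise ss w : size (segmentwise ss w) = size ss.
Proof. by elim: ss w => //= s ss IH w; rewrite IH. Qed.

Lemma segmentwise_cat ss1 ss2 w : segmentwise (ss1 ++ ss2) w =
  segmentwise ss1 w ++ segmentwise ss2 (drop (size (flatten ss1)) w).
Proof.
elim: ss1 w => [|s ss IH] w /=; first by rewrite drop0.
by rewrite IH size_cat drop_drop addnC.
Qed.

End Segmentwise.

Lemma words_flatten_cons (T : eqType) (sp : nat -> seq T) (s : seq nat) ss w :
  w \in words sp (flatten (s :: ss)) ->
  take (size s) w \in words sp s /\ drop (size s) w \in words sp (flatten ss).
Proof.
move=> /= hw; have hs := size_in_words hw; rewrite size_cat in hs.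
have := hw; rewrite -{1}(cat_take_drop (size s) w) in_words_cat; first by case/andP.
by rewrite size_takel// hs leq_addr.
Qed.

Lemma segmentwise_in_words (T : eqType) (L : choiceType) (f : seq nat -> seq T -> L)
  (sp : nat -> seq T) ss w : w \in words sp (flatten ss) ->
  segmentwise f ss w \in words (fun t => labels (words sp t) (f t)) ss.
Proof.
elim: ss w => [|s ss IH] w hw; first by rewrite inE.
have [h1 h2] := words_flatten_cons hw.
by rewrite [segmentwise _ _ _]/= in_words_cons labels_mem// IH.
Qed.

Record tower (R : numDomainType) (T : eqType) := Tower {
  gap_names : bool -> nat -> nat -> seq T;
  gap_wt : bool -> nat -> nat -> T -> R;
  coarsen_gap : bool -> nat -> nat -> T -> T;
  gap_names_uniq : forall b j n, uniq (gap_names b j n);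
  gap_wt_gt0 : forall b j n a, a \in gap_names b j n -> 0 < gap_wt b j n a;
  sum_gap_wt : forall b j n, \sum_(a <- gap_names b j n) gap_wt b j n a = 1;
  coarsen_gap_in : forall b j n a, a \in gap_names b j.+1 n ->
    coarsen_gap b j n a \in gap_names b j n;
  coarsen_gap_push : forall b j n (G : T -> R),
    \sum_(a <- gap_names b j.+1 n) gap_wt b j.+1 n a * G (coarsen_gap b j n a) =
    \sum_(a <- gap_names b j n) gap_wt b j n a * G a }.

(* The names of side [b] at stage [j] read [level b] bits; stage-[j] blocks end with a gap
   longer than [gap_bound]; typical names have weight between [expR (- info_hi * n)] and
   [expR (- info_lo * n)]; there are at most [expR (label_rate * n)] labels; a block around the
   origin lies within [radius] with high probability. *)
Record stage (R : realType) := Stage {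
  level : bool -> nat; gap_bound : nat;
  info_hi : R; info_lo : R; label_rate : R; radius : nat }.

Definition label_growth (R : realType) (st : nat -> stage R) : Prop :=
  [/\ 0 <= label_rate (st 0%N),
      forall j, label_rate (st j) <= label_rate (st j.+1) &
      forall j n, (gap_bound (st j.+1) <= n)%N ->
        expR (info_hi (st j.+1) * n%:R) + expR (label_rate (st j) * n%:R)
          <= expR (label_rate (st j.+1) * n%:R)].

Section Stages.
Context {R : realType} {T : choiceType}.
Notation L := (GenTree.tree (seq T)).
Variables (tw : tower R T) (st : nat -> stage R).
Implicit Types (b : bool) (s : seq nat) (w : seq T) (l : L).

Definition fillers b j s := words (gap_names tw b j) s.
Definition filler_wt b j s w : R := word_wt (gap_wt tw b j) s w.
Definition coarsen b j s w := map_word (coarsen_gap tw b j) s w.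

Definition typical b j s w : bool :=
  [&& b == odd j, (gap_bound (st j) <= sumn s)%N,
      expR (- (info_hi (st j) * (sumn s)%:R)) <= filler_wt b j s w &
      filler_wt b j s w <= expR (- (info_lo (st j) * (sumn s)%:R))].

(* A typical name is its own label; any other name keeps the labels of its segments. *)
Fixpoint label b j s w : L :=
  if j is j'.+1 then
    if typical b j s w then GenTree.Leaf w
    else GenTree.Node 0
      (segmentwise (label b j') (segments (gap_bound (st j')) s) (coarsen b j' s w))
  else GenTree.Node 0 [::].

Lemma fillers_uniq b j s : uniq (fillers b j s).
Proof. by apply: words_uniq; exact: gap_names_uniq. Qed.

Lemma filler_wt_gt0 b j s w : w \in fillers b j s -> 0 < filler_wt b j s w.
Proof. by apply: word_wt_gt0 => n a; exact: gap_wt_gt0. Qed.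

Lemma sum_filler_wt b j s : \sum_(w <- fillers b j s) filler_wt b j s w = 1.
Proof. by apply: sum_word_wt; exact: sum_gap_wt. Qed.

Lemma coarsen_in b j s w : w \in fillers b j.+1 s -> coarsen b j s w \in fillers b j s.
Proof. by apply: map_word_in => n a; exact: coarsen_gap_in. Qed.

Definition nlabels b j s := size (labels (fillers b j s) (label b j s)).

Lemma size_typical_le b j s :
  (size [seq w <- fillers b j s | typical b j s w])%:R <= expR (info_hi (st j) * (sumn s)%:R).
Proof.
rewrite -[leRHS]mul1r -ler_pdivrMr ?expR_gt0// -expRN -[leRHS](sum_filler_wt b j s).
rewrite -sum1_size natr_sum mulr_suml big_filter big_mkcond /=.
apply: ler_sum_seq => w hw; case: ifP => [/and4P[_ _ h _]|_]; first by rewrite mul1r.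
exact: ltW (filler_wt_gt0 hw).
Qed.

Lemma size_segment_labels_le b j s :
  (forall t, (nlabels b j t)%:R <= expR (label_rate (st j) * (sumn t)%:R)) ->
  (size (words (fun t => labels (fillers b j t) (label b j t)) (segments (gap_bound (st j)) s)))%:R
    <= expR (label_rate (st j) * (sumn s)%:R).
Proof.
move=> IH; rewrite size_words -{2}(flatten_segments (gap_bound (st j)) s).
elim: (segments _ s) => [|t ts IHt]; first by rewrite big_nil mulr0 expR0.
by rewrite big_cons /= sumn_cat natrD mulrDr expRD natrM ler_pM// ?ler0n//; exact: IH.
Qed.

Lemma nlabels_step b j s :
  (forall t, (nlabels b j t)%:R <= expR (label_rate (st j) * (sumn t)%:R)) ->
  (nlabels b j.+1 s)%:R <=
    (if (b == odd j.+1) && (gap_bound (st j.+1) <= sumn s)%N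
     then expR (info_hi (st j.+1) * (sumn s)%:R) else 0) + expR (label_rate (st j) * (sumn s)%:R).
Proof.
move=> IH; set X := if _ then _ else _.
have size_typical : (size [seq w <- fillers b j.+1 s | typical b j.+1 s w])%:R <= X.
  rewrite /X; case: ifP => [_|h]; first exact: size_typical_le.
  rewrite (_ : [seq _ <- _ | _] = [::])// -[RHS](filter_pred0 (fillers b j.+1 s)).
  by apply: eq_filter => w; rewrite /typical andbA h.
apply: le_trans (lerD size_typical (size_segment_labels_le s IH)).
rewrite -natrD ler_nat -(size_map (@GenTree.Leaf (seq T))).
rewrite -(size_map (@GenTree.Node (seq T) 0)) -size_cat.
apply: uniq_leq_size; first exact: undup_uniq.
move=> l; rewrite mem_undup => /mapP[w hw ->]; rewrite mem_cat /=; case: ifP => ht.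
  by rewrite map_f// mem_filter ht.
apply/orP; right; apply: map_f; apply: segmentwise_in_words.
by rewrite flatten_segments; exact: coarsen_in.
Qed.

Section LabelCount.
Hypothesis growth : label_growth st.

Lemma nlabels_le b j s : (nlabels b j s)%:R <= expR (label_rate (st j) * (sumn s)%:R).
Proof.
have [rate0 rate_mono rate_step] := growth.
elim: j s => [|j IH] s.
  apply: (@le_trans _ _ 1); last by rewrite -expR0 ler_expR mulr_ge0// ler0n.
  rewrite -[1]/(1%:R) ler_nat; apply: (@uniq_leq_size _ _ [:: GenTree.Node 0 [::]]).
    exact: undup_uniq.
  by move=> l; rewrite mem_undup => /mapP[w _ ->] /=; rewrite inE.
apply: le_trans (nlabels_step s IH) _; case: ifP => [/andP[_ h]|_]; first exact: rate_step.
by rewrite add0r ler_expR ler_wpM2r// ler0n.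
Qed.

Lemma nlabels_idle_le b j s : b != odd j.+1 ->
  (nlabels b j.+1 s)%:R <= expR (label_rate (st j) * (sumn s)%:R).
Proof.
move=> hb; apply: le_trans (nlabels_step s (nlabels_le b j)) _.
by rewrite (negbTE hb) add0r.
Qed.

End LabelCount.

Definition orient b (g : L -> L -> R) l l' := if b then g l l' else g l' l.

Lemma orient_ge0 b g l l' : (forall l l', 0 <= g l l') -> 0 <= orient b g l l'.
Proof. by rewrite /orient; case: b. Qed.

Lemma orient_flip b g l l' : orient (~~ b) g l l' = orient b g l' l.
Proof. by rewrite /orient; case: b. Qed.

Definition couples j s (g : L -> L -> R) :=
  (forall l l', 0 <= g l l') /\
  forall b, {in fillers b j s, forall w,
    \sum_(w' <- fillers (~~ b) j s) filler_wt (~~ b) j s w' *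
        orient b g (label b j s w) (label (~~ b) j s w') = 1}.

Fixpoint seg_density b (g : seq nat -> L -> L -> R) ss ls ls' : R :=
  match ss, ls, ls' with
  | s :: ss, l :: ls, l' :: ls' => orient b (g s) l l' * seg_density b g ss ls ls'
  | [::], [::], [::] => 1
  | _, _, _ => 0
  end.

Lemma seg_density_flip g ss ls ls' : seg_density false g ss ls ls' = seg_density true g ss ls' ls.
Proof. by elim: ss ls ls' => [|s ss IH] [|l ls] [|l' ls'] //=; rewrite IH. Qed.

Lemma seg_density_ge0 b g ss ls ls' : (forall s l l', 0 <= g s l l') ->
  0 <= seg_density b g ss ls ls'.
Proof.
by move=> g0; elim: ss ls ls' => [|s ss IH] [|l ls] [|l' ls'] //=; rewrite mulr_ge0// orient_ge0.
Qed.

Lemma seg_density_gt0_mid b g ss1 t ss2 ls1 l ls2 ls1' l' ls2' :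
  (forall s l l', 0 <= g s l l') -> size ls1 = size ss1 -> size ls1' = size ss1 ->
  0 < seg_density b g (ss1 ++ t :: ss2) (ls1 ++ l :: ls2) (ls1' ++ l' :: ls2') ->
  0 < orient b (g t) l l'.
Proof.
move=> g0; elim: ss1 ls1 ls1' => [|s ss IH] [|x ls] [|x' ls'] //=.
  move=> _ _ h; rewrite lt_neqAle orient_ge0// andbT.
  by apply: contraTneq h => <-; rewrite mul0r ltxx.
move=> [h1] [h2] h; apply: (IH ls ls') => //.
by rewrite lt_neqAle seg_density_ge0// andbT; apply: contraTneq h => <-; rewrite mulr0 ltxx.
Qed.

Lemma sum_seg_density b j g ss w : (forall s, couples j s (g s)) ->
  w \in fillers b j (flatten ss) ->
  \sum_(w' <- fillers (~~ b) j (flatten ss)) filler_wt (~~ b) j (flatten ss) w' *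
    seg_density b g ss (segmentwise (label b j) ss w) (segmentwise (label (~~ b) j) ss w') = 1.
Proof.
move=> hg; elim: ss w => [|s ss IH] w hw.
  by rewrite /fillers /= big_seq1 /filler_wt /= mulr1.
have [h1 h2] := words_flatten_cons hw.
rewrite big_words_cat big_seq.
rewrite (eq_bigr (fun w1 => \sum_(w2 <- fillers (~~ b) j (flatten ss))
  word_wt (gap_wt tw (~~ b) j) (s ++ flatten ss) (w1 ++ w2) *
  (orient b (g s) (label b j s (take (size s) w)) (label (~~ b) j s w1) *
   seg_density b g ss (segmentwise (label b j) ss (drop (size s) w))
     (segmentwise (label (~~ b) j) ss w2)))); last first.
  move=> w1 /size_in_words hw1; apply: eq_bigr => w2 _ /=.
  by rewrite -hw1 take_size_cat // drop_size_cat.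
by rewrite -big_seq sum_word_wt_cat IH// mulr1; case: (hg s) => _; apply.
Qed.

Lemma eq_label_segments b j s w1 w2 : label b j.+1 s w1 = label b j.+1 s w2 ->
  segmentwise (label b j) (segments (gap_bound (st j)) s) (coarsen b j s w1) =
  segmentwise (label b j) (segments (gap_bound (st j)) s) (coarsen b j s w2).
Proof. by rewrite /=; case: ifP => _; case: ifP => _ // -[->]. Qed.

Definition coarse_density b j s g w w' :=
  seg_density b g (segments (gap_bound (st j)) s)
    (segmentwise (label b j) (segments (gap_bound (st j)) s) (coarsen b j s w))
    (segmentwise (label (~~ b) j) (segments (gap_bound (st j)) s) (coarsen (~~ b) j s w')).

Lemma coarse_density_ge0 b j s g w w' : (forall t, couples j t (g t)) ->
  0 <= coarse_density b j s g w w'.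
Proof. by move=> hg; apply: seg_density_ge0 => t; case: (hg t). Qed.

Lemma coarse_density_flip j s g w w' :
  coarse_density false j s g w w' = coarse_density true j s g w' w.
Proof. exact: seg_density_flip. Qed.

Lemma sum_coarse_density b j g s w : (forall t, couples j t (g t)) ->
  w \in fillers b j.+1 s ->
  \sum_(w' <- fillers (~~ b) j.+1 s) filler_wt (~~ b) j.+1 s w' * coarse_density b j s g w w' = 1.
Proof.
move=> hg hw; set ss := segments (gap_bound (st j)) s.
rewrite (sum_map_word (m' := gap_wt tw (~~ b) j) (sp' := gap_names tw (~~ b) j) _
  (fun w' => seg_density b g ss (segmentwise (label b j) ss (coarsen b j s w))
              (segmentwise (label (~~ b) j) ss w'))); last by move=> n F; exact: coarsen_gap_push.
have := @sum_seg_density b j g ss (coarsen b j s w) hg.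
by rewrite flatten_segments; apply; exact: coarsen_in.
Qed.

Definition multivalued b j s (g : L -> L -> R) (l : L) : bool :=
  ambiguous (fillers (~~ b) j s) (label (~~ b) j s) (orient b g) l.

Definition refines j s (g : seq nat -> L -> L -> R) (g' : L -> L -> R) :=
  [/\ couples j.+1 s g',
      forall b, {in fillers b j.+1 s & fillers (~~ b) j.+1 s, forall w w',
        0 < orient b g' (label b j.+1 s w) (label (~~ b) j.+1 s w') ->
        0 < coarse_density b j s g w w'} &
      forall b, (size (labels
        [seq w <- fillers b j.+1 s | multivalued b j.+1 s g' (label b j.+1 s w)]
        (label b j.+1 s)) <= nlabels (~~ b) j.+1 s)%N].

Lemma exists_refinement j g s : (forall t, couples j t (g t)) -> exists g', refines j s g g'.
Proof.
move=> hg; have sum1 b w := @sum_coarse_density b j g s w hg.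
have [||||||| g' [g'0 g'_supp sum_g'1 sum_g'2 [size1 size2]]] := @exists_sparse_label_density
  R _ _ _ (fillers true j.+1 s) (fillers false j.+1 s) (filler_wt true j.+1 s)
  (filler_wt false j.+1 s) (label true j.+1 s) (label false j.+1 s) (coarse_density true j s g).
- by move=> w; exact: filler_wt_gt0.
- by move=> w; exact: filler_wt_gt0.
- by move=> w w'; exact: coarse_density_ge0.
- by move=> w1 w2 _ _ h w' _; rewrite /coarse_density (eq_label_segments h).
- by move=> w1 w2 _ _ h w' _; rewrite /coarse_density (eq_label_segments h).
- by move=> w hw; have := sum1 true w hw.
- by move=> w hw; have := sum1 false w hw; under eq_bigr do rewrite coarse_density_flip.
exists g'; split.
- by split=> // -[] w hw /=; [exact: sum_g'1|exact: sum_g'2].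
- by case=> w w' hw hw' /=; [exact: g'_supp|rewrite coarse_density_flip; exact: g'_supp].
- by case.
Qed.

Lemma couples0 s : couples 0 s (fun _ _ => 1).
Proof.
split=> // b w _; rewrite -[RHS](sum_filler_wt (~~ b) 0 s).
by apply: eq_bigr => w' _; case: (b); rewrite /orient mulr1.
Qed.

Definition refining (g : nat -> seq nat -> L -> L -> R) : Prop :=
  (forall j s, couples j s (g j s)) /\ forall j s, refines j s (g j) (g j.+1 s).

Lemma exists_refining : exists g, refining g.
Proof.
have step j (g : {g | forall s, couples j s (g s)}) :
  {g' : {g' | forall s, couples j.+1 s (g' s)} | forall s, refines j s (sval g) (sval g' s)}.
  case: g => g hg /=; apply: cid.
  have [g' hg'] := choice (fun s => exists_refinement s hg).
  have ok : forall s, couples j.+1 s (g' s) by move=> s; case: (hg' s).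
  by exists (exist _ g' ok).
pose fix h j : {g | forall s, couples j s (g s)} :=
  if j is j'.+1 then sval (step j' (h j')) else exist _ _ couples0.
exists (fun j => sval (h j)); split=> [j|j s]; first exact: (svalP (h j)).
exact: (svalP (step j (h j))).
Qed.

(* The labels of the idle side are so few that few typical names, which have small weight, are
   multivalued. *)
Lemma sum_multivalued_le j s g g' : label_growth st -> refines j s g g' ->
  forall b, b = odd j.+1 ->
  \sum_(w <- fillers b j.+1 s | typical b j.+1 s w && multivalued b j.+1 s g' (label b j.+1 s w))
     filler_wt b j.+1 s w
   <= expR (- ((info_lo (st j.+1) - label_rate (st j)) * (sumn s)%:R)).
Proof.
move=> growth [_ _ few] b hb'; rewrite -big_filter; set ws := [seq _ <- _ | _].
have hb : ~~ b != odd j.+1 by rewrite hb'; case: odd.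
apply: (@le_trans _ _ ((size ws)%:R * expR (- (info_lo (st j.+1) * (sumn s)%:R)))).
  rewrite -sum1_size natr_sum mulr_suml; apply: ler_sum_seq => w.
  by rewrite mem_filter mul1r => /andP[/andP[/and4P[_ _ _]]].
rewrite mulrBl opprB expRD; apply: ler_wpM2r; first exact: expR_ge0.
apply: le_trans (nlabels_idle_le growth s hb); rewrite ler_nat; apply: leq_trans (few b).
rewrite -(size_map (label b j.+1 s)); apply: uniq_leq_size.
  rewrite map_inj_in_uniq ?filter_uniq ?fillers_uniq// => w1 w2.
  rewrite !mem_filter => /andP[/andP[t1 _] _] /andP[/andP[t2 _] _] /=.
  by rewrite t1 t2 => -[].
move=> l /mapP[w]; rewrite mem_filter => /andP[/andP[_ hm] hw] ->.
by rewrite labels_mem// mem_filter hm.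
Qed.

End Stages.

(** * Marks and blocks *)

Lemma addr_abszBr (u v : int) : u <= v -> u + `|v - u|%N%:Z = v.
Proof. by lia. Qed.

Lemma subr_abszBl (u v : int) : u <= v -> v - `|v - u|%N%:Z = u.
Proof. by lia. Qed.

Definition bitarray := int -> nat -> bool.

Definition window r (x : bitarray) (u : int) (n : nat) : seq (seq bool) :=
  [seq mkseq (x (u + k%:Z)) r | k <- iota 0 n].

Lemma size_window r x u n : size (window r x u n) = n.
Proof. by rewrite size_map size_iota. Qed.

Lemma window_cat r x u a b : window r x u (a + b) = window r x u a ++ window r x (u + a%:Z) b.
Proof.
rewrite /window iotaD map_cat add0n -{2}[a]addn0 iotaDl -map_comp.
by congr (_ ++ _); apply: eq_map => k /=; congr (mkseq (x _) r); lia.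
Qed.

Lemma nth_window r x u n k : (k < n)%N -> nth [::] (window r x u n) k = mkseq (x (u + k%:Z)) r.
Proof. by move=> h; rewrite (nth_map 0%N) ?size_iota// nth_iota. Qed.

Lemma map_take_window r r' x u n : (r' <= r)%N -> map (take r') (window r x u n) = window r' x u n.
Proof. by move=> h; rewrite /window -map_comp; apply: eq_map => k /=; rewrite take_mkseq. Qed.

Lemma take_window r x u a b : take a (window r x u (a + b)) = window r x u a.
Proof. by rewrite window_cat take_size_cat ?size_window. Qed.

Lemma drop_window r x u a b : drop a (window r x u (a + b)) = window r x (u + a%:Z) b.
Proof. by rewrite window_cat drop_size_cat ?size_window. Qed.

Lemma take_drop_window r x u n a b : (a + b <= n)%N ->
  take b (drop a (window r x u n)) = window r x (u + a%:Z) b.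
Proof.
move=> h; have -> : n = (a + (b + (n - a - b)))%N by lia.
by rewrite drop_window take_window.
Qed.

Lemma eq_window r x y u n :
  (forall k, (k < n)%N -> mkseq (x (u + k%:Z)) r = mkseq (y (u + k%:Z)) r) ->
  window r x u n = window r y u n.
Proof. by move=> h; apply/eq_in_map => k; rewrite mem_iota => /andP[_ hk]; apply: h; lia. Qed.

Lemma window_inj r x y u n k : window r x u n = window r y u n -> (k < n)%N ->
  mkseq (x (u + k%:Z)) r = mkseq (y (u + k%:Z)) r.
Proof. by move=> h hk; rewrite -!(nth_window _ _ _ hk) h. Qed.

Definition bshift (x : bitarray) : bitarray := fun i => x (i + 1).

Lemma window_bshift r x u n : window r (bshift x) u n = window r x (u + 1) n.
Proof. by apply: eq_map => k; rewrite /bshift; congr mkseq; congr x; lia. Qed.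

Section Marks.
Variable M : int -> bool.

Definition markfree (u : int) (n : nat) := all (fun k => ~~ M (u + k%:Z)) (iota 0 n).

Lemma markfreeP u n : reflect (forall i, u <= i < u + n%:Z -> ~~ M i) (markfree u n).
Proof.
apply: (iffP allP) => [h i hi|h k].
  by have := h `|i - u|%N; rewrite mem_iota addr_abszBr; [apply; lia|lia].
by rewrite mem_iota => hk; apply: h; lia.
Qed.

Lemma markfreeF u n i : markfree u n -> M i -> u <= i < u + n%:Z -> False.
Proof. by move=> /markfreeP h hM /h; rewrite hM. Qed.

(* [s] lists consecutive gaps between marks, the first of which starts at [u]. *)
Fixpoint gap_path (u : int) (s : seq nat) : bool :=
  M u && (if s is n :: s' then [&& (0 < n)%N, markfree (u + 1) n.-1 & gap_path (u + n%:Z) s']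
          else true).

Fixpoint block_shape (N : nat) (s : seq nat) : bool :=
  if s is n :: s' then if s' is [::] then (N < n)%N else (n <= N)%N && block_shape N s' else false.

Definition block N u s := [&& gap_path u s, markfree (u - N%:Z) N & block_shape N s].

Lemma gap_path_start u s : gap_path u s -> M u.
Proof. by case: s => [|n s] /= /andP[]. Qed.

Lemma gap_path_cat u s1 s2 :
  gap_path u (s1 ++ s2) = gap_path u s1 && gap_path (u + (sumn s1)%:Z) s2.
Proof.
elim: s1 u => [|n s IH] u /=.
  by rewrite addr0 andbT; apply/idP/andP => [h|[]//]; split=> //; exact: gap_path_start h.
rewrite IH -!andbA; do 4 congr (_ && _).
by congr (gap_path _ _); lia.
Qed.

Lemma gap_path_head u n s : gap_path u (n :: s) -> gap_path u [:: n].
Proof. by move=> /= /and4P[-> -> -> /gap_path_start ->]. Qed.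

Lemma gap_path_end u s : gap_path u s -> M (u + (sumn s)%:Z).
Proof. by move=> h; have := h; rewrite -{1}[s]cats0 gap_path_cat => /andP[_ /andP[]]. Qed.

Lemma gap_path_head_eq u n s n' s' : gap_path u (n :: s) -> gap_path u (n' :: s') -> n = n'.
Proof.
move=> /= /and4P[_ a0 ha' /gap_path_start ha] /and4P[_ b0 hb' /gap_path_start hb].
apply/eqP; rewrite eqn_leq; apply/andP; split; rewrite leqNgt; apply/negP => hlt.
  by apply: markfreeF ha' hb _; lia.
by apply: markfreeF hb' ha _; lia.
Qed.

Lemma block_shape_eq N u s s' : gap_path u s -> gap_path u s' ->
  block_shape N s -> block_shape N s' -> s = s'.
Proof.
elim: s s' u => [|n s IH] [|n' s'] u // h h'.
have e := gap_path_head_eq h h'; subst n'.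
move: h h' => /= /and4P[_ _ _ h] /and4P[_ _ _ h'].
case: s s' IH h h' => [|a s] [|a' s'] IH h h'.
- by [].
- by move=> h1 /andP[h2 _]; lia.
- by move=> /andP[h2 _] h1; lia.
by move=> /andP[_ h1] /andP[_ h2]; rewrite (IH (a' :: s') _ h h').
Qed.

Lemma gap_path_gt0 u s : gap_path u s -> all (leq 1) s.
Proof. by elim: s u => //= n s IH u /and4P[_ -> _ /IH]. Qed.

Lemma block_shape_sumn N s : block_shape N s -> (N < sumn s)%N.
Proof.
elim: s => //= n [|a s] IH; first by rewrite /= addn0.
by move=> /andP[_ /IH] /=; lia.
Qed.

(* Such a mark ends a gap of length at most [N]. *)
Lemma markfreeN_in_block N u s v : gap_path u s -> block_shape N s ->
  u < v < u + (sumn s)%:Z -> M v -> ~~ markfree (v - N%:Z) N.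
Proof.
elim: s u => //= n s IH u /and4P[hu n0 hn hp] hr hv hM.
have hnv : u + n%:Z <= v.
  by rewrite leNgt; apply/negP => h; apply: markfreeF hn hM _; lia.
case: s IH hr hv hp => [|a s] IH hr hv hp; first by exfalso; move: hv => /=; lia.
move: hr => /andP[hnN hr].
have [e|hne] := eqVneq v (u + n%:Z).
  by apply/negP => h; apply: markfreeF h hu _; lia.
by apply: (IH (u + n%:Z)) => //; move: hv => /=; lia.
Qed.

Lemma block_start_le N u s u' s' i : block N u s -> block N u' s' ->
  u <= i < u + (sumn s)%:Z -> u' <= i < u' + (sumn s')%:Z -> u' <= u.
Proof.
move=> /and3P[p n r] /and3P[p' n' r'] h h'; rewrite leNgt; apply/negP => hlt.
have in_s : u < u' < u + (sumn s)%:Z by lia.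
by have := markfreeN_in_block p r in_s (gap_path_start p'); rewrite n'.
Qed.

Lemma block_uniq N u s u' s' i : block N u s -> block N u' s' ->
  u <= i < u + (sumn s)%:Z -> u' <= i < u' + (sumn s')%:Z -> u = u' /\ s = s'.
Proof.
move=> h h' hi hi'; have e : u = u'.
  by have := block_start_le h h' hi hi'; have := block_start_le h' h hi' hi; lia.
subst u'; split=> //; move: h h' => /and3P[p _ r] /and3P[p' _ r'].
exact: block_shape_eq p p' r r'.
Qed.

Lemma segments_block_shape N N' s : (N <= N')%N -> block_shape N' s ->
  all (block_shape N) (segments N s).
Proof.
move=> hN; elim: s => // n s IH /= h.
have hs : s != [::] -> all (block_shape N) (segments N s).
  by case: (s) h IH => // a s' /andP[_ h] IH _; exact: IH.
case: ifP => hn /=.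
  rewrite hn; case: (eqVneq s [::]) => [->//|/hs//].
have sne : s != [::] by case: (s) h => //; lia.
have := hs sne; case e : (segments N s) => [|t ts] /=.
  by have := flatten_segments N s; rewrite e /= => h1; rewrite -h1 in sne.
by move=> /andP[ht ->]; rewrite andbT; case: (t) ht => // a t' ht; rewrite ht andbT; lia.
Qed.

Lemma block_shape_last N s : block_shape N s -> exists s' n, s = rcons s' n /\ (N < n)%N.
Proof.
elim: s => // n [|a s] IH /=; first by exists [::], n.
by move=> /andP[_ /IH[s' [n' [-> h]]]]; exists (n :: s'), n'.
Qed.

Lemma segment_block N N' u s ss1 t ss2 : (N <= N')%N -> block N' u s ->
  segments N s = ss1 ++ t :: ss2 -> block N (u + (sumn (flatten ss1))%:Z) t.
Proof.
move=> hN /and3P[hp hn hr] e.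
have := segments_block_shape hN hr; rewrite e all_cat /= => /and3P[h1 h2 _].
have hf := segments_cat_cons e.
move: hp; rewrite hf !gap_path_cat => /and3P[p1 p2 _].
rewrite /block p2 h2 andbT /=.
case/lastP: ss1 e h1 hf p1 p2 => [|ss0 t0] e h1 hf p1 p2.
  by rewrite /= addr0; apply/markfreeP => i hi; move/markfreeP: hn; apply; lia.
move: h1; rewrite all_rcons => /andP[/block_shape_last[t' [n [et hn']]] _].
move: p1; rewrite et -cats1 flatten_cat /= cats0 -cats1 !gap_path_cat !sumn_cat /= addn0.
move=> /and3P[_ _ /and4P[_ _ /markfreeP h _]].
by apply/markfreeP => i hi; apply: h; lia.
Qed.

Lemma flatten_find (ss : seq (seq nat)) (u i : int) :
  u <= i < u + (sumn (flatten ss))%:Z ->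
  exists ss1 t ss2, ss = ss1 ++ t :: ss2 /\
    u + (sumn (flatten ss1))%:Z <= i < u + (sumn (flatten ss1))%:Z + (sumn t)%:Z.
Proof.
elim: ss u => [|t ss IH] u /=; first by lia.
rewrite sumn_cat => h; case: (ltP i (u + (sumn t)%:Z)) => hi.
  by exists [::], t, ss; split=> //=; lia.
have [|ss1 [t' [ss2 [-> h']]]] := IH (u + (sumn t)%:Z); first by lia.
by exists (t :: ss1), t', ss2; split=> //=; rewrite sumn_cat; lia.
Qed.

Lemma exists_gap_path u v : M u -> M v -> u <= v -> exists s, gap_path u s /\ u + (sumn s)%:Z = v.
Proof.
move=> hu hv huv.
have [n] := ubnP `|v - u|%N; elim: n u hu huv => // n IH u hu huv hn.
have [->|hne] := eqVneq u v; first by exists [::]; rewrite /= hv; split=> //; lia.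
have hex : exists k : nat, (0 < k)%N && M (u + k%:Z).
  by exists `|v - u|%N; rewrite addr_abszBr// hv andbT; lia.
case: (ex_minnP hex) => k /andP[k0 hk] hmin.
have hkv : u + k%:Z <= v.
  suff : (k <= `|v - u|)%N by lia.
  by apply: hmin; rewrite addr_abszBr// hv andbT; lia.
have [|s [hs e]] := IH (u + k%:Z) hk hkv; first by lia.
exists (k :: s); split; last by rewrite /=; lia.
rewrite /= hu k0 hs andbT /=; apply/markfreeP => i hi; apply/negP => hM.
by have := hmin `|i - u|%N; rewrite addr_abszBr ?hM; lia.
Qed.

Definition cut_point N u := M u && markfree (u - N%:Z) N.

Lemma block_shape_between_cut_points N u s : gap_path u s -> s != [::] ->
  cut_point N (u + (sumn s)%:Z) ->
  (forall v, u < v < u + (sumn s)%:Z -> ~~ cut_point N v) -> block_shape N s.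
Proof.
elim: s u => // n s IH u /= /and4P[hu n0 /markfreeP hn hp] _ /andP[_ hc] hno.
case: s IH hp hc hno => [|a s] IH hp hc hno.
  rewrite ltnNge; apply/negP => hnN; apply: markfreeF hc hu _; move=> /=; lia.
have hsp : (0 < sumn (a :: s))%N by have := gap_path_gt0 hp => /= /andP[]; lia.
apply/andP; split; last first.
  apply: (IH (u + n%:Z)) => //.
    rewrite /cut_point (gap_path_end hp); move: hc; congr (markfree _ _); lia.
  by move=> v hv; apply: hno; lia.
have := hno (u + n%:Z); rewrite /cut_point (gap_path_start hp) /=.
have inside : u < u + n%:Z < u + (n + sumn (a :: s))%:Z by lia.
move=> /(_ inside) /=; apply: contraR; rewrite -ltnNge => hnN.
by apply/markfreeP => i hi; apply: hn; lia.
Qed.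

Lemma exists_block N u0 v0 i : cut_point N u0 -> cut_point N v0 -> u0 <= i < v0 ->
  exists u s, [/\ block N u s, u0 <= u <= i & i < u + (sumn s)%:Z <= v0].
Proof.
move=> hu hv hi.
have left_cut : exists k : nat, (k <= `|i - u0|)%N && cut_point N (i - k%:Z).
  by exists `|i - u0|%N; rewrite subr_abszBl ?hu ?andbT; lia.
case: (ex_minnP left_cut) => k /andP[hk ck] hkmin.
have right_cut : exists k : nat, (0 < k <= `|v0 - i|)%N && cut_point N (i + k%:Z).
  by exists `|v0 - i|%N; rewrite addr_abszBr ?hv ?andbT; lia.
case: (ex_minnP right_cut) => l /andP[hl cl] hlmin.
have [|||s [hs es]] := @exists_gap_path (i - k%:Z) (i + l%:Z).
- by case/andP: ck.
- by case/andP: cl.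
- by lia.
exists (i - k%:Z), s; split; [|lia|lia].
apply/and3P; split=> //; first by case/andP: ck.
apply: (block_shape_between_cut_points hs).
- by case: (s) es => //= ; lia.
- by rewrite es.
move=> v hv'; apply/negP => cv.
case: (leP v i) => hvi.
  by have := hkmin `|i - v|%N; rewrite subr_abszBl// cv; lia.
by have := hlmin `|v - i|%N; rewrite addr_abszBr ?cv; lia.
Qed.

Lemma block_end_cut_point n u s : block n u s -> cut_point n (u + (sumn s)%:Z).
Proof.
move=> /and3P[hp _ /block_shape_last[s' [k [e hk]]]]; subst s.
rewrite /cut_point (gap_path_end hp) /=.
move: hp; rewrite -cats1 gap_path_cat sumn_cat /= addn0 => /andP[_ /and4P[_ _ h _]].
by apply/markfreeP => i hi; move/markfreeP: h; apply; lia.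
Qed.

Lemma gap_path_find u s i : gap_path u s -> u <= i < u + (sumn s)%:Z ->
  exists s1 n s2, [/\ s = s1 ++ n :: s2, u + (sumn s1)%:Z <= i < u + (sumn s1)%:Z + n%:Z &
    gap_path (u + (sumn s1)%:Z) (n :: s2)].
Proof.
elim: s u => [|n s IH] u hp; first by rewrite /=; lia.
move=> /= h; case: (ltP i (u + n%:Z)) => hi.
  by exists [::], n, s; rewrite addr0; split=> //; lia.
have hp' : gap_path (u + n%:Z) s by move: hp => /= /and4P[].
have [|s1 [n' [s2 [-> h1 h2]]]] := IH _ hp'; first by lia.
exists (n :: s1), n', s2; split=> //=; first by lia.
by rewrite (_ : u + (n + sumn s1)%N%:Z = u + n%:Z + (sumn s1)%:Z)//; lia.
Qed.

Lemma exists_gap (v1 v2 i : int) : M v1 -> M v2 -> v1 <= i < v2 ->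
  exists u n, [/\ v1 <= u, u <= i < u + n%:Z, u + n%:Z <= v2 & gap_path u [:: n]].
Proof.
move=> h1 h2 hi; have [|s [hp es]] := exists_gap_path h1 h2; first by lia.
have [|s1 [n [s2 [e hin hp']]]] := gap_path_find (i := i) hp; first by rewrite es.
exists (v1 + (sumn s1)%:Z), n; split=> //.
- by lia.
- by rewrite -es e sumn_cat /=; lia.
exact: gap_path_head hp'.
Qed.

Lemma gap_start_le u n u' n' i : gap_path u [:: n] -> gap_path u' [:: n'] ->
  u <= i < u + n%:Z -> u' <= i < u' + n'%:Z -> u' <= u.
Proof.
move=> /= /and4P[_ _ hn _] /= /and4P[hu' _ _ _] hi hi'; rewrite leNgt; apply/negP => hlt.
by apply: markfreeF hn hu' _; lia.
Qed.

Lemma gap_uniq u n u' n' i : gap_path u [:: n] -> gap_path u' [:: n'] ->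
  u <= i < u + n%:Z -> u' <= i < u' + n'%:Z -> u = u' /\ n = n'.
Proof.
move=> h h' hi hi'; have e : u = u'.
  by have := gap_start_le h h' hi hi'; have := gap_start_le h' h hi' hi; lia.
by subst u'; split=> //; exact: gap_path_head_eq h h'.
Qed.

Lemma gap_path_split u s v n : gap_path u s -> gap_path v [:: n] -> u <= v < u + (sumn s)%:Z ->
  exists s1 s2, s = s1 ++ n :: s2 /\ u + (sumn s1)%:Z = v.
Proof.
move=> hs hv huv; have [s1 [n' [s2 [e hin hp]]]] := gap_path_find hs huv.
have n0 : (0 < n)%N by move: hv => /= /and4P[].
have [|e1 e2] := gap_uniq (i := v) (gap_path_head hp) hv hin; first by lia.
by exists s1, s2; rewrite e1 -e2.
Qed.

End Marks.

Lemma eq_markfree M M' u n : (forall k, u <= k < u + n%:Z -> M k = M' k) ->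
  markfree M u n = markfree M' u n.
Proof. by move=> h; apply: eq_in_all => k; rewrite mem_iota => hk; rewrite h//; lia. Qed.

Lemma eq_gap_path M M' u s : (forall k, u <= k <= u + (sumn s)%:Z -> M k = M' k) ->
  gap_path M u s = gap_path M' u s.
Proof.
elim: s u => [|n s IH] u /= h; first by rewrite h//; lia.
rewrite (h u); last by lia.
case: n h => [|n] h; first by rewrite !andbF.
by rewrite (@eq_markfree M M') ?(IH (u + n.+1%:Z))// => k hk; apply: h; lia.
Qed.

Lemma eq_block M M' n u s : (forall k, u - n%:Z <= k <= u + (sumn s)%:Z -> M k = M' k) ->
  block M n u s = block M' n u s.
Proof.
move=> h; rewrite /block (@eq_gap_path M M') ?(@eq_markfree M M')// => k hk; apply: h; lia.
Qed.

Lemma block_shift M n u s : block (fun i => M (i + 1)) n u s = block M n (u + 1) s.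
Proof.
have hn w k : markfree (fun i => M (i + 1)) w k = markfree M (w + 1) k.
  by apply: eq_all => l; congr (~~ M _); lia.
rewrite /block; congr (_ && (_ && _)).
  elim: s u => //= a s IH u; rewrite hn IH; congr [&& _, _, _ & gap_path M _ _]; lia.
by rewrite hn; congr (markfree M _ _); lia.
Qed.

Section Fillers.
Implicit Types (lv : nat -> nat) (x y : bitarray).

Fixpoint filler lv x (u : int) (s : seq nat) : seq (seq (seq bool)) :=
  if s is n :: s' then window (lv n) x u n :: filler lv x (u + n%:Z) s' else [::].

Fixpoint depth_at lv (s : seq nat) (k : nat) : nat :=
  if s is n :: s' then if (k < n)%N then lv n else depth_at lv s' (k - n) else 0.

Lemma size_filler lv x u s : size (filler lv x u s) = size s.
Proof. by elim: s u => //= n s IH u; rewrite IH. Qed.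

Lemma filler_cat lv x u s1 s2 :
  filler lv x u (s1 ++ s2) = filler lv x u s1 ++ filler lv x (u + (sumn s1)%:Z) s2.
Proof.
elim: s1 u => [|n s IH] u /=; first by rewrite addr0.
by rewrite IH; congr (_ :: _ ++ filler _ _ _ _); lia.
Qed.

Lemma map_word_filler lv lv' x u s : (forall n, (lv' n <= lv n)%N) ->
  map_word (fun n => map (take (lv' n))) s (filler lv x u s) = filler lv' x u s.
Proof. by move=> h; elim: s u => //= n s IH u; rewrite IH map_take_window. Qed.

Lemma eq_filler lv x y u s :
  (forall k, (k < sumn s)%N ->
     mkseq (x (u + k%:Z)) (depth_at lv s k) = mkseq (y (u + k%:Z)) (depth_at lv s k)) ->
  filler lv x u s = filler lv y u s.
Proof.
elim: s u => //= n s IH u h; congr (_ :: _).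
  by apply: eq_window => k hk; have := h k; rewrite hk; apply; lia.
apply: IH => k hk; have := h (n + k)%N.
have -> : (n + k < n)%N = false by lia.
have -> : (n + k - n)%N = k by lia.
by rewrite PoszD addrA; apply; lia.
Qed.

Lemma filler_inj lv x y u s k : filler lv x u s = filler lv y u s -> (k < sumn s)%N ->
  mkseq (x (u + k%:Z)) (depth_at lv s k) = mkseq (y (u + k%:Z)) (depth_at lv s k).
Proof.
elim: s u k => //= n s IH u k [h1 h2] hk; case: ifP => hkn; first exact: window_inj h1 hkn.
have := IH _ (k - n)%N h2; have -> : u + n%:Z + (k - n)%N%:Z = u + k%:Z by lia.
by apply; lia.
Qed.

Lemma filler_bshift lv x u s : filler lv (bshift x) u s = filler lv x (u + 1) s.
Proof.
by elim: s u => //= n s IH u; rewrite window_bshift IH; congr (_ :: filler _ _ _ _); lia.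
Qed.

Lemma depth_at_cat lv s1 s2 k : depth_at lv (s1 ++ s2) (sumn s1 + k) = depth_at lv s2 k.
Proof.
elim: s1 => //= n s IH; rewrite -addnA.
have -> : (n + (sumn s + k) < n)%N = false by lia.
by have -> : (n + (sumn s + k) - n)%N = (sumn s + k)%N by [lia].
Qed.

Lemma depth_at_catl lv s1 s2 k : (k < sumn s1)%N -> depth_at lv (s1 ++ s2) k = depth_at lv s1 k.
Proof.
elim: s1 k => //= n s IH k hk; case: ifP => // h; apply: IH; lia.
Qed.

Lemma leq_depth_at lv lv' s k : (forall n, (lv' n <= lv n)%N) ->
  (depth_at lv' s k <= depth_at lv s k)%N.
Proof. by move=> h; elim: s k => //= n s IH k; case: ifP. Qed.

Lemma depth_at_le lv B s k : (forall n, (lv n <= B)%N) -> (depth_at lv s k <= B)%N.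
Proof. by move=> h; elim: s k => //= n s IH k; case: ifP. Qed.

Lemma filler_mid lv x u s1 t s2 :
  take (size t) (drop (size s1) (filler lv x u (s1 ++ t ++ s2))) = filler lv x (u + (sumn s1)%:Z) t.
Proof.
by rewrite filler_cat drop_size_cat ?size_filler// filler_cat take_size_cat ?size_filler.
Qed.

End Fillers.

Lemma depth_at_gap (M : int -> bool) lv (u : int) s (i v1 v2 : int) : gap_path M u s ->
  u <= i < u + (sumn s)%:Z -> M v1 -> M v2 -> v1 <= i < v2 ->
  exists u' n, [/\ u <= u', u' + n%:Z <= u + (sumn s)%:Z, n%:Z <= v2 - v1, gap_path M u' [:: n] &
    depth_at lv s `|i - u|%N = lv n].
Proof.
move=> hp hi m1 m2 hv; have [s1 [n [s2 [e hin hp']]]] := gap_path_find hp hi.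
have hp1 := gap_path_head hp'.
exists (u + (sumn s1)%:Z), n; have /= /and4P[_ n0 hn _] := hp1; split=> //.
- by lia.
- by rewrite e sumn_cat /=; lia.
- have a1 : v1 <= u + (sumn s1)%:Z.
    by rewrite leNgt; apply/negP => h; apply: markfreeF hn m1 _; lia.
  have a2 : u + (sumn s1)%:Z + n%:Z <= v2.
    by rewrite leNgt; apply/negP => h; apply: markfreeF hn m2 _; lia.
  by lia.
have -> : `|i - u|%N = (sumn s1 + `|i - (u + (sumn s1)%:Z)%R|)%N by lia.
rewrite e depth_at_cat /=; case: ifP => // h; exfalso; move/negbT: h; lia.
Qed.

Lemma exists_filler lv u s (w : seq (seq (seq bool))) : size w = size s ->
  (forall k, (k < size s)%N -> size (nth [::] w k) = nth 0%N s k /\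
     all (fun c => size c == lv (nth 0%N s k)) (nth [::] w k)) ->
  exists y, filler lv y u s = w.
Proof.
elim: s u w => [|n s IH] u [|e w] //; first by exists (fun _ _ => false).
move=> [hs] hw.
have [||y hy] := IH (u + n%:Z) w; [done|by move=> k hk; exact: (hw k.+1 hk)|].
have [/= he hl] := hw 0%N isT.
exists (fun i r => if i < u + n%:Z then nth false (nth [::] e `|i - u|%N) r else y i r).
rewrite /=; congr (_ :: _); last first.
  rewrite -hy; apply: eq_filler => k hk; apply: eq_map => r /=.
  by have -> : (u + n%:Z + k%:Z < u + n%:Z) = false by lia.
apply: (@eq_from_nth _ [::]); rewrite size_window// => k hk; rewrite nth_window//.
have hsz : size (nth [::] e k) = lv n.
  by apply/eqP; move/allP: hl; apply; rewrite mem_nth// he.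
apply: (@eq_from_nth _ false); rewrite size_mkseq ?hsz// => r hr; rewrite nth_mkseq//.
have -> : (u + k%:Z < u + n%:Z) by lia.
by congr (nth _ (nth _ _ _) _); lia.
Qed.

Definition agree_upto (n : nat) (x x' : bitarray) :=
  forall i r, `|i| <= n%:Z -> (r < n)%N -> x' i r = x i r.

Lemma agree_upto_le m n x x' : (m <= n)%N -> agree_upto n x x' -> agree_upto m x x'.
Proof. by move=> h ha i r hi hr; apply: ha; lia. Qed.

Lemma agree_window n x x' r u k : agree_upto n x x' -> (r <= n)%N -> - n%:Z <= u ->
  u + k%:Z <= n%:Z -> window r x' u k = window r x u k.
Proof.
move=> h hr hu hk; apply: eq_window => l hl; apply: eq_in_mkseq => r' hr'.
by apply: h; lia.
Qed.

(** * Sources and markers *)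

Section Source.
Context {R : realDomainType}.

Record source (P : seq bool -> R) : Prop := Source {
  source_ge0 : forall w, 0 <= P w;
  source_nil : P [::] = 1;
  source_add : forall w, P w = P (rcons w false) + P (rcons w true) }.

Fixpoint bitwords (r : nat) : seq (seq bool) :=
  if r is r'.+1 then [seq rcons w c | w <- bitwords r', c <- [:: false; true]] else [:: [::]].

Definition letters (P : seq bool -> R) r := [seq w <- bitwords r | 0 < P w].

Lemma mem_bitwords r w : (w \in bitwords r) = (size w == r).
Proof.
elim: r w => [|r IH] w; first by rewrite inE; case: w.
apply/allpairsP/eqP => [[[v c] /= [hv _ ->]]|].
  by rewrite size_rcons; move: hv; rewrite IH => /eqP ->.
case/lastP: w => // v c; rewrite size_rcons => -[hv].
by exists (v, c); rewrite /= IH hv eqxx; split=> //; case: c.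
Qed.

Lemma bitwords_uniq r : uniq (bitwords r).
Proof.
elim: r => [//|r IH]; apply: (@allpairs_uniq _ _ _ rcons) => //.
by move=> -[w c] [w' c'] _ _ /= /rcons_inj [-> ->].
Qed.

Lemma big_bitwordsS r (F : seq bool -> R) :
  \sum_(w <- bitwords r.+1) F w = \sum_(w <- bitwords r) (F (rcons w false) + F (rcons w true)).
Proof. by rewrite big_allpairs_dep; apply: eq_bigr => w _; rewrite big_cons big_seq1. Qed.

Variable P : seq bool -> R.
Hypothesis sP : source P.

Lemma sum_letters r (F : seq bool -> R) :
  \sum_(w <- letters P r) P w * F w = \sum_(w <- bitwords r) P w * F w.
Proof.
rewrite /letters big_filter big_mkcond /=; apply: eq_bigr => w _; case: ltP => // h.
by have -> : P w = 0 by [apply/eqP; rewrite eq_le h source_ge0]; rewrite mul0r.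
Qed.

Lemma sum_letters_take r r' (G : seq bool -> R) : (r <= r')%N ->
  \sum_(w <- letters P r') P w * G (take r w) = \sum_(w <- letters P r) P w * G w.
Proof.
move=> /subnK <-; rewrite !sum_letters; elim: (r' - r)%N => [|k IH].
  rewrite add0n; apply: eq_big_seq => w; rewrite mem_bitwords => /eqP <-.
  by rewrite take_size.
rewrite addSn big_bitwordsS -IH; apply: eq_big_seq => w; rewrite mem_bitwords => /eqP hw.
by rewrite (source_add sP w) mulrDl -!cats1 !takel_cat// hw leq_addl.
Qed.

Lemma sum_letters1 r : \sum_(w <- letters P r) P w = 1.
Proof.
have := @sum_letters_take 0 r (fun=> 1) (leq0n r).
under eq_bigr do rewrite mulr1.
move=> ->; rewrite sum_letters /= big_seq1 mulr1; exact: source_nil.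
Qed.

Lemma sum_bitwords1 r : \sum_(w <- bitwords r) P w = 1.
Proof.
by rewrite -(sum_letters1 r); under eq_bigr do rewrite -[P _]mulr1;
  under [RHS]eq_bigr do rewrite -[P _]mulr1; rewrite sum_letters.
Qed.

Lemma source_le1 w : P w <= 1.
Proof.
rewrite -(sum_bitwords1 (size w)); apply: ler_sum_mem; first by rewrite mem_bitwords.
by move=> y _; exact: source_ge0.
Qed.

Lemma mem_letters r w : (w \in letters P r) = (size w == r) && (0 < P w).
Proof. by rewrite mem_filter mem_bitwords andbC. Qed.

Lemma letters_uniq r : uniq (letters P r).
Proof. by rewrite filter_uniq ?bitwords_uniq. Qed.

Lemma source_take w r : P w <= P (take r w).
Proof.
elim/last_ind: w => [//|w c IH]; case: (leqP r (size w)) => h.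
  rewrite -cats1 takel_cat// cats1; apply: le_trans IH; rewrite (source_add sP w).
  by case: c; rewrite ?lerDl ?lerDr source_ge0.
by rewrite take_oversize// size_rcons.
Qed.

Definition letter_words r n := words (fun=> letters P r) (nseq n tt).
Definition letter_wt n w : R := word_wt (fun=> P) (nseq n tt) w.

Lemma letter_words_uniq r n : uniq (letter_words r n).
Proof. by apply: words_uniq => _; exact: letters_uniq. Qed.

Lemma mem_letter_words r n w :
  (w \in letter_words r n) = (size w == n) && all (fun a => (size a == r) && (0 < P a)) w.
Proof.
elim: n w => [|n IH] [|a w] //=; first by apply/negP => /size_in_words.
by rewrite in_words_cons mem_letters IH eqSS andbCA.
Qed.

Lemma letter_words_size r n w : w \in letter_words r n ->
  size w = n /\ all (fun a => size a == r) w.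
Proof.
by rewrite mem_letter_words => /andP[/eqP -> /allP h]; split=> //; apply/allP => a /h /andP[].
Qed.

Lemma letter_words_sub r n w s : w \in letter_words r n -> {subset s <= w} ->
  s \in letter_words r (size s).
Proof.
by rewrite !mem_letter_words eqxx => /andP[_ /allP h] sw; apply/allP => a /sw /h.
Qed.

Lemma letter_wt_gt0 r n w : w \in letter_words r n -> 0 < letter_wt n w.
Proof. by apply: word_wt_gt0 => _ a; rewrite mem_letters => /andP[]. Qed.

Lemma letter_wt_ge0 n w : 0 <= letter_wt n w.
Proof. by apply: word_wt_ge0 => _ a; exact: source_ge0. Qed.

Lemma sum_letter_wt r n : \sum_(w <- letter_words r n) letter_wt n w = 1.
Proof. by apply: sum_word_wt => _; exact: sum_letters1. Qed.

Lemma letter_wt_prod n w : size w = n -> letter_wt n w = \prod_(k <- iota 0 n) P (nth [::] w k).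
Proof.
rewrite /letter_wt; elim: n w => [|n IH] [|a w] //=; first by rewrite big_nil.
by move=> [h]; rewrite big_cons IH// -[1%N]addn0 iotaDl big_map.
Qed.

Lemma letter_wt_take_le r r' n w : w \in letter_words r' n ->
  letter_wt n w <= letter_wt n (map (take r) w).
Proof.
rewrite mem_letter_words => /andP[/eqP <- _]; elim: w => //= a w IH; rewrite /letter_wt /=.
by apply: ler_pM => //; [exact: source_ge0|exact: letter_wt_ge0|exact: source_take].
Qed.

Lemma map_word_nseq (T T' : eqType) (f : T -> T') n w : size w = n ->
  map_word (fun=> f) (nseq n tt) w = map f w.
Proof. by elim: n w => [|n IH] [|a w] //= [h]; rewrite IH. Qed.

Lemma sum_letter_wt_take r r' n (F : seq (seq bool) -> R) : (r <= r')%N ->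
  \sum_(w <- letter_words r' n) letter_wt n w * F (map (take r) w) =
  \sum_(w <- letter_words r n) letter_wt n w * F w.
Proof.
move=> h; rewrite -(@sum_map_word R unit _ _ (fun=> letters P r') (fun=> P) (fun=> letters P r)
  (fun=> P) (fun=> take r)); last by move=> _ G; exact: sum_letters_take.
by apply: eq_big_seq => w /size_in_words hw; rewrite map_word_nseq// hw size_nseq.
Qed.

Lemma letter_words_take r r' n w : (r <= r')%N ->
  w \in letter_words r' n -> map (take r) w \in letter_words r n.
Proof.
rewrite !mem_letter_words size_map => h /andP[-> /= /allP ha].
apply/allP => a /mapP[c /ha /andP[/eqP hs hp] ->].
by rewrite size_takel ?hs// eqxx (lt_le_trans hp)// source_take.
Qed.

Lemma sum_letter_wt_cat r n k (F : seq (seq bool) -> R) :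
  \sum_(w <- letter_words r (n + k)) letter_wt (n + k) w * F w =
  \sum_(w <- letter_words r n) letter_wt n w *
    \sum_(w' <- letter_words r k) letter_wt k w' * F (w ++ w').
Proof.
rewrite /letter_words nseqD big_words_cat; apply: eq_big_seq => w /size_in_words hw.
rewrite mulr_sumr; apply: eq_bigr => w' _.
by rewrite /letter_wt nseqD word_wt_cat// mulrA.
Qed.

End Source.

(* A marker of length [K] is a set of words of [K] letters, read to depth [mdepth], no two
   occurrences of which overlap. *)
Record marker (R : realType) (K : nat) := Marker {
  mlaw : seq bool -> R;
  mdepth : nat;
  mword : pred (seq (seq bool));
  mlaw_source : source mlaw;
  mlen_gt0 : (0 < K)%N;
  mword_nonoverlap : forall x u d, (0 < d < K)%N ->
    mword (window mdepth x u K) -> ~~ mword (window mdepth x (u + d%:Z) K) }.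

Section Marker.
Context {R : realType} {K : nat} (M : marker R K).
Implicit Types (x : bitarray) (e : seq (seq bool)).
Local Notation P := (mlaw M).
Local Notation r0 := (mdepth M).

Definition mark x (i : int) := mword M (window r0 x i K).
Definition mark_in e k := mword M (map (take r0) (take K (drop k e))).
Definition gap_word n e :=
  [&& (K <= n)%N, mark_in e 0 & all (fun k => ~~ mark_in e k) (iota 1 (n - K))].
Definition gap_prob n : R := \sum_(e <- letter_words P r0 n | gap_word n e) letter_wt P n e.

Lemma mark_in_window r x u n k : (r0 <= r)%N -> (k + K <= n)%N ->
  mark_in (window r x u n) k = mark x (u + k%:Z).
Proof. by move=> hr hk; rewrite /mark_in take_drop_window// map_take_window. Qed.

Lemma mark_in_map_take r e k : (r0 <= r)%N -> mark_in (map (take r) e) k = mark_in e k.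
Proof.
move=> hr; rewrite /mark_in -map_drop -map_take -map_comp; congr (mword M).
by apply: eq_map => a /=; rewrite take_takel.
Qed.

Lemma gap_word_map_take r n e : (r0 <= r)%N -> gap_word n (map (take r) e) = gap_word n e.
Proof.
move=> hr; rewrite /gap_word mark_in_map_take//; do 2 congr (_ && _).
by apply: eq_all => k; rewrite mark_in_map_take.
Qed.

Lemma gap_probE r n : (r0 <= r)%N ->
  \sum_(e <- letter_words P r n | gap_word n e) letter_wt P n e = gap_prob n.
Proof.
move=> hr; rewrite /gap_prob big_mkcond [RHS]big_mkcond /=.
transitivity (\sum_(e <- letter_words P r n) letter_wt P n e * (gap_word n (map (take r0) e))%:R).
  by apply: eq_bigr => e _; rewrite gap_word_map_take//; case: ifP; rewrite ?mulr1 ?mulr0.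
rewrite (sum_letter_wt_take (mlaw_source M) n (fun e => (gap_word n e)%:R) hr).
by apply: eq_bigr => e _; case: ifP; rewrite ?mulr1 ?mulr0.
Qed.

Lemma gap_word_wt_le r n e : (r0 <= r)%N -> e \in letter_words P r n -> gap_word n e ->
  letter_wt P n e <= gap_prob n.
Proof.
move=> hr he hge; rewrite -(gap_probE n hr) big_mkcond /=.
have := @ler_sum_mem R _ _ (fun e => if gap_word n e then letter_wt P n e else 0) e he.
rewrite hge; apply=> a _ /=; case: ifP => // _; exact: letter_wt_ge0 (mlaw_source M) _ _.
Qed.

Lemma gap_word_prob_gt0 r n e : (r0 <= r)%N -> e \in letter_words P r n -> gap_word n e ->
  0 < gap_prob n.
Proof. by move=> hr he /(gap_word_wt_le hr he); apply: lt_le_trans; exact: letter_wt_gt0 he. Qed.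

Lemma mark_before x i v : mark x v -> v - K%:Z < i < v -> ~~ mark x i.
Proof.
move=> hv hi; apply/negP => hi'; have hd : (0 < `|v - i| < K)%N by lia.
by have /negP := mword_nonoverlap hd hi'; rewrite addr_abszBr//; lia.
Qed.

Lemma gap_path_cons r x u n s : (r0 <= r)%N ->
  gap_path (mark x) u (n :: s) = gap_word n (window r x u n) && gap_path (mark x) (u + n%:Z) s.
Proof.
move=> hr; have K0 := mlen_gt0 M; apply/idP/andP => /=.
  case/and4P => hu n0 hn hp; split=> //.
  have hK : (K <= n)%N.
    rewrite leqNgt; apply/negP => h; move: hu; apply/negP.
    by apply: (mark_before (gap_path_start hp)); lia.
  rewrite /gap_word hK mark_in_window// addr0 hu /=; apply/allP => k; rewrite mem_iota => hk.
  by rewrite mark_in_window; [move/markfreeP: hn; apply; lia|done|lia].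
case=> /and3P[hK]; rewrite mark_in_window ?add0n// addr0 => hu /allP hn hp.
rewrite hu hp andbT (leq_trans K0 hK) /=; apply/markfreeP => i hi.
have [hi'|hi'] := leP i (u + (n - K)%N%:Z); last first.
  by apply: (mark_before (gap_path_start hp)); lia.
by have := hn `|i - u|%N; rewrite mem_iota mark_in_window ?addr_abszBr//; [apply; lia|lia..].
Qed.

Lemma gap_word_mark r x u n : (r0 <= r)%N -> gap_word n (window r x u n) -> mark x u.
Proof. by move=> hr /and3P[hK]; rewrite mark_in_window// addr0. Qed.

Lemma mark_bshift x i : mark (bshift x) i = mark x (i + 1).
Proof. by rewrite /mark window_bshift. Qed.

End Marker.

Lemma map_take0 (T : Type) n (e : seq (seq T)) : size e = n -> map (take 0) e = nseq n [::].
Proof. by move=> <-; elim: e => //= a e ->; rewrite take0. Qed.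

Definition leveled (R : realType) (K : nat) (M : bool -> marker R K) (st : nat -> stage R) :=
  [/\ forall b j, (mdepth (M b) <= level (st j) b)%N,
      forall b j, (level (st j) b <= level (st j.+1) b)%N &
      forall j, (gap_bound (st j) <= gap_bound (st j.+1))%N].

Section GapTower.
Context {R : realType} {K : nat} (M : bool -> marker R K) (st : nat -> stage R).
Hypothesis st_lev : leveled M st.
Local Notation T := (seq (seq bool)).
Local Notation P b := (mlaw (M b)).

(* Only gaps no longer than the current level are named; the others carry no information. *)
Definition named b j n := (n <= level (st j) b)%N && (0 < gap_prob (M b) n).
Definition gap_depth b j n := if named b j n then level (st j) b else 0%N.
Definition names b j n : seq T :=
  if named b j n then [seq e <- letter_words (P b) (level (st j) b) n | gap_word (M b) n e]
  else [:: nseq n [::]].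
Definition name_wt b j n (e : T) : R :=
  if named b j n then letter_wt (P b) n e / gap_prob (M b) n else 1.
Definition coarsen_name b j n : T -> T := map (take (gap_depth b j n)).

Lemma gap_depth_le b j n : (gap_depth b j n <= level (st j) b)%N.
Proof. by rewrite /gap_depth; case: ifP. Qed.

Lemma names_uniq b j n : uniq (names b j n).
Proof.
by rewrite /names; case: ifP => // _; rewrite filter_uniq// letter_words_uniq.
Qed.

Lemma name_wt_gt0 b j n a : a \in names b j n -> 0 < name_wt b j n a.
Proof.
rewrite /names /name_wt; case: ifP => // /andP[_ v0]; rewrite mem_filter => /andP[_ ha].
by rewrite divr_gt0// (letter_wt_gt0 ha).
Qed.

Lemma names_size b j n a : a \in names b j n ->
  size a = n /\ all (fun c => size c == gap_depth b j n) a.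
Proof.
rewrite /names /gap_depth; case: ifP => _; last first.
  by rewrite inE => /eqP ->; rewrite size_nseq all_nseq orbT.
by rewrite mem_filter => /andP[_]; exact: letter_words_size.
Qed.

Lemma named_le b j n : named b j n -> named b j.+1 n.
Proof.
by case: st_lev => _ hS _ /andP[h h']; rewrite /named h' andbT (leq_trans h).
Qed.

Lemma gap_depth_mono b j n : (gap_depth b j n <= gap_depth b j.+1 n)%N.
Proof. by case: st_lev => _ hS _; rewrite /gap_depth; case: ifP => // /named_le ->. Qed.

Lemma sum_name_wt b j n : \sum_(a <- names b j n) name_wt b j n a = 1.
Proof.
case: st_lev => h0 _ _.
rewrite /names /name_wt; case: ifP => [/andP[_ v0]|_]; last by rewrite big_seq1.
by rewrite big_filter -mulr_suml gap_probE// divff// gt_eqF.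
Qed.

Lemma coarsen_name_in b j n a : a \in names b j.+1 n -> coarsen_name b j n a \in names b j n.
Proof.
case: st_lev => h0 hS _ ha; rewrite /coarsen_name /gap_depth /names.
case: ifP => hk; last by rewrite (map_take0 (proj1 (names_size ha))) inE.
move: ha; rewrite /names (named_le hk) !mem_filter => /andP[h1 h2].
by rewrite gap_word_map_take// h1 (letter_words_take (mlaw_source _) _ h2).
Qed.

Lemma coarsen_name_push b j n (G : T -> R) :
  \sum_(a <- names b j.+1 n) name_wt b j.+1 n a * G (coarsen_name b j n a) =
  \sum_(a <- names b j n) name_wt b j n a * G a.
Proof.
case: st_lev => h0 hS _; rewrite /coarsen_name /gap_depth; have [hk|hk] := boolP (named b j n).
  rewrite /names /name_wt hk (named_le hk) !big_filter big_mkcond [RHS]big_mkcond /=.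
  pose H e := if gap_word (M b) n e then G e / gap_prob (M b) n else 0.
  transitivity (\sum_(e <- letter_words (P b) (level (st j.+1) b) n)
      letter_wt (P b) n e * H (map (take (level (st j) b)) e)).
    apply: eq_bigr => e _; rewrite /H gap_word_map_take//; case: ifP => _; last by rewrite mulr0.
    by rewrite mulrAC -mulrA.
  rewrite (sum_letter_wt_take (mlaw_source (M b)) n H)//.
  apply: eq_bigr => e _; rewrite /H; case: ifP => _; last by rewrite mulr0.
  by rewrite mulrCA mulrC mulrAC.
have -> : \sum_(a <- names b j n) name_wt b j n a * G a = G (nseq n [::]).
  by rewrite /names /name_wt (negbTE hk) big_seq1 mul1r.
rewrite (eq_big_seq (fun a => name_wt b j.+1 n a * G (nseq n [::]))).
  by rewrite -mulr_suml sum_name_wt mul1r.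
by move=> a ha; rewrite (map_take0 (proj1 (names_size ha))).
Qed.

Definition gap_tower : tower R T :=
  Tower names_uniq name_wt_gt0 sum_name_wt coarsen_name_in coarsen_name_push.

End GapTower.

(** * The coding map *)

Section Decode.
Context {R : realType} {K : nat} (M : bool -> marker R K) (st : nat -> stage R).
Hypothesis st_lev : leveled M st.
Local Notation T := (seq (seq bool)).
Local Notation L := (GenTree.tree (seq T)).
Local Notation tw := (gap_tower st_lev).
Local Notation depth b j := (gap_depth M st b j).
Variable g : nat -> seq nat -> L -> L -> R.
Hypothesis g_ref : refining tw st g.
Implicit Types (b be : bool) (j : nat) (x y : bitarray) (u i : int) (s : seq nat).

Definition stage_block b j x u s := block (mark (M b) x) (gap_bound (st j)) u s.
Definition block_filler b j x u s := filler (depth b j) x u s.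
Definition regular b j x u s := block_filler b j x u s \in fillers tw b j s.
Definition coupled b j x y u s :=
  0 < orient b (g j s) (label tw st b j s (block_filler b j x u s))
        (label tw st (~~ b) j s (block_filler (~~ b) j y u s)).

(* The stage-[j] block of [x] around [i] forces the [r]-th bit at [i] of every array it is
   coupled with. *)
Definition decodes b j x i r be := exists u s,
  [/\ stage_block b j x u s, u <= i < u + (sumn s)%:Z, regular b j x u s,
      (r < depth_at (depth (~~ b) j) s `|i - u|)%N &
      forall y, regular (~~ b) j y u s -> coupled b j x y u s -> y i r = be].

Definition decode b x : bitarray := fun i r => `[< exists j, decodes b j x i r true >].

Definition decodable_at b n j x :=
  forall i r, `|i| <= n%:Z -> (r < n)%N -> exists be, decodes b j x i r be.

Definition decodable b x := forall n : nat, exists j, (n <= j)%N /\ decodable_at b n j x.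

Lemma coarsen_block_filler b j x u s :
  coarsen tw b j s (block_filler b j.+1 x u s) = block_filler b j x u s.
Proof. by apply: map_word_filler => n; exact: gap_depth_mono. Qed.

Lemma regular_pred b j x u s : regular b j.+1 x u s -> regular b j x u s.
Proof. by rewrite /regular -(coarsen_block_filler b j x u s); exact: coarsen_in. Qed.

Lemma regular_cat b j x u s1 s2 :
  regular b j x u (s1 ++ s2) = regular b j x u s1 && regular b j x (u + (sumn s1)%:Z) s2.
Proof. by rewrite /regular /block_filler filler_cat /fillers in_words_cat ?size_filler. Qed.

Lemma regular_segment b j x u s ss1 t ss2 : regular b j.+1 x u s ->
  segments (gap_bound (st j)) s = ss1 ++ t :: ss2 ->
  regular b j x (u + (sumn (flatten ss1))%:Z) t.
Proof.
by move=> /regular_pred h /segments_cat_cons e; move: h; rewrite e !regular_cat => /and3P[].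
Qed.

Lemma coupled_segment b j x y u s ss1 t ss2 : regular b j.+1 x u s -> regular (~~ b) j.+1 y u s ->
  coupled b j.+1 x y u s -> segments (gap_bound (st j)) s = ss1 ++ t :: ss2 ->
  coupled b j x y (u + (sumn (flatten ss1))%:Z) t.
Proof.
case: g_ref => g_cpl g_refines hx hy hc e; have [_ h _] := g_refines j s.
have := h b _ _ hx hy hc; rewrite /coarse_density !coarsen_block_filler e !segmentwise_cat /=.
rewrite {2 5}(segments_cat_cons e) !filler_mid; apply: seg_density_gt0_mid.
- by move=> s'; case: (g_cpl j s').
- by rewrite size_segmentwise.
- by rewrite size_segmentwise.
Qed.

Lemma coupled_descent b j j' x y u s u' s' (m : int -> bool) i : (j <= j')%N ->
  block m (gap_bound (st j')) u' s' -> block m (gap_bound (st j)) u s ->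
  u' <= i < u' + (sumn s')%:Z -> u <= i < u + (sumn s)%:Z ->
  regular b j' x u' s' -> regular (~~ b) j' y u' s' -> coupled b j' x y u' s' ->
  [/\ regular b j x u s, regular (~~ b) j y u s, coupled b j x y u s &
      u' <= u /\ u + (sumn s)%:Z <= u' + (sumn s')%:Z].
Proof.
have [_ _ bound_mono] := st_lev.
move=> /subnK <-; elim: (j' - j)%N u' s' => [|k IH] u' s' hb' hb hi' hi hx hy hc.
  by have [<- <-] := block_uniq hb' hb hi' hi.
have hi'' := hi'; rewrite -{1}(flatten_segments (gap_bound (st (k + j)%N)) s') in hi''.
have [ss1 [t [ss2 [e ht]]]] := flatten_find hi''.
have hbt := segment_block (bound_mono _) hb' e.
have [h1 h2 h3 h4] := IH _ _ hbt hb ht hi (regular_segment hx e) (regular_segment hy e)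
  (coupled_segment hx hy hc e).
by split=> //; have := segments_cat_cons e => ->; rewrite !sumn_cat; lia.
Qed.

Lemma exists_block_filler b j u s w : w \in fillers tw b j s ->
  exists y, block_filler b j y u s = w.
Proof.
move=> hw; apply: exists_filler; first exact: size_in_words hw.
suff h k : (k < size s)%N -> nth [::] w k \in names M st b j (nth 0%N s k).
  by move=> k /h; exact: names_size.
elim: s w hw k => // n s IH [|e w] hw; first by have := size_in_words hw.
by move: hw; rewrite /fillers in_words_cons => /andP[he hw] [|k] //= hk; exact: IH.
Qed.

Lemma exists_coupled b j x u s : regular b j x u s ->
  exists y, regular (~~ b) j y u s /\ coupled b j x y u s.
Proof.
case: g_ref => g_cpl _ hx; have [g_ge0 g_sum] := g_cpl j s; set w := block_filler b j x u s.
have [w' hw' hg] : exists2 w', w' \in fillers tw (~~ b) j s &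
    0 < orient b (g j s) (label tw st b j s w) (label tw st (~~ b) j s w').
  apply: contrapT => hn; have := g_sum b _ hx; rewrite big_seq big1 => [/esym/eqP|w' hw'].
    by rewrite oner_eq0.
  have [->|neq0] := eqVneq (orient b (g j s) (label tw st b j s w) (label tw st (~~ b) j s w')) 0.
    by rewrite mulr0.
  by exfalso; apply: hn; exists w'; rewrite // lt_neqAle orient_ge0// eq_sym neq0.
have [y hy] := exists_block_filler u hw'.
by exists y; rewrite /regular /coupled hy.
Qed.

Lemma coupled_sym b j x y u s : coupled (~~ b) j y x u s = coupled b j x y u s.
Proof. by rewrite /coupled negbK orient_flip. Qed.

Lemma decodes_uniq b j j' x i r be be' :
  decodes b j x i r be -> decodes b j' x i r be' -> be = be'.
Proof.
wlog le_j : j j' be be' / (j <= j')%N => [H|].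
  by case/orP: (leq_total j j') => h d d'; [exact: H h d d'|apply/esym; exact: H h d' d].
move=> [u [s [hb hi hx hr hd]]] [u' [s' [hb' hi' hx' hr' hd']]].
have [y [hy hc]] := exists_coupled hx'.
have [h1 h2 h3 _] := coupled_descent le_j hb' hb hi' hi hx' hy hc.
by rewrite -(hd y h2 h3) -(hd' y hy hc).
Qed.

Lemma decodesE b j x i r be : decodes b j x i r be -> decode b x i r = be.
Proof.
move=> h; rewrite /decode; case: be h => h; apply/asboolP; first by exists j.
by case=> j' /decodes_uniq /(_ h).
Qed.

Lemma decode_coupled b j x u s y i r : stage_block b j x u s -> u <= i < u + (sumn s)%:Z ->
  regular (~~ b) j y u s -> coupled b j x y u s ->
  (exists be, decodes b j x i r be) -> y i r = decode b x i r.
Proof.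
move=> hb hi hy hc [be hd]; rewrite (decodesE hd).
have [u' [s' [hb' hi' _ _ h]]] := hd.
by have [e1 e2] := block_uniq hb hb' hi hi'; subst u' s'; exact: h.
Qed.

Lemma decodable_decodes b x i r : decodable b x -> exists j be, decodes b j x i r be.
Proof.
move=> hG; have [j [_ h]] := hG (`|i| + r).+1%N.
by have [||be hd] := h i r; [lia|lia|exists j, be].
Qed.

Lemma decodable_block b x n : decodable b x -> exists j, (n <= j)%N /\
  forall i, `|i| <= n%:Z -> exists u s, [/\ stage_block b j x u s,
    u <= i < u + (sumn s)%:Z, regular b j x u s,
    (n <= depth_at (depth (~~ b) j) s `|i - u|)%N &
    forall r, (r < n)%N -> exists be, decodes b j x i r be].
Proof.
move=> hG; have [j [hj hD]] := hG n.+1; exists j; split; first exact: ltnW.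
move=> i hi; have hi1 : `|i| <= n.+1%:Z by lia.
have [be [u [s [hb hi' hx hr _]]]] := hD i n hi1 (ltnSn n).
exists u, s; split=> //; first exact: ltnW.
by move=> r hr'; apply: hD => //; lia.
Qed.

Lemma regular_gap_word b j y u n s1 s2 : regular b j y u (s1 ++ n :: s2) ->
  (0 < depth b j n)%N -> gap_word (M b) n (window (mdepth (M b)) y (u + (sumn s1)%:Z) n).
Proof.
have [h0 _ _] := st_lev; rewrite regular_cat => /andP[_].
rewrite /regular [block_filler _ _ _ _ _]/= /fillers in_words_cons => /andP[+ _].
rewrite [gap_names _ _ _ _]/(names M st b j n) /names /gap_depth.
case: (named M st b j n) => //; rewrite mem_filter => /andP[hg _] _.
by rewrite -(map_take_window y _ n (h0 b j)) gap_word_map_take.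
Qed.

(* Deep inside a block all partners agree with [decode b x], and they have the same gaps. *)
Lemma decode_gap_word b x u0 n : decodable b x -> gap_path (mark (M b) x) u0 [:: n] ->
  gap_word (M (~~ b)) n (window (mdepth (M (~~ b))) (decode b x) u0 n).
Proof.
move=> hG hp; have /= /and4P[_ n0 _ _] := hp.
pose n1 := (`|u0| + n + mdepth (M (~~ b))).+1%N.
have [j [_ hj]] := decodable_block n1 hG.
have start_near : `|u0| <= n1%:Z by rewrite /n1; lia.
have [u [s [hb hi hx deep _]]] := hj _ start_near; have [y [hy hc]] := exists_coupled hx.
have [s1 [s2 [es eu]]] := gap_path_split (proj1 (andP hb)) hp hi.
have hk : (`|u0 - u| = sumn s1)%N by lia.
rewrite es hk -[sumn s1]addn0 depth_at_cat /= n0 in deep.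
have := hy; rewrite es => /regular_gap_word; rewrite eu; set wy := window _ y _ _.
suff -> : wy = window (mdepth (M (~~ b))) (decode b x) u0 n by apply; rewrite (leq_trans _ deep).
apply: eq_window => k hkn; apply: eq_in_mkseq => r hr.
have site_near : `|u0 + k%:Z| <= n1%:Z by rewrite /n1; lia.
have [_ [_ [_ _ _ _ hD]]] := hj _ site_near.
apply: (decode_coupled hb _ hy hc); last by apply: hD; rewrite /n1; lia.
by rewrite es sumn_cat /=; lia.
Qed.

Lemma decodable_gap b x i : decodable b x ->
  exists u n, u <= i < u + n%:Z /\ gap_path (mark (M b) x) u [:: n].
Proof.
move=> hG; have [j [_ hj]] := decodable_block `|i|%N hG.
have [|u [s [hb hi _ _ _]]] := hj i; first by lia.
have [s1 [n [s2 [_ h1 h2]]]] := gap_path_find (proj1 (andP hb)) hi.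
by exists (u + (sumn s1)%:Z), n; split=> //; exact: gap_path_head h2.
Qed.

Lemma mark_decode b x i : decodable b x -> mark (M b) x i -> mark (M (~~ b)) (decode b x) i.
Proof.
move=> hG hi; have [u [n [hu hp]]] := decodable_gap i hG.
have e : u = i.
  apply/eqP; rewrite eq_le; apply/andP; split; first by lia.
  rewrite leNgt; apply/negP => hlt; have /= /and4P[_ _ free _] := hp.
  by apply: markfreeF free hi _; lia.
by subst u; apply: gap_word_mark (decode_gap_word hG hp).
Qed.

Lemma decode_mark b x : decodable b x -> mark (M (~~ b)) (decode b x) = mark (M b) x.
Proof.
move=> hG; apply/funext => i; apply/idP/idP; last exact: mark_decode.
apply: contraTT => hn; have [u [n [hu hp]]] := decodable_gap i hG.
have /and3P[hK _ /allP free] := decode_gap_word hG hp.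
have /= /and4P[hmu n0 _ /andP[/(mark_decode hG) hmn _]] := hp.
have hui : u != i by apply: contraNneq hn => <-.
have [hi'|hi'] := leP i (u + (n - K)%N%:Z); last by apply: (mark_before hmn); lia.
by have := free `|i - u|%N; rewrite mem_iota mark_in_window ?addr_abszBr//; [apply; lia|lia..].
Qed.

Theorem decodeK b x : decodable b x -> decodable (~~ b) (decode b x) ->
  decode (~~ b) (decode b x) = x.
Proof.
move=> hG hG'; apply/funext => i; apply/funext => r; set y := decode b x in hG' *.
have [j [be hD]] := decodable_decodes i r hG'; rewrite (decodesE hD).
have [u [s [hb hi hy _ forces]]] := hD; rewrite /stage_block decode_mark// in hb.
pose n2 := (`|i| + `|u| + sumn s + j + level (st j) (~~ b))%N.
have [J [hJ hGJ]] := decodable_block n2 hG.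
have [|u' [s' [hb' hi' hx' _ _]]] := hGJ i; first by rewrite /n2; lia.
have [y' [hy' hc']] := exists_coupled hx'.
have jJ : (j <= J)%N by rewrite /n2 in hJ; lia.
have [hx _ hc [hu1 hu2]] := coupled_descent jJ hb' hb hi' hi hx' hy' hc'.
have e : block_filler (~~ b) j y' u s = block_filler (~~ b) j y u s.
  apply: eq_filler => k hk; apply: eq_in_mkseq => r' hr'.
  have site_near : `|u + k%:Z| <= n2%:Z by rewrite /n2; lia.
  have [_ [_ [_ _ _ _ hDk]]] := hGJ _ site_near.
  apply: (decode_coupled hb' _ hy' hc'); first by lia.
  apply: hDk; have := depth_at_le s k (gap_depth_le M st (~~ b) j).
  by rewrite /n2; lia.
apply/esym; apply: forces; first by rewrite negbK.
by rewrite coupled_sym /coupled -e.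
Qed.

Lemma decodes_local b j x i r be : decodes b j x i r be ->
  exists n, forall x', agree_upto n x x' -> decodes b j x' i r be.
Proof.
move=> [u [s [hb hi hx hr hd]]].
pose n := (`|u| + sumn s + gap_bound (st j) + K + mdepth (M b) + level (st j) b)%N.
exists n => x' ha; exists u, s.
have e : block_filler b j x' u s = block_filler b j x u s.
  apply: eq_filler => k hk; apply: eq_in_mkseq => r' hr'.
  apply: ha; first by rewrite /n; lia.
  by have := depth_at_le s k (gap_depth_le M st b j); rewrite /n; lia.
split=> //.
- rewrite /stage_block (@eq_block _ (mark (M b) x))// => k hk.
  by rewrite /mark (agree_window ha)//; rewrite /n; lia.
- by rewrite /regular e.
- by move=> y; rewrite /coupled e; exact: hd.
Qed.

Lemma decode_local b x i r : (exists j be, decodes b j x i r be) ->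
  exists n, forall x', agree_upto n x x' -> decode b x' i r = decode b x i r.
Proof.
move=> [j [be hd]]; have [n hn] := decodes_local hd; exists n => x' /hn hd'.
by rewrite (decodesE hd) (decodesE hd').
Qed.

Lemma stage_block_bshift b j x u s : stage_block b j (bshift x) u s = stage_block b j x (u + 1) s.
Proof.
rewrite /stage_block -block_shift; congr (block _ _ _ _).
by apply/funext => k; rewrite mark_bshift.
Qed.

Lemma decodes_bshift b j x i r be : decodes b j (bshift x) i r be <-> decodes b j x (i + 1) r be.
Proof.
split=> [[u [s [hb hi hx hr hd]]]|[u [s [hb hi hx hr hd]]]].
  exists (u + 1), s; rewrite -stage_block_bshift /regular /block_filler -filler_bshift.
  split=> //; [by lia|by have -> : (i + 1 - (u + 1)) = i - u by lia|].
  move=> y; rewrite /regular /coupled /block_filler -!filler_bshift => h1 h2.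
  exact: (hd (bshift y)).
have e : u - 1 + 1 = u by lia.
exists (u - 1), s; rewrite stage_block_bshift /regular /block_filler filler_bshift e.
split=> //; [by lia|by have -> : (i - (u - 1)) = i + 1 - u by lia|].
move=> y; pose y' : bitarray := fun k => y (k - 1).
have -> : y = bshift y' by apply/funext => k; rewrite /bshift /y' addrK.
by rewrite /regular /coupled /block_filler !filler_bshift e; exact: hd.
Qed.

Lemma decode_bshift b x : decode b (bshift x) = bshift (decode b x).
Proof.
apply/funext => i; apply/funext => r; apply/asboolP/asboolP.
  by move=> [j /decodes_bshift]; exists j.
by move=> [j h]; exists j; apply/decodes_bshift.
Qed.

Lemma decodable_bshift b x : decodable b (bshift x) <-> decodable b x.
Proof.
split=> h n; have [j [hj hd]] := h n.+1; exists j; split; try exact: ltnW.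
  move=> i r hi hr; have [||be] := hd (i - 1) r; [lia|lia|].
  by move=> /decodes_bshift; rewrite subrK; exists be.
move=> i r hi hr; have [||be hd'] := hd (i + 1) r; [lia|lia|].
by exists be; apply/decodes_bshift.
Qed.

End Decode.

(** * Probabilities on finite windows *)

Definition extend (u0 : int) (w : seq (seq bool)) : bitarray :=
  fun i k => nth false (nth [::] w `|i - u0|%N) k.

Lemma window_extend_sub r r' u0 n w u k : size w = n -> all (fun a => size a == r) w ->
  (r' <= r)%N -> u0 <= u -> u + k%:Z <= u0 + n%:Z ->
  window r' (extend u0 w) u k = map (take r') (take k (drop `|u - u0|%N w)).
Proof.
move=> hs /allP ha hr hu hk.
have hsz : size (map (take r') (take k (drop `|u - u0|%N w))) = k.
  by rewrite size_map size_takel// size_drop hs; lia.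
apply: (@eq_from_nth _ [::]); rewrite size_window ?hsz// => l hl.
rewrite nth_window// (nth_map [::]); last by rewrite size_map in hsz; rewrite hsz.
rewrite nth_take// nth_drop.
have e : `|(u + l%:Z - u0)%R|%N = (`|u - u0| + l)%N by lia.
have hsl : size (nth [::] w (`|u - u0| + l)) = r.
  by apply/eqP; apply: ha; apply: mem_nth; rewrite hs; lia.
apply: (@eq_from_nth _ false); rewrite size_mkseq ?size_takel ?hsl// => m hm.
by rewrite nth_mkseq// nth_take// /extend e.
Qed.

Lemma window_extend r u n w : size w = n -> all (fun a => size a == r) w ->
  window r (extend u w) u n = w.
Proof.
move=> hs ha; rewrite (@window_extend_sub r r u n)// subrr drop0 take_oversize ?hs//.
exact: map_take_id.
Qed.

Section WordExp.
Context {R : realType} (P : seq bool -> R).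
Hypothesis sP : source P.
Implicit Types (F G : seq (seq bool) -> R).

Definition word_exp (r n : nat) F : R := \sum_(w <- letter_words P r n) letter_wt P n w * F w.

Lemma eq_word_exp r n F G : {in letter_words P r n, F =1 G} -> word_exp r n F = word_exp r n G.
Proof. by move=> h; apply: eq_big_seq => w /h ->. Qed.

Lemma le_word_exp r n F G : {in letter_words P r n, forall w, F w <= G w} ->
  word_exp r n F <= word_exp r n G.
Proof.
by move=> h; apply: ler_sum_seq => w /h hw; apply: ler_wpM2l => //; exact: letter_wt_ge0.
Qed.

Lemma word_exp_cst r n c : word_exp r n (fun=> c) = c.
Proof. by rewrite /word_exp -mulr_suml sum_letter_wt// mul1r. Qed.

Lemma word_exp_ge0 r n F : {in letter_words P r n, forall w, 0 <= F w} -> 0 <= word_exp r n F.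
Proof. by move=> h; rewrite -(word_exp_cst r n 0); exact: le_word_exp. Qed.

Lemma word_exp_gt0 r n F w : w \in letter_words P r n ->
  {in letter_words P r n, forall v, 0 <= F v} -> 0 < F w -> 0 < word_exp r n F.
Proof.
move=> hw F0 Fw; apply: (sumr_gt0_seq hw); last by rewrite mulr_gt0// (letter_wt_gt0 hw).
by move=> v hv; rewrite mulr_ge0 ?F0// letter_wt_ge0.
Qed.

Lemma word_expD r n F G : word_exp r n (fun w => F w + G w) = word_exp r n F + word_exp r n G.
Proof. by rewrite /word_exp -big_split /=; apply: eq_bigr => w _; rewrite mulrDr. Qed.

Lemma word_expZ r n c F : word_exp r n (fun w => c * F w) = c * word_exp r n F.
Proof. by rewrite /word_exp mulr_sumr; apply: eq_bigr => w _; rewrite mulrCA. Qed.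

Lemma word_expB r n F G : word_exp r n (fun w => F w - G w) = word_exp r n F - word_exp r n G.
Proof. by rewrite /word_exp -sumrB; apply: eq_bigr => w _; rewrite mulrBr. Qed.

Lemma word_exp_not r n (Q : pred (seq (seq bool))) :
  word_exp r n (fun w => (~~ Q w)%:R) = 1 - word_exp r n (fun w => (Q w)%:R).
Proof.
rewrite -[X in X - _](word_exp_cst r n 1) -word_expB; apply: eq_word_exp => w _.
by case: (Q w); rewrite ?subrr ?subr0.
Qed.

Lemma word_exp_sum (I : Type) (s : seq I) (p : pred I) r n (F : I -> seq (seq bool) -> R) :
  word_exp r n (fun w => \sum_(i <- s | p i) F i w) = \sum_(i <- s | p i) word_exp r n (F i).
Proof. by rewrite /word_exp exchange_big /=; apply: eq_bigr => w _; rewrite mulr_sumr. Qed.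

Lemma word_exp_cat r n k F :
  word_exp r (n + k) F = word_exp r n (fun w => word_exp r k (fun w' => F (w ++ w'))).
Proof. exact: sum_letter_wt_cat. Qed.

Lemma word_exp_prod r n k F G :
  word_exp r (n + k) (fun w => F (take n w) * G (drop n w)) = word_exp r n F * word_exp r k G.
Proof.
rewrite word_exp_cat [RHS]mulr_suml; apply: eq_big_seq => w /letter_words_size [hs _].
rewrite -mulrA; congr (_ * _); rewrite mulr_sumr; apply: eq_bigr => w' _.
by rewrite take_size_cat// drop_size_cat// mulrCA.
Qed.

Lemma word_exp_take r n k F : word_exp r (n + k) (fun w => F (take n w)) = word_exp r n F.
Proof.
rewrite -[RHS]mulr1 -(word_exp_cst r k 1) -word_exp_prod.
by apply: eq_word_exp => w _; rewrite mulr1.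
Qed.

Lemma word_exp_drop r n k F : word_exp r (n + k) (fun w => F (drop n w)) = word_exp r k F.
Proof.
rewrite -[RHS]mul1r -(word_exp_cst r n 1) -word_exp_prod.
by apply: eq_word_exp => w _; rewrite mul1r.
Qed.

Lemma word_exp_map_take r r' n F : (r' <= r)%N ->
  word_exp r n (fun w => F (map (take r') w)) = word_exp r' n F.
Proof. exact: sum_letter_wt_take. Qed.

End WordExp.

Section WinExp.
Context {R : realType} (P : seq bool -> R).
Hypothesis sP : source P.
Implicit Types (B : nat) (F G : bitarray -> R) (E : bitarray -> Prop) (x : bitarray).

(* [B] bounds both the positions, in [-B, B[, and the number of bits read. *)
Definition win_exp B F : R := word_exp P B (B + B) (fun w => F (extend (- B%:Z) w)).
Definition win_pr B E : R := win_exp B (fun x => (`[< E x >])%:R).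
Definition in_support B x : Prop := window B x (- B%:Z) (B + B) \in letter_words P B (B + B).

Lemma win_exp_window B r u k (F : seq (seq bool) -> R) : (r <= B)%N -> - B%:Z <= u ->
  u + k%:Z <= B%:Z -> win_exp B (fun x => F (window r x u k)) = word_exp P r k F.
Proof.
move=> hr hu hk; rewrite /win_exp.
have [a [c [ha hB]]] : exists a c : nat, a%:Z = u + B%:Z /\ (B + B = a + (k + c))%N.
  by exists `|(u + B%:Z)%R|%N, `|(B%:Z - (u + k%:Z))%R|%N; split; lia.
transitivity (word_exp P B (B + B) (fun w => F (map (take r) (take k (drop a w))))).
  apply: eq_word_exp => w /letter_words_size [hs hal]; congr F.
  by rewrite (@window_extend_sub B r _ (B + B)%N)//; [congr (map _ (take _ (drop _ _))); lia|lia].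
rewrite hB (word_exp_drop sP B a _ (fun w => F (map (take r) (take k w)))).
by rewrite (word_exp_take sP B k c (fun w => F (map (take r) w))) word_exp_map_take.
Qed.

Lemma le_win_exp B F G : (forall x, in_support B x -> F x <= G x) -> win_exp B F <= win_exp B G.
Proof.
move=> h; apply: le_word_exp => // w hw; apply: h; rewrite /in_support.
by have [hs hal] := letter_words_size hw; rewrite window_extend.
Qed.

Lemma eq_win_exp B F G : (forall x, in_support B x -> F x = G x) -> win_exp B F = win_exp B G.
Proof. by move=> h; apply/eqP; rewrite eq_le !le_win_exp// => x /h ->. Qed.

Lemma win_expD B F G : win_exp B (fun x => F x + G x) = win_exp B F + win_exp B G.
Proof. exact: word_expD. Qed.

Lemma win_expZ B c F : win_exp B (fun x => c * F x) = c * win_exp B F.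
Proof. exact: word_expZ. Qed.

Lemma win_exp_sum (I : Type) (s : seq I) (p : pred I) B (F : I -> bitarray -> R) :
  win_exp B (fun x => \sum_(i <- s | p i) F i x) = \sum_(i <- s | p i) win_exp B (F i).
Proof. exact: word_exp_sum. Qed.

Lemma win_exp_cst B c : win_exp B (fun=> c) = c.
Proof. exact: word_exp_cst. Qed.

Lemma le_win_pr B E E' : (forall x, in_support B x -> E x -> E' x) -> win_pr B E <= win_pr B E'.
Proof.
move=> h; apply: le_win_exp => x hx; rewrite ler_nat.
by case: asboolP => // hE; case: asboolP => // /(_ (h x hx hE)).
Qed.

Lemma eq_win_pr B E E' : (forall x, in_support B x -> E x <-> E' x) -> win_pr B E = win_pr B E'.
Proof. by move=> h; apply/eqP; rewrite eq_le !le_win_pr// => x /h []. Qed.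

Lemma win_prU B E E' : win_pr B (fun x => E x \/ E' x) <= win_pr B E + win_pr B E'.
Proof.
rewrite /win_pr -win_expD le_win_exp// => x _; rewrite -natrD ler_nat.
by case: asboolP => // -[] h; case: asboolP => // _; case: asboolP.
Qed.

Lemma win_pr_bigU B (I : eqType) (s : seq I) (E : I -> bitarray -> Prop) :
  win_pr B (fun x => exists2 i, i \in s & E i x) <= \sum_(i <- s) win_pr B (E i).
Proof.
elim: s => [|i s IH].
  rewrite big_nil -(win_exp_cst B 0); apply: le_win_exp => x _.
  by case: asboolP => // -[].
rewrite big_cons; apply: le_trans (lerD (lexx _) IH); apply: le_trans (win_prU _ _ _).
by apply: le_win_pr => x _ [i']; rewrite inE => /orP[/eqP->|h hE]; [left|right; exists i'].
Qed.

Lemma win_pr_window B r u k (Q : pred (seq (seq bool))) : (r <= B)%N -> - B%:Z <= u ->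
  u + k%:Z <= B%:Z -> win_pr B (fun x => Q (window r x u k)) = word_exp P r k (fun w => (Q w)%:R).
Proof.
move=> *; rewrite -(win_exp_window (B := B) (u := u))//.
by apply: eq_win_exp => x _; rewrite asboolb.
Qed.

Lemma in_support_letter B x i : in_support B x -> - B%:Z <= i < B%:Z -> 0 < P (mkseq (x i) B).
Proof.
rewrite /in_support mem_letter_words => /andP[_ /allP h] hi.
have := h (mkseq (x i) B); case/(_ _)/andP => //.
have -> : mkseq (x i) B = nth [::] (window B x (- B%:Z) (B + B)) `|(i + B%:Z)%R|%N.
  by rewrite nth_window; [congr mkseq; congr x; lia|lia].
by apply: mem_nth; rewrite size_window; lia.
Qed.

Lemma in_support_window B x r u k : in_support B x -> (r <= B)%N -> - B%:Z <= u ->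
  u + k%:Z <= B%:Z -> window r x u k \in letter_words P r k.
Proof.
move=> hx hr hu hk; rewrite mem_letter_words size_window eqxx /=; apply/allP => a /mapP[l].
rewrite mem_iota => hl ->; rewrite size_mkseq eqxx /=.
have : 0 < P (mkseq (x (u + l%:Z)) B) by apply: in_support_letter hx _; lia.
by rewrite -(take_mkseq (x (u + l%:Z)) hr) => h; apply: lt_le_trans h (source_take sP _ _).
Qed.

End WinExp.

Lemma letter_words_extend (R : realDomainType) (P : seq bool -> R) r n w :
  w \in letter_words P r n -> window r (extend 0 w) 0 n = w.
Proof. by move=> /letter_words_size [hs ha]; exact: window_extend. Qed.

Section MarkProb.
Context {R : realType} {K : nat} (M : marker R K).
Local Notation P := (mlaw M).
Local Notation r0 := (mdepth M).
Let sP := mlaw_source M.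

Definition markfree_word n w := all (fun k => ~~ mark_in M w k) (iota 0 (n.+1 - K)).
Definition mark_prob : R := word_exp P r0 K (fun w => (mark_in M w 0)%:R).
Definition markfree_prob n : R := word_exp P r0 n (fun w => (markfree_word n w)%:R).

Lemma markfree_word_map_take r n w : (r0 <= r)%N ->
  markfree_word n (map (take r) w) = markfree_word n w.
Proof. by move=> h; apply: eq_all => k; rewrite mark_in_map_take. Qed.

Lemma mark_probE r : (r0 <= r)%N -> word_exp P r K (fun w => (mark_in M w 0)%:R) = mark_prob.
Proof.
move=> h; rewrite /mark_prob -(word_exp_map_take sP _ _ h); apply: eq_word_exp => w _.
by rewrite mark_in_map_take.
Qed.

Lemma markfree_probE r n : (r0 <= r)%N ->
  word_exp P r n (fun w => (markfree_word n w)%:R) = markfree_prob n.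
Proof.
move=> h; rewrite /markfree_prob -(word_exp_map_take sP _ _ h); apply: eq_word_exp => w _.
by rewrite markfree_word_map_take.
Qed.

Lemma markfree_window r x u n : (r0 <= r)%N -> mark M x (u + n%:Z) ->
  markfree (mark M x) u n = markfree_word n (window r x u n).
Proof.
move=> hr hm; have K0 := mlen_gt0 M; apply/markfreeP/allP => [h k|h i hi].
  by rewrite mem_iota => hk; rewrite mark_in_window//; [apply: h; lia|lia].
have [hK|hK] := leP (i + K%:Z) (u + n%:Z); last by apply: (mark_before hm); lia.
by have := h `|i - u|%N; rewrite mem_iota mark_in_window ?addr_abszBr//; [apply; lia|lia..].
Qed.

Lemma cut_point_window r n x u : (r0 <= r)%N ->
  cut_point (mark M x) n u = mark M x u && markfree_word n (window r x (u - n%:Z) n).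
Proof.
move=> hr; rewrite /cut_point; have [hm|//] := boolP (mark M x u).
by rewrite (markfree_window hr)// subrK.
Qed.

End MarkProb.

Section BlockProb.
Context {R : realType} {K : nat} (M : bool -> marker R K) (st : nat -> stage R).
Hypothesis st_lev : leveled M st.
Variables (b : bool) (j : nat).
Local Notation T := (seq (seq bool)).
Local Notation tw := (gap_tower st_lev).
Local Notation P := (mlaw (M b)).
Local Notation lv := (gap_depth M st b j).
Implicit Types (s : seq nat) (e : T).
Let sP := mlaw_source (M b).

Let r0_le r : (level (st j) b <= r)%N -> (mdepth (M b) <= r)%N.
Proof. by case: st_lev => h _ _; exact: leq_trans. Qed.

Fixpoint gap_path_word s w : bool :=
  if s is n :: s' then gap_word (M b) n (take n w) && gap_path_word s' (drop n w)
  else mark_in (M b) w 0.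

Fixpoint filler_word s w : seq T :=
  if s is n :: s' then map (take (lv n)) (take n w) :: filler_word s' (drop n w) else [::].

Lemma gap_path_window r x u s : (mdepth (M b) <= r)%N ->
  gap_path (mark (M b) x) u s = gap_path_word s (window r x u (sumn s + K)).
Proof.
move=> hr; elim: s u => [|n s IH] u; first by rewrite /= mark_in_window// addr0 andbT.
by rewrite (gap_path_cons _ _ _ _ hr) [gap_path_word _ _]/= -addnA take_window drop_window IH.
Qed.

Lemma filler_window r x u s : (level (st j) b <= r)%N ->
  filler lv x u s = filler_word s (window r x u (sumn s + K)).
Proof.
move=> hr; elim: s u => //= n s IH u; rewrite -addnA take_window drop_window IH map_take_window//.
exact: leq_trans (gap_depth_le _ _ _ _ _) hr.
Qed.

Lemma word_exp_gap r n (G : T -> R) : (level (st j) b <= r)%N ->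
  word_exp P r n (fun e => (gap_word (M b) n e)%:R * G (map (take (lv n)) e)) =
  gap_prob (M b) n * \sum_(a <- names M st b j n) name_wt M st b j n a * G a.
Proof.
move=> hr; rewrite /gap_depth /names /name_wt; have [hk|hk] := boolP (named M st b j n).
  pose H e := (gap_word (M b) n e)%:R * G e.
  transitivity (word_exp P r n (fun e => H (map (take (level (st j) b)) e))).
    by apply: eq_word_exp => e _; rewrite /H gap_word_map_take//; case: st_lev.
  rewrite (word_exp_map_take sP n H)// [in RHS]big_filter [in RHS]big_mkcond mulr_sumr.
  apply: eq_bigr => e _; have /andP[_ v0] := hk; rewrite /H.
  case: ifP => _; last by rewrite mul0r !mulr0.
  by rewrite mul1r mulrA mulrCA mulfV ?mulr1 ?gt_eqF.
rewrite big_seq1 mul1r mulrC -(gap_probE n (r0_le hr)) mulr_sumr [RHS]big_mkcond /=.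
apply: eq_big_seq => e /letter_words_size [hs _]; rewrite (map_take0 hs).
by case: ifP => _; rewrite ?mul0r ?mulr0// mul1r mulrC.
Qed.

Definition gaps_prob s := \prod_(n <- s) gap_prob (M b) n.

Lemma word_exp_gap_path r s (F : seq T -> R) : (level (st j) b <= r)%N ->
  word_exp P r (sumn s + K) (fun w => (gap_path_word s w)%:R * F (filler_word s w)) =
  gaps_prob s * mark_prob (M b) * \sum_(w <- fillers tw b j s) filler_wt tw b j s w * F w.
Proof.
move=> hr; elim: s F => [|n s IH] F.
  rewrite /gaps_prob big_nil mul1r /fillers /= big_seq1 /filler_wt /= mul1r.
  by rewrite -(mark_probE (r0_le hr)) mulrC -word_expZ; apply: eq_word_exp => w _; rewrite mulrC.
pose G e := gaps_prob s * mark_prob (M b) *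
  \sum_(w <- fillers tw b j s) filler_wt tw b j s w * F (e :: w).
rewrite [sumn _]/= -addnA word_exp_cat.
transitivity (word_exp P r n (fun e => (gap_word (M b) n e)%:R * G (map (take (lv n)) e))).
  apply: eq_word_exp => e /letter_words_size [hs _].
  rewrite /G -(IH (fun w => F (map (take (lv n)) e :: w))) -word_expZ.
  apply: eq_word_exp => w' _ /=.
  by rewrite take_size_cat// drop_size_cat// -mulnb natrM mulrA.
rewrite word_exp_gap// /gaps_prob big_cons -!mulrA; congr (_ * _).
rewrite [\sum_(w <- fillers _ _ _ (n :: s)) _]big_words_cons.
rewrite [RHS]mulrA [RHS]mulr_sumr; apply: eq_bigr => a _.
rewrite [LHS]mulrCA; congr (_ * _); rewrite mulr_sumr; apply: eq_bigr => w _.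
by rewrite /filler_wt /= mulrA.
Qed.

(* Given the position and shape of a block, its filler is distributed as in the tower. *)
Lemma win_exp_block B n u s (F : seq T -> R) : (level (st j) b <= B)%N -> - B%:Z <= u - n%:Z ->
  u + (sumn s)%:Z + K%:Z <= B%:Z ->
  win_exp P B (fun x => (block (mark (M b) x) n u s)%:R * F (filler lv x u s)) =
  (block_shape n s)%:R * markfree_prob (M b) n *
  (gaps_prob s * mark_prob (M b) *
     \sum_(w <- fillers tw b j s) filler_wt tw b j s w * F w).
Proof.
move=> hB h1 h2; have hr0 := r0_le hB.
rewrite -(word_exp_gap_path _ _ hB) -(markfree_probE n hr0) -mulrA -word_exp_prod -word_expZ.
rewrite -(win_exp_window sP (B := B) (u := u - n%:Z))//; last by lia.
apply: eq_win_exp => // x _; rewrite take_window drop_window.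
rewrite subrK -gap_path_window// -filler_window// /block.
have [hp|hp] /= := boolP (gap_path (mark (M b) x) u s); last by rewrite !mul0r !mulr0.
rewrite (@markfree_window _ _ _ B)//; last by rewrite subrK; exact: gap_path_start hp.
by rewrite mul1r mulrA -natrM mulnb andbC.
Qed.

Lemma in_support_filler B x u s : in_support P B x -> (level (st j) b <= B)%N -> - B%:Z <= u ->
  u + (sumn s)%:Z <= B%:Z -> gap_path (mark (M b) x) u s ->
  filler lv x u s \in fillers tw b j s.
Proof.
move=> hx hB hu hs; elim: s u hu hs => // n s IH u hu hs hp; have [h0 _ _] := st_lev.
have := hp; rewrite (gap_path_cons _ _ _ _ (h0 b j)) => /andP[he hp'].
rewrite /fillers [filler _ _ _ _]/= in_words_cons IH ?andbT//; [|by lia|by move: hs => /=; lia].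
rewrite [gap_names _ _ _ _]/(names M st b j n) /names /gap_depth.
have [_|hk] := boolP (named M st b j n).
  by rewrite mem_filter he /=; apply: in_support_window hx hB hu _ => //; move: hs => /=; lia.
by rewrite inE -(map_take0 (size_window 0 x u n)) map_take_window.
Qed.

End BlockProb.

(** * Laws of large numbers *)

Lemma expR_le_quadratic (R : realType) (y : R) : `|y| <= 2^-1 -> expR y <= 1 + y + 2 * y ^+ 2.
Proof.
move=> hy; have y1 : 0 < 1 - y by rewrite ler_norml in hy; lra.
have h : expR y <= (1 - y)^-1.
  rewrite -[expR y]invrK lef_pV2 ?posrE ?invr_gt0 ?expR_gt0// -expRN.
  by have := @expR_ge1Dx R (- y); lra.
apply: le_trans h _; rewrite -[leLHS]mul1r ler_pdivrMr//.
rewrite ler_norml in hy; nra.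
Qed.

Lemma expR_decay (R : realType) (c A e : R) : 0 < c -> 0 <= A -> 0 < e ->
  exists n0, forall n, (n0 <= n)%N -> A * expR (- (c * n%:R)) <= e.
Proof.
move=> c0 A0 e0; exists (Num.bound (A / (e * c))) => n hn; rewrite expRN ler_pdivrMr ?expR_gt0//.
have exp_ge : 1 + c * n%:R <= expR (c * n%:R) by exact: expR_ge1Dx.
have n_gt : A / (e * c) < n%:R.
  by apply: lt_le_trans (archi_boundP _) _; rewrite ?ler_nat// divr_ge0// mulr_ge0// ltW.
rewrite ltr_pdivrMr ?mulr_gt0// in n_gt.
have : e * (1 + c * n%:R) <= e * expR (c * n%:R) by rewrite ler_pM2l.
by nra.
Qed.

Lemma sum_expR_geometric_le (R : realType) (c : R) n0 k : 0 < c ->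
  \sum_(n <- iota n0 k) expR (- (c * n%:R)) <= expR (- (c * n0%:R)) / (1 - expR (- c)).
Proof.
move=> c0; have hc : 0 < 1 - expR (- c) by rewrite subr_gt0 expR_lt1; lra.
elim: k n0 => [|k IH] n0; first by rewrite big_nil divr_ge0 ?expR_ge0 ?ltW.
rewrite big_cons; apply: le_trans (lerD (lexx _) (IH n0.+1)) _.
rewrite -natr1 mulrDr mulr1 opprD expRD.
set E := expR (- (c * n0%:R)); set q := expR (- c) in hc *.
by have -> : E + E * q / (1 - q) = E / (1 - q) by field; rewrite gt_eqF.
Qed.

Lemma sum_mul_residues (R : nmodType) (h : nat -> R) m q :
  \sum_(k < q * m) h k = \sum_(res < m) \sum_(i < q) h (res + i * m)%N.
Proof.
elim: q => [|q IH]; first by rewrite mul0n big_ord0 big1// => i _; rewrite big_ord0.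
rewrite mulSnr big_split_ord /= IH -big_split /=; apply: eq_bigr => i _.
by rewrite big_ord_recr /= addnC.
Qed.

Lemma exists_residue_sum_ge0 (R : realDomainType) (h : nat -> R) m q : (0 < m)%N ->
  0 <= \sum_(k < q * m) h k -> exists res : 'I_m, 0 <= \sum_(i < q) h (res + i * m)%N.
Proof.
move=> m0 hs; apply: contrapT => hn; move: hs; rewrite sum_mul_residues leNgt => /negP; apply.
have neg (res : 'I_m) : \sum_(i < q) h (res + i * m)%N < 0.
  by rewrite ltNge; apply/negP => h'; apply: hn; exists res.
rewrite (bigD1 (Ordinal m0))// -[ltRHS]addr0; apply: ltr_leD; first exact: (neg (Ordinal m0)).
by apply: sumr_le0 => i _; exact: ltW.
Qed.

(* Dropping fewer than [m] terms changes the sum little, so a large deviation of the whole sum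
   is a deviation of the sum over a multiple of [m]. *)
Lemma sum_deviation_prefix (R : realDomainType) (F : nat -> R) (a C d : R) k re m :
  (forall i, (i < k + re)%N -> `|F i| <= C) -> `|a| <= C -> (re <= m)%N -> 0 <= d ->
  m%:R * (2 * C) <= d * (k + re)%:R ->
  2 * d * (k + re)%:R < \sum_(i < k + re) F i - a * (k + re)%:R ->
  0 <= \sum_(i < k) (F i - a - d).
Proof.
move=> FC aC re_m d0 hm; rewrite big_split_ord /=.
set S := \sum_(i < k) _; set S' := \sum_(i < re) _.
have S'_le : S' - a * re%:R <= m%:R * (2 * C).
  have -> : S' - a * re%:R = \sum_(i < re) (F (k + i)%N - a).
    by rewrite big_split /= sumr_const card_ord mulNrn mulr_natr.
  apply: (@le_trans _ _ (\sum_(i < re) (2 * C))); last first.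
    rewrite sumr_const card_ord -[leLHS]mulr_natl ler_wpM2r ?ler_nat//.
    by rewrite mulr_ge0// (le_trans _ aC).
  apply: ler_sum => i _; have := FC (k + i)%N; rewrite ltn_add2l ltn_ord => /(_ isT).
  by move: aC; rewrite !ler_norml; lra.
rewrite !big_split /= !sumr_const !card_ord -[(- a) *+ k]mulr_natr -[(- d) *+ k]mulr_natr -/S.
have : 0 <= d * re%:R by rewrite mulr_ge0.
by move: hm; rewrite natrD; lra.
Qed.

Section LargeDeviations.
Context {R : realType} (P : seq bool -> R).
Hypothesis sP : source P.
Variables (r m : nat).
Hypothesis m_gt0 : (0 < m)%N.
Implicit Types (w : seq (seq bool)) (f h phi : seq (seq bool) -> R).
Local Notation E n := (word_exp P r n).

Definition at_pos h w k := h (take m (drop k w)).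

Lemma at_pos_take h w n k : (k + m <= n)%N -> at_pos h (take n w) k = at_pos h w k.
Proof. by move=> hk; rewrite /at_pos take_drop take_takel -?take_drop// addnC. Qed.

Lemma at_pos_drop h w n k : at_pos h (drop n w) k = at_pos h w (k + n).
Proof. by rewrite /at_pos drop_drop. Qed.

Lemma at_pos_window h x u n k : (k + m <= n)%N ->
  at_pos h (window r x u n) k = h (window r x (u + k%:Z) m).
Proof. by move=> hk; rewrite /at_pos take_drop_window. Qed.

Lemma at_pos_bounded h C w n k : {in letter_words P r m, forall w, `|h w| <= C} ->
  w \in letter_words P r n -> (k + m <= n)%N -> `|at_pos h w k| <= C.
Proof.
move=> hC hw hk; apply: hC; have [hs _] := letter_words_size hw.
have := @letter_words_sub _ _ _ _ _ (take m (drop k w)) hw; rewrite size_takel.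
  by apply=> a /mem_take /mem_drop.
by rewrite size_drop hs; lia.
Qed.

Lemma word_exp_prod_blocks phi res q n : (res + q * m <= n)%N ->
  E n (fun w => \prod_(i < q) at_pos phi w (res + i * m)) = E m phi ^+ q.
Proof.
move=> hn; rewrite -(subnKC hn); set c := (n - _)%N.
pose F w := \prod_(i < q) at_pos phi w (i * m).
have -> : E (res + q * m + c) (fun w => \prod_(i < q) at_pos phi w (res + i * m)) = E (q * m) F.
  rewrite -addnA -(word_exp_take sP r (q * m) c F).
  rewrite -(word_exp_drop sP r res _ (fun w => F (take (q * m) w))).
  apply: eq_word_exp => w _; apply: eq_bigr => i _.
  by rewrite at_pos_take ?at_pos_drop 1?addnC//; have := ltn_ord i; nia.
elim: q @F {hn c} => [|q IH] F.
  rewrite expr0 -[RHS](word_exp_cst sP r (0 * m)); apply: eq_word_exp => w _.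
  by rewrite /F big_ord0.
rewrite mulSn exprS -IH -word_exp_prod; apply: eq_word_exp => w _; rewrite /F big_ord_recl /=.
congr (_ * _); first by rewrite /at_pos mul0n drop0.
by apply: eq_bigr => i _; rewrite at_pos_drop /bump /= mulnDl mul1n addnC.
Qed.

Lemma word_exp_expR_le h (C de : R) : 0 < de <= C ->
  {in letter_words P r m, forall w, `|h w| <= C} -> E m h <= - de ->
  E m (fun w => expR (de / (4 * C ^+ 2) * h w)) <= 1 - de ^+ 2 / (8 * C ^+ 2).
Proof.
move=> /andP[de0 deC] hC h_mean; have C0 : 0 < C := lt_le_trans de0 deC.
set t := de / (4 * C ^+ 2).
have t0 : 0 < t by rewrite divr_gt0// mulr_gt0// exprn_gt0.
have tC : t * C <= 2^-1.
  rewrite /t invfM expr2 invfM !mulrA mulfVK ?gt_eqF// ler_pdivrMr//; lra.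
apply: (@le_trans _ _ (E m (fun w => (1 + 2 * (t * C) ^+ 2) + t * h w))).
  apply: le_word_exp => // w hw; have hh := hC w hw.
  have hth : `|t * h w| <= t * C by rewrite normrM gtr0_norm// ler_pM2l.
  apply: le_trans (expR_le_quadratic (le_trans hth tC)) _.
  have : (t * h w) ^+ 2 <= (t * C) ^+ 2.
    by rewrite -[leLHS]real_normK ?num_real// lerXn2r ?nnegrE// ltW// mulr_gt0.
  by lra.
rewrite word_expD word_exp_cst// word_expZ.
have : t * E m h <= t * - de by rewrite ler_pM2l.
have -> : de ^+ 2 / (8 * C ^+ 2) = t * de / 2 by rewrite /t; field; rewrite gt_eqF.
have -> : 2 * (t * C) ^+ 2 = t * de / 2 by rewrite /t; field; rewrite gt_eqF.
by lra.
Qed.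

(* Split the positions into residue classes mod [m]: within a class the windows are disjoint. *)
Lemma chernoff_bound h (C de : R) q : 0 < de <= C ->
  {in letter_words P r m, forall w, `|h w| <= C} -> E m h <= - de ->
  E (q * m + m) (fun w => (0 <= \sum_(k < q * m) at_pos h w k)%R%:R) <=
  m%:R * (1 - de ^+ 2 / (8 * C ^+ 2)) ^+ q.
Proof.
move=> deC hC h_mean; have phi_le := word_exp_expR_le deC hC h_mean.
set t := de / (4 * C ^+ 2) in phi_le; pose phi w := expR (t * h w).
have t0 : 0 < t.
  by case/andP: deC => de0 /(lt_le_trans de0) C0; rewrite divr_gt0// mulr_gt0// exprn_gt0.
have phi0 : 0 <= E m phi by apply: word_exp_ge0 => // w _; exact: expR_ge0.
apply: (@le_trans _ _ (E (q * m + m)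
    (fun w => \sum_(res < m) \prod_(i < q) at_pos phi w (res + i * m)))).
  apply: le_word_exp => // w _; case: (leP 0 (\sum_(k < q * m) at_pos h w k)) => [hs|_]; last first.
    by rewrite sumr_ge0// => i _; rewrite prodr_ge0// => k _; exact: expR_ge0.
  have [res hres] := exists_residue_sum_ge0 m_gt0 hs.
  rewrite (bigD1 res)//= -[leLHS]addr0; apply: lerD; last first.
    by apply: sumr_ge0 => i _; apply: prodr_ge0 => k _; exact: expR_ge0.
  rewrite -expR_sum -mulr_sumr -expR0 ler_expR mulr_ge0//; exact: ltW.
rewrite word_exp_sum (eq_bigr (fun=> E m phi ^+ q)); last first.
  by move=> i _; rewrite word_exp_prod_blocks//; have := ltn_ord i; lia.
rewrite sumr_const card_ord -[leLHS]mulr_natl ler_wpM2l// lerXn2r ?nnegrE//.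
exact: le_trans phi0 phi_le.
Qed.

Lemma word_exp_upper_deviation_le f (C d : R) q re : 0 < d ->
  {in letter_words P r m, forall w, `|f w| <= C} -> `|E m f| <= C -> (re <= m)%N ->
  m%:R * (2 * C) <= d * (q * m + re)%:R ->
  E (q * m + re + m) (fun w =>
    (2 * d * (q * m + re)%:R < \sum_(k < q * m + re) at_pos f w k - E m f * (q * m + re)%:R)%R%:R)
  <= m%:R * (1 - d ^+ 2 / (8 * (2 * C + 2 * d) ^+ 2)) ^+ q.
Proof.
move=> d0 fC aC re_m hm; set a := E m f in aC *; pose h w := f w - a - d.
have C0 : 0 <= C := le_trans (normr_ge0 a) aC.
apply: le_trans (@chernoff_bound h (2 * C + 2 * d) d q _ _ _); first last.
- by rewrite !word_expB !word_exp_cst// subrr add0r.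
- by move=> w /fC; move: aC d0; rewrite !ler_norml /h; lra.
- by rewrite d0; lra.
rewrite -(word_exp_take sP r (q * m + m) re (fun w => (0 <= \sum_(k < q * m) at_pos h w k)%R%:R)).
rewrite addnAC; apply: le_word_exp => // w hw; rewrite ler_nat.
case: ltP => // dev; rewrite (_ : 0 <= _)//.
have -> : \sum_(k < q * m) at_pos h (take (q * m + m) w) k =
    \sum_(k < q * m) (at_pos f w k - a - d).
  by apply: eq_bigr => k _; rewrite at_pos_take// leq_add2r ltnW.
apply: (sum_deviation_prefix _ aC re_m (ltW d0) hm) dev => i hi.
by apply: (at_pos_bounded fC hw); lia.
Qed.

Lemma word_exp_upper_tail (C de : R) : 0 <= C -> 0 < de -> exists A c n0, [/\ 0 <= A, 0 < c &
  forall f, {in letter_words P r m, forall w, `|f w| <= C} -> `|E m f| <= C ->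
  forall n, (n0 <= n)%N ->
    E (n + m) (fun w => (de * n%:R < \sum_(k < n) at_pos f w k - E m f * n%:R)%R%:R)
      <= A * expR (- (c * n%:R))].
Proof.
move=> C0 de0; pose d := de / 2; have d0 : 0 < d by rewrite divr_gt0.
have e2d : 2 * d = de by rewrite /d; field.
pose c := d ^+ 2 / (8 * (2 * C + 2 * d) ^+ 2).
have D0 : 0 < 2 * C + 2 * d by lra.
have c0 : 0 < c by rewrite divr_gt0 ?exprn_gt0// mulr_gt0// exprn_gt0.
have mR : 0 < m%:R :> R by rewrite ltr0n.
have c_le1 : c <= 1.
  rewrite ler_pdivrMr ?mulr_gt0 ?exprn_gt0// mul1r.
  have : d ^+ 2 <= (2 * C + 2 * d) ^+ 2 by rewrite lerXn2r ?nnegrE ?ltW//; lra.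
  by have : 0 < (2 * C + 2 * d) ^+ 2 by [rewrite exprn_gt0]; lra.
exists (m%:R * expR c), (c / m%:R), (Num.bound (m%:R * (2 * C) / d)); split.
- by rewrite mulr_ge0 ?expR_ge0.
- by rewrite divr_gt0.
move=> f fC aC n hn; have hm : m%:R * (2 * C) <= d * n%:R.
  rewrite [leRHS]mulrC -ler_pdivrMr//; apply: le_trans (ltW (archi_boundP _)) _.
    by rewrite divr_ge0 ?(ltW d0)// !mulr_ge0.
  by rewrite ler_nat.
have re_m : (n %% m < m)%N by rewrite ltn_mod.
have := @word_exp_upper_deviation_le f C d (n %/ m) (n %% m) d0 fC aC (ltnW re_m).
rewrite -divn_eq -/c e2d => /(_ hm) h; apply: le_trans h _.
rewrite -mulrA ler_wpM2l//; apply: (@le_trans _ _ (expR (- c) ^+ (n %/ m))).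
  rewrite lerXn2r ?nnegrE ?expR_ge0 ?subr_ge0//.
  by have := @expR_ge1Dx R (- c); lra.
rewrite -expRM_natl -expRD ler_expR -mulr_natl.
suff : c / m%:R * n%:R <= c * (1 + (n %/ m)%:R) by lra.
rewrite -mulrA ler_pM2l// mulrC ler_pdivrMr// {1}(divn_eq n m) natrD natrM.
by have : (n %% m)%:R <= m%:R :> R; [rewrite ler_nat ltnW|lra].
Qed.

Lemma word_exp_norm_le f C : {in letter_words P r m, forall w, `|f w| <= C} -> `|E m f| <= C.
Proof.
move=> fC; have := word_exp_cst sP r m (- C); have := word_exp_cst sP r m C => cstC cstNC.
rewrite ler_norml -{1}cstNC -{2}cstC.
by apply/andP; split; apply: le_word_exp => // w /fC; rewrite ler_norml => /andP[].
Qed.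

Lemma word_exp_tail f (C de : R) : 0 < de ->
  {in letter_words P r m, forall w, `|f w| <= C} ->
  exists A c n0, [/\ 0 <= A, 0 < c & forall n, (n0 <= n)%N ->
    E (n + m) (fun w => (de * n%:R < `|\sum_(k < n) at_pos f w k - E m f * n%:R|)%R%:R)
     <= A * expR (- (c * n%:R))].
Proof.
move=> de0 fC; have aC := word_exp_norm_le fC; have C0 := le_trans (normr_ge0 _) aC.
have [A [c [n0 [A0 c0 upper]]]] := word_exp_upper_tail C0 de0.
have oppE : E m (fun w => - f w) = - E m f.
  by rewrite -mulN1r -word_expZ; apply: eq_word_exp => w _; rewrite mulN1r.
exists (A + A), c, n0; split=> [||n hn]; [by rewrite addr_ge0|by []|].
have up := upper f fC aC n hn.
have := upper (fun w => - f w) _ _ n hn; rewrite oppE normrN => lo.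
rewrite mulrDl; apply: le_trans (lerD up (lo _ aC)); last by move=> w /fC; rewrite normrN.
rewrite -word_expD; apply: le_word_exp => // w _; rewrite -natrD ler_nat.
have -> : \sum_(k < n) at_pos (fun w => - f w) w k = - \sum_(k < n) at_pos f w k by rewrite sumrN.
by rewrite mulNr -opprD -normrN real_ltr_normr ?num_real// opprK; do 2 case: (_ < _).
Qed.

End LargeDeviations.

Section UniformLaw.
Context {R : realType} (P : seq bool -> R).
Hypothesis sP : source P.
Implicit Types (f : seq (seq bool) -> R) (u : int).

Definition window_sum r m f (x : bitarray) u n : R :=
  \sum_(k < n) f (window r x (u + k%:Z) m).

Definition window_average_near r m f (de : R) x u n : Prop :=
  `|window_sum r m f x u n - word_exp P r m f * n%:R| <= de * n%:R.

Lemma window_sumD r m f x u n k :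
  window_sum r m f x u (n + k) = window_sum r m f x u n + window_sum r m f x (u + n%:Z) k.
Proof.
rewrite /window_sum big_split_ord; congr (_ + _); apply: eq_bigr => i _ /=.
by rewrite PoszD addrA.
Qed.

Lemma window_average_nearD r m f de x u n k : window_average_near r m f de x u n ->
  window_average_near r m f de x (u + n%:Z) k -> window_average_near r m f de x u (n + k).
Proof.
rewrite /window_average_near window_sumD natrD !mulrDr opprD addrACA => hn hk.
exact: le_trans (ler_normD _ _) (lerD hn hk).
Qed.

Lemma win_pr_window_average r m f de n B u : (r <= B)%N -> - B%:Z <= u ->
  u + (n + m)%:Z <= B%:Z ->
  win_pr P B (fun x => ~ window_average_near r m f de x u n) =
  word_exp P r (n + m)
    (fun w => (de * n%:R < `|\sum_(k < n) at_pos m f w k - word_exp P r m f * n%:R|)%R%:R).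
Proof.
move=> hr hu hB; rewrite -(win_pr_window sP _ hr hu hB); apply: eq_win_pr => // x _.
have -> : \sum_(k < n) at_pos m f (window r x u (n + m)) k = window_sum r m f x u n.
  by apply: eq_bigr => k _; rewrite at_pos_window// leq_add2r ltnW.
by rewrite /window_average_near ltNge; split; [move/negP|move/negP].
Qed.

(* Chernoff's exponential bound makes the deviation probabilities summable over [n]. *)
Lemma uniform_law_of_large_numbers r m f (C de e : R) : (0 < m)%N -> 0 < de -> 0 < e ->
  {in letter_words P r m, forall w, `|f w| <= C} ->
  exists n0 : nat, forall n1 B : nat, (r <= B)%N -> (n1 + m <= B)%N ->
  win_pr P B (fun x => exists n, [/\ (n0 <= n)%N, (n <= n1)%N &
     ~ window_average_near r m f de x 0 n \/ ~ window_average_near r m f de x (- n%:Z) n]) <= e.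
Proof.
move=> m0 de0 e0 fC; have [A [c [n0 [A0 c0 tail]]]] := word_exp_tail sP m0 de0 fC.
have hc : 0 < 1 - expR (- c) by rewrite subr_gt0 expR_lt1; lra.
have [n2 hn2] := expR_decay c0 (divr_ge0 (mulr_ge0 (ler0n R 2) A0) (ltW hc)) e0.
set k0 := maxn n0 n2; exists k0 => n1 B hr hB.
apply: (@le_trans _ _ (\sum_(n <- iota k0 (n1.+1 - k0)) (2 * A) * expR (- (c * n%:R)))); last first.
  rewrite -mulr_sumr; apply: le_trans (ler_wpM2l _ (sum_expR_geometric_le _ _ c0)) _.
    by rewrite mulr_ge0.
  by apply: le_trans (hn2 k0 (leq_maxr _ _)); rewrite mulrA mulrAC.
apply: le_trans (_ : \sum_(n <- iota k0 (n1.+1 - k0)) win_pr P B (fun x =>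
    ~ window_average_near r m f de x 0 n \/ ~ window_average_near r m f de x (- n%:Z) n) <= _).
  apply: le_trans (win_pr_bigU sP _ _ _); apply: le_win_pr => // x _ [n [h1 h2 h3]].
  by exists n => //; rewrite mem_iota; lia.
apply: ler_sum_seq => n; rewrite mem_iota => hn; have hn0 : (n0 <= n)%N by rewrite /k0 in hn; lia.
apply: le_trans (win_prU sP _ _ _) _; rewrite -mulrA mulr2n mulrDl !mul1r.
by apply: lerD; rewrite win_pr_window_average ?tail//; lia.
Qed.

Lemma win_pr_miss r m (Q : pred (seq (seq bool))) q B u : (0 < m)%N -> (r <= B)%N ->
  - B%:Z <= u -> u + (q * m)%N%:Z <= B%:Z ->
  win_pr P B (fun x => forall i, (i < q)%N -> ~~ Q (window r x (u + (i * m)%N%:Z) m)) <=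
  expR (- (word_exp P r m (fun w => (Q w)%:R) * q%:R)).
Proof.
move=> m0 hr hu hB; set eta := word_exp P r m _.
have missE : word_exp P r m (fun w => (~~ Q w)%:R) = 1 - eta by exact: word_exp_not.
apply: (@le_trans _ _ ((1 - eta) ^+ q)); last first.
  rewrite -mulNr mulrC expRM_natl lerXn2r ?nnegrE ?expR_ge0//.
    by rewrite -missE; exact: word_exp_ge0.
  by have := @expR_ge1Dx R (- eta); lra.
rewrite -missE -(word_exp_prod_blocks sP r m0 (fun w => (~~ Q w)%:R) (res := 0) (leqnn _)).
rewrite -(win_exp_window sP (B := B) (u := u))//; apply: le_win_exp => // x _.
case: asboolP => h; last by apply: prodr_ge0.
rewrite big1// => i _; rewrite add0n at_pos_window; first by rewrite h.
by have := ltn_ord i; nia.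
Qed.

End UniformLaw.

(* The window of radius [B] contains the block, with the [N] sites before it and the [K] sites
   after it; the block itself covers [-j, j]. *)
Definition spans (K B N j : nat) (u : int) (s : seq nat) : bool :=
  [&& - B%:Z <= u - N%:Z, u + (sumn s)%:Z + K%:Z <= B%:Z, u <= - j%:Z & j%:Z < u + (sumn s)%:Z].

Lemma spans_le K B B' N j j' u s : (B <= B')%N -> (j' <= j)%N ->
  spans K B N j u s -> spans K B' N j' u s.
Proof. by move=> hB hj /and4P[h1 h2 h3 h4]; apply/and4P; split; lia. Qed.

(* No cut point near the origin, but one on each side not too far away: the block around the
   origin is long but not too long. *)
Lemma exists_long_block (M : int -> bool) N n L :
  (forall i, - n%:Z <= i <= n%:Z -> ~ cut_point M N i) ->
  (exists2 i, - n%:Z - L%:Z <= i <= - n%:Z & cut_point M N i) ->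
  (exists2 i, n%:Z <= i <= n%:Z + L%:Z & cut_point M N i) ->
  exists u s, [/\ block M N u s, - n%:Z - L%:Z <= u < - n%:Z &
    n%:Z < u + (sumn s)%:Z <= n%:Z + L%:Z].
Proof.
move=> hn [u0 hu0 cu0] [v0 hv0 cv0].
have out i : cut_point M N i -> (i < - n%:Z) || (n%:Z < i).
  by move=> hc; apply: contrapT => h; apply: (hn i) => //; lia.
have [|u [s [hb hu hv]]] := exists_block (i := 0) cu0 cv0.
  by have := out _ cu0; have := out _ cv0; lia.
have cu : cut_point M N u.
  by move: hb => /and3P[/gap_path_start hm h' _]; rewrite /cut_point hm.
have := out _ cu; have := out _ (block_end_cut_point hb) => hv' hu'.
by exists u, s; split=> //; lia.
Qed.

Section TypicalBlocks.
Context {R : realType} {K : nat} (M : marker R K).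
Local Notation P := (mlaw M).
Local Notation r0 := (mdepth M).
Let sP := mlaw_source M.
Let K_gt0 := mlen_gt0 M.
Hypothesis mark_prob_gt0 : 0 < mark_prob M.
Hypothesis markfree_prob_gt0 : forall n, 0 < markfree_prob M n.

Lemma mark_miss_small e : 0 < e -> exists L : nat, forall B (u : int), (r0 <= B)%N ->
  - B%:Z <= u -> u + L%:Z <= B%:Z ->
  win_pr P B (fun x => forall i, u <= i <= u + L%:Z -> ~ mark M x i) <= e.
Proof.
move=> e0; have [q hq] := expR_decay mark_prob_gt0 ler01 e0.
exists (q * K)%N => B u hr h1 h2; apply: le_trans (hq q (leqnn q)); rewrite mul1r.
apply: le_trans (win_pr_miss sP (fun w => mark_in M w 0) K_gt0 hr h1 h2).
apply: le_win_pr => // x _ h i hi; rewrite mark_in_window// addr0; apply/negP; apply: h.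
by have : (i * K + K <= q * K)%N by [rewrite addnC -mulSn leq_mul2r hi orbT]; lia.
Qed.

Lemma markfree_prob_small e : 0 < e -> exists n0, forall n, (n0 <= n)%N -> markfree_prob M n <= e.
Proof.
move=> e0; have [q0 hq0] := expR_decay mark_prob_gt0 ler01 e0.
exists (q0 * K)%N => n hn; pose q := (n %/ K)%N.
have hq : (q * K <= n)%N by rewrite /q leq_trunc_div.
have hq' : (q0 <= q)%N by rewrite /q leq_divRL.
apply: le_trans (hq0 q hq'); rewrite mul1r.
have u1 : - (n + r0)%N%:Z <= 0 by lia.
have u2 : 0 + n%:Z <= (n + r0)%N%:Z by lia.
have u3 : 0 + (q * K)%N%:Z <= (n + r0)%N%:Z by lia.
rewrite /markfree_prob -(win_pr_window sP _ (leq_addl n r0) u1 u2).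
apply: le_trans (win_pr_miss sP (fun w => mark_in M w 0) K_gt0 (leq_addl n r0) u1 u3).
apply: le_win_pr => // x _ /allP h i hi; rewrite mark_in_window// addr0 add0r.
have hiK : (i * K + K <= n)%N.
  by apply: leq_trans hq; rewrite addnC -mulSn leq_mul2r hi orbT.
by have := h (i * K)%N; rewrite mark_in_window// add0r mem_iota; apply; lia.
Qed.

Lemma win_pr_cut_point_le B n u : (r0 <= B)%N -> - B%:Z <= u - n%:Z -> u <= B%:Z ->
  win_pr P B (fun x => cut_point (mark M x) n u) <= markfree_prob M n.
Proof.
move=> hr h1 h2.
rewrite /markfree_prob -(win_pr_window sP (B := B) (u := u - n%:Z))//; last by lia.
by apply: le_win_pr => // x _; rewrite (@cut_point_window _ _ _ r0)// => /andP[].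
Qed.

Lemma win_pr_some_cut_point_small n e : 0 < e -> exists N0, forall N, (N0 <= N)%N ->
  forall B, (r0 + n + N <= B)%N ->
  win_pr P B (fun x => exists2 i, i \in [seq k%:Z - n%:Z | k <- iota 0 (n + n).+1] &
    cut_point (mark M x) N i) <= e.
Proof.
move=> e0; have e' : 0 < e / (n + n).+1%:R by rewrite divr_gt0.
have [N0 hN0] := markfree_prob_small e'; exists N0 => N hN B hB.
apply: le_trans (win_pr_bigU sP _ _ _) _.
apply: (@le_trans _ _ (\sum_(i <- [seq k%:Z - n%:Z | k <- iota 0 (n + n).+1]) (e / (n + n).+1%:R))).
  apply: ler_sum_seq => i /mapP[k]; rewrite mem_iota => hk ->.
  by apply: le_trans (hN0 N hN); apply: win_pr_cut_point_le; lia.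
by rewrite big_map big_const_seq count_predT size_iota iter_addr addr0 -[_ *+ _]mulr_natr divfK.
Qed.

Lemma cut_point_miss_small n e : 0 < e -> exists L : nat, forall B (u : int), (r0 <= B)%N ->
  - B%:Z <= u -> u + L%:Z <= B%:Z ->
  win_pr P B (fun x => forall i, u <= i <= u + L%:Z -> ~ cut_point (mark M x) n i) <= e.
Proof.
move=> e0; pose Q w := markfree_word M n (take n w) && mark_in M (drop n w) 0.
have hQ : word_exp P r0 (n + K) (fun w => (Q w)%:R) = markfree_prob M n * mark_prob M.
  by rewrite -word_exp_prod; apply: eq_word_exp => w _; rewrite /Q -mulnb natrM.
have [q hq] := expR_decay (mulr_gt0 (markfree_prob_gt0 n) mark_prob_gt0) ler01 e0.
have nK : (0 < n + K)%N by lia.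
exists (q * (n + K))%N => B u hr h1 h2.
apply: le_trans (hq q (leqnn q)); rewrite mul1r -hQ.
apply: le_trans (win_pr_miss sP Q nK hr h1 h2); apply: le_win_pr => // x _ h i hi.
rewrite /Q take_window drop_window mark_in_window// addr0; apply/negP => /andP[hn hm].
have hle : (i * (n + K) + (n + K) <= q * (n + K))%N by rewrite addnC -mulSn leq_mul2r hi orbT.
apply: (h (u + (i * (n + K))%N%:Z + n%:Z)).
  by move: (i * (n + K))%N (q * (n + K))%N hle => a c; lia.
by rewrite (@cut_point_window _ _ _ r0)// hm addrK hn.
Qed.

Definition has_typical_block r m f de N B0 j (x : bitarray) := exists u s,
  [/\ block (mark M x) N u s, spans K B0 N j u s & window_average_near P r m f de x u (sumn s)].

Lemma typical_block_of_events r m f de N n L B0 j x : (j <= n)%N -> (n + L + N + K <= B0)%N ->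
  (forall k, (n <= k)%N -> (k <= n + L)%N ->
     window_average_near P r m f de x 0 k /\ window_average_near P r m f de x (- k%:Z) k) ->
  (forall i, - n%:Z <= i <= n%:Z -> ~ cut_point (mark M x) N i) ->
  (exists2 i, - n%:Z - L%:Z <= i <= - n%:Z & cut_point (mark M x) N i) ->
  (exists2 i, n%:Z <= i <= n%:Z + L%:Z & cut_point (mark M x) N i) ->
  has_typical_block r m f de N B0 j x.
Proof.
move=> hj hB avg h1 h2 h3; have [u [s [hb hu hv]]] := exists_long_block h1 h2 h3.
exists u, s; split=> //; first by apply/and4P; split; lia.
have [a1 [a2 [ea1 ea]]] : exists a1 a2 : nat, u = - a1%:Z /\ sumn s = (a1 + a2)%N.
  by exists `|u|%N, (sumn s - `|u|)%N; lia.
rewrite ea ea1; apply: window_average_nearD.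
  by have [_] := avg a1 ltac:(lia) ltac:(lia).
by rewrite addNr; have [] := avg a2 ltac:(lia) ltac:(lia).
Qed.

Lemma typical_block_likely r m f (C de e : R) (j : nat) :
  (0 < m)%N -> 0 < de -> 0 < e -> {in letter_words P r m, forall w, `|f w| <= C} ->
  exists N0, forall N, (N0 <= N)%N -> exists B0, forall B, (B0 <= B)%N ->
  win_pr P B (fun x => ~ has_typical_block r m f de N B0 j x) <= e.
Proof.
move=> m0 de0 e0 fC; have e4 : 0 < e / 4 by rewrite divr_gt0.
have [n0 lln] := uniform_law_of_large_numbers sP m0 de0 e4 fC.
have [n [n0n jn]] : exists n, (n0 <= n)%N /\ (j <= n)%N.
  by exists (n0 + j)%N; rewrite leq_addr leq_addl.
have [N0 no_near] := win_pr_some_cut_point_small n e4; exists N0 => N hN.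
have [L far] := cut_point_miss_small N e4; exists (n + L + N + K + m + r + r0)%N => B hB.
have off_average := lln (n + L)%N B ltac:(lia) ltac:(lia).
have cut_near := no_near N hN B ltac:(lia).
have no_cut_right := far B n%:Z ltac:(lia) ltac:(lia) ltac:(lia).
have no_cut_left := far B (- n%:Z - L%:Z) ltac:(lia) ltac:(lia) ltac:(lia).
have -> : e = e / 4 + (e / 4 + (e / 4 + e / 4)) by field.
apply: le_trans (lerD off_average (lerD cut_near (lerD no_cut_right no_cut_left))).
apply: le_trans (lerD (lexx _) (lerD (lexx _) (win_prU sP _ _ _))).
apply: le_trans (lerD (lexx _) (win_prU sP _ _ _)); apply: le_trans (win_prU sP _ _ _).
apply: le_win_pr => // x _ no_block; apply: contrapT => hn; apply: no_block.
clear off_average cut_near no_cut_right no_cut_left lln no_near far.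
apply: (typical_block_of_events jn (L := L)); first by rewrite -!addnA !leq_add2l leq_addr.
- move=> k hk1 hk2; have hk := leq_trans n0n hk1.
  by split; apply: contrapT => near; apply: hn; left; exists k; split; by [|left|right].
- move=> i hi hc; apply: hn; right; left; exists i => //; apply/mapP; exists `|(i + n%:Z)%R|%N.
    by rewrite mem_iota; lia.
  by lia.
- apply: contrapT => h; apply: hn; right; right; right => i hi hc.
  by apply: h; exists i => //; lia.
by apply: contrapT => h; apply: hn; right; right; left => i hi hc; apply: h; exists i.
Qed.

End TypicalBlocks.

Section GapInformation.
Context {R : realType} {K : nat} (M : marker R K).
Local Notation P := (mlaw M).
Local Notation r0 := (mdepth M).
Let sP := mlaw_source M.
Implicit Types (x : bitarray) (u : int).

Definition next_mark rho w := (find (mark_in M w) (iota 1 rho)).+1.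

(* The information of a gap is charged to the mark at its start. *)
Definition gap_info rho w : R :=
  let n := next_mark rho w in
  if [&& mark_in M w 0, (n <= rho)%N & 0 < gap_prob M n]
  then - ln (letter_wt P n (take n w) / gap_prob M n) else 0.

Definition info_rate rho := word_exp P rho (rho + K) (gap_info rho).

Lemma gap_info_bounded rho :
  exists C, {in letter_words P rho (rho + K), forall w, `|gap_info rho w| <= C}.
Proof.
exists (\sum_(w <- letter_words P rho (rho + K)) `|gap_info rho w|) => w hw.
exact: (ler_sum_mem (F := fun w => `|gap_info rho w|) hw).
Qed.

Lemma gap_info_no_mark rho x u : (r0 <= rho)%N -> ~~ mark M x u ->
  gap_info rho (window rho x u (rho + K)) = 0.
Proof. by move=> hr hm; rewrite /gap_info mark_in_window ?leq_addl// addr0 (negbTE hm). Qed.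

Lemma next_mark_window rho x u n : (r0 <= rho)%N -> gap_path (mark M x) u [:: n] ->
  next_mark rho (window rho x u (rho + K)) = if (n <= rho)%N then n else rho.+1.
Proof.
move=> hr /= /and4P[_ n0 /markfreeP hn /andP[hm _]]; rewrite /next_mark; set a := mark_in M _.
have ha k : (k <= rho)%N -> a k = mark M x (u + k%:Z).
  by move=> hk; rewrite /a mark_in_window// leq_add2r.
have hlt k : (0 < k < n)%N -> (k <= rho)%N -> ~~ a k.
  by move=> hk hk'; rewrite ha//; apply: hn; lia.
case: (leqP n rho) => hnr; last first.
  congr S; rewrite hasNfind ?size_iota//; apply/hasPn => k; rewrite mem_iota => hk.
  by apply: hlt; lia.
have en : (rho = n.-1 + (1 + (rho - n)))%N by lia.
rewrite en iotaD find_cat hasNfind; last first.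
  by apply/hasPn => k; rewrite mem_iota => hk; apply: hlt; lia.
by rewrite size_iota add1n (prednK n0) add1n /= (ha n hnr) hm addn0 if_same prednK.
Qed.

Lemma gap_info_window rho x u n : (r0 <= rho)%N -> gap_path (mark M x) u [:: n] ->
  gap_info rho (window rho x u (rho + K)) =
  if (n <= rho)%N && (0 < gap_prob M n)
  then - ln (letter_wt P n (window rho x u n) / gap_prob M n) else 0.
Proof.
move=> hr hp; rewrite /gap_info (next_mark_window hr hp) mark_in_window ?leq_addl// addr0.
have -> : mark M x u by move: hp => /= /andP[].
case: (leqP n rho) => hn /=; last by rewrite ltnn.
by rewrite hn /=; case: ifP => // _; rewrite -(subnKC hn) -addnA take_window.
Qed.

Lemma window_sum_gap_info rho x u n : (r0 <= rho)%N -> gap_path (mark M x) u [:: n] ->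
  window_sum rho (rho + K) (gap_info rho) x u n = gap_info rho (window rho x u (rho + K)).
Proof.
move=> hr /= /and4P[hm n0 /markfreeP hn _]; case: n n0 hn => // n _ hn.
rewrite /window_sum big_ord_recl addr0 big1 ?addr0// => k _; apply: gap_info_no_mark => //.
by apply: hn; rewrite lift0; have := ltn_ord k; lia.
Qed.

End GapInformation.

Lemma filler_wt_info (R : realType) (K : nat) (M : bool -> marker R K) (st : nat -> stage R)
  (st_lev : leveled M st) b j x u s :
  filler (gap_depth M st b j) x u s \in fillers (gap_tower st_lev) b j s ->
  gap_path (mark (M b) x) u s ->
  filler_wt (gap_tower st_lev) b j s (filler (gap_depth M st b j) x u s) =
  expR (- window_sum (level (st j) b) (level (st j) b + K)
            (gap_info (M b) (level (st j) b)) x u (sumn s)).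
Proof.
have [h0 _ _] := st_lev; elim: s u => [|n s IH] u hw hp.
  by rewrite /window_sum big_ord0 oppr0 expR0.
move: hw; rewrite /fillers [filler _ _ _ _]/= in_words_cons => /andP[h1 h2].
have hp1 := gap_path_head hp; have hp' : gap_path (mark (M b) x) (u + n%:Z) s.
  by move: hp => /= /and4P[].
rewrite [sumn _]/= window_sumD opprD expRD -(IH _ h2 hp'); congr (_ * _).
rewrite (window_sum_gap_info (h0 b j) hp1) (gap_info_window (h0 b j) hp1).
have := gap_wt_gt0 h1; rewrite [gap_wt _ _ _ _ _]/(name_wt M st b j n _) /name_wt /gap_depth.
rewrite -/(named M st b j n); case: ifP => hk w_gt0; last by rewrite oppr0 expR0.
by move: w_gt0; rewrite hk opprK => w_gt0; rewrite lnK ?posrE.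
Qed.

Section MarkStatistics.
Context {R : realType} {K : nat} (M : marker R K).
Local Notation r0 := (mdepth M).
Local Notation free w := (fun k => ~~ mark_in M w k).
Let sP := mlaw_source M.
Let K_gt0 := mlen_gt0 M.

Lemma mark_in_take n w k : (k + K <= n)%N -> mark_in M (take n w) k = mark_in M w k.
Proof. by move=> h; rewrite /mark_in !take_drop take_takel// addnC. Qed.

Lemma mark_in_drop n w k : mark_in M (drop n w) k = mark_in M w (k + n).
Proof. by rewrite /mark_in drop_drop. Qed.

Lemma mark_in_nonoverlap r n w k d : (r0 <= r)%N -> w \in letter_words (mlaw M) r n ->
  (0 < d < K)%N -> (k + d + K <= n)%N -> mark_in M w k -> ~~ mark_in M w (k + d).
Proof.
move=> hr /letter_words_extend <- hd hn; rewrite !mark_in_window//; last by lia.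
by rewrite !add0r PoszD => hm; apply: mword_nonoverlap hd hm.
Qed.

Lemma markfree_word_short n w : (n < K)%N -> markfree_word M n w.
Proof. by move=> h; rewrite /markfree_word (_ : n.+1 - K = 0)%N//; lia. Qed.

Lemma markfree_word_add n w : markfree_word M (n + K) w = all (free w) (iota 0 n.+1).
Proof. by rewrite /markfree_word -addSn addnK. Qed.

Lemma markfree_word_take n w :
  markfree_word M n (take n w) = all (free w) (iota 0 (n.+1 - K)).
Proof.
by apply: eq_in_all => k; rewrite mem_iota => hk; rewrite mark_in_take//; lia.
Qed.

(* Before an occurrence of the marker there is no room for a second one. *)
Lemma markfree_word_mark r n w : (r0 <= r)%N -> w \in letter_words (mlaw M) r (n + K) ->
  mark_in M w n -> markfree_word M n (take n w) = all (free w) (iota 0 n).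
Proof.
move=> hr hw hm; rewrite markfree_word_take; apply/idP/idP => /allP h; apply/allP => k.
  rewrite mem_iota => hk; have [hkn|hkn] := ltnP k (n.+1 - K).
    by apply: h; rewrite mem_iota.
  apply: contraL hm => hm; rewrite -(subnKC (n := n) (m := k)); last by lia.
  by apply: mark_in_nonoverlap hw _ _ hm; lia.
by rewrite mem_iota => hk; apply: h; rewrite mem_iota; lia.
Qed.

Lemma markfree_word_split r n w : (r0 <= r)%N -> w \in letter_words (mlaw M) r (n + K) ->
  markfree_word M (n + K).-1 (take (n + K).-1 w) =
  (markfree_word M (n + K) w + (markfree_word M n (take n w) && mark_in M (drop n w) 0))%N :> nat.
Proof.
move=> hr hw; rewrite markfree_word_add -addn1 iotaD all_cat /= andbT add0n mark_in_drop add0n.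
rewrite markfree_word_take prednK ?addnK; last by lia.
have [hm|_] := boolP (mark_in M w n); last by rewrite andbT andbF addn0.
by rewrite (markfree_word_mark hr hw hm) andbT andbF.
Qed.

Lemma markfree_prob_rec n :
  markfree_prob M (n + K) = markfree_prob M (n + K).-1 - markfree_prob M n * mark_prob M.
Proof.
apply/eqP; rewrite eq_sym subr_eq; apply/eqP.
rewrite /markfree_prob -[LHS](word_exp_take sP _ _ 1) -word_exp_prod.
have -> : ((n + K).-1 + 1)%N = (n + K)%N by lia.
rewrite -word_expD; apply: eq_word_exp => w hw.
by rewrite (markfree_word_split (leqnn _) hw) natrD -natrM mulnb.
Qed.

Lemma markfree_prob_short n : (n < K)%N -> markfree_prob M n = 1.
Proof.
move=> h; rewrite /markfree_prob -[RHS](word_exp_cst sP r0 n).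
by apply: eq_word_exp => w _; rewrite markfree_word_short.
Qed.

Lemma gap_word_add r n w : (r0 <= r)%N -> w \in letter_words (mlaw M) r (K + n) ->
  gap_word M (K + n) w = mark_in M (take K w) 0 && markfree_word M n (drop K w).
Proof.
move=> hr hw; rewrite /gap_word leq_addr mark_in_take ?leqnn// addKn /=.
have [hm /=|//] := boolP (mark_in M w 0); apply/allP/allP => h k; rewrite mem_iota => hk.
  by rewrite mark_in_drop; apply: h; rewrite mem_iota; lia.
have [hkK|hkK] := leqP K k.
  by rewrite -(subnK hkK) -mark_in_drop; apply: h; rewrite mem_iota; lia.
by rewrite -[k]add0n; apply: mark_in_nonoverlap hw _ _ hm; lia.
Qed.

Lemma gap_prob_markfree n :
  gap_prob M n = if (K <= n)%N then mark_prob M * markfree_prob M (n - K) else 0.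
Proof.
rewrite /gap_prob big_mkcond /=; case: (leqP K n) => hK; last first.
  by rewrite big1// => e _; rewrite /gap_word leqNgt hK.
rewrite -(subnKC hK) addKn -word_exp_prod /word_exp; apply: eq_big_seq => w hw.
rewrite (gap_word_add (leqnn _) hw) -natrM mulnb.
by case: (_ && _); rewrite ?mulr1 ?mulr0.
Qed.

End MarkStatistics.

Lemma eq_markfree_prob (R : realType) (K : nat) (M M' : marker R K) n :
  mark_prob M = mark_prob M' -> markfree_prob M n = markfree_prob M' n.
Proof.
move=> hM; have K0 := mlen_gt0 M; have [m] := ubnP n; elim: m n => // m IH n hm.
have [h|h] := ltnP n K; first by rewrite !markfree_prob_short.
rewrite -(subnK h) !markfree_prob_rec hM (IH (n - K)%N); last by lia.
by rewrite (IH (n - K + K).-1)//; lia.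
Qed.

Lemma eq_gap_prob (R : realType) (K : nat) (M M' : marker R K) n :
  mark_prob M = mark_prob M' -> gap_prob M n = gap_prob M' n.
Proof. by move=> hM; rewrite !gap_prob_markfree hM (eq_markfree_prob _ hM). Qed.

(** * The law of the coding map *)

Lemma eq_window_letter B x y i : window B x (- B%:Z) (B + B) = window B y (- B%:Z) (B + B) ->
  - B%:Z <= i < B%:Z -> mkseq (x i) B = mkseq (y i) B.
Proof.
move=> hxy hi; have := window_inj (k := `|(i + B%:Z)%R|%N) hxy.
have -> : - B%:Z + `|(i + B%:Z)%R|%N%:Z = i by lia.
by apply; lia.
Qed.

Lemma eq_window_sub B x y r u n : window B x (- B%:Z) (B + B) = window B y (- B%:Z) (B + B) ->
  (r <= B)%N -> - B%:Z <= u -> u + n%:Z <= B%:Z -> window r x u n = window r y u n.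
Proof.
move=> hxy hr hu hn; apply: eq_window => k hk; apply: mkseq_eq_le hr _.
by apply: eq_window_letter hxy _; lia.
Qed.

Definition gap_lists (k : nat) : seq (seq nat) :=
  flatten [seq words (fun _ : nat => iota 1 k) (nseq l 0%N) | l <- iota 0 k.+1].

Lemma mem_gap_lists k s : all (leq 1) s -> (sumn s <= k)%N -> s \in gap_lists k.
Proof.
move=> s_gt0 hs; apply/flatten_mapP; exists (size s).
  rewrite mem_iota /= add0n ltnS; apply: leq_trans hs.
  by elim: s s_gt0 => //= n s IH /andP[h1 /IH]; lia.
elim: s s_gt0 hs => [|n s IH] //= /andP[h1 h2] hs.
rewrite -/(words _ (0%N :: nseq (size s) 0%N)) in_words_cons IH//; last by lia.
by rewrite mem_iota andbT; lia.
Qed.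

Definition spanning_blocks K B N : seq (int * seq nat) :=
  undup [seq p <- [seq (i%:Z - B%:Z, s) | i <- iota 0 (B + B).+1, s <- gap_lists (B + B)]
     | spans K B N 0 p.1 p.2].

Lemma spanning_blocks_spans K B N p : p \in spanning_blocks K B N -> spans K B N 0 p.1 p.2.
Proof. by rewrite mem_undup mem_filter => /andP[]. Qed.

Lemma mem_spanning_blocks K B N m u s : spans K B N 0 u s -> block m N u s ->
  (u, s) \in spanning_blocks K B N.
Proof.
move=> hw /and3P[hp _ _]; rewrite mem_undup mem_filter hw andTb.
have /and4P[h1 h2 h3 h4] := hw.
apply/allpairsP; exists (`|(u + B%:Z)%R|%N, s); split; rewrite ?mem_iota /=; first by lia.
  by apply: mem_gap_lists; [exact: gap_path_gt0 hp|lia].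
by congr (_, _); lia.
Qed.

Lemma spanning_block_uniq K B N m :
  {in spanning_blocks K B N &, forall p p', block m N p.1 p.2 -> block m N p'.1 p'.2 -> p = p'}.
Proof.
move=> [u s] [u' s'] /spanning_blocks_spans /and4P[/= _ _ h1 h2].
move=> /spanning_blocks_spans /and4P[/= _ _ h3 h4] hb hb'.
by have [||-> ->//] := block_uniq (i := 0) hb hb'; lia.
Qed.

Section FillerMass.
Context {R : realType} {K : nat} (M : bool -> marker R K) (st : nat -> stage R).
Hypothesis st_lev : leveled M st.
Local Notation T := (seq (seq bool)).
Local Notation tw := (gap_tower st_lev).
Local Notation P b := (mlaw (M b)).
Variables (j B0 B : nat).
Local Notation N := (gap_bound (st j)).
Local Notation blocks := (spanning_blocks K B0 N).
Implicit Types (b : bool) (F : int * seq nat -> pred (seq T)).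

Definition block_prob b s := (block_shape N s)%:R * markfree_prob (M b) N *
  (gaps_prob M b s * mark_prob (M b)).

Definition filler_mass b F := \sum_(p <- blocks) block_prob b p.2 *
  \sum_(w <- fillers tw b j p.2) filler_wt tw b j p.2 w * (F p w)%:R.

Definition block_event b (p : int * seq nat) (F : pred (seq T)) (x : bitarray) :=
  stage_block M st b j x p.1 p.2 && F (block_filler M st b j x p.1 p.2).

Lemma eq_block_prob b b' s : mark_prob (M b) = mark_prob (M b') ->
  block_prob b s = block_prob b' s.
Proof.
move=> same; rewrite /block_prob (eq_markfree_prob _ same) same /gaps_prob.
by under eq_bigr do rewrite (eq_gap_prob _ same).
Qed.

Lemma block_prob_ge0 b s : 0 <= block_prob b s.
Proof.
have indicator_ge0 r n (Q : pred T) : 0 <= word_exp (P b) r n (fun w => (Q w)%:R).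
  by apply: word_exp_ge0 => [|w _]; [exact: mlaw_source|exact: ler0n].
rewrite /block_prob !mulr_ge0 ?ler0n ?indicator_ge0//; apply: prodr_ge0 => m _.
by apply: sumr_ge0 => e _; exact: letter_wt_ge0 (mlaw_source _) _ _.
Qed.

Hypothesis B0_le : (B0 <= B)%N.
Variable b : bool.
Hypothesis level_le : (level (st j) b <= B)%N.

Lemma filler_massE F :
  filler_mass b F = win_exp (P b) B (fun x => \sum_(p <- blocks) (block_event b p (F p) x)%:R).
Proof.
rewrite win_exp_sum; apply: eq_big_seq => -[u s] /spanning_blocks_spans /and4P[/= h1 h2 _ _].
rewrite -mulrA -(win_exp_block st_lev (B := B) (u := u) (fun w => (F (u, s) w)%:R))//.
- by apply: eq_win_exp => [|x _]; [exact: mlaw_source|rewrite -natrM mulnb].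
- by lia.
- by lia.
Qed.

Lemma filler_mass_le F E :
  (forall x p, in_support (P b) B x -> p \in blocks -> block_event b p (F p) x -> E x) ->
  filler_mass b F <= win_pr (P b) B E.
Proof.
move=> FE; rewrite filler_massE; apply: le_win_exp => [|x hx]; first exact: mlaw_source.
apply: sum_indicator_uniq_le; first exact: undup_uniq.
  by move=> p p' hp hp' /andP[h1 _] /andP[h2 _]; exact: spanning_block_uniq hp hp' h1 h2.
by move=> p hp hF; apply/asboolP; exact: FE hx hp hF.
Qed.

Lemma win_pr_le_filler_mass F E :
  (forall x, in_support (P b) B x -> E x -> exists2 p, p \in blocks & block_event b p (F p) x) ->
  win_pr (P b) B E <= filler_mass b F.
Proof.
move=> EF; rewrite filler_massE; apply: le_win_exp => [|x hx]; first exact: mlaw_source.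
case: asboolP => [/(EF x hx) [p hp hF]|_]; last exact: sumr_ge0.
have := @ler_sum_mem R _ blocks (fun p => (block_event b p (F p) x)%:R) p hp.
by rewrite hF; apply=> q _ /=; rewrite ler0n.
Qed.

Lemma sum_block_prob_le1 : \sum_(p <- blocks) block_prob b p.2 <= 1.
Proof.
apply: (@le_trans _ _ (filler_mass b (fun _ _ => true))).
  apply: ler_sum => p _; under [in leRHS]eq_bigr do rewrite mulr1.
  by rewrite sum_filler_wt mulr1.
rewrite -(win_exp_cst (mlaw_source (M b)) B 1).
apply: le_trans (filler_mass_le (E := fun=> True) _) _ => //.
by apply: le_win_exp => [|x _]; [exact: mlaw_source|rewrite lern1 leq_b1].
Qed.

End FillerMass.

Section Law.
Context {R : realType} {K : nat} (M : bool -> marker R K) (st : nat -> stage R).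
Hypothesis st_lev : leveled M st.
Local Notation T := (seq (seq bool)).
Local Notation L := (GenTree.tree (seq T)).
Local Notation tw := (gap_tower st_lev).
Local Notation P b := (mlaw (M b)).
Variable g : nat -> seq nat -> L -> L -> R.
Hypothesis g_ref : refining tw st g.
Hypothesis growth : label_growth st.
Hypothesis same_marks : forall b b', mark_prob (M b) = mark_prob (M b').
Variables (j n r : nat) (target : int -> nat -> bool) (b : bool).
Local Notation J := j.+2.
Local Notation N i := (gap_bound (st i)).
Implicit Types (x y : bitarray) (u : int) (s t : seq nat) (w : seq T).

Definition in_cylinder y := forall i k, - n%:Z <= i < n%:Z -> (k < r)%N -> y i k = target i k.

(* The fillers of stage [i] of the passive side on the block [u], [s] determine the cylinder. *)
Definition exposes i u s := [/\ u <= - n%:Z, n%:Z < u + (sumn s)%:Z &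
  forall k, - n%:Z <= k < n%:Z -> (r <= depth_at (gap_depth M st (~~ b) i) s `|k - u|)%N].

Definition has_typical_segment u s y := exists ss1 t ss2,
  segments (N j.+1) s = ss1 ++ t :: ss2 /\
  let v := u + (sumn (flatten ss1))%:Z in
  exposes j.+1 v t /\ typical tw st (~~ b) j.+1 t (block_filler M st (~~ b) j.+1 y v t).

Definition hits u s w' : bool := `[< exists y,
  [/\ block_filler M st (~~ b) J y u s = w', in_cylinder y & has_typical_segment u s y] >].

Definition forces u s w : bool := `[< exposes J u s /\
  forall y, regular st_lev (~~ b) J y u s ->
    0 < orient b (g J s) (label tw st b J s w)
          (label tw st (~~ b) J s (block_filler M st (~~ b) J y u s)) ->
    in_cylinder y >].

Definition confused s w : bool :=
  typical tw st b J s w && multivalued tw st b J s (g J s) (label tw st b J s w).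

Lemma exposes_segment u s ss1 t ss2 : segments (N j.+1) s = ss1 ++ t :: ss2 ->
  exposes j.+1 (u + (sumn (flatten ss1))%:Z) t -> exposes J u s.
Proof.
move=> /segments_cat_cons -> [h1 h2 deep]; split; [by lia|by rewrite !sumn_cat; lia|].
move=> k hk; have hlt : (`|(k - (u + (sumn (flatten ss1))%:Z))%R| < sumn t)%N by lia.
have -> : `|(k - u)%R|%N = (sumn (flatten ss1) + `|(k - (u + (sumn (flatten ss1))%:Z))%R|)%N by lia.
rewrite depth_at_cat depth_at_catl//; apply: leq_trans (deep k hk) _.
by apply: leq_depth_at => m; exact: gap_depth_mono.
Qed.

Lemma eq_label_cylinder u s y0 y : in_cylinder y0 -> has_typical_segment u s y0 ->
  label tw st (~~ b) J s (block_filler M st (~~ b) J y u s) =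
  label tw st (~~ b) J s (block_filler M st (~~ b) J y0 u s) -> in_cylinder y.
Proof.
move=> y0_in [ss1 [t [ss2 [es [[h1 h2 deep] typ_t]]]]] /eq_label_segments.
rewrite !coarsen_block_filler es !segmentwise_cat /= (segments_cat_cons es) !filler_mid => /eqP.
rewrite eqseq_cat ?size_segmentwise// => /andP[_ /eqP[+ _]].
rewrite -!/(block_filler _ _ _ _ _ _ _) typ_t; case: ifP => // _ [eq_fillers] i k hi hk.
set v := u + _ in h1 h2 deep eq_fillers.
have hlt : (`|(i - v)%R| < sumn t)%N by lia.
have := filler_inj eq_fillers hlt; have -> : v + `|(i - v)%R|%N%:Z = i by lia.
by move=> /mkseq_eq_nth -> //; [exact: y0_in|exact: leq_trans (deep i hi)].
Qed.

(* An unambiguous typical filler has all its partners in one label, and a typical passive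
   block inside is read off from that label. *)
Lemma hits_forces u s w w' : w \in fillers tw b J s -> w' \in fillers tw (~~ b) J s ->
  0 < orient b (g J s) (label tw st b J s w) (label tw st (~~ b) J s w') -> hits u s w' ->
  typical tw st b J s w -> ~~ confused s w -> forces u s w.
Proof.
move=> hw hw' hg /asboolP[y0 [e0 y0_in seg]]; rewrite /confused => -> /= /hasPn single.
apply/asboolP; split.
  by have [ss1 [t [ss2 [es [exposed _]]]]] := seg; exact: exposes_segment es exposed.
move=> y hy hgy; apply: (eq_label_cylinder y0_in seg); rewrite e0.
apply/eqP; apply: contrapT => /negP neq; have /hasPn := single _ hy.
by move=> /(_ _ hw'); rewrite neq /= hg andbT hgy.
Qed.

Lemma sum_partners b' s w : w \in fillers tw b' J s -> \sum_(w' <- fillers tw (~~ b') J s)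
  filler_wt tw (~~ b') J s w' * orient b' (g J s) (label tw st b' J s w)
    (label tw st (~~ b') J s w') = 1.
Proof. by case: g_ref => g_couples _; have [_] := g_couples J s; apply. Qed.

Lemma orient_coupling_ge0 s l l' : 0 <= orient b (g J s) l l'.
Proof. by case: g_ref => g_couples _; apply: orient_ge0; case: (g_couples J s). Qed.

Lemma sum_partners_hits_le u s w : w \in fillers tw b J s ->
  \sum_(w' <- fillers tw (~~ b) J s) filler_wt tw (~~ b) J s w' *
    orient b (g J s) (label tw st b J s w) (label tw st (~~ b) J s w') * (hits u s w')%:R <=
  (forces u s w)%:R + (~~ typical tw st b J s w)%:R + (confused s w)%:R.
Proof.
move=> hw; set S := \sum_(w' <- _) _.
have S_le1 : S <= 1.
  rewrite -(sum_partners hw); apply: ler_sum_seq => w' hw'; rewrite ler_piMr ?lern1 ?leq_b1//.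
  by rewrite mulr_ge0 ?orient_coupling_ge0// ltW ?filler_wt_gt0.
have [typ_w|_] /= := boolP (typical tw st b J s w); last first.
  by apply: le_trans S_le1 _; rewrite addrAC lerDr addr_ge0.
have [|single] := boolP (confused s w).
  by move=> _; apply: le_trans S_le1 _; rewrite lerDr addr_ge0.
rewrite !addr0; have [//|not_forces] := boolP (forces u s w).
rewrite /S big_seq big1// => w' hw'; have [hit|_] := boolP (hits u s w'); last by rewrite mulr0.
have [hg|] := ltP 0 (orient b (g J s) (label tw st b J s w) (label tw st (~~ b) J s w')).
  by have := hits_forces hw hw' hg hit typ_w single; rewrite (negbTE not_forces).
rewrite le_eqVlt ltNge orient_coupling_ge0 orbF => /eqP ->.
by rewrite mulr0 mul0r.
Qed.

Lemma sum_hits_le u s :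
  \sum_(w' <- fillers tw (~~ b) J s) filler_wt tw (~~ b) J s w' * (hits u s w')%:R <=
  \sum_(w <- fillers tw b J s) filler_wt tw b J s w *
    ((forces u s w)%:R + (~~ typical tw st b J s w)%:R + (confused s w)%:R).
Proof.
have -> : \sum_(w' <- fillers tw (~~ b) J s) filler_wt tw (~~ b) J s w' * (hits u s w')%:R =
  \sum_(w <- fillers tw b J s) filler_wt tw b J s w *
    \sum_(w' <- fillers tw (~~ b) J s) filler_wt tw (~~ b) J s w' *
     orient b (g J s) (label tw st b J s w) (label tw st (~~ b) J s w') * (hits u s w')%:R.
  under [RHS]eq_bigr do rewrite mulr_sumr.
  rewrite exchange_big /=; apply: eq_big_seq => w' hw'.
  have := sum_partners hw'; rewrite negbK => sum1; rewrite -[LHS]mulr1 -sum1 mulr_sumr.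
  by apply: eq_bigr => w _; rewrite orient_flip; ring.
apply: ler_sum_seq => w hw; apply: ler_wpM2l; first exact/ltW/filler_wt_gt0.
exact: sum_partners_hits_le.
Qed.

Lemma sum_confused_le s e : b = odd J -> (N J <= sumn s)%N ->
  label_rate (st j.+1) <= info_lo (st J) ->
  expR (- ((info_lo (st J) - label_rate (st j.+1)) * (N J)%:R)) <= e ->
  \sum_(w <- fillers tw b J s) filler_wt tw b J s w * (confused s w)%:R <= e.
Proof.
move=> b_active hs hrate; apply: le_trans.
set gap := info_lo (st J) - label_rate (st j.+1).
apply: (@le_trans _ _ (expR (- (gap * (sumn s)%:R)))); last first.
  by rewrite ler_expR lerN2 ler_wpM2l ?subr_ge0// ler_nat.
case: g_ref => _ g_refines; apply: le_trans (sum_multivalued_le growth (g_refines j.+1 s) b_active).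
rewrite [leRHS]big_mkcond le_eqVlt; apply/orP; left; apply/eqP; apply: eq_bigr => w _.
by rewrite /confused; case: ifP => _; rewrite ?mulr1 ?mulr0.
Qed.

Definition typical_active B0 x := exists u s, [/\ stage_block M st b J x u s,
  spans K B0 (N J) 0 u s & typical tw st b J s (block_filler M st b J x u s)].

Definition typical_passive B0 y :=
  (exists u s, stage_block M st (~~ b) J y u s /\ spans K B0 (N J) 0 u s) /\
  exists v t, [/\ stage_block M st (~~ b) j.+1 y v t, exposes j.+1 v t &
    typical tw st (~~ b) j.+1 t (block_filler M st (~~ b) j.+1 y v t)].

Definition forces_cylinder B0 x := exists u s, [/\ spans K B0 (N J) 0 u s,
  stage_block M st b J x u s, regular st_lev b J x u s & forces u s (block_filler M st b J x u s)].

Lemma typical_passive_segment B0 y u s : typical_passive B0 y -> stage_block M st (~~ b) J y u s ->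
  u <= 0 < u + (sumn s)%:Z -> has_typical_segment u s y.
Proof.
move=> [_ [v [t [hv exposed typ_t]]]] hb h0.
have h0' : u <= 0 < u + (sumn (flatten (segments (N j.+1) s)))%:Z by rewrite flatten_segments.
have [ss1 [t' [ss2 [es ht']]]] := flatten_find h0'.
have [_ _ bound_mono] := st_lev; have hv' := segment_block (bound_mono _) hb es.
have [e1 e2] : u + (sumn (flatten ss1))%:Z = v /\ t' = t.
  by apply: block_uniq hv' hv ht' _; case: exposed; lia.
by exists ss1, t, ss2; rewrite es e2 /= e1.
Qed.

Lemma forces_cylinder_decodes B0 x i k : forces_cylinder B0 x -> - n%:Z <= i < n%:Z -> (k < r)%N ->
  decodes st_lev g b J x i k (target i k).
Proof.
move=> [u [s [_ hb hx /asboolP[[h1 h2 deep] all_in]]]] hi hk; exists u, s; split=> //.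
- by lia.
- exact: leq_trans hk (deep i hi).
- by move=> y hy hc; apply: (all_in y hy hc).
Qed.

Lemma filler_mass_confused_le B0 B e : b = odd J -> (B0 <= B)%N -> (level (st J) b <= B)%N ->
  label_rate (st j.+1) <= info_lo (st J) ->
  expR (- ((info_lo (st J) - label_rate (st j.+1)) * (N J)%:R)) <= e ->
  filler_mass st_lev J B0 b (fun p => confused p.2) <= e.
Proof.
move=> b_active hB hl hrate he; have e0 : 0 <= e by apply: le_trans he; exact: expR_ge0.
apply: (@le_trans _ _ (\sum_(p <- spanning_blocks K B0 (N J)) block_prob M st J b p.2 * e)).
  apply: ler_sum => p _; have [hs|hs] := boolP (block_shape (N J) p.2); last first.
    by rewrite /block_prob (negbTE hs) !mul0r.
  apply: ler_wpM2l; last exact: sum_confused_le b_active (ltnW (block_shape_sumn hs)) hrate he.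
  exact: block_prob_ge0.
by rewrite -mulr_suml ler_piMl// (sum_block_prob_le1 st_lev hB hl).
Qed.

Lemma filler_mass_hits_le B0 :
  filler_mass st_lev J B0 (~~ b) (fun p => hits p.1 p.2) <=
  filler_mass st_lev J B0 b (fun p => forces p.1 p.2) +
  filler_mass st_lev J B0 b (fun p w => ~~ typical tw st b J p.2 w) +
  filler_mass st_lev J B0 b (fun p => confused p.2).
Proof.
rewrite /filler_mass -!big_split /=; apply: ler_sum => p _.
rewrite (eq_block_prob st J p.2 (same_marks (~~ b) b)) -!mulrDr.
apply: ler_wpM2l; first exact: block_prob_ge0.
apply: le_trans (sum_hits_le p.1 p.2) _; rewrite -!big_split /=.
by apply: ler_sum => w _; rewrite !mulrDr.
Qed.

(* The passive side puts no more mass on the cylinder than the active side puts on the event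
   that the coding map is forced into it; summed over the cylinders this gives the law. *)
Theorem win_pr_cylinder_le B0 e1 e2 e3 B : b = odd J ->
  (B0 <= B)%N -> (level (st J) b <= B)%N -> (level (st J) (~~ b) <= B)%N ->
  win_pr (P b) B (fun x => ~ typical_active B0 x) <= e1 ->
  win_pr (P (~~ b)) B (fun y => ~ typical_passive B0 y) <= e2 ->
  label_rate (st j.+1) <= info_lo (st J) ->
  expR (- ((info_lo (st J) - label_rate (st j.+1)) * (N J)%:R)) <= e3 ->
  win_pr (P (~~ b)) B in_cylinder <= win_pr (P b) B (forces_cylinder B0) + (e1 + e2 + e3).
Proof.
move=> b_active hB hl hl' active passive hrate he3.
have hits_le : win_pr (P (~~ b)) B in_cylinder <=
    e2 + filler_mass st_lev J B0 (~~ b) (fun p => hits p.1 p.2).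
  apply: (@le_trans _ _ (win_pr (P (~~ b)) B (fun y => ~ typical_passive B0 y \/
      (in_cylinder y /\ typical_passive B0 y)))).
    apply: le_win_pr => [|y _ y_in]; first exact: mlaw_source.
    by case: (pselect (typical_passive B0 y)) => h; [right|left].
  apply: le_trans (win_prU (mlaw_source _) _ _ _) (lerD passive _).
  apply: win_pr_le_filler_mass => // y _ [y_in hy]; have [[u [s [hb hs]]] _] := hy.
  exists (u, s); first exact: mem_spanning_blocks hs hb.
  rewrite /block_event /= hb /=; apply/asboolP; exists y; split=> //.
  by apply: typical_passive_segment hy hb _; case/and4P: hs => _ _ -> ->.
have forces_le : filler_mass st_lev J B0 b (fun p => forces p.1 p.2) <=
    win_pr (P b) B (forces_cylinder B0).
  apply: filler_mass_le => // x [u s] hx /spanning_blocks_spans hs /andP[/= hb hf].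
  exists u, s; split=> //; have /and4P[/= h1 h2 _ _] := hs.
  by apply: (in_support_filler st_lev hx); [|lia|lia|case/andP: hb].
have typical_le : filler_mass st_lev J B0 b (fun p w => ~~ typical tw st b J p.2 w) <= e1.
  apply: le_trans active; apply: filler_mass_le => // x p hx hp /andP[hb /negP not_typ].
  move=> [u [s [hb' hs typ_s]]]; apply: not_typ.
  by have := spanning_block_uniq hp (mem_spanning_blocks hs hb') hb hb' => ->.
have := filler_mass_confused_le b_active hB hl hrate he3; have := filler_mass_hits_le B0.
by lra.
Qed.

Lemma forces_cylinder_window B0 B x x' : (B0 <= B)%N -> (level (st J) b <= B)%N ->
  window B x (- B%:Z) (B + B) = window B x' (- B%:Z) (B + B) ->
  forces_cylinder B0 x -> forces_cylinder B0 x'.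
Proof.
move=> hB hl hx [u [s [hs hb reg_x hf]]]; exists u, s.
have /and4P[w1 w2 w3 w4] := hs; have [depth_le _ _] := st_lev.
have same_filler : block_filler M st b J x' u s = block_filler M st b J x u s.
  apply: eq_filler => k hk; have hd := leq_trans (depth_at_le s k (gap_depth_le M st b J)) hl.
  by apply: mkseq_eq_le hd _; apply/esym; apply: eq_window_letter hx _; lia.
split; [by []| |by rewrite /regular same_filler|by rewrite same_filler].
rewrite /stage_block -(@eq_block (mark (M b) x))// => k hk; rewrite /mark.
by congr (mword _ _); apply: (eq_window_sub hx); [exact: leq_trans (depth_le b J) hl|lia|lia].
Qed.

End Law.

(** * Entropy rates *)

Lemma ln_prod_seq (R : realType) (I : eqType) (s : seq I) (F : I -> R) :
  {in s, forall i, 0 < F i} -> ln (\prod_(i <- s) F i) = \sum_(i <- s) ln (F i).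
Proof.
move=> F0.
suff [] : 0 < \prod_(i <- s) F i /\ ln (\prod_(i <- s) F i) = \sum_(i <- s) ln (F i) by [].
elim: s F0 => [|i s IH] F0; first by rewrite !big_nil ln1.
have Fi : 0 < F i by apply: F0; rewrite inE eqxx.
have [|p0 e] := IH; first by move=> k hk; apply: F0; rewrite inE hk orbT.
by rewrite !big_cons mulr_gt0// lnM ?posrE// e.
Qed.

Definition letter_entropy {R : realType} (P : seq bool -> R) r : R :=
  word_exp P r 1 (fun e => - ln (letter_wt P 1 e)).

Lemma letter_entropy_mono (R : realType) (P : seq bool -> R) r r' : source P -> (r <= r')%N ->
  letter_entropy P r <= letter_entropy P r'.
Proof.
move=> sP hr; rewrite /letter_entropy -(word_exp_map_take sP 1 _ hr).
apply: le_word_exp => // e he; have he' := letter_words_take sP hr he.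
rewrite lerN2 ler_ln ?posrE ?(letter_wt_gt0 he) ?(letter_wt_gt0 he')//.
by have := letter_wt_take_le sP r he.
Qed.

Section GapEntropy.
Context {R : realType} {K : nat} (M : marker R K).
Local Notation P := (mlaw M).
Local Notation r0 := (mdepth M).
Let sP := mlaw_source M.
Implicit Types (x : bitarray) (u : int).

Definition gap_entropy r n : R :=
  word_exp P r n (fun e => (gap_word M n e)%:R * - ln (letter_wt P n e / gap_prob M n)).

Lemma gap_entropy_term_ge0 r n e : (r0 <= r)%N -> e \in letter_words P r n ->
  0 <= (gap_word M n e)%:R * - ln (letter_wt P n e / gap_prob M n).
Proof.
move=> hr he; have [hg|] := boolP (gap_word M n e); last by rewrite mul0r.
have v0 := gap_word_prob_gt0 hr he hg.
by rewrite mul1r oppr_ge0 ln_le0// ler_pdivrMr// mul1r (gap_word_wt_le hr).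
Qed.

Lemma gap_entropy_ge0 r n : (r0 <= r)%N -> 0 <= gap_entropy r n.
Proof. by move=> hr; apply: word_exp_ge0 => // e; exact: gap_entropy_term_ge0. Qed.

Lemma gap_entropy_mono r r' n : (r0 <= r)%N -> (r <= r')%N -> gap_entropy r n <= gap_entropy r' n.
Proof.
move=> hr hrr; rewrite /gap_entropy -(word_exp_map_take sP n _ hrr); apply: le_word_exp => // e he.
rewrite gap_word_map_take//; have [hg|] := boolP (gap_word M n e); last by rewrite !mul0r.
have he' := letter_words_take sP hrr he.
have v0 := gap_word_prob_gt0 (leq_trans hr hrr) he hg.
rewrite !mul1r lerN2 ler_ln ?posrE ?divr_gt0 ?(letter_wt_gt0 he) ?(letter_wt_gt0 he')//.
by rewrite ler_pM2r ?invr_gt0// (letter_wt_take_le sP _ he).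
Qed.

Lemma gap_path_next_mark rho x u n : (r0 <= rho)%N -> (0 < n <= rho)%N ->
  gap_path (mark M x) u [:: n] =
  mark M x u && (n == next_mark M rho (window rho x u (rho + K))).
Proof.
move=> hr hn; set w := window _ _ _ _; apply/idP/andP => [hp|[hm /eqP en]].
  have hnr : (n <= rho)%N by case/andP: hn.
  by rewrite (gap_path_start hp) /w (next_mark_window hr hp) hnr.
have mark_w k : (k <= rho)%N -> mark_in M w k = mark M x (u + k%:Z).
  by move=> hk; rewrite mark_in_window// leq_add2r.
have has_mark : has (mark_in M w) (iota 1 rho).
  by rewrite has_find size_iota; move: hn; rewrite en => /andP[].
have hn1 : n.-1 = find (mark_in M w) (iota 1 rho) by rewrite en.
have := nth_find 0%N has_mark; rewrite -hn1 nth_iota; last by lia.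
rewrite add1n prednK; last by lia.
rewrite mark_w => [hmn|]; last by lia.
apply/and4P; split; [by []|by lia| |by rewrite /= hmn].
apply/markfreeP => i hi; have ei : i = u + `|i - u|%N%:Z by lia.
rewrite ei -mark_w; last by lia.
have := @before_find _ 0%N (mark_in M w) (iota 1 rho) `|i - u|.-1.
rewrite -hn1 nth_iota; last by lia.
by rewrite add1n prednK => [h|]; [rewrite h//; lia|lia].
Qed.

Lemma gap_word_next_mark rho w n : (r0 <= rho)%N -> w \in letter_words P rho (rho + K) ->
  (0 < n <= rho)%N ->
  gap_word M n (take n w) && mark_in M (drop n w) 0 = mark_in M w 0 && (n == next_mark M rho w).
Proof.
move=> hr hw hn; rewrite -(letter_words_extend hw); set x := extend 0 w.
rewrite mark_in_window ?leq_addl// addr0 -gap_path_next_mark// (gap_path_cons _ _ _ _ hr) /=.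
have -> : (rho + K = n + (rho - n + K))%N by lia.
by rewrite take_window drop_window mark_in_window ?leq_addl// addr0 andbT.
Qed.

Lemma gap_infoE rho w : (r0 <= rho)%N -> w \in letter_words P rho (rho + K) ->
  gap_info M rho w = \sum_(n <- iota 1 rho)
    (gap_word M n (take n w))%:R * - ln (letter_wt P n (take n w) / gap_prob M n) *
    (mark_in M (drop n w) 0)%:R.
Proof.
move=> hr hw; pose F n := - ln (letter_wt P n (take n w) / gap_prob M n).
transitivity (\sum_(n <- iota 1 rho) (mark_in M w 0 && (n == next_mark M rho w))%:R * F n).
  rewrite /gap_info -/(F _); have [hm|hm] /= := boolP (mark_in M w 0); last first.
    by rewrite big1// => n _; rewrite mul0r.
  have [hn|hn] := leqP (next_mark M rho w) rho; last first.
    rewrite big_seq big1// => n; rewrite mem_iota => hn'.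
    by rewrite (_ : (n == _) = false) ?mul0r//; apply/eqP; lia.
  rewrite sum_pred1_seq ?iota_uniq//; last by rewrite mem_iota add1n ltnS.
  have hn0 : (0 < next_mark M rho w <= rho)%N by rewrite hn.
  have := gap_word_next_mark hr hw hn0; rewrite hm eqxx => /andP[hg _].
  rewrite (gap_word_prob_gt0 hr _ hg)//.
  have := letter_words_sub hw (@mem_take (next_mark M rho w) _ w).
  by rewrite size_takel// (proj1 (letter_words_size hw)) (leq_trans hn) ?leq_addr.
apply: eq_big_seq => n; rewrite mem_iota add1n ltnS => hn.
by rewrite -(gap_word_next_mark hr hw hn) -mulnb natrM mulrAC.
Qed.

Lemma info_rateE rho : (r0 <= rho)%N ->
  info_rate M rho = \sum_(n <- iota 1 rho) mark_prob M * gap_entropy rho n.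
Proof.
move=> hr; rewrite /info_rate (eq_word_exp (fun w => @gap_infoE rho w hr)) word_exp_sum.
apply: eq_big_seq => n; rewrite mem_iota => hn.
have -> : (rho + K)%N = (n + (K + (rho - n)))%N by lia.
rewrite (word_exp_prod P rho n _
  (fun e => (gap_word M n e)%:R * - ln (letter_wt P n e / gap_prob M n))
  (fun w => (mark_in M w 0)%:R)) mulrC; congr (_ * _).
rewrite -(mark_probE hr) -(word_exp_take sP rho K (rho - n) (fun w => (mark_in M w 0)%:R)).
by apply: eq_word_exp => w _; rewrite mark_in_take.
Qed.

End GapEntropy.

Section GapPositions.
Context {R : realType} {K : nat} (M : marker R K).
Local Notation P := (mlaw M).
Local Notation r0 := (mdepth M).
Let sP := mlaw_source M.
Let K_gt0 := mlen_gt0 M.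
Implicit Types (x : bitarray) (q : nat * nat).

Definition abs_gap_entropy r n : R :=
  word_exp P r n (fun e => (gap_word M n e)%:R * - ln (letter_wt P n e)).

Lemma gap_entropyE r n : (r0 <= r)%N ->
  gap_entropy M r n = abs_gap_entropy r n + gap_prob M n * ln (gap_prob M n).
Proof.
move=> hr; have -> : gap_prob M n * ln (gap_prob M n) =
    word_exp P r n (fun e => ln (gap_prob M n) * (gap_word M n e)%:R).
  rewrite word_expZ mulrC -(gap_probE n hr) /word_exp big_mkcond; congr (_ * _).
  by apply: eq_bigr => e _; case: ifP; rewrite ?mulr1 ?mulr0.
rewrite -word_expD; apply: eq_word_exp => e he.
have [hg|] := boolP (gap_word M n e); last by rewrite !mul0r mulr0 addr0.
rewrite !mul1r mulr1 ln_div ?posrE ?(letter_wt_gt0 he) ?(gap_word_prob_gt0 hr he)//.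
by rewrite opprB addrC.
Qed.

Definition letter_info (a : seq bool) : R := - ln (P a).

Lemma letter_info_ge0 a : 0 <= letter_info a.
Proof. by rewrite oppr_ge0 ln_le0// source_le1. Qed.

Lemma ln_letter_wt r n e : e \in letter_words P r n ->
  - ln (letter_wt P n e) = \sum_(i <- iota 0 n) letter_info (nth [::] e i).
Proof.
move=> he; have [hs _] := letter_words_size he; rewrite letter_wt_prod// ln_prod_seq ?sumrN//.
move=> i; rewrite mem_iota => hi; move: he; rewrite mem_letter_words => /andP[_ /allP he].
by have /he/andP[] : nth [::] e i \in e by rewrite mem_nth ?hs.
Qed.

(* [(n, i)] stands for the gap of length [n] which starts at [- i]. *)
Definition gap_positions m := [seq (n, i) | n <- iota 1 m, i <- iota 0 n].

Definition is_gap_of x q : bool := gap_path (mark M x) (- q.2%:Z) [:: q.1].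

Lemma gap_positions_uniq m : uniq (gap_positions m).
Proof.
apply: allpairs_uniq_dep => [|n _|]; rewrite ?iota_uniq//.
by move=> [n i] [n' i'] /= _ _ [-> ->].
Qed.

Lemma mem_gap_positions m q : (q \in gap_positions m) = (0 < q.1 <= m)%N && (q.2 < q.1)%N.
Proof.
apply/allpairsPdep/idP => [[n [i [hn hi ->]]]|h] /=.
  by move: hn hi; rewrite !mem_iota; lia.
by exists q.1, q.2; rewrite !mem_iota; split; [lia|lia|case: (q)].
Qed.

Lemma sum_is_gap_of_le1 m x : \sum_(q <- gap_positions m) (is_gap_of x q)%:R <= 1 :> R.
Proof.
apply: (@sum_indicator_uniq_le R _ _ _ true) => //; first exact: gap_positions_uniq.
move=> [n i] [n' i']; rewrite !mem_gap_positions /= => h h' hp hp'.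
have [||/= e1 ->] := gap_uniq (i := 0) hp hp'; [by move=> /=; lia|by move=> /=; lia|].
by congr (_, _); lia.
Qed.

Lemma exists_is_gap_of m h x : (h + h + 2 <= m)%N ->
  (exists2 i, - h%:Z <= i <= 0 & mark M x i) -> (exists2 i, 1 <= i <= 1 + h%:Z & mark M x i) ->
  exists2 q, q \in gap_positions m & is_gap_of x q.
Proof.
move=> hm [v1 hv1 m1] [v2 hv2 m2].
have [|u [n [a1 a2 a3 a4]]] := exists_gap (i := 0) m1 m2; first by lia.
exists (n, `|u|%N); first by rewrite mem_gap_positions /=; lia.
by rewrite /is_gap_of /=; have -> : - `|u|%N%:Z = u by lia.
Qed.

(* Summing the information of a gap over its letters, or that of the letter at the origin over
   the gaps around it, gives the same result by shift invariance. *)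
Lemma sum_abs_gap_entropy r m B : (r0 <= r)%N -> (r <= B)%N -> (m + K <= B)%N ->
  \sum_(n <- iota 1 m) mark_prob M * abs_gap_entropy r n =
  win_exp P B (fun x =>
    letter_info (mkseq (x 0) r) * \sum_(q <- gap_positions m) (is_gap_of x q)%:R).
Proof.
move=> hr hrB hB.
transitivity (\sum_(q <- gap_positions m)
    win_exp P B (fun x => letter_info (mkseq (x 0) r) * (is_gap_of x q)%:R)); last first.
  by rewrite -win_exp_sum; apply: eq_win_exp => // x _; rewrite mulr_sumr.
rewrite /gap_positions big_allpairs_dep /=; apply: eq_big_seq => n; rewrite mem_iota => hn.
transitivity (\sum_(i <- iota 0 n) mark_prob M *
    word_exp P r n (fun e => (gap_word M n e)%:R * letter_info (nth [::] e i))).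
  rewrite -mulr_sumr -word_exp_sum; congr (_ * _); apply: eq_word_exp => e he.
  by rewrite (ln_letter_wt he) mulr_sumr.
apply: eq_big_seq => i; rewrite mem_iota => hi; rewrite mulrC -(mark_probE hr) -word_exp_prod.
rewrite -(win_exp_window sP (B := B) (u := - i%:Z))//; [|by lia|by lia].
apply: eq_win_exp => // x _; rewrite /is_gap_of (gap_path_cons _ _ _ _ hr) /=.
rewrite take_window drop_window mark_in_window ?leq_addl// addr0 andbT nth_window; last by lia.
by rewrite addNr mulrAC -natrM mulnb mulrC.
Qed.

Lemma letter_entropyE r B : (r <= B)%N -> (1 <= B)%N ->
  letter_entropy P r = win_exp P B (fun x => letter_info (mkseq (x 0) r)).
Proof.
move=> hr hB; rewrite /letter_entropy -(win_exp_window sP (B := B) (u := 0))//.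
by apply: eq_win_exp => // x _; rewrite /window /= addr0 /letter_wt /= mulr1.
Qed.

Lemma sum_abs_gap_entropy_le r m : (r0 <= r)%N ->
  \sum_(n <- iota 1 m) mark_prob M * abs_gap_entropy r n <= letter_entropy P r.
Proof.
move=> hr; have rB : (r <= r + m + K + 1)%N by lia.
rewrite (sum_abs_gap_entropy hr rB) ?(letter_entropyE rB); [|by lia|by lia].
apply: le_win_exp => // x _; rewrite ler_piMr ?letter_info_ge0//.
exact: sum_is_gap_of_le1.
Qed.

Lemma letter_info_bounded r : exists2 C, 0 < C & {in letters P r, forall a, letter_info a <= C}.
Proof.
exists (1 + \sum_(a <- letters P r) letter_info a) => [|a ha].
  by rewrite ltr_pwDl// sumr_ge0// => a _; exact: letter_info_ge0.
by rewrite ler_wpDl//; apply: (ler_sum_mem ha) => c _; exact: letter_info_ge0.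
Qed.

Lemma sum_abs_gap_entropy_ge r e : 0 < mark_prob M -> (r0 <= r)%N -> 0 < e ->
  exists m0, forall m, (m0 <= m)%N ->
  letter_entropy P r - e <= \sum_(n <- iota 1 m) mark_prob M * abs_gap_entropy r n.
Proof.
move=> hM hr e0; have [C C0 hC] := letter_info_bounded r.
have e1 : 0 < e / 2 / C by rewrite !divr_gt0.
have [h miss] := mark_miss_small hM e1; exists (h + h + 2)%N => m hm.
have [B rB [mB B1]] : exists2 B, (r <= B)%N & (m + K <= B)%N /\ (1 <= B)%N.
  by exists (r + m + K + 1)%N; lia.
rewrite (sum_abs_gap_entropy hr rB mB) (letter_entropyE rB B1) lerBlDr.
have r0B := leq_trans hr rB.
have p1 := miss B (- h%:Z) r0B ltac:(lia) ltac:(lia).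
have p2 := miss B 1 r0B ltac:(lia) ltac:(lia).
set E1 := fun x : bitarray => forall i, - h%:Z <= i <= - h%:Z + h%:Z -> ~ mark M x i in p1.
set E2 := fun x : bitarray => forall i, 1 <= i <= 1 + h%:Z -> ~ mark M x i in p2.
apply: (@le_trans _ _ (win_exp P B (fun x =>
   letter_info (mkseq (x 0) r) * \sum_(q <- gap_positions m) (is_gap_of x q)%:R +
   (C * (`[< E1 x >])%:R + C * (`[< E2 x >])%:R)))); last first.
  rewrite !win_expD !win_expZ lerD2l.
  have -> : e = C * (e / 2 / C) + C * (e / 2 / C) by field; rewrite gt_eqF.
  by apply: lerD; rewrite ler_pM2l.
apply: le_win_exp => // x hx; have g0 := letter_info_ge0 (mkseq (x 0) r).
have gC : letter_info (mkseq (x 0) r) <= C.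
  apply: hC; rewrite mem_letters size_mkseq eqxx -(take_mkseq _ rB) /=.
  by apply: lt_le_trans (in_support_letter hx _) (source_take sP _ _); lia.
have s0 : 0 <= letter_info (mkseq (x 0) r) * \sum_(q <- gap_positions m) (is_gap_of x q)%:R.
  by rewrite mulr_ge0// sumr_ge0.
case: asboolP => hE1; first by rewrite mulr1; case: asboolP => _; rewrite ?mulr1 ?mulr0; lra.
case: asboolP => hE2; first by rewrite mulr1 mulr0; lra.
rewrite !mulr0 !addr0 ler_peMr//.
have [||q hq gap_q] := exists_is_gap_of hm (x := x).
- by apply: contrapT => hn; apply: hE1 => i hi hm'; apply: hn; exists i; [lia|].
- by apply: contrapT => hn; apply: hE2 => i hi hm'; apply: hn; exists i.
by have := @ler_sum_mem R _ _ (fun q => (is_gap_of x q)%:R) q hq; rewrite gap_q; apply.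
Qed.

End GapPositions.

Section PartialRate.
Context {R : realType} {K : nat}.
Implicit Types M : marker R K.

Definition partial_rate M r m := \sum_(k <- iota 1 m) mark_prob M * gap_entropy M r k.

Definition gap_correction M m :=
  \sum_(k <- iota 1 m) mark_prob M * (gap_prob M k * ln (gap_prob M k)).

Lemma partial_rate_le M r r' m m' : 0 < mark_prob M -> (mdepth M <= r)%N -> (r <= r')%N ->
  (m <= m')%N -> partial_rate M r m <= partial_rate M r' m'.
Proof.
move=> hM hr hrr hm; rewrite /partial_rate -(subnKC hm) iotaD big_cat /= -[leLHS]addr0.
apply: lerD; first by apply: ler_sum => k _; rewrite ler_pM2l// gap_entropy_mono.
apply: sumr_ge0 => k _; apply: mulr_ge0; first exact: ltW.
by apply: gap_entropy_ge0; exact: leq_trans hr hrr.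
Qed.

Lemma partial_rate_gain M r r' m m' n : 0 < mark_prob M -> (mdepth M <= r)%N -> (r <= r')%N ->
  (m < n <= m')%N ->
  partial_rate M r m + mark_prob M * gap_entropy M r' n <= partial_rate M r' m'.
Proof.
move=> hM hr hrr /andP[hmn hn]; have hm : (m <= m')%N by lia.
rewrite {2}/partial_rate -(subnKC hm) iotaD big_cat /=; apply: lerD.
  by apply: partial_rate_le.
apply: (ler_sum_mem (F := fun k => mark_prob M * gap_entropy M r' k)).
  by rewrite mem_iota; lia.
move=> k _; apply: mulr_ge0; first exact: ltW.
by apply: gap_entropy_ge0; exact: leq_trans hr hrr.
Qed.

Lemma partial_rateE M r m : (mdepth M <= r)%N ->
  partial_rate M r m =
  \sum_(k <- iota 1 m) mark_prob M * abs_gap_entropy M r k + gap_correction M m.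
Proof.
by move=> hr; rewrite -big_split /=; apply: eq_bigr => k _; rewrite gap_entropyE// mulrDr.
Qed.

Lemma eq_gap_correction M M' m : mark_prob M = mark_prob M' ->
  gap_correction M m = gap_correction M' m.
Proof. by move=> same; apply: eq_bigr => k _; rewrite same (eq_gap_prob _ same). Qed.

Lemma info_rate_mono M r r' : 0 < mark_prob M -> (mdepth M <= r)%N -> (r <= r')%N ->
  info_rate M r <= info_rate M r'.
Proof.
by move=> hM hr hrr; rewrite !info_rateE ?(leq_trans hr)//; exact: partial_rate_le.
Qed.

(* The rates of the two sides approach the same limit without ever reaching it. *)
Lemma info_rate_interleave M M' rho : mark_prob M = mark_prob M' -> 0 < mark_prob M ->
  (forall r e, 0 < e -> exists r', letter_entropy (mlaw M) r - e <= letter_entropy (mlaw M') r') ->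
  (forall m, exists n r, [/\ (m < n)%N, (mdepth M <= r)%N & 0 < gap_entropy M r n]) ->
  (mdepth M <= rho)%N ->
  exists2 rho', (mdepth M' <= rho')%N & info_rate M rho < info_rate M' rho'.
Proof.
move=> same hM entropy_le gaps hr; have [n [r1 [hn hr1 gain]]] := gaps rho.
have hM' : 0 < mark_prob M' by rewrite -same.
have [r2 [r2rho r2r1 r2n]] : exists r2, [/\ (rho <= r2)%N, (r1 <= r2)%N & (n <= r2)%N].
  by exists (rho + r1 + n)%N; split; lia.
set d := mark_prob M * gap_entropy M r1 n.
have d0 : 0 < d by rewrite mulr_gt0.
have [r3 hr3] := entropy_le r2 (d / 4) ltac:(by rewrite divr_gt0).
have [r4 [r4M' r43]] : exists r4, (mdepth M' <= r4)%N /\ (r3 <= r4)%N.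
  by exists (r3 + mdepth M')%N; rewrite leq_addl leq_addr.
have d4 : 0 < d / 4 by rewrite divr_gt0.
have [m0 hm0] := sum_abs_gap_entropy_ge hM' r4M' d4.
have [m [mm0 mr2 mr4]] : exists m, [/\ (m0 <= m)%N, (r2 <= m)%N & (r4 <= m)%N].
  by exists (m0 + r2 + r4)%N; split; lia.
exists m; first exact: leq_trans r4M' mr4.
have r2M := leq_trans hr r2rho.
have low : info_rate M rho + d <= partial_rate M r2 m.
  rewrite info_rateE// -/(partial_rate M rho rho).
  have nm : (rho < n <= m)%N by lia.
  apply: le_trans (partial_rate_gain hM hr r2rho nm).
  by rewrite lerD2l ler_pM2l// gap_entropy_mono.
have high : partial_rate M' r4 m <= info_rate M' m.
  by rewrite info_rateE ?(leq_trans r4M')//; apply: partial_rate_le.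
have := letter_entropy_mono (mlaw_source M') r43.
have := sum_abs_gap_entropy_le m r2M; have := hm0 m mm0.
by move: low high; rewrite !partial_rateE// (eq_gap_correction _ same); lra.
Qed.

End PartialRate.

(** * The schedule of stages *)

Lemma expR_add_le (R : realType) (a b c : R) : a < c -> b < c ->
  exists N, forall n, (N <= n)%N -> expR (a * n%:R) + expR (b * n%:R) <= expR (c * n%:R).
Proof.
move=> ac bc; pose d := Num.min (c - a) (c - b).
have d0 : 0 < d by rewrite lt_min !subr_gt0 ac.
have [N hN] := expR_decay d0 (ler0n R 2) ltr01; exists N => n hn.
have expR_le e : e <= c - d -> expR (e * n%:R) <= expR (c * n%:R) * expR (- (d * n%:R)).
  by move=> he; rewrite -expRD ler_expR -mulrBl ler_wpM2r.
apply: (@le_trans _ _ (expR (c * n%:R) * (2 * expR (- (d * n%:R))))); last first.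
  by rewrite ler_piMr ?expR_ge0// hN.
by rewrite mulrCA mulr_natl mulr2n lerD// expR_le// lerBrDl -lerBrDr ge_min lexx ?orbT.
Qed.

Definition marks_around {R : realType} {K : nat} (M : marker R K) j rho (x : bitarray) :=
  exists v1 v2, [/\ mark M x v1, mark M x v2, v1 <= - j%:Z, j%:Z < v2 & v2 - v1 <= rho%:Z].

Definition has_block {R : realType} {K : nat} (M : marker R K) N B0 j (x : bitarray) :=
  exists u s, block (mark M x) N u s /\ spans K B0 N j u s.

Definition has_informed_block {R : realType} {K : nat} (M : marker R K) rho de N B0 j
    (x : bitarray) :=
  has_typical_block M rho (rho + K) (gap_info M rho) de N B0 j x /\ marks_around M j rho x.

Section LikelyBlocks.
Context {R : realType} {K : nat} (M : marker R K).
Local Notation P := (mlaw M).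
Let sP := mlaw_source M.
Hypothesis mark_prob_gt0 : 0 < mark_prob M.
Hypothesis markfree_prob_gt0 : forall n, 0 < markfree_prob M n.

Lemma marks_around_likely j e : 0 < e -> exists h, forall rho, (h <= rho)%N ->
  exists B0, forall B, (B0 <= B)%N -> win_pr P B (fun x => ~ marks_around M j rho x) <= e.
Proof.
move=> e0; have e2 : 0 < e / 2 by rewrite divr_gt0.
have [h miss] := mark_miss_small mark_prob_gt0 e2; exists (j + j + h + h + 2)%N => rho hrho.
exists (j + h + 1 + mdepth M)%N => B hB; have hr : (mdepth M <= B)%N by lia.
have p1 := miss B (- j%:Z - h%:Z) hr ltac:(lia) ltac:(lia).
have p2 := miss B (j%:Z + 1) hr ltac:(lia) ltac:(lia).
have -> : e = e / 2 + e / 2 by field.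
apply: le_trans (lerD p1 p2); apply: le_trans (win_prU sP _ _ _).
apply: le_win_pr => // x _ not_around; apply: contrapT => hn; apply: not_around.
have [v1 hv1 m1] : exists2 i, - j%:Z - h%:Z <= i <= - j%:Z - h%:Z + h%:Z & mark M x i.
  by apply: contrapT => hc; apply: hn; left => i hi hm; apply: hc; exists i.
have [v2 hv2 m2] : exists2 i, j%:Z + 1 <= i <= j%:Z + 1 + h%:Z & mark M x i.
  by apply: contrapT => hc; apply: hn; right => i hi hm; apply: hc; exists i.
by exists v1, v2; split=> //; lia.
Qed.

Lemma has_typical_block_le r m f de N B0 B0' j x : (B0 <= B0')%N ->
  has_typical_block M r m f de N B0 j x -> has_typical_block M r m f de N B0' j x.
Proof. by move=> hB [u [s [h1 h2 h3]]]; exists u, s; split=> //; apply: spans_le h2. Qed.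

Lemma block_likely j e : 0 < e -> exists N0, forall N, (N0 <= N)%N -> exists B0,
  forall B0' B, (B0 <= B0')%N -> (B0' <= B)%N ->
  win_pr P B (fun x => ~ has_block M N B0' j x) <= e.
Proof.
move=> e0.
have bounded : {in letter_words P 0 1, forall w, `|0 : R| <= 0} by move=> w _; rewrite normr0.
have [N0 likely] :=
  typical_block_likely mark_prob_gt0 markfree_prob_gt0 j (ltnSn 0) ltr01 e0 bounded.
exists N0 => N /likely[B0 hB0]; exists B0 => B0' B hB' hB.
apply: le_trans (hB0 B (leq_trans hB' hB)); apply: le_win_pr => // x _ no_block.
by move=> /(has_typical_block_le hB') [u [s [h1 h2 _]]]; apply: no_block; exists u, s.
Qed.

Lemma informed_block_likely j e : 0 < e -> exists h, forall rho de, (h <= rho)%N -> 0 < de ->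
  exists N0, forall N, (N0 <= N)%N -> exists B0, forall B0' B, (B0 <= B0')%N -> (B0' <= B)%N ->
  win_pr P B (fun x => ~ has_informed_block M rho de N B0' j x) <= e.
Proof.
move=> e0; have e2 : 0 < e / 2 by rewrite divr_gt0.
have [h around] := marks_around_likely j e2; exists h => rho de /around[B1 hB1] de0.
have [C hC] := gap_info_bounded M rho; have len : (0 < rho + K)%N by have := mlen_gt0 M; lia.
have [N0 likely] := typical_block_likely mark_prob_gt0 markfree_prob_gt0 j len de0 e2 hC.
exists N0 => N /likely[B2 hB2]; exists (B1 + B2)%N => B0' B hB' hB.
have p1 := hB1 B ltac:(lia); have p2 := hB2 B ltac:(lia).
have -> : e = e / 2 + e / 2 by field.
apply: le_trans (lerD p1 p2); apply: le_trans (win_prU sP _ _ _).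
apply: le_win_pr => // x _ not_informed; apply: contrapT => hn; apply: not_informed.
split; last by apply: contrapT => h1; apply: hn; left.
by apply: contrapT => h2; apply: hn; right => typ; apply: h2; apply: has_typical_block_le typ; lia.
Qed.

End LikelyBlocks.

Section Schedule.
Context {R : realType} {K : nat} (M : bool -> marker R K).
Hypothesis mark_prob_gt0 : forall b, 0 < mark_prob (M b).
Hypothesis markfree_prob_gt0 : forall b n, 0 < markfree_prob (M b) n.
Hypothesis rates_interleave : forall b b' rho, (mdepth (M b) <= rho)%N ->
  exists2 rho', (mdepth (M b') <= rho')%N & info_rate (M b) rho < info_rate (M b') rho'.

Definition tolerance j : R := j.+1%:R^-1.

Lemma tolerance_gt0 j : 0 < tolerance j. Proof. by rewrite invr_gt0. Qed.

Definition extendable (s : stage R) := (forall b, (mdepth (M b) <= level s b)%N) /\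
  forall b, exists2 rho, (mdepth (M b) <= rho)%N & label_rate s < info_rate (M b) rho.

(* The side [b] is active: only its level is raised. *)
Record advances b j (s s' : stage R) : Prop := Advances {
  advances_passive : level s' (~~ b) = level s (~~ b);
  advances_level : (level s b <= level s' b)%N;
  advances_level_gt : (j < level s' b)%N;
  advances_gap_bound : (gap_bound s <= gap_bound s')%N;
  advances_info_lo : label_rate s <= info_lo s';
  advances_label_rate : label_rate s <= label_rate s';
  advances_growth : forall n, (gap_bound s' <= n)%N ->
    expR (info_hi s' * n%:R) + expR (label_rate s * n%:R) <= expR (label_rate s' * n%:R);
  advances_confused :
    expR (- ((info_lo s' - label_rate s) * (gap_bound s')%:R)) <= tolerance j.+1;
  advances_active : exists de, [/\ info_lo s' + de <= info_rate (M b) (level s' b),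
    info_rate (M b) (level s' b) + de <= info_hi s' &
    forall B, (radius s' <= B)%N -> win_pr (mlaw (M b)) B (fun x =>
      ~ has_informed_block (M b) (level s' b) de (gap_bound s') (radius s') j.+1 x)
      <= tolerance j.+1];
  advances_passive_block : forall B, (radius s' <= B)%N -> win_pr (mlaw (M (~~ b))) B (fun x =>
      ~ has_block (M (~~ b)) (gap_bound s') (radius s') j.+1 x) <= tolerance j.+1 }.

Lemma exists_higher_rate (s : stage R) b l : extendable s -> exists rho,
  [/\ (l <= rho)%N, (mdepth (M b) <= rho)%N & label_rate s < info_rate (M b) rho].
Proof.
move=> [_ rates]; have [rho hr above] := rates b; exists (l + rho)%N.
split; [exact: leq_addr|exact: leq_trans hr (leq_addl _ _)|].
by apply: lt_le_trans above _; apply: info_rate_mono => //; exact: leq_addl.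
Qed.

Lemma exists_rate_bound b rho : (mdepth (M b) <= rho)%N ->
  exists2 c, info_rate (M b) rho < c &
  forall c', c' < c ->
    forall b', exists2 rho', (mdepth (M b') <= rho')%N & c' < info_rate (M b') rho'.
Proof.
move=> hr; have [rt hrt art] := rates_interleave true hr.
have [rf hrf arf] := rates_interleave false hr.
exists (Num.min (info_rate (M true) rt) (info_rate (M false) rf)); first by rewrite lt_min art.
by move=> c' hc' [|]; [exists rt|exists rf] => //;
  apply: lt_le_trans hc' _; rewrite ge_min lexx ?orbT.
Qed.

Lemma exists_next_stage b j s : extendable s -> exists s', extendable s' /\ advances b j s s'.
Proof.
move=> ext; have [depth_le _] := ext; have e0 := tolerance_gt0 j.+1.
have [h informed] := informed_block_likely (mark_prob_gt0 b) (markfree_prob_gt0 b) j.+1 e0.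
have [rho [hrho hr above]] := exists_higher_rate b (h + level s b + j.+1) ext.
have [c above_rho higher] := exists_rate_bound hr; set a := info_rate (M b) rho in above above_rho.
pose hi := a + (c - a) / 3; pose rate := a + (c - a) * 2 / 3; pose lo := (label_rate s + a) / 2.
pose de := Num.min ((a - label_rate s) / 2) ((c - a) / 3).
have de_gt0 : 0 < de by rewrite lt_min; apply/andP; split; lra.
have de_lo : de <= (a - label_rate s) / 2 by rewrite ge_min lexx.
have de_hi : de <= (c - a) / 3 by rewrite ge_min lexx orbT.
have [N1 hN1] := informed rho de ltac:(lia) de_gt0.
have [N2 hN2] := block_likely (mark_prob_gt0 (~~ b)) (markfree_prob_gt0 (~~ b)) j.+1 e0.
have [N3 hN3] := @expR_add_le R hi (label_rate s) rate ltac:(rewrite /hi /rate; lra)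
  ltac:(rewrite /rate; lra).
have [N4 hN4] := @expR_decay R (lo - label_rate s) 1 _ ltac:(rewrite /lo; lra) ler01 e0.
have [N [NN1 NN2 NN3 NN4 NNs]] : exists N, [/\ (N1 <= N)%N, (N2 <= N)%N, (N3 <= N)%N, (N4 <= N)%N &
    (gap_bound s <= N)%N].
  by exists (N1 + N2 + N3 + N4 + gap_bound s)%N; split; lia.
have [B1 hB1] := hN1 N NN1; have [B2 hB2] := hN2 N NN2.
exists (Stage (fun b' => if b' == b then rho else level s b') N hi lo rate (B1 + B2)); split.
  split=> [b'|] /=; first by case: eqP => [->|_].
  by apply: higher; rewrite /rate; lra.
have b_neq : (~~ b == b) = false by case: (b).
split; rewrite /= ?eqxx ?b_neq //.
- by lia.
- by lia.
- by rewrite /lo; lra.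
- by rewrite /rate; lra.
- by move=> n hn; apply: hN3; exact: leq_trans hn.
- by have := hN4 N NN4; rewrite mul1r.
- exists de; split; [by rewrite -/a /lo; lra|by rewrite -/a /hi; lra|].
  by move=> B; apply: hB1; exact: leq_addr.
- by move=> B; apply: hB2; exact: leq_addl.
Qed.

Lemma exists_schedule : exists st : nat -> stage R,
  [/\ label_rate (st 0%N) = 0, forall b j, (mdepth (M b) <= level (st j) b)%N &
      forall j, advances (odd j.+1) j (st j) (st j.+1)].
Proof.
have step j (s : {s | extendable s}) :
    {s' : {s' | extendable s'} | advances (odd j.+1) j (sval s) (sval s')}.
  by case: s => s hs /=; apply: cid; have [s' [h1 h2]] := exists_next_stage (odd j.+1) j hs;
    exists (exist _ s' h1).
have start : extendable (Stage (fun b => mdepth (M b)) 0 0 0 0 0).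
  split=> //= b; have [rho hr above] := rates_interleave b (leqnn (mdepth (M b))).
  exists rho => //; apply: le_lt_trans above; rewrite info_rateE//; apply: sumr_ge0 => n _.
  by rewrite mulr_ge0 ?gap_entropy_ge0// ltW.
pose fix f j : {s | extendable s} :=
  if j is j'.+1 then sval (step j' (f j')) else exist _ _ start.
exists (fun j => sval (f j)); split=> // [b j|j]; first by case: (svalP (f j)).
exact: (svalP (step j (f j))).
Qed.

Lemma advances_leveled (st : nat -> stage R) : (forall b j, (mdepth (M b) <= level (st j) b)%N) ->
  (forall j, advances (odd j.+1) j (st j) (st j.+1)) -> leveled M st.
Proof.
move=> depth_le adv; split=> // [b j|j]; last by case: (adv j).
have [passive active _ _ _ _ _ _ _ _] := adv j.
by have [->//|] := eqVneq b (odd j.+1); move: passive active; case: b; case: (odd _) => // ->.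
Qed.

Lemma advances_label_growth (st : nat -> stage R) : label_rate (st 0%N) = 0 ->
  (forall j, advances (odd j.+1) j (st j) (st j.+1)) -> label_growth st.
Proof. by move=> rate0 adv; split=> [|j|j]; [rewrite rate0|case: (adv j)..]. Qed.

End Schedule.

Import numFieldNormedType.Exports.
Local Open Scope classical_set_scope.
Local Open Scope ring_scope.

(** * Random bit arrays *)

Section MeasurablePredicates.
Context {d : measure_display} {T : measurableType d}.
Implicit Types A B : T -> Prop.

Lemma measurable_exists (I : countType) (A : I -> T -> Prop) :
  (forall i, measurable [set t | A i t]) -> measurable [set t | exists i, A i t].
Proof.
move=> h; rewrite (_ : [set t | _] = \bigcup_i [set t | A i t]).
  by apply: countable_bigcupT_measurable => //; exact: countableP.
by apply/seteqP; split=> [t [i hi]|t [i _ hi]]; exists i.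
Qed.

Lemma measurable_not A : measurable [set t | A t] -> measurable [set t | ~ A t].
Proof. by move=> h; exact: measurableC h. Qed.

Lemma measurable_forall (I : countType) (A : I -> T -> Prop) :
  (forall i, measurable [set t | A i t]) -> measurable [set t | forall i, A i t].
Proof.
move=> h; rewrite (_ : [set t | _] = [set t | ~ exists i, ~ A i t]).
  by apply: measurable_not; apply: measurable_exists => i; exact: measurable_not.
by apply/seteqP; split=> [t hi [i]|t /= hn i]; [exact|apply: contrapT => hi; apply: hn; exists i].
Qed.

Lemma measurable_conj A B : measurable [set t | A t] -> measurable [set t | B t] ->
  measurable [set t | A t /\ B t].
Proof. by move=> hA hB; exact: measurableI hA hB. Qed.

Lemma measurable_prop (p : Prop) : measurable [set t : T | p].
Proof.
have [h|h] := pselect p; first by rewrite (_ : [set _ | _] = setT)//; apply/seteqP; split.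
by rewrite (_ : [set _ | _] = set0)//; apply/seteqP; split.
Qed.

Lemma measurable_imply (p : Prop) A : measurable [set t | A t] -> measurable [set t | p -> A t].
Proof.
have [h|h] := pselect p => hA.
  by rewrite (_ : [set _ | _] = [set t | A t])//; apply/seteqP; split=> t /=; [apply|].
by rewrite (_ : [set _ | _] = setT)//; apply/seteqP; split=> t //= _ /h.
Qed.

Definition measurable_bits (X : T -> bitarray) := forall i r, measurable [set t | X t i r].

End MeasurablePredicates.

(* Measurability tested on all random bit arrays, which avoids a sigma-algebra on arrays. *)
Definition borel_pred (S : bitarray -> Prop) :=
  forall (d : measure_display) (T : measurableType d) (X : T -> bitarray),
  measurable_bits X -> measurable [set t | S (X t)].

Lemma borel_bit i r be : borel_pred (fun x => x i r = be).
Proof.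
move=> d T X hX; case: be; first exact: hX.
rewrite (_ : [set _ | _] = [set t | ~ X t i r]); first exact: measurable_not (hX i r).
by apply/seteqP; split=> t /=; case: (X t i r).
Qed.

Lemma borel_window r u n c : borel_pred (fun x => window r x u n = c).
Proof.
move=> d T X hX.
rewrite (_ : [set _ | _] = [set t | size c = n /\ forall k, (k < n)%N ->
    size (nth [::] c k) = r /\
    forall l, (l < r)%N -> X t (u + k%:Z) l = nth false (nth [::] c k) l]).
  apply: measurable_conj; first exact: measurable_prop.
  apply: measurable_forall => k; apply: measurable_imply; apply: measurable_conj.
    exact: measurable_prop.
  by apply: measurable_forall => l; apply: measurable_imply; exact: borel_bit.
apply/seteqP; split=> t /=.
  move=> <-; rewrite size_window; split=> // k hk; rewrite nth_window// size_mkseq.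
  by split=> // l hl; rewrite nth_mkseq.
move=> [hs h]; apply: (@eq_from_nth _ [::]); rewrite size_window// => k hk.
have [h1 h2] := h k hk; rewrite nth_window//.
by apply: (@eq_from_nth _ false); rewrite size_mkseq ?h1// => l hl; rewrite nth_mkseq// h2.
Qed.

Lemma borel_finitary (S : bitarray -> Prop) :
  (forall x, S x -> exists n, forall x', agree_upto n x x' -> S x') -> borel_pred S.
Proof.
move=> h d T X hX; pose around n x := window n x (- n%:Z) (n + n).+1.
have agree_around n x x' : around n x' = around n x -> agree_upto n x x'.
  move=> e i r hi hr; have hk : (`|(i + n%:Z)%R| < (n + n).+1)%N by lia.
  have := window_inj e hk; have -> : - n%:Z + `|(i + n%:Z)%R|%N%:Z = i by lia.
  by move=> /mkseq_eq_nth; exact.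
have -> : [set t | S (X t)] = [set t | exists nc : nat * seq (seq bool),
    (forall x', around nc.1 x' = nc.2 -> S x') /\ around nc.1 (X t) = nc.2].
  apply/seteqP; split=> t /=; last by move=> [nc [h1 h2]]; exact: h1.
  move=> /h[n hn]; exists (n, around n (X t)); split=> // x' e.
  exact/hn/agree_around.
apply: measurable_exists => nc; apply: measurable_conj; first exact: measurable_prop.
exact: borel_window.
Qed.

Section ProbabilityFacts.
Context {R : realType} {d : measure_display} {T : measurableType d} (mu : probability T R).

Lemma probability_disjoint_exists (I : eqType) (A : I -> T -> Prop) (ws : seq I) : uniq ws ->
  (forall w, measurable [set t | A w t]) ->
  (forall w w' t, A w t -> A w' t -> w = w') ->
  measurable [set t | exists2 w, w \in ws & A w t] /\
  mu [set t | exists2 w, w \in ws & A w t] = (\sum_(w <- ws) mu [set t | A w t])%E.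
Proof.
move=> hu hm hd; elim: ws hu => [_|w ws IH /= /andP[hw /IH[m1 e1]]].
  rewrite (_ : [set t | _] = set0) ?measure0 ?big_nil//.
  by apply/seteqP; split=> t //= [].
have -> : [set t | exists2 w0, w0 \in w :: ws & A w0 t] =
    [set t | A w t] `|` [set t | exists2 w0, w0 \in ws & A w0 t].
  apply/seteqP; split=> t /=.
    by move=> [w0]; rewrite inE => /orP[/eqP -> h|h1 h2]; [left|right; exists w0].
  by move=> [h|[w0 h1 h2]]; [exists w|exists w0] => //; rewrite inE ?eqxx ?h1 ?orbT.
split; first exact: measurableU.
rewrite measureU//; last first.
  by apply/seteqP; split=> t //= [h [w0 h1 h2]]; rewrite (hd _ _ _ h h2) h1 in hw.
by rewrite [RHS]big_cons; congr (_ + _)%E; exact: e1.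
Qed.

Lemma probability_in_seq (I : eqType) (f : T -> I) (ws : seq I) : uniq ws ->
  (forall w, measurable [set t | f t = w]) ->
  mu [set t | f t \in ws] = (\sum_(w <- ws) mu [set t | f t = w])%E.
Proof.
move=> hu hm; have [|_ <-] := probability_disjoint_exists hu hm; first by move=> w w' t <-.
congr (mu _); apply/seteqP; split=> t /=; first by exists (f t).
by move=> [w hw ->].
Qed.

Lemma probability_not0 (A : T -> Prop) : measurable [set t | A t] -> mu [set t | A t] = 1%E ->
  mu [set t | ~ A t] = 0%E.
Proof. by move=> mA e; have := probability_setC mu mA; rewrite e subee. Qed.

Lemma probability_forall1 (I : countType) (A : I -> T -> Prop) :
  (forall i, measurable [set t | A i t]) -> (forall i, mu [set t | A i t] = 1%E) ->
  mu [set t | forall i, A i t] = 1%E.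
Proof.
move=> mA A1; have mall : measurable [set t | forall i, A i t] by exact: measurable_forall.
pose fails n := if unpickle n is Some i then [set t | ~ A i t] else set0.
have null_fails : mu.-negligible (\bigcup_n fails n).
  apply: negligible_bigcup => n; rewrite /fails.
  case: unpickle => [i|]; last exact: negligible_set0.
  apply/negligibleP; first exact: measurable_not.
  exact: probability_not0.
have null_compl : mu (~` [set t | forall i, A i t]) = 0%E.
  apply/negligibleP; first exact: measurableC.
  apply: negligibleS null_fails => t /= not_all; apply: contrapT => h; apply: not_all => i.
  by apply: contrapT => not_A; apply: h; exists (pickle i); rewrite // /fails pickleK.
by have := probability_setC mu (measurableC mall); rewrite setCK null_compl sube0.
Qed.

Lemma probability_and1 (A B : T -> Prop) : measurable [set t | A t] -> measurable [set t | B t] ->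
  mu [set t | A t] = 1%E -> mu [set t | B t] = 1%E -> mu [set t | A t /\ B t] = 1%E.
Proof.
move=> mA mB A1 B1; pose C (b : bool) t := if b then A t else B t.
rewrite (_ : [set t | _] = [set t | forall b, C b t]).
  by apply: probability_forall1 => -[].
apply/seteqP; split=> t /=; first by move=> [a1 a2] [].
by move=> h; split; [exact: (h true)|exact: (h false)].
Qed.

End ProbabilityFacts.

Section AllWords.
Context {R : realType} (P : seq bool -> R).
Hypothesis sP : source P.

Definition all_words r n := words (fun=> bitwords r) (nseq n tt).

Lemma mem_all_words r n w : (w \in all_words r n) = (size w == n) && all (fun a => size a == r) w.
Proof.
elim: n w => [|n IH] [|a w] //=; first by apply/negP => /size_in_words.
rewrite [all_words _ _]/(words (fun=> bitwords r) (tt :: nseq n tt)).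
rewrite (in_words_cons _ tt) mem_bitwords.
by rewrite -/(all_words r n) IH eqSS andbCA.
Qed.

Lemma all_words_uniq r n : uniq (all_words r n).
Proof. by apply: words_uniq => _; exact: bitwords_uniq. Qed.

Lemma window_all_words r x u n : window r x u n \in all_words r n.
Proof.
rewrite mem_all_words size_window eqxx /=; apply/allP => a /mapP[k _ ->].
by rewrite size_mkseq.
Qed.

Lemma window_extend_all_words r u n w : w \in all_words r n -> window r (extend u w) u n = w.
Proof. by rewrite mem_all_words => /andP[/eqP hs ha]; exact: window_extend. Qed.

Lemma sum_all_words r n (F : seq (seq bool) -> R) :
  \sum_(w <- all_words r n) letter_wt P n w * F w =
  \sum_(w <- letter_words P r n) letter_wt P n w * F w.
Proof.
rewrite /all_words /letter_words; elim: n F => [|n IH] F; first by rewrite /= !big_seq1.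
rewrite !big_words_cons.
transitivity (\sum_(a <- bitwords r) P a *
    \sum_(w <- words (fun=> letters P r) (nseq n tt)) letter_wt P n w * F (a :: w)).
  apply: eq_bigr => a _; rewrite -IH mulr_sumr; apply: eq_bigr => w _.
  by rewrite /letter_wt /= mulrA.
rewrite -(sum_letters sP); apply: eq_bigr => a _; rewrite mulr_sumr; apply: eq_bigr => w _.
by rewrite /letter_wt /= mulrA.
Qed.

Lemma sum_all_words1 r n : \sum_(w <- all_words r n) letter_wt P n w = 1.
Proof.
have := sum_all_words r n (fun=> 1); under eq_bigr do rewrite mulr1; move=> ->.
by under eq_bigr do rewrite mulr1; exact: sum_letter_wt.
Qed.

Lemma win_pr_eq_word r B w : (r <= B)%N -> w \in all_words r (r + r) ->
  win_pr P B (fun x => window r x (- r%:Z) (r + r) = w) = letter_wt P (r + r) w.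
Proof.
move=> hr hw; transitivity (win_pr P B (fun x => pred1 w (window r x (- r%:Z) (r + r)))).
  by apply: eq_win_pr => // x _; split=> /= /eqP.
rewrite win_pr_window//; [|by lia|by lia].
rewrite /word_exp -sum_all_words -[RHS](sum_pred1_seq _ (all_words_uniq r (r + r)) hw).
by apply: eq_bigr => v _; rewrite mulrC.
Qed.

Context {d : measure_display} {T : measurableType d} (mu : probability T R) (X : T -> bitarray).
Hypothesis mX : measurable_bits X.

Definition has_law := forall B w, w \in all_words B (B + B) ->
  mu [set t | window B (X t) (- B%:Z) (B + B) = w] = (letter_wt P (B + B) w)%:E.

Lemma probability_window_event B (S : bitarray -> Prop) : has_law ->
  (forall x x', window B x (- B%:Z) (B + B) = window B x' (- B%:Z) (B + B) -> S x -> S x') ->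
  mu [set t | S (X t)] = (win_pr P B S)%:E.
Proof.
move=> law S_det; pose f t := window B (X t) (- B%:Z) (B + B).
pose ws := [seq w <- all_words B (B + B) | `[< S (extend (- B%:Z) w) >]].
have ext w := @window_extend_all_words B (- B%:Z) (B + B) w.
have -> : [set t | S (X t)] = [set t | f t \in ws].
  apply/seteqP; split=> t /=; rewrite mem_filter window_all_words andbT; last first.
    by move=> /asboolP; apply: S_det; rewrite ext ?window_all_words.
  by move=> hS; apply/asboolP; apply: S_det hS; rewrite ext ?window_all_words.
rewrite probability_in_seq ?filter_uniq ?all_words_uniq//; last first.
  by move=> w; exact: borel_window.
rewrite /win_pr /win_exp /word_exp -sum_all_words /ws big_filter -sumEFin big_mkcond.
apply: eq_big_seq => w hw /=; case: ifP => h; last by rewrite mulr0.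
by rewrite mulr1 law.
Qed.

(* Both sides are probabilities, so one inequality suffices. *)
Lemma has_law_of_ge : (forall B w, w \in all_words B (B + B) ->
    ((letter_wt P (B + B) w)%:E <= mu [set t | window B (X t) (- B%:Z) (B + B) = w])%E) ->
  has_law.
Proof.
move=> wt_le B w hw; set f := fun t => window B (X t) (- B%:Z) (B + B).
have mf v : measurable [set t | f t = v] by exact: borel_window.
pose q v := fine (mu [set t | f t = v]).
have qE v : mu [set t | f t = v] = (q v)%:E by rewrite fineK ?fin_num_measure.
have sum_q : \sum_(v <- all_words B (B + B)) q v = 1.
  have : mu [set t | f t \in all_words B (B + B)] = 1%E.
    rewrite (_ : [set t | _] = setT) ?probability_setT//; apply/seteqP; split=> t //= _.
    exact: window_all_words.
  rewrite probability_in_seq ?all_words_uniq//; under eq_bigr do rewrite qE.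
  by rewrite sumEFin => -[].
rewrite -/(f _) qE; congr (_%:E); apply/eqP; rewrite -subr_eq0.
have : \sum_(v <- all_words B (B + B)) (q v - letter_wt P (B + B) v) == 0.
  by rewrite sumrB sum_q sum_all_words1 subrr.
rewrite big_seq psumr_eq0 => [/allP/(_ w hw)|v hv]; first by rewrite hw.
by rewrite subr_ge0 -lee_fin -qE; exact: wt_le.
Qed.

End AllWords.

(** * Isomorphism of sources with a common marker *)

Definition local_on (D : bitarray -> Prop) (F : bitarray -> bitarray) := forall x, D x ->
  forall i r, exists n, forall x', D x' -> agree_upto n x x' -> F x' i r = F x i r.

(* A shift-equivariant map, continuous on an invariant set of full measure, which carries the law
   of the i.i.d. process with letter law [P] to that with letter law [Q]. *)
Record coding (R : realType) (P Q : seq bool -> R) (F : bitarray -> bitarray)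
    (D : bitarray -> Prop) : Prop := Coding {
  coding_shift : forall x, F (bshift x) = bshift (F x);
  coding_borel : forall i r, borel_pred (fun x => F x i r);
  coding_domain_borel : borel_pred D;
  coding_domain_shift : forall x, D (bshift x) <-> D x;
  coding_local : local_on D F;
  coding_full : forall (d : measure_display) (T : measurableType d) (mu : probability T R)
    (X : T -> bitarray), measurable_bits X -> has_law P mu X -> mu [set t | D (X t)] = 1%E;
  coding_law : forall (d : measure_display) (T : measurableType d) (mu : probability T R)
    (X : T -> bitarray), measurable_bits X -> has_law P mu X -> has_law Q mu (fun t => F (X t)) }.

Definition process_iso (R : realType) (P Q : seq bool -> R) : Prop := exists F G D E,
  [/\ coding P Q F D, coding Q P G E, forall x, D x -> E (F x) /\ G (F x) = x &
      forall x, E x -> D (G x) /\ F (G x) = x].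

Lemma process_iso_sym (R : realType) (P Q : seq bool -> R) : process_iso P Q -> process_iso Q P.
Proof. by move=> [F [G [D [E [? ? ? ?]]]]]; exists G, F, E, D. Qed.

Section CommonMarker.
Context {R : realType} {K : nat} (M : bool -> marker R K) (st : nat -> stage R).
Hypothesis st_lev : leveled M st.
Hypothesis growth : label_growth st.
Hypothesis adv : forall j, advances M (odd j.+1) j (st j) (st j.+1).
Hypothesis same_marks : forall b b', mark_prob (M b) = mark_prob (M b').
Local Notation T := (seq (seq bool)).
Local Notation L := (GenTree.tree (seq T)).
Local Notation tw := (gap_tower st_lev).
Local Notation P b := (mlaw (M b)).
Variable g : nat -> seq nat -> L -> L -> R.
Hypothesis g_ref : refining tw st g.
Local Notation decode := (decode st_lev g).
Local Notation decodes := (decodes st_lev g).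
Local Notation decodable := (decodable st_lev g).
Implicit Types (b : bool) (x y : bitarray) (u : int).

Lemma typical_of_average b j B de x u s : b = odd j -> in_support (P b) B x ->
  (level (st j) b <= B)%N -> - B%:Z <= u -> u + (sumn s)%:Z <= B%:Z -> stage_block M st b j x u s ->
  info_lo (st j) + de <= info_rate (M b) (level (st j) b) ->
  info_rate (M b) (level (st j) b) + de <= info_hi (st j) ->
  window_average_near (P b) (level (st j) b) (level (st j) b + K)
    (gap_info (M b) (level (st j) b)) de x u (sumn s) ->
  typical tw st b j s (block_filler M st b j x u s).
Proof.
move=> bj hx hB hu hs hb lo hi avg; have hp : gap_path (mark (M b) x) u s by case/and3P: hb.
have reg_x := in_support_filler st_lev hx hB hu hs hp.
rewrite /typical bj eqxx -bj (filler_wt_info reg_x hp) !ler_expR !lerN2 andTb.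
apply/andP; split; first by case/and3P: hb => _ _ /block_shape_sumn /ltnW.
move: avg; rewrite /window_average_near ler_norml => /andP[low high].
have n0 : 0 <= (sumn s)%:R :> R by [].
move: (ler_wpM2r n0 lo) (ler_wpM2r n0 hi) low high; rewrite !mulrDl /info_rate.
set rate := word_exp _ _ _ _ * _; set sum := window_sum _ _ _ _ _ _.
by move=> lo' hi' low high; apply/andP; split; lra.
Qed.

(* Near the marks around a point all gaps are short, hence read to full depth. *)
Lemma depth_at_marks b j B x u s v1 v2 i : in_support (P b) B x -> (level (st j) b <= B)%N ->
  - B%:Z <= u -> u + (sumn s)%:Z <= B%:Z -> gap_path (mark (M b) x) u s ->
  u <= i < u + (sumn s)%:Z -> mark (M b) x v1 -> mark (M b) x v2 -> v1 <= i < v2 ->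
  v2 - v1 <= (level (st j) b)%:Z ->
  depth_at (gap_depth M st b j) s `|i - u|%N = level (st j) b.
Proof.
move=> hx hB hu hs hp hi m1 m2 hv hl; have [depth_le _ _] := st_lev.
have [u' [k [a1 a2 a3 a4 ->]]] := depth_at_gap (gap_depth M st b j) hp hi m1 m2 hv.
have hw : window (level (st j) b) x u' k \in letter_words (P b) (level (st j) b) k.
  by apply: (in_support_window (mlaw_source _) hx hB); lia.
move: a4; rewrite (gap_path_cons _ _ _ _ (depth_le b j)) => /andP[hg _].
rewrite /gap_depth /named (gap_word_prob_gt0 (depth_le b j) hw hg) andbT.
by case: ifP => // h; exfalso; move: h; lia.
Qed.

Lemma active_advance j b : b = odd j.+1 ->
  exists de, [/\ info_lo (st j.+1) + de <= info_rate (M b) (level (st j.+1) b),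
    info_rate (M b) (level (st j.+1) b) + de <= info_hi (st j.+1) &
    forall B, (radius (st j.+1) <= B)%N -> win_pr (P b) B (fun x =>
      ~ has_informed_block (M b) (level (st j.+1) b) de (gap_bound (st j.+1))
        (radius (st j.+1)) j.+1 x) <= tolerance j.+1].
Proof. by move=> ->; exact: advances_active (adv j). Qed.

Lemma passive_advance j b : b = ~~ odd j.+1 -> forall B, (radius (st j.+1) <= B)%N ->
  win_pr (P b) B (fun x => ~ has_block (M b) (gap_bound (st j.+1)) (radius (st j.+1)) j.+1 x)
    <= tolerance j.+1.
Proof. by move=> ->; exact: advances_passive_block (adv j). Qed.

Section StageLaw.
Variables (j : nat) (b : bool) (n r : nat) (target : int -> nat -> bool) (B : nat).
Hypothesis b_active : b = odd j.+2.
Hypothesis n_le : (n <= j.+1)%N.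
Hypothesis r_le : (r <= j.+1)%N.
Local Notation J := j.+2.
Hypothesis radiusJ_le : (radius (st J) <= B)%N.
Hypothesis radius_le : (radius (st j.+1) <= B)%N.
Hypothesis level_le : forall b, (level (st J) b <= B)%N.

Let passive_active : ~~ b = odd j.+1.
Proof. by rewrite b_active /= negbK. Qed.

Let level_le' b' : (level (st j.+1) b' <= B)%N.
Proof. by have [_ level_mono _] := st_lev; exact: leq_trans (level_mono _ _) (level_le b'). Qed.

Lemma win_pr_not_typical_active_le :
  win_pr (P b) B (fun x => ~ typical_active st_lev j b (radius (st J)) x) <= tolerance J.
Proof.
have [de [lo hi informed]] := active_advance b_active.
apply: le_trans (informed B radiusJ_le).
apply: le_win_pr => [|x hx not_typ]; first exact: mlaw_source.
move=> [[u [s [hb hs avg]]] _]; apply: not_typ; exists u, s; split=> //; first exact: spans_le hs.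
have /and4P[h1 h2 _ _] := hs.
by apply: (typical_of_average b_active hx (level_le b) _ _ hb lo hi avg); lia.
Qed.

Lemma informed_block_exposes de y : in_support (P (~~ b)) B y ->
  info_lo (st j.+1) + de <= info_rate (M (~~ b)) (level (st j.+1) (~~ b)) ->
  info_rate (M (~~ b)) (level (st j.+1) (~~ b)) + de <= info_hi (st j.+1) ->
  has_informed_block (M (~~ b)) (level (st j.+1) (~~ b)) de (gap_bound (st j.+1))
    (radius (st j.+1)) j.+1 y ->
  exists v t, [/\ stage_block M st (~~ b) j.+1 y v t, exposes M st n r b j.+1 v t &
    typical tw st (~~ b) j.+1 t (block_filler M st (~~ b) j.+1 y v t)].
Proof.
move=> hy lo hi [[v [t [hb hs avg]]] [v1 [v2 [m1 m2 c1 c2 c3]]]].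
have [h1 h2 h3 h4] := and4P hs; have hl := level_le' (~~ b).
have hv : - B%:Z <= v by move: h1 radius_le; clear; lia.
have ht : v + (sumn t)%:Z <= B%:Z by move: h2 radius_le; clear; lia.
exists v, t; split=> //; last exact: (typical_of_average passive_active hy hl hv ht hb lo hi avg).
have inside i : - n%:Z <= i < n%:Z -> (v <= i < v + (sumn t)%:Z) && (v1 <= i < v2).
  by move: n_le h3 h4 c1 c2; clear; lia.
split; [by move: n_le h3; clear; lia|by move: n_le h4; clear; lia|].
move=> i /inside/andP[hit him].
rewrite (depth_at_marks hy hl hv ht (proj1 (andP hb)) hit m1 m2 him c3).
by apply: leq_trans r_le _; rewrite passive_active; exact: advances_level_gt (adv j).
Qed.

Lemma win_pr_not_typical_passive_le :
  win_pr (P (~~ b)) B (fun y => ~ typical_passive st_lev j n r b (radius (st J)) y) <=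
  tolerance J + tolerance j.+1.
Proof.
have [de [lo hi informed]] := active_advance passive_active.
have has_blocks := @passive_advance j.+1 (~~ b) ltac:(by rewrite b_active) B radiusJ_le.
apply: le_trans (lerD has_blocks (informed B radius_le)).
apply: le_trans (win_prU (mlaw_source _) _ _ _).
apply: le_win_pr => [|y hy not_typ]; first exact: mlaw_source.
apply: contrapT => hn; apply: not_typ; split.
  have [u [s [hb hs]]] : has_block (M (~~ b)) (gap_bound (st J)) (radius (st J)) J y.
    by apply: contrapT => h; apply: hn; left.
  by exists u, s; split=> //; exact: spans_le hs.
apply: (informed_block_exposes hy lo hi).
by apply: contrapT => h; apply: hn; right.
Qed.

Lemma win_pr_cylinder_tolerance : win_pr (P (~~ b)) B (in_cylinder n r target) <=
  win_pr (P b) B (forces_cylinder st_lev g j n r target b (radius (st J))) + 4 * tolerance j.+1.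
Proof.
have tol_le : (tolerance J : R) <= tolerance j.+1 by rewrite /tolerance lef_pV2 ?posrE// ler_nat.
have := win_pr_cylinder_le g_ref growth same_marks target b_active radiusJ_le (level_le b)
  (level_le (~~ b)) win_pr_not_typical_active_le win_pr_not_typical_passive_le
  (advances_info_lo (adv j.+1)) (advances_confused (adv j.+1)).
by move/le_trans; apply; rewrite lerD2l; lra.
Qed.

End StageLaw.

Lemma borel_decodes b j i r be : borel_pred (fun x => decodes b j x i r be).
Proof. by apply: borel_finitary => x; exact: decodes_local. Qed.

Lemma borel_decode b i r : borel_pred (fun x => decode b x i r).
Proof.
apply: borel_finitary => x /asboolP[j /decodes_local[n hn]]; exists n => x' /hn h.
by apply/asboolP; exists j.
Qed.

Lemma measurable_decode b d (Om : measurableType d) (X : Om -> bitarray) :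
  measurable_bits X -> measurable_bits (fun t => decode b (X t)).
Proof. by move=> mX i r; exact: borel_decode mX. Qed.

Definition decodable_from b n x :=
  exists j, (n <= j)%N /\ decodable_at st_lev g b n j x.

Lemma borel_decodable_from b n : borel_pred (decodable_from b n).
Proof.
move=> d Om X mX; apply: (@measurable_exists _ _ nat) => j.
apply: measurable_conj; first exact: measurable_prop.
apply: (@measurable_forall _ _ int) => i; apply: (@measurable_forall _ _ nat) => r.
apply: measurable_imply; apply: measurable_imply; apply: (@measurable_exists _ _ bool) => be.
exact: borel_decodes mX.
Qed.

Lemma borel_decodable b : borel_pred (decodable b).
Proof.
by move=> d Om X mX; apply: (@measurable_forall _ _ nat) => n; exact: borel_decodable_from mX.
Qed.

Lemma exists_small_tolerance b m (c e : R) : 0 < e ->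
  exists j, [/\ (m <= j)%N, b = odd j.+2 & c * tolerance j.+1 <= e].
Proof.
move=> e0; exists (b + (m + Num.bound `|c / e|).*2)%N; split.
- by rewrite -addnn; lia.
- by rewrite /= negbK oddD odd_double addbF; case: b.
rewrite /tolerance ler_pdivrMr// -ler_pdivrMl// [e^-1 * c]mulrC.
have := archi_boundP (normr_ge0 (c / e)); move: (Num.bound _) => k hk.
apply: le_trans (ler_norm _) (le_trans (ltW hk) _).
by rewrite ler_nat -addnn; case: b; lia.
Qed.

Section RandomElement.
Context {d : measure_display} {Om : measurableType d} (mu : probability Om R) (X : Om -> bitarray).
Hypothesis mX : measurable_bits X.
Variable b : bool.
Hypothesis X_law : has_law (P b) mu X.

Definition forces_word j B w :=
  forces_cylinder st_lev g j B B (extend (- B%:Z) w) b (radius (st j.+2)).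

Lemma forces_word_decodes j B w x i r : forces_word j B w x -> - B%:Z <= i < B%:Z -> (r < B)%N ->
  decodes b j.+2 x i r (extend (- B%:Z) w i r).
Proof. exact: forces_cylinder_decodes. Qed.

Lemma forces_word_window j B w x : w \in all_words B (B + B) -> forces_word j B w x ->
  window B (decode b x) (- B%:Z) (B + B) = w.
Proof.
move=> hw hf; rewrite -[RHS](window_extend_all_words (- B%:Z) hw); apply: eq_window => k hk.
apply: eq_in_mkseq => r hr; apply: (decodesE g_ref); apply: forces_word_decodes hf _ hr.
by lia.
Qed.

Lemma measurable_forces_word j B w : measurable [set t | forces_word j B w (X t)].
Proof.
pose C := (radius (st j.+2) + level (st j.+2) b)%N.
pose at_C x := window C x (- C%:Z) (C + C).
have det x x' : at_C x = at_C x' -> forces_word j B w x -> forces_word j B w x'.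
  by apply: forces_cylinder_window; [exact: leq_addr|exact: leq_addl].
rewrite (_ : [set t | _] = [set t | exists v : seq (seq bool),
    (exists x, at_C x = v /\ forces_word j B w x) /\ at_C (X t) = v]).
  apply: measurable_exists => v; apply: measurable_conj; first exact: measurable_prop.
  exact: borel_window.
apply/seteqP; split=> t /=; first by move=> h; exists (at_C (X t)); split=> //; exists (X t).
by move=> [v [[x [<- hx]] /esym e]]; exact: det hx.
Qed.

Lemma forces_word_prob_ge j B w : b = odd j.+2 -> (B <= j.+1)%N -> w \in all_words B (B + B) ->
  ((letter_wt (P (~~ b)) (B + B) w - 4 * tolerance j.+1)%:E <=
    mu [set t | forces_word j B w (X t)])%E.
Proof.
move=> b_active hB hw.
have [C [C1 C2 C3 C4]] : exists C, [/\ (radius (st j.+2) <= C)%N, (radius (st j.+1) <= C)%N,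
    forall b, (level (st j.+2) b <= C)%N & (B <= C)%N].
  exists (radius (st j.+2) + radius (st j.+1) + level (st j.+2) true + level (st j.+2) false + B)%N.
  by split; [lia|lia|case; lia|lia].
rewrite (probability_window_event (mlaw_source _) mX (B := C) X_law); last first.
  by move=> x x'; apply: forces_cylinder_window.
rewrite lee_fin lerBlDr.
apply: le_trans (win_pr_cylinder_tolerance (extend (- B%:Z) w) b_active hB hB C1 C2 C3).
rewrite -(win_pr_eq_word (mlaw_source _) C4 hw); apply: le_win_pr => [|y _ e i k hi hk].
  exact: mlaw_source.
rewrite /extend -e nth_window; last by lia.
by rewrite nth_mkseq//; congr (y _ k); lia.
Qed.

Lemma decode_law : has_law (P (~~ b)) mu (fun t => decode b (X t)).
Proof.
apply: (has_law_of_ge (mlaw_source _) (measurable_decode b mX)) => B w hw.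
have mw : measurable [set t | window B (decode b (X t)) (- B%:Z) (B + B) = w].
  exact: borel_window (measurable_decode b mX).
apply/lee_addgt0Pr => e e0; rewrite -leeBlDr// -EFinB.
have [j [hj b_active small]] := exists_small_tolerance b B 4 e0.
apply: (@le_trans _ _ (mu [set t | forces_word j B w (X t)])); last first.
  apply: le_measure; rewrite ?inE//; first exact: measurable_forces_word.
  by move=> t; exact: forces_word_window.
apply: le_trans (forces_word_prob_ge b_active (leqW hj) hw).
by rewrite lee_fin lerD2l lerN2.
Qed.

Lemma decodable_from_prob_ge n e : 0 < e ->
  ((1 - e)%:E <= mu [set t | decodable_from b n (X t)])%E.
Proof.
move=> e0; pose ws := all_words n.+1 (n.+1 + n.+1).
have [j [hj b_active small]] := exists_small_tolerance b n (4 * (size ws)%:R) e0.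
pose A w t := w \in ws /\ forces_word j n.+1 w (X t).
have mA w : measurable [set t | A w t].
  by apply: measurable_conj; [exact: measurable_prop|exact: measurable_forces_word].
have [|mE muE] := probability_disjoint_exists mu (all_words_uniq n.+1 (n.+1 + n.+1)) mA.
  by move=> w w' t [h1 /(forces_word_window h1) <-] [h2 /(forces_word_window h2) <-].
apply: (@le_trans _ _ (mu [set t | exists2 w, w \in ws & A w t])); last first.
  apply: le_measure; rewrite ?inE//; first exact: borel_decodable_from mX.
  move=> t /= [w hw [_ hf]]; exists j.+2; split; first by lia.
  move=> i r hi hr; exists (extend (- n.+1%:Z) w i r).
  by apply: (forces_word_decodes hf); lia.
rewrite muE.
apply: (@le_trans _ _ (\sum_(w <- ws)
    (letter_wt (P (~~ b)) (n.+1 + n.+1) w - 4 * tolerance j.+1)%:E)%E).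
  rewrite sumEFin lee_fin sumrB sum_all_words1 ?lerD2l ?lerN2; last exact: mlaw_source.
  by rewrite big_const_seq count_predT iter_addr_0 -[_ *+ size ws]mulr_natr mulrAC.
rewrite big_seq [leRHS]big_seq; apply: lee_sum => w hw.
rewrite (_ : [set t | A w t] = [set t | forces_word j n.+1 w (X t)]).
  exact: forces_word_prob_ge.
by apply/seteqP; split=> t /=; [case|].
Qed.

Lemma decodable_full : mu [set t | decodable b (X t)] = 1%E.
Proof.
apply: probability_forall1 => n; first exact: borel_decodable_from mX.
apply: le_anti; apply/andP; split.
  by apply: probability_le1; exact: borel_decodable_from mX.
apply/lee_addgt0Pr => e e0; rewrite -leeBlDr// -EFinB.
exact: decodable_from_prob_ge.
Qed.

End RandomElement.

Lemma process_iso_stages : process_iso (P true) (P false).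
Proof.
pose D b x := decodable b x /\ decodable (~~ b) (decode b x).
have D_inv b x : D b x -> D (~~ b) (decode b x) /\ decode (~~ b) (decode b x) = x.
  by move=> [h1 h2]; have e := decodeK g_ref h1 h2; rewrite /D e negbK.
have code b : coding (P b) (P (~~ b)) (decode b) (D b).
  have mD (d : measure_display) (Om : measurableType d) (X : Om -> bitarray) : measurable_bits X ->
      measurable [set t | decodable (~~ b) (decode b (X t))].
    by move=> mX; exact: (@borel_decodable (~~ b) _ _ _ (measurable_decode b mX)).
  split.
  - exact: decode_bshift.
  - exact: borel_decode.
  - by move=> d Om X mX; apply: measurable_conj; [exact: borel_decodable|exact: mD].
  - by move=> x; rewrite /D decode_bshift !decodable_bshift.
  - move=> x [h _] i r; have [n hn] := decode_local g_ref (decodable_decodes i r h).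
    by exists n => x' _; exact: hn.
  - move=> d Om mu X mX law; apply: probability_and1; [exact: borel_decodable|exact: mD| |].
      exact: decodable_full mX b law.
    exact: decodable_full (measurable_decode b mX) (~~ b) (decode_law mX law).
  - by move=> d Om mu X mX; exact: decode_law.
exists (decode true), (decode false), (D true), (D false).
by split; [exact: code|exact: (code false)|exact: D_inv|exact: (D_inv false)].
Qed.

End CommonMarker.

Definition entropy_le (R : realType) (P Q : seq bool -> R) :=
  forall r e, 0 < e -> exists r', letter_entropy P r - e <= letter_entropy Q r'.

Lemma entropy_le_refl (R : realType) (P : seq bool -> R) : entropy_le P P.
Proof. by move=> r e e0; exists r; rewrite gerBl ltW. Qed.

Lemma process_iso_common_marker (R : realType) (K : nat) (M : bool -> marker R K) :
  mark_prob (M true) = mark_prob (M false) -> 0 < mark_prob (M true) ->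
  (forall b n, 0 < markfree_prob (M b) n) ->
  (forall b b', entropy_le (mlaw (M b)) (mlaw (M b'))) ->
  (forall b m, exists n r, [/\ (m < n)%N, (mdepth (M b) <= r)%N & 0 < gap_entropy (M b) r n]) ->
  process_iso (mlaw (M true)) (mlaw (M false)).
Proof.
move=> same_mark mark_gt0 free_gt0 entropies gaps.
have same b b' : mark_prob (M b) = mark_prob (M b') by case: b b' => [] [].
have mark_prob_gt0 b : 0 < mark_prob (M b) by rewrite (same b true).
have [|st [rate0 depth_le adv]] := exists_schedule mark_prob_gt0 free_gt0.
  by move=> b b' rho; exact: info_rate_interleave (same b b') _ (entropies b b') (gaps b).
have st_lev := advances_leveled depth_le adv.
have [g g_ref] := exists_refining (gap_tower st_lev) st.
exact: process_iso_stages (advances_label_growth rate0 adv) adv same g g_ref.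
Qed.

(** * Composition of codings and degenerate sources *)

Lemma local_on_agree D F x n : local_on D F -> D x ->
  exists m, forall x', D x' -> agree_upto m x x' -> agree_upto n (F x) (F x').
Proof.
move=> loc hx.
have bit_local (q : int * nat) : exists m, forall x', D x' -> agree_upto m x x' ->
  F x' q.1 q.2 = F x q.1 q.2 by exact: loc.
have [f hf] := choice bit_local.
exists (\sum_(k < (n + n).+1) \sum_(r < n) f ((k%:Z - n%:Z)%R, r : nat))%N => x' hx' ha i r hi hr.
apply: (hf (i, r)) => //; apply: agree_upto_le ha.
have hk : (`|(i + n%:Z)%R| < (n + n).+1)%N by lia.
rewrite (bigD1 (Ordinal hk))//= (bigD1 (Ordinal hr))//=.
have -> : `|(i + n%:Z)%R|%N%:Z - n%:Z = i by lia.
by rewrite -addnA leq_addr.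
Qed.

Lemma borel_pred_comp (S : bitarray -> Prop) (F : bitarray -> bitarray) : borel_pred S ->
  (forall i r, borel_pred (fun x => F x i r)) -> borel_pred (fun x => S (F x)).
Proof. by move=> hS hF d T X mX; apply: (hS d T (fun t => F (X t))) => i r; exact: hF. Qed.

Lemma coding_comp (R : realType) (P Q S : seq bool -> R) F D F' D' :
  coding P Q F D -> coding Q S F' D' ->
  coding P S (fun x => F' (F x)) (fun x => D x /\ D' (F x)).
Proof.
move=> [shF mF mD shD locF fullD lawF] [shF' mF' mD' shD' locF' fullD' lawF'].
have mX_F d (T : measurableType d) (X : T -> bitarray) : measurable_bits X ->
  measurable_bits (fun t => F (X t)) by move=> mX i r; exact: mF.
split.
- by move=> x; rewrite shF shF'.
- by move=> i r; exact: (borel_pred_comp (mF' i r) mF).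
- by move=> d T X mX; apply: measurable_conj; [exact: mD|exact: (borel_pred_comp mD' mF)].
- by move=> x; rewrite shD shF shD'.
- move=> x [h1 h2] i r; have [n hn] := locF' _ h2 i r.
  have [m hm] := local_on_agree n locF h1; exists m => x' [h1' h2'] ha.
  by apply: hn => //; exact: hm.
- move=> d T mu X mX law; apply: probability_and1; [exact: mD|exact: mD' (mX_F _ _ _ mX)| |].
    exact: fullD mX law.
  by apply: fullD' (lawF _ _ _ _ mX law); exact: mX_F.
- by move=> d T mu X mX law; apply: lawF' (lawF _ _ _ _ mX law); exact: mX_F.
Qed.

Lemma process_iso_trans (R : realType) (P Q S : seq bool -> R) :
  process_iso P Q -> process_iso Q S -> process_iso P S.
Proof.
move=> [F [G [D [E [codF codG DE ED]]]]] [F' [G' [D' [E' [codF' codG' DE' ED']]]]].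
exists (fun x => F' (F x)), (fun x => G (G' x)), (fun x => D x /\ D' (F x)),
  (fun x => E' x /\ E (G' x)).
split; [exact: coding_comp codF codF'|exact: coding_comp codG' codG| |].
  move=> x [h1 h2]; have [e1 e2] := DE x h1; have [e3 e4] := DE' _ h2.
  by rewrite e4 e2.
move=> x [h1 h2]; have [e1 e2] := ED' x h1; have [e3 e4] := ED _ h2.
by rewrite e4 e2.
Qed.

Section Degenerate.
Context {R : realType}.
Implicit Types (P : seq bool -> R) (be : nat -> bool).

Definition degenerate P be := forall r, P (mkseq be r) = 1.

Lemma letter_wt_degenerate P be r x u n : degenerate P be -> (forall i, x i = be) ->
  letter_wt P n (window r x u n) = 1.
Proof.
move=> deg hx; rewrite letter_wt_prod ?size_window// big1_seq// => i; rewrite mem_iota => hi.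
by rewrite nth_window ?hx//; lia.
Qed.

Lemma letter_wt_degenerate0 P be B w : source P -> degenerate P be -> w \in all_words B (B + B) ->
  w != window B (fun=> be) (- B%:Z) (B + B) -> letter_wt P (B + B) w = 0.
Proof.
move=> sP deg hw neq; apply/eqP; rewrite eq_le (letter_wt_ge0 sP) andbT leNgt; apply/negP => w_gt0.
have : letter_wt P (B + B) (window B (fun=> be) (- B%:Z) (B + B)) < 1.
  rewrite -(sum_all_words1 sP B (B + B)); apply: (ltr_sum_mem (y := w)) => //.
  - exact: all_words_uniq.
  - exact: window_all_words.
  - by rewrite eq_sym.
  - by move=> v _; exact: letter_wt_ge0.
by rewrite (letter_wt_degenerate _ _ _ deg)// ltxx.
Qed.

Lemma has_law_degenerate P be d (T : measurableType d) (mu : probability T R) (X : T -> bitarray) :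
  source P -> degenerate P be -> (forall t i, X t i = be) -> has_law P mu X.
Proof.
move=> sP deg hX B w hw; have winE t : window B (X t) (- B%:Z) (B + B) =
  window B (fun=> be) (- B%:Z) (B + B) by apply: eq_window => k _; rewrite hX.
have [->|neq] := eqVneq w (window B (fun=> be) (- B%:Z) (B + B)).
  rewrite (letter_wt_degenerate _ _ _ deg)// (_ : [set t | _] = setT) ?probability_setT//.
  by apply/seteqP; split=> // t _; exact: winE.
rewrite (letter_wt_degenerate0 sP deg hw neq) (_ : [set t | _] = set0) ?measure0//.
by apply/seteqP; split=> t //=; rewrite winE => e; rewrite e eqxx in neq.
Qed.

Lemma coding_degenerate P Q be be' : source P -> source Q -> degenerate P be -> degenerate Q be' ->
  coding P Q (fun _ _ => be') (fun x => x = fun=> be).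
Proof.
move=> sP sQ degP degQ; have atE x : (x = fun=> be) <-> (forall B,
    window B x (- B%:Z) (B + B) = window B (fun=> be) (- B%:Z) (B + B)).
  split=> [-> //|h]; apply/funext => i; apply/funext => r; pose B := (`|i| + r).+1.
  have hi : - B%:Z <= i < B%:Z by rewrite /B; lia.
  by apply: mkseq_eq_nth (eq_window_letter (h B) hi) _; rewrite /B; lia.
split=> //.
- by move=> i r d T X mX; exact: measurable_prop.
- move=> d T X mX; rewrite (_ : [set t | _] = [set t | forall B,
      window B (X t) (- B%:Z) (B + B) = window B (fun=> be) (- B%:Z) (B + B)]).
    by apply: (@measurable_forall _ _ nat) => B; exact: borel_window mX.
  by apply/seteqP; split=> t /atE.
- move=> x; split=> [h|-> //]; apply/funext => i.
  by rewrite -[x i]/(x i) -(subrK 1 i) -/(bshift x (i - 1)) h.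
- by move=> x _ i r; exists 0%N.
- move=> d T mu X mX law; rewrite (_ : [set t | _] = [set t | forall B,
      window B (X t) (- B%:Z) (B + B) = window B (fun=> be) (- B%:Z) (B + B)]).
    apply: probability_forall1 => B; first exact: borel_window mX.
    by rewrite law ?window_all_words// (letter_wt_degenerate _ _ _ degP).
  by apply/seteqP; split=> t /atE.
- by move=> d T mu X mX _; exact: has_law_degenerate.
Qed.

Lemma process_iso_degenerate P Q be be' : source P -> source Q -> degenerate P be ->
  degenerate Q be' -> process_iso P Q.
Proof.
move=> sP sQ degP degQ; exists (fun _ _ => be'), (fun _ _ => be), (fun x => x = fun=> be),
  (fun x => x = fun=> be').
by split; [exact: coding_degenerate|exact: coding_degenerate|move=> x ->|move=> x ->].
Qed.

End Degenerate.

(** * Markers made of letters *)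

Definition letter_mass (R : realType) (P : seq bool -> R) r (V : pred (seq bool)) : R :=
  \sum_(a <- letters P r | V a) P a.

Definition splits (R : realType) (P : seq bool -> R) r (V : pred (seq bool)) : Prop :=
  (exists2 a, a \in letters P r & V a) /\ (exists2 a, a \in letters P r & ~~ V a).

(* A letter in [V] followed by [k.+1] letters outside of [V]. *)
Definition letter_mword (V : pred (seq bool)) (w : seq (seq bool)) :=
  all V (take 1 w) && all (predC V) (drop 1 w).

Section LetterMass.
Context {R : realType} (P : seq bool -> R) (r : nat).
Hypothesis sP : source P.
Implicit Types V : pred (seq bool).

Lemma letter_massE V : letter_mass P r V = \sum_(a <- bitwords r) P a * (V a)%:R.
Proof.
rewrite -(sum_letters sP) /letter_mass big_mkcond; apply: eq_bigr => a _.
by case: (V a); rewrite ?mulr1 ?mulr0.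
Qed.

Lemma letter_massC V : letter_mass P r (predC V) = 1 - letter_mass P r V.
Proof.
by rewrite -(sum_letters1 sP r) (bigID V) /= addrAC subrr add0r.
Qed.

Lemma letter_mass_gt0 V a : a \in letters P r -> V a -> 0 < letter_mass P r V.
Proof.
move=> ha Va; rewrite /letter_mass big_mkcond /=.
apply: (sumr_gt0_seq ha) => [c _|]; first by case: ifP => // _; exact: source_ge0.
by rewrite Va; move: ha; rewrite mem_letters => /andP[].
Qed.

Lemma splits_letter_mass V : splits P r V -> 0 < letter_mass P r V < 1.
Proof.
move=> [[a ha Va] [c hc Vc]]; rewrite (letter_mass_gt0 ha Va) -subr_gt0 -letter_massC.
exact: letter_mass_gt0 hc Vc.
Qed.

Lemma word_exp_all V n : word_exp P r n (fun w => (all V w)%:R) = letter_mass P r V ^+ n.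
Proof.
elim: n => [|n IH]; first by rewrite expr0 /word_exp /letter_words /= big_seq1 /letter_wt /= mulr1.
rewrite exprS -IH /word_exp /letter_words big_words_cons /letter_mass mulr_suml [RHS]big_mkcond.
apply: eq_bigr => a _; case: (boolP (V a)) => Va; last first.
  by rewrite big1// => w _; rewrite /= (negbTE Va) mulr0.
by rewrite mulr_sumr; apply: eq_bigr => w _; rewrite /= Va /letter_wt /= mulrA.
Qed.

End LetterMass.

Section LetterMarker.
Context {R : realType} (P : seq bool -> R) (r0 k : nat) (V : pred (seq bool)).
Hypothesis sP : source P.
Local Notation K := k.+2.

Lemma letter_mword_window x i : letter_mword V (window r0 x i K) =
  V (mkseq (x i) r0) && all (fun d : nat => ~~ V (mkseq (x (i + d%:Z)) r0)) (iota 1 k.+1).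
Proof.
rewrite /window (_ : iota 0 K = 0%N :: iota 1 k.+1)// map_cons /letter_mword.
by rewrite -(cat1s (mkseq _ _)) take_size_cat// drop_size_cat// all_seq1 addr0 all_map.
Qed.

Lemma letter_mword_nonoverlap x i d : (0 < d < K)%N -> letter_mword V (window r0 x i K) ->
  ~~ letter_mword V (window r0 x (i + d%:Z) K).
Proof.
rewrite !letter_mword_window => hd /andP[_ /allP free].
by rewrite negb_and free// mem_iota; lia.
Qed.

Definition letter_marker : marker R K := Marker sP (ltn0Sn k.+1) letter_mword_nonoverlap.

Lemma letter_mark_prob :
  mark_prob letter_marker = letter_mass P r0 V * (1 - letter_mass P r0 V) ^+ k.+1.
Proof.
rewrite -letter_massC// -word_exp_all -[X in X * _]expr1 -word_exp_all -word_exp_prod.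
apply: eq_word_exp => w /letter_words_size [hs ha].
by rewrite /mark_in drop0 take_oversize ?hs// map_take_id// -mulnb natrM.
Qed.

Lemma mark_in_letters n w j : w \in letter_words P r0 n -> (j + K <= n)%N ->
  mark_in letter_marker w j =
  V (nth [::] w j) && all (fun d => ~~ V (nth [::] w (j + d))) (iota 1 k.+1).
Proof.
move=> hw hj; rewrite -{1}(letter_words_extend hw) mark_in_window// [LHS]letter_mword_window.
have letterE i : (i < n)%N -> mkseq (extend 0 w (0 + i%:Z)) r0 = nth [::] w i.
  by move=> hi; rewrite -[in RHS](letter_words_extend hw) nth_window.
rewrite letterE; last by lia.
congr (_ && _); apply: eq_in_all => d; rewrite mem_iota => hd.
by rewrite -addrA -PoszD letterE//; lia.
Qed.

Hypothesis PV : splits P r0 V.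

Lemma letter_mark_prob_gt0 : 0 < mark_prob letter_marker.
Proof.
have /andP[m0 m1] := splits_letter_mass sP PV.
by rewrite letter_mark_prob mulr_gt0// exprn_gt0// subr_gt0.
Qed.

Lemma letter_markfree_prob_gt0 n : 0 < markfree_prob letter_marker n.
Proof.
have [_ [a ha Va]] := PV.
have hw : nseq n a \in letter_words P r0 n.
  by rewrite mem_letter_words size_nseq eqxx all_nseq -mem_letters ha orbT.
apply: (word_exp_gt0 sP hw) => [w _|]; first exact: ler0n.
rewrite (_ : markfree_word _ _ _) ?ltr01//; apply/allP => j; rewrite mem_iota => hj.
rewrite (mark_in_letters hw); last by lia.
by rewrite nth_nseq (_ : (j < n)%N) ?(negbTE Va)//; lia.
Qed.

(* Gaps longer than the marker have at least two fillers. *)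
Lemma letter_gap_word a a' c m : a \in letters P r0 -> V a -> a' \in letters P r0 -> ~~ V a' ->
  c \in letters P r0 -> let w := a :: nseq k.+1 a' ++ nseq m.+1 c in
  w \in letter_words P r0 (m + k + 3) /\ gap_word letter_marker (m + k + 3) w.
Proof.
move=> ha Va ha' Va' hc w.
have hw : w \in letter_words P r0 (m + k + 3).
  rewrite mem_letter_words; apply/andP; split.
    by rewrite /= size_cat /= !size_nseq; apply/eqP; lia.
  apply/allP => y; rewrite inE mem_cat !mem_nseq -mem_letters.
  by case/or3P => [/eqP->|/andP[_ /eqP->]|/andP[_ /eqP->]].
have nthS i : nth [::] w i.+1 = if (i < k.+1)%N then a' else nth [::] (nseq m.+1 c) (i - k.+1).
  rewrite -[LHS]/(nth [::] (nseq k.+1 a' ++ nseq m.+1 c) i) nth_cat size_nseq.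
  by case: ifP => // hi; rewrite nth_nseq hi.
have near i : (0 < i <= k.+1)%N -> nth [::] w i = a'.
  by case: i => // i /andP[_ hi]; rewrite nthS ifT.
have far i : (k.+1 < i < m + k + 3)%N -> nth [::] w i = c.
  case: i => // i hi; rewrite nthS nth_nseq ifF; last by lia.
  by rewrite ifT//; lia.
split=> //; rewrite /gap_word; apply/and3P; split; first by lia.
  rewrite (mark_in_letters hw); last by lia.
  by rewrite Va; apply/allP => d; rewrite mem_iota => hd; rewrite add0n near//; lia.
apply/allP => j; rewrite mem_iota => hj; rewrite (mark_in_letters hw); last by lia.
have [h|h] := leqP j k.+1; first by rewrite near ?(negbTE Va')//; lia.
rewrite [iota _ _]/= far; last by lia.
by rewrite /= far ?andbA ?andbN//; lia.
Qed.

Lemma letter_gap_entropy_gt0 m : 0 < gap_entropy letter_marker r0 (m + k + 3).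
Proof.
have [[a ha Va] [a' ha' Va']] := PV.
have [w1 g1] := letter_gap_word m ha Va ha' Va' ha.
have [w2 g2] := letter_gap_word m ha Va ha' Va' ha'.
move: w1 g1 w2 g2; set u := (X in X \in _); move=> w1 g1; set v := (X in X \in _) => w2 g2.
have uv : u != v.
  apply: contraNneq Va' => /eqP.
  by rewrite /u /v eqseq_cons eqxx eqseq_cat// eqxx eqseq_cons !andTb => /andP[/eqP <-].
apply: (word_exp_gt0 sP w1) => [w hw|].
  exact: (@gap_entropy_term_ge0 _ _ letter_marker _ _ _ (leqnn _) hw).
have wt_lt : letter_wt P (m + k + 3) u < gap_prob letter_marker (m + k + 3).
  pose F w := if gap_word letter_marker (m + k + 3) w then letter_wt P (m + k + 3) w else 0.
  have <- : F u = letter_wt P (m + k + 3) u by rewrite /F g1.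
  rewrite /gap_prob big_mkcond; apply: (ltr_sum_mem (letter_words_uniq P r0 _) w1 w2 uv).
    by move=> w _; rewrite /F; case: ifP => // _; exact: letter_wt_ge0.
  by rewrite /F g2; exact: letter_wt_gt0 w2.
have u_gt0 := letter_wt_gt0 w1; have prob_gt0 := lt_trans u_gt0 wt_lt.
by rewrite g1 mul1r oppr_gt0 ln_lt0// divr_gt0//= ltr_pdivrMr ?mul1r.
Qed.

End LetterMarker.

Lemma process_iso_letter_markers (R : realType) (P Q : seq bool -> R) rP rQ VP VQ k :
  source P -> source Q -> splits P rP VP -> splits Q rQ VQ ->
  letter_mass P rP VP * (1 - letter_mass P rP VP) ^+ k.+1 =
  letter_mass Q rQ VQ * (1 - letter_mass Q rQ VQ) ^+ k.+1 ->
  entropy_le P Q -> entropy_le Q P -> process_iso P Q.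
Proof.
move=> sP sQ PV QV same PQ QP.
pose M b := if b then letter_marker rP k VP sP else letter_marker rQ k VQ sQ.
apply: (@process_iso_common_marker R k.+2 M); rewrite /M.
- by rewrite !letter_mark_prob.
- exact: letter_mark_prob_gt0.
- by case=> n; exact: letter_markfree_prob_gt0.
- by case=> [] [] //=; exact: entropy_le_refl.
by case=> m; [exists (m + k + 3)%N, rP|exists (m + k + 3)%N, rQ]; split=> //=; try lia;
  exact: letter_gap_entropy_gt0.
Qed.

(** * Binary entropy *)

Section BinaryEntropy.
Context {R : realType}.
Implicit Types x y t c d e : R.

Definition entropy_term x : R := - (x * ln x).
Definition binary_entropy t : R := entropy_term t + entropy_term (1 - t).

Lemma entropy_term0 : entropy_term 0 = 0. Proof. by rewrite /entropy_term mul0r oppr0. Qed.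
Lemma entropy_term1 : entropy_term 1 = 0. Proof. by rewrite /entropy_term ln1 mulr0 oppr0. Qed.

Lemma entropy_termM x y : 0 <= x -> 0 <= y ->
  entropy_term (x * y) = y * entropy_term x + x * entropy_term y.
Proof.
rewrite !le_eqVlt => /predU1P[<-|hx]; first by rewrite !(entropy_term0, mul0r) mulr0 addr0.
move=> /predU1P[<-|hy]; first by rewrite !(entropy_term0, mulr0) mul0r addr0.
by rewrite /entropy_term lnM ?posrE//; ring.
Qed.

Lemma entropy_term_ge0 x : 0 <= x <= 1 -> 0 <= entropy_term x.
Proof. by move=> /andP[h0 h1]; rewrite oppr_ge0 mulr_ge0_le0// ln_le0. Qed.

Lemma entropy_term_gt0 x : 0 < x < 1 -> 0 < entropy_term x.
Proof. by move=> /andP[h0 h1]; rewrite oppr_gt0 pmulr_rlt0// ln_lt0// h0. Qed.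

Lemma binary_entropy_ge0 t : 0 <= t <= 1 -> 0 <= binary_entropy t.
Proof. by move=> h; rewrite addr_ge0// entropy_term_ge0//; move: h; lra. Qed.

Lemma binary_entropy0 : binary_entropy 0 = 0.
Proof. by rewrite /binary_entropy subr0 entropy_term0 entropy_term1 addr0. Qed.

Lemma binary_entropy_half : binary_entropy 2^-1 = ln 2.
Proof.
rewrite /binary_entropy (_ : 1 - 2^-1 = 2^-1 :> R); last by field.
by rewrite /entropy_term lnV ?posrE//; field.
Qed.

Lemma ln_le_sub1 x : 0 < x -> ln x <= x - 1.
Proof. by move=> h; rewrite -{1}(subrK 1 x) [x - 1 + 1]addrC le_ln1Dx//; lra. Qed.

Lemma neg_ln_le x : 0 < x -> - ln x <= x^-1 - 1.
Proof. by move=> x0; rewrite -lnV ?posrE//; apply: ln_le_sub1; rewrite invr_gt0. Qed.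

Lemma entropy_term_le_sqrt t : 0 < t -> entropy_term t <= 2 * Num.sqrt t.
Proof.
move=> t0; have s0 : 0 < Num.sqrt t by rewrite sqrtr_gt0.
have -> : entropy_term t = entropy_term (Num.sqrt t * Num.sqrt t).
  by rewrite -expr2 sqr_sqrtr// ltW.
move: (Num.sqrt t) s0 => s s0; rewrite entropy_termM ?ltW// /entropy_term.
have := ler_wpM2l (ltW (mulr_gt0 s0 s0)) (neg_ln_le s0); rewrite mulrBr mulfK ?gt_eqF//.
by have := mulr_gt0 s0 s0; lra.
Qed.

Lemma entropy_term_compl_le t : t < 1 -> entropy_term (1 - t) <= t.
Proof.
move=> t1; have u0 : 0 < 1 - t by lra.
have := ler_wpM2l (ltW u0) (neg_ln_le u0); rewrite mulrBr mulfV ?gt_eqF// /entropy_term.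
by lra.
Qed.

Lemma binary_entropy_le_sqrt t : 0 < t < 1 -> binary_entropy t <= 3 * Num.sqrt t.
Proof.
move=> /andP[t0 t1]; have := entropy_term_le_sqrt t0; have := entropy_term_compl_le t1.
have s0 : 0 < Num.sqrt t by rewrite sqrtr_gt0.
have e : Num.sqrt t ^+ 2 = t by rewrite sqr_sqrtr// ltW.
have s1 : Num.sqrt t <= 1 by rewrite -sqrtr1 ler_sqrt// ltW.
have : t <= Num.sqrt t by rewrite -{1}e expr2 ler_piMl// ltW.
by rewrite /binary_entropy; lra.
Qed.

Lemma binary_entropy_small e : 0 < e ->
  exists d, [/\ 0 < d, d < 2^-1 & forall t, 0 < t <= d -> binary_entropy t <= e].
Proof.
move=> e0; pose d := Num.min ((e / 3) ^+ 2) 4^-1.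
have d0 : 0 < d by rewrite lt_min; apply/andP; split; [apply: exprn_gt0; lra|lra].
have d1 : d <= 4^-1 by rewrite ge_min lexx orbT.
exists d; split=> //; first by lra.
move=> t /andP[t0 td]; apply: le_trans (binary_entropy_le_sqrt _) _; first by rewrite t0 /=; lra.
suff : Num.sqrt t <= e / 3 by lra.
rewrite -[e / 3]ger0_norm; last by lra.
rewrite -sqrtr_sqr ler_sqrt; last by rewrite exprn_ge0//; lra.
by apply: le_trans td _; rewrite ge_min lexx.
Qed.

Lemma continuous_binary_entropy t : 0 < t -> t < 1 -> {for t, continuous binary_entropy}%classic.
Proof.
move=> t0 t1; apply: continuousD.
  apply: continuousN; apply: continuousM; first exact: cvg_id.
  exact: continuous_ln.
apply: (@continuous_comp _ _ _ (fun x => 1 - x) entropy_term).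
  by apply: continuousB; [exact: cvg_cst|exact: cvg_id].
apply: continuousN; apply: continuousM; first exact: cvg_id.
by apply: continuous_ln; lra.
Qed.

Lemma binary_entropy_onto y : 0 < y <= ln 2 -> exists2 t, 0 <= t <= 1 & binary_entropy t = y.
Proof.
move=> /andP[y0 y1]; have [d [d0 d1 hd]] := binary_entropy_small y0.
have [|||t ht <-] := @IVT R binary_entropy d 2^-1 y; [by rewrite ltW| | |].
- apply: continuous_in_subspaceT => x; rewrite inE /= in_itv /= => /andP[h1 h2].
  by apply: continuous_binary_entropy; [exact: lt_le_trans h1|lra].
- by rewrite binary_entropy_half ge_min le_max y1 (hd d) ?d0 ?lexx//= orbT.
by exists t => //; move: ht; rewrite in_itv /=; lra.
Qed.

Lemma bernoulli_inequality y k : 0 <= y -> 1 + k%:R * y <= (1 + y) ^+ k.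
Proof.
move=> y0; elim: k => [|k IH]; first by rewrite mul0r addr0 expr0.
rewrite exprS; apply: le_trans (ler_wpM2l (_ : 0 <= 1 + y) IH); last by lra.
have : 0 <= k%:R * (y * y) by rewrite !mulr_ge0.
by rewrite -natr1; lra.
Qed.

Lemma pattern_prob_eventually_le c d : 0 < d -> d < c -> c < 1 ->
  exists k0, forall k, (k0 <= k)%N -> c * (1 - c) ^+ k <= d * (1 - d) ^+ k.
Proof.
move=> d0 dc c1; have u0 : 0 < 1 - c by lra.
pose q := (1 - d) / (1 - c) - 1.
have q0 : 0 < q by rewrite subr_gt0 ltr_pdivlMr// mul1r; lra.
have e : 1 - d = (1 + q) * (1 - c) by rewrite /q [1 + (_ - 1)]addrC subrK divfK ?gt_eqF.
exists (Num.bound (c / d / q)) => k hk.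
rewrite e exprMn mulrA; apply: ler_wpM2r; first by rewrite exprn_ge0 ?ltW.
rewrite -ler_pdivrMl// [d^-1 * c]mulrC.
apply: le_trans (bernoulli_inequality k (ltW q0)).
have : c / d / q <= k%:R.
  apply: ltW; apply: lt_le_trans (archi_boundP _) _; last by rewrite ler_nat.
  by rewrite !divr_ge0// ltW// (lt_trans d0).
by rewrite ler_pdivrMr//; lra.
Qed.

Lemma pattern_prob_onto c d k : 0 < c < 1 -> 0 < d < 1 ->
  c * (1 - c) ^+ k <= d * (1 - d) ^+ k ->
  exists2 t, 0 < t <= d & t * (1 - t) ^+ k = c * (1 - c) ^+ k.
Proof.
move=> /andP[c0 c1] /andP[d0 d1] h; pose f t : R := t * (1 - t) ^+ k.
have fc0 : 0 < c * (1 - c) ^+ k by rewrite mulr_gt0// exprn_gt0// subr_gt0.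
have [|||t ht e] := @IVT R f 0 d (c * (1 - c) ^+ k); [by rewrite ltW| | |].
- suff h' x : {for x, continuous f}%classic by apply: continuous_subspaceT.
  rewrite /f; apply: continuousM; first exact: cvg_id.
  elim: k {h fc0 f} => [|k IH]; first exact: cvg_cst.
  rewrite (_ : (fun t => _) = (fun t => (1 - t) * (1 - t) ^+ k)); last first.
    by apply/funext => t; rewrite exprS.
  by apply: continuousM => //; apply: continuousB; [exact: cvg_cst|exact: cvg_id].
- by rewrite /f mul0r ge_min le_max h (ltW fc0) orbT.
exists t => //; move: ht; rewrite in_itv /= => /andP[t0 ->]; rewrite andbT lt_neqAle t0 andbT.
by apply/negP => /eqP t00; move: fc0; rewrite -e /f -t00 mul0r ltxx.
Qed.

(* Both markers can be replaced by equally likely ones whose letters carry little entropy. *)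
Lemma exists_small_pattern_probs c d e : 0 < c < 1 -> 0 < d < 1 -> 0 < e -> exists k t s,
  [/\ 0 < t < 1 /\ 0 < s < 1, binary_entropy t <= e, binary_entropy s <= e,
      t * (1 - t) ^+ k.+1 = c * (1 - c) ^+ k.+1 & s * (1 - s) ^+ k.+1 = d * (1 - d) ^+ k.+1].
Proof.
move=> hc hd e0; have [a0 [a0_gt0 a0_lt small]] := binary_entropy_small e0.
pose a := Num.min a0 (Num.min (c / 2) (d / 2)).
have [ac ad] : a <= c / 2 /\ a <= d / 2 by rewrite !ge_min !lexx !orbT.
have aa0 : a <= a0 by rewrite ge_min lexx.
have a_gt0 : 0 < a by rewrite !lt_min a0_gt0 !divr_gt0//; [case/andP: hd|case/andP: hc].
clearbody a; have a01 : 0 < a < 1 by lra.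
have [k1 hk1] := @pattern_prob_eventually_le c a a_gt0 ltac:(lra) (proj2 (andP hc)).
have [k2 hk2] := @pattern_prob_eventually_le d a a_gt0 ltac:(lra) (proj2 (andP hd)).
exists (k1 + k2)%N.
have [t ht et] := pattern_prob_onto hc a01 (hk1 (k1 + k2).+1 (leqW (leq_addr _ _))).
have [s hs es] := pattern_prob_onto hd a01 (hk2 (k1 + k2).+1 (leqW (leq_addl _ _))).
by exists t, s; split=> //; [split; lra|apply: small; lra|apply: small; lra].
Qed.

End BinaryEntropy.

(** * Isomorphism of sources of equal entropy *)

Section SourceEntropy.
Context {R : realType}.
Implicit Types (P Q : seq bool -> R) (tau : nat -> R).

Lemma letter_entropy_bitwords P r : source P ->
  letter_entropy P r = \sum_(a <- bitwords r) entropy_term (P a).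
Proof.
move=> sP; rewrite /letter_entropy /word_exp /letter_words big_words_cons.
transitivity (\sum_(a <- letters P r) P a * - ln (P a)).
  by apply: eq_bigr => a _; rewrite /= big_seq1 /letter_wt /= mulr1.
by rewrite (sum_letters sP); apply: eq_bigr => a _; rewrite mulrN.
Qed.

Lemma letter_lt1 P r a a' : source P -> a \in letters P r -> a' \in letters P r -> a != a' ->
  P a < 1.
Proof.
move=> sP ha ha' neq; rewrite -(sum_letters1 sP r).
apply: (ltr_sum_mem (letters_uniq P r) ha ha' neq) => [y _|]; first exact: source_ge0.
by move: ha'; rewrite mem_letters => /andP[].
Qed.

Lemma letter_entropy_degenerate P be r : source P -> degenerate P be -> letter_entropy P r = 0.
Proof.
move=> sP deg; rewrite letter_entropy_bitwords//.
have deg_letter : mkseq be r \in letters P r by rewrite mem_letters size_mkseq eqxx deg ltr01.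
rewrite big_seq big1// => a; rewrite mem_bitwords => ha.
have [->|neq] := eqVneq a (mkseq be r); first by rewrite deg entropy_term1.
have [Pa|] := ltP 0 (P a); last first.
  by rewrite le_eqVlt ltNge source_ge0// orbF => /eqP ->; exact: entropy_term0.
have := letter_lt1 sP deg_letter (a' := a); rewrite mem_letters ha Pa deg ltxx eq_sym neq.
by move/(_ isT isT).
Qed.

Lemma letter_entropy_splits_gt0 P r V : source P -> splits P r V -> 0 < letter_entropy P r.
Proof.
move=> sP [[a ha Va] [a' ha' Va']]; rewrite letter_entropy_bitwords//.
have neq : a != a' by apply: contraNneq Va' => <-.
have Pa_lt1 := letter_lt1 sP ha ha' neq; move: ha; rewrite mem_letters => /andP[sa Pa].
apply: (@sumr_gt0_seq _ _ _ (fun c => entropy_term (P c)) a); first by rewrite mem_bitwords.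
  by move=> c _; rewrite entropy_term_ge0// source_ge0//= source_le1.
by rewrite entropy_term_gt0// Pa.
Qed.

Lemma degenerate_or_splits P : source P ->
  (exists be, degenerate P be) \/ (exists r V, splits P r V).
Proof.
move=> sP; have [[r [V h]]|no_split] := pselect (exists r V, splits P r V).
  by right; exists r, V.
left; have letter_uniq r a a' : a \in letters P r -> a' \in letters P r -> a = a'.
  move=> h h'; apply: contrapT => neq; apply: no_split; exists r, (pred1 a); split.
    by exists a => //=.
  by exists a' => //=; apply/eqP => e; apply: neq.
have lettersE r : exists a, P a = 1 /\ letters P r = [:: a].
  have := sum_letters1 sP r; have := letters_uniq P r; have := @letter_uniq r.
  case: (letters P r) => [|a [|a' s]] hu.
  - by rewrite big_nil => _ /esym/eqP; rewrite oner_eq0.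
  - by rewrite big_seq1; exists a.
  - by rewrite (hu a a') ?inE ?eqxx ?orbT//= inE eqxx.
have [f hf] := choice lettersE.
have size_f r : size (f r) = r.
  have [_ e] := hf r; have : f r \in letters P r by rewrite e inE.
  by rewrite mem_letters => /andP[/eqP].
exists (fun k => nth false (f k.+1) k) => r; have [<- _] := hf r; congr P.
apply: (@eq_from_nth _ false); rewrite size_mkseq ?size_f// => i hi; rewrite nth_mkseq//.
have : take i.+1 (f r) \in letters P i.+1.
  rewrite mem_letters size_takel ?size_f// eqxx /=.
  by apply: lt_le_trans (source_take sP _ _); rewrite (proj1 (hf r)).
by rewrite (proj2 (hf i.+1)) inE => /eqP <-; rewrite nth_take.
Qed.

Definition independent_bits tau (a : seq bool) : R :=
  \prod_(k < size a) (if nth false a k then tau k else 1 - tau k).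

Lemma independent_bits_rcons tau a be : independent_bits tau (rcons a be) =
  independent_bits tau a * (if be then tau (size a) else 1 - tau (size a)).
Proof.
rewrite /independent_bits size_rcons big_ord_recr /= nth_rcons ltnn eqxx; congr (_ * _).
by apply: eq_bigr => i _; rewrite nth_rcons ltn_ord.
Qed.

Lemma source_independent_bits tau : (forall k, 0 <= tau k <= 1) -> source (independent_bits tau).
Proof.
move=> h; split=> [w||w].
- by apply: prodr_ge0 => i _; have := h i; case: ifP => _; lra.
- by rewrite /independent_bits big_ord0.
- by rewrite !independent_bits_rcons -mulrDr subrK mulr1.
Qed.

Lemma letter_entropy_independent_bits tau r : (forall k, 0 <= tau k <= 1) ->
  letter_entropy (independent_bits tau) r = \sum_(k < r) binary_entropy (tau k).
Proof.
move=> h; have sP := source_independent_bits h; rewrite letter_entropy_bitwords//.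
elim: r => [|r IH]; first by rewrite big_ord0 /= big_seq1 (source_nil sP) entropy_term1.
rewrite big_ord_recr /= -IH big_bitwordsS.
transitivity (\sum_(w <- bitwords r) (entropy_term (independent_bits tau w) +
    independent_bits tau w * binary_entropy (tau r))).
  apply: eq_big_seq => w; rewrite mem_bitwords => /eqP hw.
  have /andP[t0 t1] := h r; rewrite -subr_ge0 in t1; have p0 := source_ge0 sP w.
  by rewrite !independent_bits_rcons hw !entropy_termM// /binary_entropy; ring.
by rewrite big_split /=; congr (_ + _); rewrite -mulr_suml (sum_bitwords1 sP) mul1r.
Qed.

Lemma entropy_le_trans P Q S : entropy_le P Q -> entropy_le Q S -> entropy_le P S.
Proof.
move=> PQ QS r e e0; have e1 : 0 < e / 2 by lra.
have [r1 hr1] := PQ r _ e1; have [r2 hr2] := QS r1 _ e1.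
by exists r2; lra.
Qed.

Lemma exists_sum_binary_entropy l : 0 < l -> exists tau,
  [/\ forall k, 0 <= tau k <= 1, exists n, \sum_(k < n) binary_entropy (tau k) = l &
      forall r, \sum_(k < r) binary_entropy (tau k) <= l].
Proof.
move=> l0; have l2 : 0 < ln 2 :> R by rewrite ln_gt0// ltr1n.
pose n := (Num.bound (l / ln 2)).+1; have n0 : 0 < n%:R :> R by [].
have [|t ht et] := @binary_entropy_onto R (l / n%:R).
  rewrite divr_gt0//= ler_pdivrMr// mulrC -ler_pdivrMr//; apply: ltW.
  apply: lt_le_trans (archi_boundP _) _; first by rewrite divr_ge0 ?ltW.
  by rewrite ler_nat.
pose tau k := if (k < n)%N then t else 0.
have tau01 k : 0 <= tau k <= 1 by rewrite /tau; case: ifP => _ //; lra.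
have sum_n : \sum_(k < n) binary_entropy (tau k) = l.
  under eq_bigr do rewrite /tau ltn_ord et.
  by rewrite sumr_const card_ord -[(l / n%:R) *+ n]mulr_natr divfK ?gt_eqF.
exists tau; split=> // [|r]; first by exists n.
rewrite -sum_n -!(big_mkord xpredT (fun k => binary_entropy (tau k))).
have [h|/ltnW h] := leqP r n; rewrite (big_cat_nat _ h)//=.
  by rewrite lerDl sumr_ge0// => k _; exact: binary_entropy_ge0.
by rewrite gerDl big_nat big1// => k /andP[hk _]; rewrite /tau ltnNge hk binary_entropy0.
Qed.

(* The entropies of [P], less [x], are matched by independent bits: fair ones if they are
   unbounded, and finitely many equal ones otherwise. *)
Lemma exists_tail_bits P x r0 : x < letter_entropy P r0 -> exists tau,
  [/\ forall k, 0 <= tau k <= 1,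
      forall r e, 0 < e -> exists r',
        letter_entropy P r - e <= x + \sum_(k < r') binary_entropy (tau k) &
      forall r e, 0 < e -> exists r',
        x + \sum_(k < r) binary_entropy (tau k) - e <= letter_entropy P r'].
Proof.
move=> hx; have [bounded|unbounded] := pselect (exists C, forall r, letter_entropy P r <= C).
  pose S := [set letter_entropy P r | r in setT]%classic.
  have S_sup : has_sup S.
    by case: bounded => C hC; split; [exists (letter_entropy P 0), 0%N|exists C => _ [r _ <-]].
  have le_sup r : letter_entropy P r <= sup S by apply: sup_upper_bound => //; exists r.
  have [|tau [tau01 [n sum_n] sum_le]] := @exists_sum_binary_entropy (sup S - x).
    by rewrite subr_gt0 (lt_le_trans hx).
  exists tau; split=> // r e e0; first by exists n; have := le_sup r; rewrite sum_n; lra.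
  by have [_ [r' _ <-] hy] := sup_adherent e0 S_sup; exists r'; have := sum_le r; lra.
have entropy_above C : exists r, C <= letter_entropy P r.
  apply: contrapT => hn; apply: unbounded; exists C => r.
  by apply/ltW; rewrite ltNge; apply/negP => h; apply: hn; exists r.
have bits_above C : exists n, C <= \sum_(k < n) binary_entropy 2^-1 :> R.
  have l2 : 0 < ln 2 :> R by rewrite ln_gt0// ltr1n.
  exists (Num.bound (`|C| / ln 2)); rewrite sumr_const card_ord binary_entropy_half.
  rewrite -[_ *+ Num.bound _]mulr_natl -ler_pdivrMr//; apply: ltW.
  apply: le_lt_trans (archi_boundP _).
    by rewrite ler_pM2r ?invr_gt0// ler_norm.
  by rewrite divr_ge0// ltW.
exists (fun=> 2^-1); split=> [k|r e e0|r e e0]; first by lra.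
  by have [n hn] := bits_above (letter_entropy P r - e - x); exists n; lra.
exact: entropy_above.
Qed.

(* The first two bits of [S] are independent, with biases [t] and [s]. *)
Lemma exists_hub P r0 t s : 0 < t < 1 -> 0 < s < 1 ->
  binary_entropy t + binary_entropy s < letter_entropy P r0 -> exists S,
  [/\ source S, entropy_le P S /\ entropy_le S P,
      exists V, splits S 1 V /\ letter_mass S 1 V = t &
      exists V, splits S 2 V /\ letter_mass S 2 V = s].
Proof.
move=> t01 s01 /exists_tail_bits[tail [tail01 P_le le_P]].
pose tau k := match k with 0 => t | 1 => s | k'.+2 => tail k' end.
have tau01 k : 0 <= tau k <= 1 by case: k => [|[|k]] //=; lra.
have sS := source_independent_bits tau01; set S := independent_bits tau in sS *.
have entropyS r : letter_entropy S r.+2 =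
    binary_entropy t + binary_entropy s + \sum_(k < r) binary_entropy (tail k).
  by rewrite letter_entropy_independent_bits// !big_ord_recl /= addrA.
have S1 (x : bool) : S [:: x] = if x then t else 1 - t.
  by rewrite /S /independent_bits !big_ord_recl big_ord0 /= mulr1.
have S2 (x y : bool) : S [:: x; y] = (if x then t else 1 - t) * (if y then s else 1 - s).
  by rewrite /S /independent_bits !big_ord_recl big_ord0 /= mulr1.
exists S; split=> //.
- split=> r e e0; first by have [r' hr'] := P_le r e e0; exists r'.+2; rewrite entropyS.
  have [r' hr'] := le_P r e e0; exists r'; apply: le_trans hr'; rewrite lerB// -entropyS.
  by apply: letter_entropy_mono => //; exact: leqW.
- exists (fun a => nth false a 0); split; last first.
    by rewrite letter_massE// /bitwords /= !big_cons big_nil /= mulr1 mulr0 add0r addr0 S1.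
  by split; [exists [:: true]|exists [:: false]]; rewrite // mem_letters /= S1; lra.
exists (fun a => nth false a 1); split; last first.
  by rewrite letter_massE// /bitwords /= !big_cons big_nil /= !mulr1 !mulr0 !add0r addr0 !S2; ring.
by split; [exists [:: false; true]|exists [:: false; false]];
  rewrite // mem_letters /= S2 mulr_gt0//; lra.
Qed.

Lemma process_iso_splits P Q rP rQ VP VQ : source P -> source Q -> splits P rP VP ->
  splits Q rQ VQ -> entropy_le P Q -> entropy_le Q P -> process_iso P Q.
Proof.
move=> sP sQ splitP splitQ PQ QP; have H_gt0 := letter_entropy_splits_gt0 sP splitP.
have quarter_gt0 : 0 < letter_entropy P rP / 4 by lra.
have [k [t [s [[t01 s01] ht hs et es]]]] := exists_small_pattern_probs
  (splits_letter_mass sP splitP) (splits_letter_mass sQ splitQ) quarter_gt0.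
have [|S [sS [PS SP] [V1 [split1 mass1]] [V2 [split2 mass2]]]] := @exists_hub P rP t s t01 s01.
  by lra.
apply: (@process_iso_trans _ _ S).
  by apply: (process_iso_letter_markers (k := k) sP sS splitP split1) => //; rewrite mass1.
apply: process_iso_sym.
apply: (process_iso_letter_markers (k := k) sQ sS splitQ split2); rewrite ?mass2//.
- exact: entropy_le_trans QP PS.
- exact: entropy_le_trans SP PQ.
Qed.

Lemma degenerate_not_splits P Q be r V : source P -> source Q -> entropy_le Q P ->
  degenerate P be -> splits Q r V -> False.
Proof.
move=> sP sQ QP deg split; have H_gt0 := letter_entropy_splits_gt0 sQ split.
have [|r' hr'] := QP r (letter_entropy Q r / 2); first by lra.
by move: hr'; rewrite (letter_entropy_degenerate _ sP deg); lra.
Qed.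

Theorem process_iso_entropy P Q : source P -> source Q -> entropy_le P Q -> entropy_le Q P ->
  process_iso P Q.
Proof.
move=> sP sQ PQ QP.
have [[be degP]|[rP [VP splitP]]] := degenerate_or_splits sP;
  have [[be' degQ]|[rQ [VQ splitQ]]] := degenerate_or_splits sQ.
- exact: process_iso_degenerate degP degQ.
- by have := degenerate_not_splits sP sQ QP degP splitQ.
- by have := degenerate_not_splits sQ sP PQ degQ splitP.
- exact: process_iso_splits splitP splitQ PQ QP.
Qed.

End SourceEntropy.

(** * Uniqueness of the law *)

Definition window_cylinder B c : set (int -> nat -> bool) :=
  [set x | window B x (- B%:Z) (B + B) = c].

Definition window_cylinders : set (set (int -> nat -> bool)) :=
  [set S | S = set0 \/ exists B c, S = window_cylinder B c].

Definition bitarrayT := g_sigma_algebraType window_cylinders.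

Lemma setI_closed_window_cylinders : setI_closed window_cylinders.
Proof.
move=> S S' [-> _|[B [c ->]]]; first by left; rewrite set0I.
move=> [->|[B' [c' ->]]]; first by left; rewrite setI0.
wlog hB : B B' c c' / (B <= B')%N.
  move=> h; have [hB|hB] := leqP B B'; first exact: h.
  by rewrite setIC; apply: h; exact: ltnW.
have [[x [h1 h2]]|hn] := pselect (exists x, (window_cylinder B c `&` window_cylinder B' c') x);
    last first.
  by left; apply/seteqP; split=> x // hx; apply: hn; exists x.
right; exists B', c'; apply/seteqP; split=> y; first by case.
move=> hy; split=> //; rewrite /window_cylinder /= -h1.
by apply: (eq_window_sub (etrans hy (esym h2))); lia.
Qed.

Lemma measurable_bits_id : measurable_bits (id : bitarrayT -> bitarray).
Proof.
move=> i r; pose B := (`|i| + r).+1; pose k := `|(i + B%:Z)%R|%N.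
have entry x : nth false (nth [::] (window B x (- B%:Z) (B + B)) k) r = x i r.
  rewrite nth_window; last by rewrite /k /B; lia.
  by rewrite nth_mkseq; [congr (x _ r); rewrite /k /B; lia|rewrite /B; lia].
have -> : [set x : bitarrayT | id x i r] = [set x : bitarrayT | exists c : seq (seq bool),
    nth false (nth [::] c k) r /\ window B x (- B%:Z) (B + B) = c].
  apply/seteqP; split=> x /=; last by move=> [c [h hc]]; rewrite -(entry x) hc.
  by move=> h; exists (window B x (- B%:Z) (B + B)); rewrite entry.
apply: measurable_exists => c; apply: measurable_conj; first exact: measurable_prop.
by apply: sub_sigma_algebra; right; exists B, c.
Qed.

Lemma measurable_bits_fun (d : measure_display) (T : measurableType d) (X : T -> bitarray) :
  measurable_bits X -> measurable_fun setT (X : T -> bitarrayT).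
Proof.
move=> mX; apply: (@measurability _ _ _ bitarrayT _ _ window_cylinders) => // _ [S hS <-].
rewrite setTI; case: hS => [->|[B [c ->]]]; first by rewrite preimage_set0.
exact: (borel_window B (- B%:Z) (B + B) c mX).
Qed.

Lemma has_law_unique (R : realType) (P : seq bool -> R) (d d' : measure_display)
    (T : measurableType d) (T' : measurableType d') (mu : probability T R) (nu : probability T' R)
    (X : T -> bitarray) (Y : T' -> bitarray) S :
  measurable_bits X -> measurable_bits Y -> has_law P mu X -> has_law P nu Y -> borel_pred S ->
  mu [set t | S (X t)] = nu [set t | S (Y t)].
Proof.
move=> mX mY lawX lawY bS.
have mS : measurable [set x : bitarrayT | S x] by exact: (bS _ _ _ measurable_bits_id).
pose m1 := measure_function_pushforward__canonical__measure_function_Measure mu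
  (measurable_bits_fun mX).
pose m2 := measure_function_pushforward__canonical__measure_function_Measure nu
  (measurable_bits_fun mY).
apply: (@measure_unique _ R bitarrayT window_cylinders (fun=> window_cylinder 0 [::]) _
  setI_closed_window_cylinders _ _ m1 m2 _ _ _ mS) => //.
- by move=> i; right; exists 0%N, [::].
- by apply/seteqP; split=> x // _; exists 0%N.
- move=> A [->|[B [c ->]]]; first by rewrite !measure0.
  rewrite /m1 /m2 /= /pushforward; have [hc|hc] := boolP (c \in all_words B (B + B)).
    exact: etrans (lawX _ _ hc) (esym (lawY _ _ hc)).
  have e (U : Type) (Z : U -> bitarray) : Z @^-1` window_cylinder B c = set0.
    apply/seteqP; split=> t //=; rewrite /window_cylinder /= => h.
    by move: hc; rewrite -h window_all_words.
  by rewrite !e !measure0.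
move=> k; rewrite /m1 /= /pushforward; apply: le_lt_trans (probability_le1 _ _) (ltry 1).
exact: (borel_window 0 _ _ _ mX).
Qed.

Section DisjointSets.
Context {R : realType} {d : measure_display} {T : measurableType d} (mu : probability T R).

Lemma sum_disjoint_le (I : eqType) (f : I -> set T) (s : seq I) (C : set T) : uniq s ->
  (forall i, measurable (f i)) -> (forall i j t, f i t -> f j t -> i = j) ->
  measurable C -> (forall i, i \in s -> f i `<=` C) ->
  (\sum_(i <- s) mu (f i) <= mu C)%E.
Proof.
move=> us mf f_disj mC fC; have [m1 <-] := probability_disjoint_exists mu us mf f_disj.
apply: le_measure; [exact/mem_set|exact/mem_set|].
by move=> t /= [i hi]; exact: fC.
Qed.

Lemma finite_disjoint_ge (I : choiceType) (f : I -> set T) (e : R) : 0 < e ->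
  (forall i, measurable (f i)) -> (forall i j t, f i t -> f j t -> i = j) ->
  finite_set [set i | (e%:E <= mu (f i))%E].
Proof.
move=> e0 mf f_disj; apply: contrapT => infinite.
have [B hB hn] := infinite_set_fset (Num.bound e^-1).+1 infinite.
pose s := finmap.enum_fset B; have hn' : (Num.bound e^-1 < size s)%N := hn.
have := @sum_disjoint_le I f s setT (finmap.fset_uniq B) mf f_disj measurableT
  (fun _ _ => @subsetT _ _).
have : ((e * (size s)%:R)%:E <= \sum_(i <- s) mu (f i))%E.
  have -> : e * (size s)%:R = \sum_(i <- s) e.
    by rewrite big_const_seq count_predT iter_addr_0 mulr_natr.
  by rewrite -sumEFin big_seq [leRHS]big_seq; apply: lee_sum => i hi; exact: hB.
move=> /le_trans /[apply]; rewrite probability_setT lee_fin.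
apply/negP; rewrite -ltNge -ltr_pdivrMl// mulr1.
apply: lt_le_trans (archi_boundP _) _; first by rewrite invr_ge0 ltW.
by rewrite ler_nat; exact: ltnW.
Qed.

(* Only countably many level sets are charged. *)
Lemma exists_null_level (g : T -> R) (a b : R) : (forall t, measurable [set x | g x = t]) ->
  a < b -> exists2 t, a < t < b & mu [set x | g x = t] = 0%E.
Proof.
move=> mg ab; apply: contrapT => hn.
pose F n := [set t | ((n.+1%:R^-1)%:E <= mu [set x | g x = t])%E] : set R.
have cF : countable (\bigcup_n F n).
  apply: bigcup_countable => // n _; apply/finite_set_countable/finite_disjoint_ge => //.
  by move=> t t' x /= -> ->.
have sub : `]a, b[%classic `<=` \bigcup_n F n.
  move=> t /=; rewrite in_itv /= => ht.
  have m0 : (0 < mu [set x | g x = t])%E.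
    by rewrite lt0e measure_ge0 andbT; apply/eqP => h; apply: hn; exists t.
  have fin := fin_num_measure mu _ (mg t); rewrite -(fineK fin) lte_fin in m0.
  exists (Num.bound (fine (mu [set x | g x = t]))^-1) => //=.
  rewrite /F /= -(fineK fin) lee_fin -[leRHS]invrK lef_pV2 ?posrE ?invr_gt0//.
  apply: ltW; apply: lt_le_trans (archi_boundP _) _; first by rewrite invr_ge0 ltW.
  by rewrite ler_nat.
have := countable_lebesgue_measure0 (sub_countable (subset_card_le sub) cF).
rewrite lebesgue_measure_itv /= lte_fin ab => /eqP; rewrite -EFinB eqe subr_eq0 => /eqP e.
by rewrite e ltxx in ab.
Qed.

End DisjointSets.

(** * Coding of Polish alphabets *)

Record complete_metric (R : realType) (A : ptopologicalType) (d : A -> A -> R) : Prop :=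
  CompleteMetric {
  dist_ge0 : forall x y, 0 <= d x y;
  dist_eq0 : forall x y, d x y = 0 <-> x = y;
  dist_sym : forall x y, d x y = d y x;
  dist_triangle : forall x y z, d x z <= d x y + d y z;
  dist_open : forall U : set A, open U <->
    (forall x, U x -> exists2 e : R, 0 < e & [set y | d x y < e] `<=` U);
  dist_complete : forall v : nat -> A,
    (forall e : R, 0 < e -> exists N : nat, forall m n : nat,
       (N <= m)%N -> (N <= n)%N -> d (v m) (v n) < e) ->
    exists l : A, v @ \oo --> l }.

Lemma exists_inv_lt (R : archiRealFieldType) (e : R) : 0 < e -> exists l : nat, l.+1%:R^-1 < e.
Proof.
move=> e0; exists (Num.bound e^-1); rewrite -[ltRHS]invrK ltf_pV2 ?posrE ?invr_gt0//.
by apply: lt_le_trans (archi_boundP _) _; [rewrite invr_ge0 ltW|rewrite ler_nat].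
Qed.

Section MetricFacts.
Context {R : realType} {A : ptopologicalType} (d : A -> A -> R).
Hypothesis md : complete_metric d.
Implicit Types (x y a : A) (t e : R).

Lemma dist_lipschitz x y a t : `|d x y - t| <= `|d x a - t| + d y a.
Proof.
have := dist_triangle md x a y; have := dist_triangle md x y a; rewrite (dist_sym md a y) => h1 h2.
have : `|d x y - d x a| <= d y a by rewrite ler_norml; lra.
by have := ler_distD (d x a) (d x y) t; lra.
Qed.

Lemma dist_side x y a t : d y a < `|d x y - t| -> d x a <> t /\ (d x a < t) = (d x y < t).
Proof.
move=> near; have t1 := dist_triangle md x y a.
have t2 := dist_triangle md x a y; rewrite (dist_sym md a y) in t2; move: near.
have [lt_t|ge_t] := ltP (d x y) t.
  rewrite ltr0_norm ?subr_lt0// => near; have h : d x a < t by lra.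
  by split; [apply/eqP; rewrite lt_eqF|].
rewrite ger0_norm ?subr_ge0// => near; have h : t < d x a by lra.
by split; [apply/eqP; rewrite gt_eqF|apply/negbTE; rewrite -leNgt ltW].
Qed.

Lemma open_dist_lt x e : open [set a | d x a < e].
Proof.
apply/(dist_open md) => y /= hy; exists (e - d x y); first by lra.
by move=> z /= hz; have := dist_triangle md x y z; lra.
Qed.

Lemma open_dist_gt x e : open [set a | e < d x a].
Proof.
apply/(dist_open md) => y /= hy; exists (d x y - e); first by lra.
by move=> z /= hz; have := dist_triangle md x z y; rewrite (dist_sym md z y); lra.
Qed.

Lemma nbhs_dist_lt a e : 0 < e -> nbhs a [set y | d a y < e].
Proof.
move=> e0; apply: open_nbhs_nbhs; split; first exact: open_dist_lt.
by rewrite /= (proj2 (dist_eq0 md a a)).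
Qed.

Lemma cvg_dist (v : nat -> A) a e : v @ \oo --> a -> 0 < e ->
  exists N, forall n, (N <= n)%N -> d a (v n) < e.
Proof. by move=> hv /(nbhs_dist_lt a)/hv[N _ hN]; exists N => n hn; exact: hN. Qed.

Lemma measurable_sphere x t : measurable ([set a | d x a = t] : set (borelT A)).
Proof.
have -> : [set a | d x a = t] = ~` ([set a | d x a < t] `|` [set a | t < d x a]).
  apply/seteqP; split=> a /=; first by move=> ->; rewrite ltxx; case.
  by case: (ltgtP (d x a) t) => // h h'; exfalso; apply: h'; [left|right].
apply: measurableC; apply: measurableU; apply: sub_sigma_algebra.
  exact: open_dist_lt.
exact: open_dist_gt.
Qed.

End MetricFacts.

Section BallCode.
Context {R : realType} {A : ptopologicalType} (d : A -> A -> R).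
Variables (u : nat -> A) (rad : nat -> nat -> R).
Implicit Types (a : A) (m l r k : nat) (c : nat -> bool) (e : R).

Definition ball_code (a : A) (k : nat) : bool :=
  if @pickle_inv (nat * nat)%type k is Some q then d (u q.1) a < rad q.1 q.2 else false.

Definition off_spheres : set A := [set a | forall m l, d (u m) a <> rad m l].

Definition ball_code_range c := [/\ forall l, exists m : nat, c (pickle (m, l)),
  forall r, exists a, mkseq (ball_code a) r = mkseq c r &
  forall m l, exists r s, forall a, mkseq (ball_code a) r = mkseq c r ->
    s.+1%:R^-1 <= `|d (u m) a - rad m l|].

Definition ball_decode c : A := xget point [set a | off_spheres a /\ ball_code a = c].

Hypothesis md : complete_metric d.
Hypothesis u_dense : forall a (e : R), 0 < e -> exists m, d (u m) a < e.
Hypothesis rad_gt : forall m l, l.+2%:R^-1 < rad m l.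
Hypothesis rad_lt : forall m l, rad m l < l.+1%:R^-1.

Lemma ball_code_pickle a m l : ball_code a (pickle (m, l)) = (d (u m) a < rad m l).
Proof. by rewrite /ball_code pickleK_inv. Qed.

Lemma exists_ball a l : exists m : nat, ball_code a (pickle (m, l)).
Proof.
have [|m hm] := u_dense a (e := l.+2%:R^-1); first by rewrite invr_gt0.
by exists m; rewrite ball_code_pickle; exact: lt_trans hm _.
Qed.

Lemma same_ball_near a a' m l : ball_code a (pickle (m, l)) -> ball_code a' (pickle (m, l)) ->
  d a a' < 2 * l.+1%:R^-1.
Proof.
rewrite !ball_code_pickle => h h'; have := rad_lt m l.
have := dist_triangle md a (u m) a'; rewrite (dist_sym md a (u m)).
by move: h h'; move: (l.+1%:R^-1) => z; lra.
Qed.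

Lemma exists_inv_lt_half (e : R) : 0 < e -> exists l : nat, 2 * l.+1%:R^-1 < e.
Proof.
move=> e0; have [|l hl] := @exists_inv_lt R (e / 2); first by lra.
by exists l; rewrite mulrC -ltr_pdivlMr.
Qed.

Lemma exists_small_ball a (e : R) : 0 < e ->
  exists k, ball_code a k /\ forall a', ball_code a' k -> d a a' < e.
Proof.
move=> /exists_inv_lt_half[l hl]; have [m hm] := exists_ball a l; exists (pickle (m, l)).
by split=> // a' /(same_ball_near hm)/lt_trans; apply.
Qed.

Lemma ball_code_inj : injective ball_code.
Proof.
move=> a a' h; apply/(dist_eq0 md)/eqP; rewrite eq_le (dist_ge0 md) andbT.
apply/ler_addgt0Pr => e e0; rewrite add0r; have [k [h1 h2]] := exists_small_ball a e0.
by apply/ltW/h2; rewrite -h.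
Qed.

Lemma off_spheres_dist_gt0 a m l : off_spheres a -> 0 < `|d (u m) a - rad m l|.
Proof. by move=> off; rewrite normr_gt0 subr_eq0; apply/eqP; exact: off. Qed.

Lemma ball_code_in_range a : off_spheres a -> ball_code_range (ball_code a).
Proof.
move=> off; split=> [l|r|m l]; [exact: exists_ball|by exists a|].
have h0 : 0 < `|d (u m) a - rad m l| / 2 by rewrite divr_gt0// off_spheres_dist_gt0.
have [k [hk near]] := exists_small_ball a h0; have [s hs] := exists_inv_lt h0.
exists k.+1, s => a' e; have := near a'; rewrite (mkseq_eq_nth e (ltnSn k)) => /(_ hk).
have := dist_lipschitz md (u m) a a' (rad m l).
by move: hs; move: (s.+1%:R^-1) => z; lra.
Qed.

Lemma ball_decodeP c : ball_code_range c ->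
  off_spheres (ball_decode c) /\ ball_code (ball_decode c) = c.
Proof.
move=> [small prefixes gaps]; suff [a ha] : exists a, off_spheres a /\ ball_code a = c.
  by rewrite /ball_decode; case: xgetP => [y -> //|/(_ a)]; case.
have [v hv] := choice prefixes.
have code_v k r : (k < r)%N -> ball_code (v r) k = c k.
  by move=> hr; exact: (mkseq_eq_nth (hv r) hr).
have [|a va] := dist_complete md (v := v).
  move=> e /exists_inv_lt_half[l hl]; have [m hm] := small l.
  exists (pickle (m, l)).+1 => n n' hn hn'; apply: lt_trans hl; apply: (same_ball_near (m := m)).
    by rewrite code_v.
  by rewrite code_v.
have side m l : d (u m) a <> rad m l /\ (d (u m) a < rad m l) = c (pickle (m, l)).
  have [r [s gap]] := gaps m l.
  have [|N hN] := cvg_dist md va (e := s.+1%:R^-1); first by rewrite invr_gt0.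
  pose n := (N + r + (pickle (m, l)).+1)%N.
  rewrite -(code_v (pickle (m, l)) n) ?ball_code_pickle; last by rewrite /n leq_addl.
  apply: (dist_side md); rewrite (dist_sym md); apply: lt_le_trans (hN n _) (gap (v n) _).
    by rewrite /n -addnA leq_addr.
  by apply: mkseq_eq_le (hv n); rewrite /n addnAC leq_addl.
exists a; split; first by move=> m l; case: (side m l).
apply/funext => k; have := code_v k k.+1 (ltnSn k).
rewrite /ball_code; case E : (pickle_inv k) => [[m l]|] //= _.
have -> : k = pickle (m, l); last by case: (side m l).
by have := @pickle_invK (nat * nat)%type k; rewrite E /=.
Qed.

Lemma ball_code_continuous a k : off_spheres a ->
  exists2 e : R, 0 < e & forall a', d a a' < e -> ball_code a' k = ball_code a k.
Proof.
move=> off; rewrite /ball_code; case: (pickle_inv k) => [[m l]|] /=; last by exists 1.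
exists `|d (u m) a - rad m l|; first exact: off_spheres_dist_gt0.
by move=> a' /(dist_side md)[].
Qed.

Lemma ball_decode_continuous c (e : R) : ball_code_range c -> 0 < e ->
  exists r, forall c', ball_code_range c' -> mkseq c' r = mkseq c r ->
    d (ball_decode c) (ball_decode c') < e.
Proof.
move=> hc e0; have [_ dec_c] := ball_decodeP hc.
have [k [h1 h2]] := exists_small_ball (ball_decode c) e0.
exists k.+1 => c' hc' he; have [_ dec_c'] := ball_decodeP hc'; apply: h2; rewrite dec_c'.
by rewrite (mkseq_eq_nth he (ltnSn k)) -dec_c.
Qed.

Lemma open_ball_code U a : open U -> U a <-> exists q : nat * nat,
  [set a' | d (u q.1) a' < rad q.1 q.2] `<=` U /\ ball_code a (pickle q).
Proof.
move=> oU; split; last by move=> [[m l] [h]]; rewrite ball_code_pickle => /h.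
move=> /(proj1 (dist_open md U) oU)[e /exists_inv_lt_half[l hl] he].
have [m hm] := exists_ball a l; exists (m, l); split=> //= a' h'; apply: he => /=.
apply: lt_trans hl; apply: (same_ball_near hm); by rewrite ball_code_pickle.
Qed.

Lemma measurable_ball_code k : measurable ([set a | ball_code a k] : set (borelT A)).
Proof.
rewrite /ball_code; case: (pickle_inv k) => [q|]; last exact: (@measurable_prop _ (borelT A)).
by apply: sub_sigma_algebra; exact: open_dist_lt.
Qed.

Lemma measurable_off_spheres : measurable (off_spheres : set (borelT A)).
Proof.
apply: (@measurable_forall _ (borelT A) nat) => m.
apply: (@measurable_forall _ (borelT A) nat) => l.
by apply: (@measurable_not _ (borelT A)); exact: measurable_sphere.
Qed.

Lemma borel_ball_code_range i : borel_pred (fun x => ball_code_range (x i)).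
Proof.
have borel_prefix r (Q : seq bool -> Prop) : borel_pred (fun x => Q (mkseq (x i) r)).
  apply: borel_finitary => x Qx; exists (`|i| + r)%N => x' agree.
  rewrite (_ : mkseq (x' i) r = mkseq (x i) r)//.
  by apply: eq_in_mkseq => k hk; apply: agree; lia.
move=> dd T X mX.
rewrite (_ : [set t | _] = [set t | (forall l : nat, exists m : nat, X t i (pickle (m, l))) /\
   ((forall r, exists a, mkseq (ball_code a) r = mkseq (X t i) r) /\
    forall m l, exists r s, forall a, mkseq (ball_code a) r = mkseq (X t i) r ->
      s.+1%:R^-1 <= `|d (u m) a - rad m l|)]); last first.
  by apply/seteqP; split=> t /=; [case|move=> [h1 [h2 h3]]; split].
apply: measurable_conj.
  by apply: (@measurable_forall _ _ nat) => l; apply: (@measurable_exists _ _ nat) => m; exact: mX.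
apply: measurable_conj.
  apply: (@measurable_forall _ _ nat) => r.
  exact: (borel_prefix r (fun w => exists a, mkseq (ball_code a) r = w) _ _ _ mX).
apply: (@measurable_forall _ _ nat) => m; apply: (@measurable_forall _ _ nat) => l.
apply: (@measurable_exists _ _ nat) => r; apply: (@measurable_exists _ _ nat) => s.
exact: (borel_prefix r (fun w => forall a, mkseq (ball_code a) r = w ->
  s.+1%:R^-1 <= `|d (u m) a - rad m l|) _ _ _ mX).
Qed.

Lemma off_spheres_full (p : probability (borelT A) R) :
  (forall m l, p [set a | d (u m) a = rad m l] = 0%E) -> p off_spheres = 1%E.
Proof.
move=> null.
rewrite (_ : off_spheres = [set a | forall q : nat * nat, d (u q.1) a <> rad q.1 q.2]); last first.
  by apply/seteqP; split=> a off => [[m l]|m l]; [exact: off|exact: (off (m, l))].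
apply: (@probability_forall1 R _ (borelT A) p (nat * nat)%type
  (fun q a => d (u q.1) a <> rad q.1 q.2)) => q.
  by apply: (@measurable_not _ (borelT A)); exact: measurable_sphere.
have := probability_setC p (measurable_sphere md (u q.1) (rad q.1 q.2)).
by rewrite null sube0.
Qed.

End BallCode.

(** * The source of bits encoding a probability measure *)

Section Esum.
Context {R : realType} {T : choiceType}.
Implicit Types (D : set T) (f : T -> \bar R) (s : seq T).

Lemma esum_gt_exists D f y : (y < \esum_(i in D) f i)%E ->
  exists s : seq T, [/\ uniq s, {in s, forall x, D x} & (y < \sum_(x <- s) f x)%E].
Proof.
rewrite /esum => /ereal_sup_gt[_ [X [finX XD] <-] lt_y].
exists (finmap.enum_fset (fset_set X)); split; first exact: finmap.fset_uniq.
  by move=> x; rewrite in_fset_set// inE; exact: XD.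
by move: lt_y; rewrite fsbig_finite.
Qed.

Lemma sum_le_esum D f s : uniq s -> {in s, forall x, D x} ->
  (\sum_(x <- s) f x <= \esum_(i in D) f i)%E.
Proof.
move=> us sD; apply: ereal_sup_ubound; exists [set` s]; last by rewrite -fsbig_seq.
by split; [exact: finite_seq|move=> x /= /sD].
Qed.

End Esum.

Lemma ler_sum_subset (R : realType) (T : eqType) (s t : seq T) (F : T -> R) : uniq s ->
  {subset s <= t} -> {in t, forall x, 0 <= F x} -> \sum_(x <- s) F x <= \sum_(x <- t) F x.
Proof.
elim: s t => [|a s IH] t /=; first by move=> _ _ F0; rewrite big_nil big_seq sumr_ge0.
move=> /andP[as' us] st F0; have at' : a \in t by apply: st; rewrite inE eqxx.
rewrite big_cons (big_rem a at') /= lerD2l; apply: IH => // x.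
  move=> xs; have : x \in t by apply: st; rewrite inE xs orbT.
  by rewrite (perm_mem (perm_to_rem at')) inE => /orP[/eqP e|//]; move: as'; rewrite -e xs.
by move=> /mem_rem; exact: F0.
Qed.

Lemma sum_fibers (R : realType) (I : Type) (J : eqType) (f : I -> J) (s : seq I) (t : seq J)
    (g : J -> R) (F : I -> R) : uniq t -> (forall i, f i \in t) ->
  \sum_(i <- s) g (f i) * F i = \sum_(j <- t) g j * \sum_(i <- s | f i == j) F i.
Proof.
move=> ut ft; under [RHS]eq_bigr do rewrite mulr_sumr big_mkcond.
rewrite exchange_big /=; apply: eq_bigr => i _.
rewrite (big_rem _ (ft i)) /= eqxx big_seq big1 ?addr0// => j.
by rewrite mem_rem_uniq// inE eq_sym => /andP[/negbTE ->].
Qed.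

Lemma filter_in_seq (T : Type) (I : eqType) (F : set_system T) (s : seq I) (Q : I -> set T) :
  Filter F -> {in s, forall i, F (Q i)} -> F [set x | {in s, forall i, Q i x}].
Proof.
move=> FF; elim: s => [|a s IH] h; first exact: filterS filterT.
have Qa : F (Q a) by apply: h; rewrite inE eqxx.
have Qs := IH (fun q hq => h q (mem_behead (s := a :: s) hq)).
by apply: filterS (filterI Qa Qs) => x [x1 x2] q; rewrite inE => /orP[/eqP ->//|]; exact: x2.
Qed.

Lemma continuous_entropy_term (R : realType) (x : R) : 0 < x ->
  {for x, continuous (@entropy_term R)}.
Proof.
by move=> x0; apply: continuousN; apply: continuousM; [exact: cvg_id|exact: continuous_ln].
Qed.

Section LetterEntropy.
Context {R : realType} (P : seq bool -> R).
Hypothesis sP : source P.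

Lemma source_entropy_term_ge0 w : 0 <= entropy_term (P w).
Proof. by rewrite entropy_term_ge0// source_ge0//= source_le1. Qed.

Lemma sum_light_words_le r e : 0 < e ->
  - ln e * \sum_(w <- bitwords r | P w <= e) P w <= letter_entropy P r.
Proof.
move=> e0; rewrite (letter_entropy_bitwords _ sP) mulr_sumr big_mkcond /=.
apply: ler_sum => w _; case: ifP => [light|_]; last exact: source_entropy_term_ge0.
have := source_ge0 sP w; rewrite le_eqVlt => /predU1P[<-|Pw]; first by rewrite mulr0 entropy_term0.
by rewrite /entropy_term -mulrN mulrC; apply: ler_wpM2l; [exact: ltW|rewrite lerN2 ler_ln].
Qed.

Lemma letter_entropy_unbounded (c : R) : 0 < c ->
  (forall e, 0 < e -> exists r, c <= \sum_(w <- bitwords r | P w <= e) P w) ->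
  forall m, exists r, m <= letter_entropy P r.
Proof.
move=> c0 light m; have [r hr] := light (expR (- (`|m| / c))) (expR_gt0 _); exists r.
apply: le_trans (sum_light_words_le r (expR_gt0 (- (`|m| / c)))); rewrite expRK opprK.
apply: le_trans (ler_norm m) _; rewrite -[leLHS](divfK (lt0r_neq0 c0)).
by apply: ler_wpM2l hr; rewrite divr_ge0// ltW.
Qed.

End LetterEntropy.

Section CodeSource.
Context {R : realType} {d : measure_display} {T : measurableType d} (p : probability T R).
Variable code : T -> nat -> bool.
Hypothesis measurable_code : forall k, measurable [set a | code a k].
Hypothesis code_inj : injective code.
Local Notation mass a := (fine (p [set a])).
Local Notation prefix r a := (mkseq (code a) r).
Local Notation atoms := [set a | (0 < p [set a])%E].
Implicit Types (a : T) (s : seq T) (r : nat).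

Definition code_source (w : seq bool) : R := fine (p [set a | prefix (size w) a = w]).

Lemma eq_code_prefixes a b : (forall r, prefix r a = prefix r b) -> a = b.
Proof.
by move=> h; apply: code_inj; apply/funext => k; exact: mkseq_eq_nth (h k.+1) (ltnSn k).
Qed.

Lemma measurable_code_prefix r w : measurable [set a | prefix r a = w].
Proof.
have m_bits : measurable_bits (fun a : T => fun _ : int => code a).
  by move=> i k; exact: measurable_code.
have := borel_window r 0 1 [:: w] m_bits.
rewrite (_ : [set a | prefix r a = w] = [set t | window r (fun=> code t) 0 1 = [:: w]])//.
by apply/seteqP; split=> a; rewrite /window /=; [move=> ->|case].
Qed.

Lemma measurable_code_point a : measurable [set a].
Proof.
rewrite (_ : [set a] = [set b | forall r, prefix r b = prefix r a]).
  by apply: (@measurable_forall _ _ nat) => r; exact: measurable_code_prefix.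
by apply/seteqP; split=> b /=; [move=> ->|exact: eq_code_prefixes].
Qed.

Lemma code_sourceE r w : size w = r -> p [set a | prefix r a = w] = (code_source w)%:E.
Proof. by move=> <-; rewrite fineK// fin_num_measure//; exact: measurable_code_prefix. Qed.

Lemma massE a : p [set a] = (mass a)%:E.
Proof. by rewrite fineK// fin_num_measure//; exact: measurable_code_point. Qed.

Lemma source_code_source : source code_source.
Proof.
split=> [w||w]; first by rewrite fine_ge0.
  rewrite /code_source (_ : [set a | _] = setT) ?probability_setT//.
  by apply/seteqP; split.
apply: EFin_inj; rewrite EFinD -(code_sourceE (erefl (size w))).
rewrite -(code_sourceE (size_rcons w false)) -(code_sourceE (size_rcons w true)).
rewrite -measureU; try exact: measurable_code_prefix; last first.
  by apply/seteqP; split=> a //= [-> /eqP]; rewrite eqseq_rcons eqxx.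
congr (p _); apply/seteqP; split=> a /=; rewrite mkseqS.
  by move=> ->; case: (code a (size w)); [right|left].
by move=> [] /rcons_inj [].
Qed.

Let sP := source_code_source.

Lemma sum_mass_le s (C : set T) : uniq s -> measurable C -> {in s, forall a, C a} ->
  ((\sum_(a <- s) mass a)%:E <= p C)%E.
Proof.
move=> us mC sC; rewrite -sumEFin; under eq_bigr do rewrite -massE.
apply: (@sum_disjoint_le _ _ _ p T (fun a => [set a])) => //.
- exact: measurable_code_point.
- by move=> i j t /= -> ->.
by move=> a /sC h t /= ->.
Qed.

Lemma mass_le_prefix a r : mass a <= code_source (prefix r a).
Proof.
rewrite -lee_fin -(code_sourceE (size_mkseq _ _)) -massE.
apply: le_measure; rewrite ?inE; [exact: measurable_code_point|exact: measurable_code_prefix|].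
by move=> x /= ->.
Qed.

Lemma cvg_prefix_mass a : code_source (prefix r a) @[r --> \oo] --> mass a.
Proof.
pose cell r := [set x | prefix r x = prefix r a].
have cell_cap : \bigcap_r cell r = [set a].
  by apply/seteqP; split=> [x h|x -> //]; apply: eq_code_prefixes => r; exact: h.
have cvg_cell : p \o cell @ \oo --> p (\bigcap_r cell r).
  apply: nonincreasing_cvg_mu => [|r||m n le_mn].
  - by rewrite (le_lt_trans (probability_le1 _ _)) ?ltry//; exact: measurable_code_prefix.
  - exact: measurable_code_prefix.
  - by rewrite cell_cap; exact: measurable_code_point.
  by apply/subsetPset => x /=; exact: mkseq_eq_le.
rewrite cell_cap massE in cvg_cell.
have -> : (fun r => code_source (prefix r a)) = fine \o (p \o cell).
  by apply/funext => r /=; rewrite /cell (code_sourceE (size_mkseq _ _)).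
exact: fine_cvg.
Qed.

Section EntropyLower.
Variables (s : seq T) (r : nat) (missing : R).
Hypothesis us : uniq s.
Hypothesis s_mass : {in s, forall a, 0 < mass a}.
Hypothesis total : 1 - missing <= \sum_(a <- s) mass a.
Let prefix_mass w := \sum_(a <- s | prefix r a == w) mass a.

Let prefix_bitwords a : prefix r a \in bitwords r.
Proof. by rewrite mem_bitwords size_mkseq. Qed.

Lemma prefix_mass_le w : w \in bitwords r -> prefix_mass w <= code_source w.
Proof.
rewrite mem_bitwords => /eqP hw; rewrite /prefix_mass -big_filter -lee_fin -(code_sourceE hw).
apply: sum_mass_le; [exact: filter_uniq|exact: measurable_code_prefix|].
by move=> a; rewrite mem_filter => /andP[/eqP].
Qed.

Lemma prefix_mass_ge w : w \in bitwords r -> code_source w - missing <= prefix_mass w.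
Proof.
move=> hw; have := sum_bitwords1 sP r; rewrite (big_rem w)//= => sum_source.
have sum_prefix : \sum_(v <- bitwords r) prefix_mass v = \sum_(a <- s) mass a.
  have := sum_fibers s (fun=> 1) (fun a => mass a) (bitwords_uniq r) prefix_bitwords.
  by under eq_bigr do rewrite mul1r; under [in RHS]eq_bigr do rewrite mul1r.
move: total; rewrite -sum_prefix (big_rem w)//=.
have : \sum_(v <- rem w (bitwords r)) prefix_mass v <= \sum_(v <- rem w (bitwords r)) code_source v.
  by apply: ler_sum_seq => v /mem_rem; exact: prefix_mass_le.
by move: sum_source; lra.
Qed.

Lemma letter_entropy_le_atoms :
  letter_entropy code_source r - missing * \sum_(w <- bitwords r) - ln (code_source w) <=
  \sum_(a <- s) entropy_term (mass a).
Proof.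
apply: (@le_trans _ _ (\sum_(a <- s) - ln (code_source (prefix r a)) * mass a)).
  rewrite (sum_fibers s (fun w => - ln (code_source w)) (fun a => mass a) (bitwords_uniq r)
    prefix_bitwords).
  rewrite (letter_entropy_bitwords _ sP) mulr_sumr -sumrB; apply: ler_sum_seq => w hw.
  rewrite (_ : _ - _ = - ln (code_source w) * (code_source w - missing)).
    apply: ler_wpM2l; first by rewrite oppr_ge0 ln_le0// source_le1.
    exact: prefix_mass_ge.
  by rewrite /entropy_term; ring.
apply: ler_sum_seq => a ha; rewrite /entropy_term -mulrN mulrC.
apply: ler_wpM2l; first by rewrite ltW ?s_mass.
rewrite lerN2 ler_ln ?posrE ?s_mass//; first exact: mass_le_prefix.
exact: lt_le_trans (s_mass ha) (mass_le_prefix a r).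
Qed.

End EntropyLower.

Lemma letter_entropy_le_esum r : (\esum_(a in atoms) p [set a] = 1)%E ->
  ((letter_entropy code_source r)%:E <= \esum_(a in atoms) (entropy_term (mass a))%:E)%E.
Proof.
move=> total; apply/lee_addgt0Pr => e e0.
pose C := \sum_(w <- bitwords r) - ln (code_source w); have C0 : 0 <= C.
  by apply: sumr_ge0 => w _; rewrite oppr_ge0 ln_le0// source_le1.
have C1 : 0 < C + 1 by lra.
have missing0 : 0 < e / (C + 1) by rewrite divr_gt0.
have [|s [us s_atoms]] := @esum_gt_exists R T atoms (fun a => p [set a]) (1 - e / (C + 1))%:E.
  by rewrite total lte_fin; lra.
under eq_bigr do rewrite massE; rewrite sumEFin lte_fin => /ltW s_total.
have s_mass : {in s, forall a, 0 < mass a} by move=> a /s_atoms; rewrite /= massE lte_fin.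
apply: le_trans (leeD2r _ (sum_le_esum _ us s_atoms)); rewrite sumEFin -EFinD lee_fin.
have := letter_entropy_le_atoms r us s_mass s_total; rewrite -/C.
have : e / (C + 1) * C <= e by rewrite mulrAC ler_pdivrMr// ler_pM2l// lerDl.
by lra.
Qed.

Lemma prefixes_separate s : \forall r \near \oo, {in s &, injective (fun a => prefix r a)}.
Proof.
have sep : {in s, forall a, \forall r \near \oo,
    {in s, forall b, prefix r a = prefix r b -> a = b}}.
  move=> a _; apply: filter_in_seq => b _; have [->|ab] := pselect (a = b).
    exact: filterS filterT.
  have [k hk] : exists k, code a k <> code b k.
    apply: contrapT => h; apply/ab/code_inj/funext => k.
    by apply: contrapT => h'; apply: h; exists k.
  by exists k.+1 => // r /= hr e; exfalso; apply: hk; exact: mkseq_eq_nth e hr.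
by apply: filterS (filter_in_seq _ sep) => r h a b ha hb; exact: h.
Qed.

Lemma atoms_le_letter_entropy s e : uniq s -> {in s, forall a, 0 < mass a} -> 0 < e ->
  exists r, \sum_(a <- s) entropy_term (mass a) - e <= letter_entropy code_source r.
Proof.
move=> us s_mass e0.
have cvg_sum : \sum_(a <- s) entropy_term (code_source (prefix r a)) @[r --> \oo] -->
    \sum_(a <- s) entropy_term (mass a).
  rewrite [X in _ --> X]big_seq; under eq_fun do rewrite big_seq.
  apply: cvg_big; first exact: add_continuous.
  move=> a ha; apply: continuous_cvg; last exact: cvg_prefix_mass.
  exact: continuous_entropy_term (s_mass _ ha).
move/cvgrPdist_le : cvg_sum => /(_ _ e0) close.
have [N _ /(_ N (leqnn N))[close_N inj_N]] := filterI close (prefixes_separate s); exists N.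
apply: (@le_trans _ _ (\sum_(a <- s) entropy_term (code_source (prefix N a)))).
  by move: close_N; rewrite ler_norml; lra.
rewrite (letter_entropy_bitwords _ sP) -(big_map (fun a => prefix N a) predT
  (fun w => entropy_term (code_source w))).
apply: ler_sum_subset; first by rewrite map_inj_in_uniq.
  by move=> w /mapP[a _ ->]; rewrite mem_bitwords size_mkseq.
by move=> w _; exact: source_entropy_term_ge0 sP w.
Qed.

Definition heavy e r : set T := [set a | e < code_source (prefix r a)].

Lemma measurable_heavy e r : measurable (heavy e r).
Proof.
have -> : heavy e r = [set a | exists w, e < code_source w /\ prefix r a = w].
  apply/seteqP; split=> a /=; first by move=> h; exists (prefix r a).
  by move=> [w [h e']]; rewrite /heavy /= e'.
apply: (@measurable_exists _ _ (seq bool)) => w; apply: measurable_conj.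
  exact: measurable_prop.
exact: measurable_code_prefix.
Qed.

Lemma probability_heavy e r :
  p (heavy e r) = (\sum_(w <- bitwords r | e < code_source w) code_source w)%:E.
Proof.
have -> : heavy e r = [set a | prefix r a \in [seq w <- bitwords r | e < code_source w]].
  by apply/seteqP; split=> a /=; rewrite mem_filter mem_bitwords size_mkseq eqxx andbT.
rewrite (@probability_in_seq _ _ _ p _ (fun a => prefix r a)); last first.
- by move=> w; exact: measurable_code_prefix.
- exact: filter_uniq (bitwords_uniq r).
rewrite big_filter -sumEFin big_seq_cond [RHS]big_seq_cond; apply: eq_bigr => w /andP[].
by rewrite mem_bitwords => /eqP hw _; exact: code_sourceE.
Qed.

Lemma probability_always_heavy_le e : 0 < e ->
  (p (\bigcap_r heavy e r) <= \esum_(a in atoms) p [set a])%E.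
Proof.
move=> e0; have fin_heavy : finite_set [set a | (e%:E <= p [set a])%E].
  apply: (@finite_disjoint_ge _ _ _ p T (fun a => [set a])) => //.
    exact: measurable_code_point.
  by move=> i j t /= -> ->.
pose s := finmap.enum_fset (fset_set [set a | (e%:E <= p [set a])%E]).
have mem_s a : a \in s = (e%:E <= p [set a])%E.
  by rewrite in_fset_set//; apply/idP/idP; rewrite inE.
have [m_s sum_s] := @probability_disjoint_exists R _ T p T (fun a t => t = a) s
  (finmap.fset_uniq _) measurable_code_point (fun a a' t h h' => etrans (esym h) h').
apply: le_trans (_ : (p [set t | exists2 a, a \in s & t = a] <= _)%E); last first.
  rewrite sum_s; apply: sum_le_esum; first exact: finmap.fset_uniq.
  by move=> a; rewrite mem_s /=; apply: lt_le_trans; rewrite lte_fin.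
apply: le_measure; rewrite ?inE//.
  by apply: bigcap_measurable => // r _; exact: measurable_heavy.
move=> a always_heavy /=; exists a => //; rewrite mem_s massE lee_fin.
rewrite -(cvg_lim (@norm_hausdorff _ _) (@cvg_prefix_mass a)).
apply: limr_ge; first by apply/cvg_ex; exists (mass a); exact: cvg_prefix_mass.
by apply: nearW => r; apply: ltW; exact: always_heavy.
Qed.

Lemma exists_light_words (c e : R) : (\esum_(a in atoms) p [set a] <= (1 - c)%:E)%E ->
  0 < c -> 0 < e -> exists r, c / 2 <= \sum_(w <- bitwords r | code_source w <= e) code_source w.
Proof.
move=> atomic c0 e0; have m_cap : measurable (\bigcap_r heavy e r).
  by apply: bigcap_measurable => // r _; exact: measurable_heavy.
have cvg_heavy : p \o heavy e @ \oo --> p (\bigcap_r heavy e r).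
  apply: nonincreasing_cvg_mu => // [|r|m n le_mn].
  - by rewrite (le_lt_trans (probability_le1 _ _)) ?ltry//; exact: measurable_heavy.
  - exact: measurable_heavy.
  apply/subsetPset => a /= h; apply: lt_le_trans h _.
  by rewrite -(take_mkseq (code a) le_mn); exact: source_take.
have fin_cap := fin_num_measure p _ m_cap; rewrite -(fineK fin_cap) in cvg_heavy.
have c2 : 0 < c / 2 by lra.
have cvg_fine : fine (p (heavy e r)) @[r --> \oo] --> fine (p (\bigcap_r heavy e r)).
  exact: fine_cvg.
move/cvgrPdist_le : cvg_fine => /(_ _ c2)[r _ /(_ r (leqnn r))] /=.
rewrite ler_norml probability_heavy /= => /andP[near_cap _]; exists r.
have cap_le := le_trans (probability_always_heavy_le e0) atomic.
rewrite -(fineK fin_cap) lee_fin in cap_le.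
have := sum_bitwords1 sP r; rewrite (bigID (fun w => e < code_source w)) /=.
under [X in _ + X]eq_bigl do rewrite -leNgt.
by move: near_cap cap_le; lra.
Qed.

Lemma letter_entropy_nonatomic (m : R) : (\esum_(a in atoms) p [set a] <> 1)%E ->
  exists r, m <= letter_entropy code_source r.
Proof.
move=> nonatomic; pose total := (\esum_(a in atoms) p [set a])%E.
have total_le1 : (total <= 1)%E.
  rewrite leNgt; apply/negP => /esum_gt_exists[s [us _]].
  under eq_bigr do rewrite massE; rewrite sumEFin ltNge => /negP; apply.
  by rewrite -(probability_setT p); exact: sum_mass_le.
have total_ge0 : (0 <= total)%E by apply: esum_ge0 => a _.
have [c c0 totalE] : exists2 c : R, 0 < c & total = (1 - c)%:E.
  move: nonatomic; rewrite -/total.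
  case: total total_le1 total_ge0 => [x| |] //=; rewrite ?lee_fin => le1 _ neq1.
  exists (1 - x); last by congr (_%:E); ring.
  by rewrite subr_gt0 lt_neqAle le1 andbT; apply/eqP => e; apply: neq1; rewrite e.
have c2 : 0 < c / 2 by lra.
apply: (letter_entropy_unbounded sP c2) => e e0.
by apply: exists_light_words c0 e0; rewrite -totalE.
Qed.

End CodeSource.

Section BorelEntropy.
Context {R : realType} {A : ptopologicalType} (p : probability (borelT A) R).
Variable code : borelT A -> nat -> bool.
Hypothesis measurable_code : forall k, measurable [set a | code a k].
Hypothesis code_inj : injective code.

Lemma letter_entropy_le_entropy r : ((letter_entropy (code_source p code) r)%:E <= entropy p)%E.
Proof.
rewrite /entropy; case: pselect => [total|nonatomic] /=; last by rewrite leey.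
exact: letter_entropy_le_esum.
Qed.

Lemma lt_entropy_letter_entropy (m : R) : (m%:E < entropy p)%E ->
  exists r, m <= letter_entropy (code_source p code) r.
Proof.
rewrite /entropy; case: pselect => [total|nonatomic _] /=; last exact: letter_entropy_nonatomic.
move=> /esum_gt_exists[s [us s_atoms]]; rewrite sumEFin lte_fin => lt_m.
have s_mass : {in s, forall a, 0 < fine (p [set a])}.
  by move=> a /s_atoms; rewrite /atoms /= (massE _ measurable_code)// lte_fin.
have gap : 0 < \sum_(a <- s) - (fine (p [set a]) * ln (fine (p [set a]))) - m.
  by rewrite subr_gt0.
have [r hr] := atoms_le_letter_entropy measurable_code code_inj us s_mass gap.
by exists r; apply: le_trans hr; rewrite /entropy_term subKr.
Qed.

End BorelEntropy.

Lemma entropy_le_code_source (R : realType) (A B : ptopologicalType)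
    (p : probability (borelT A) R) (q : probability (borelT B) R)
    (codeA : borelT A -> nat -> bool) (codeB : borelT B -> nat -> bool) :
  (forall k, measurable [set a | codeA a k]) -> injective codeA ->
  (forall k, measurable [set b | codeB b k]) -> injective codeB ->
  entropy p = entropy q -> entropy_le (code_source p codeA) (code_source q codeB).
Proof.
move=> mA injA mB injB eq_entropy r e e0; apply: (lt_entropy_letter_entropy mB injB).
rewrite -eq_entropy; apply: lt_le_trans (letter_entropy_le_entropy p mA injA r).
by rewrite lte_fin ltrBlDr ltrDl.
Qed.

(* Off a null set, a homeomorphism from [regular] onto [range]. *)
Record topological_code (R : realType) (A : ptopologicalType) (p : probability (borelT A) R)
    (code : A -> nat -> bool) (decode : (nat -> bool) -> A) (regular : set A)
    (range : (nat -> bool) -> Prop) : Prop := TopologicalCode {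
  code_measurable : forall k, measurable ([set a | code a k] : set (borelT A));
  code_injective : injective code;
  code_regular_measurable : measurable (regular : set (borelT A));
  code_regular_full : p regular = 1%E;
  code_range_borel : forall i, borel_pred (fun x => range (x i));
  code_in_range : forall a, regular a -> range (code a);
  code_decodeP : forall c, range c -> regular (decode c) /\ code (decode c) = c;
  code_continuous : forall a k, regular a -> \forall a' \near a, code a' k = code a k;
  code_decode_continuous : forall c (V : set A), range c -> nbhs (decode c) V ->
    exists r, forall c', range c' -> mkseq c' r = mkseq c r -> V (decode c');
  code_open : forall U : set A, open U ->
    exists bits : nat -> Prop, forall a, U a <-> exists k, bits k /\ code a k }.

Lemma exists_dense_seq (R : realType) (A : ptopologicalType) (d : A -> A -> R) (D : set A) :
  complete_metric d -> countable D -> closure D = setT ->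
  exists u : nat -> A, forall a (e : R), 0 < e -> exists m, d (u m) a < e.
Proof.
move=> md /countable_injP[f f_inj] D_dense.
exists (fun n => xget point [set a | D a /\ f a = n]) => a e e0.
have : closure D a by rewrite D_dense.
move=> /(_ _ (nbhs_dist_lt md a e0))[y [Dy near_y]]; exists (f y) => /=.
case: xgetP => [_ -> [Dz fz]|/(_ y)]; last by case.
by rewrite (f_inj _ _ (mem_set Dz) (mem_set Dy) fz) (dist_sym md).
Qed.

Lemma exists_null_radii (R : realType) (A : ptopologicalType) (d : A -> A -> R)
    (p : probability (borelT A) R) (u : nat -> A) : complete_metric d ->
  exists rad : nat -> nat -> R, forall m l,
    [/\ l.+2%:R^-1 < rad m l, rad m l < l.+1%:R^-1 & p [set a | d (u m) a = rad m l] = 0%E].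
Proof.
move=> md; have radius (q : nat * nat) : exists t : R,
    [/\ q.2.+2%:R^-1 < t, t < q.2.+1%:R^-1 & p [set a | d (u q.1) a = t] = 0%E].
  have [||t /andP[t_gt t_lt] null] :=
    @exists_null_level R _ (borelT A) p (d (u q.1)) q.2.+2%:R^-1 q.2.+1%:R^-1.
  - by move=> t; exact: measurable_sphere.
  - by rewrite ltf_pV2 ?posrE// ltr_nat.
  by exists t.
by have [rad radP] := choice radius; exists (fun m l => rad (m, l)) => m l; exact: radP (m, l).
Qed.

Lemma polish_complete_metric (R : realType) (A : ptopologicalType) : polish R A ->
  exists d : A -> A -> R, complete_metric d.
Proof. by move=> [[d [[ge0 eq0] sym triangle opens complete]] _]; exists d. Qed.

Lemma topological_code_exists (R : realType) (A : ptopologicalType)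
    (p : probability (borelT A) R) : polish R A ->
  exists code decode regular range, topological_code p code decode regular range.
Proof.
move=> pA; have [d md] := polish_complete_metric pA; have [_ [D [D_countable D_dense]]] := pA.
have [u u_dense] := exists_dense_seq md D_countable D_dense.
have [rad radP] := exists_null_radii p u md.
have rad_gt m l : l.+2%:R^-1 < rad m l by case: (radP m l).
have rad_lt m l : rad m l < l.+1%:R^-1 by case: (radP m l).
exists (ball_code d u rad), (ball_decode d u rad), (off_spheres d u rad).
exists (ball_code_range d u rad); split.
- exact: measurable_ball_code.
- exact: ball_code_inj.
- exact: measurable_off_spheres.
- by apply: off_spheres_full => // m l; case: (radP m l).
- exact: borel_ball_code_range.
- exact: ball_code_in_range.
- exact: ball_decodeP.
- move=> a k /(ball_code_continuous md k)[e e0 near_a].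
  exact: filterS near_a (nbhs_dist_lt md a e0).
- move=> c V hc; rewrite nbhsE => -[U [oU Uc] UV].
  have [e e0 ball_U] := proj1 (dist_open md U) oU _ Uc.
  have [r hr] := ball_decode_continuous md u_dense rad_gt rad_lt hc e0.
  by exists r => c' hc' /(hr _ hc')/ball_U/UV.
move=> U oU; exists (fun k => exists q : nat * nat,
  [set a' | d (u q.1) a' < rad q.1 q.2] `<=` U /\ k = pickle q) => a.
rewrite (open_ball_code md u_dense rad_gt rad_lt a oU); split.
  by move=> [q [ball_U hq]]; exists (pickle q); split=> //; exists q.
by move=> [k [[q [ball_U ->]] hk]]; exists q.
Qed.

(** * Transfer to processes in Polish spaces *)

Lemma measurable_trace (d : measure_display) (T : measurableType d) (S : Type) (G : set (set S))
    (f : T -> S) (Z : T -> Prop) : measurable [set t | Z t] ->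
  (forall C, G C -> measurable [set t | Z t /\ C (f t)]) ->
  forall C, <<s G >> C -> measurable [set t | Z t /\ C (f t)].
Proof.
move=> mZ mG C; apply: (@smallest_sub _ _ G [set C | measurable [set t | Z t /\ C (f t)]]) => //.
split=> [|B /= mB|B /= mB].
- by rewrite /= (_ : [set t | _] = set0)//; apply/seteqP; split=> t // [].
- rewrite (_ : [set t | _] = [set t | Z t] `\` [set t | Z t /\ B (f t)]); first exact: measurableD.
  apply/seteqP; split=> t /=; first by move=> [h1 [_ h2]]; split=> // -[].
  by move=> [h1 h2]; split=> //; split=> // h3; apply: h2.
rewrite (_ : [set t | _] = \bigcup_n [set t | Z t /\ B n (f t)]); first exact: bigcupT_measurable.
apply/seteqP; split=> t /=; first by move=> [h1 [n _ h2]]; exists n.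
by move=> [n _ [h1 h2]]; split=> //; exists n.
Qed.

Lemma probability_eq_on (R : realType) (d : measure_display) (T : measurableType d)
    (mu : probability T R) (Z X Y : set T) :
  measurable Z -> measurable X -> measurable Y -> mu Z = 1%E ->
  (forall t, Z t -> (X t <-> Y t)) -> mu X = mu Y.
Proof.
move=> mZ mX mY Z1 eq_on.
have null_compl : mu (~` Z) = 0%E by rewrite probability_setC// Z1 subee.
have restrict (W : set T) : measurable W -> mu W = mu (W `&` Z).
  move=> mW; rewrite (measureDI mu mW mZ) -[RHS]add0e; congr (_ + _)%E.
  apply/eqP; rewrite eq_le measure_ge0 andbT -null_compl; apply: le_measure; rewrite ?inE.
  - exact: measurableD.
  - exact: measurableC.
  by move=> t [].
rewrite (restrict X)// (restrict Y)//; congr (mu _).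
by apply/seteqP; split=> t [h1 h2]; split=> //; exact/eq_on.
Qed.

Lemma cvg_ptws (I : Type) (A : ptopologicalType) (F : set_system {ptws I -> A})
    (f : {ptws I -> A}) : Filter F -> (forall i V, nbhs (f i) V -> F [set g | V (g i)]) -> F --> f.
Proof.
move=> FF h; apply/cvg_sup => i; apply/cvg_image.
  by apply/seteqP; split=> y // _; exists (fun=> y).
move=> V hV; exists [set g : {ptws I -> A} | V (g i)]; first exact: h.
apply/seteqP; split=> y /=; first by move=> [g hg <-].
by move=> hy; exists (fun=> y).
Qed.

Lemma forall_shift (T : Type) (Q : T -> Prop) (x : int -> T) :
  (forall i, Q (x (i + 1))) <-> forall i, Q (x i).
Proof. by split=> h i; [have := h (i - 1); rewrite subrK|exact: h]. Qed.

Lemma image_inverse (S T : Type) (f : S -> T) (g : T -> S) (D : set S) (E : set T) :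
  (forall x, D x -> E (f x)) -> (forall y, E y -> D (g y) /\ f (g y) = y) -> f @` D = E.
Proof.
move=> fD gE; apply/seteqP; split=> [_ [x hx <-]|y /gE[hy fg]]; first exact: fD.
by exists (g y).
Qed.

Definition encode_process (A : Type) (code : A -> nat -> bool) (x : int -> A) : bitarray :=
  fun i => code (x i).

Definition decode_process (A : Type) (decode : (nat -> bool) -> A) (z : bitarray) : int -> A :=
  fun i => decode (z i).

Definition process_in (T : Type) (S : set T) (x : int -> T) := forall i, S (x i).

Section CodedProcess.
Context {R : realType} {A : ptopologicalType} {p : probability (borelT A) R}
  {mu : probability (seqT A) R}.
Context {code : A -> nat -> bool} {decode : (nat -> bool) -> A} {regular : set A}
  {range : (nat -> bool) -> Prop}.
Hypothesis tc : topological_code p code decode regular range.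
Hypothesis iid : iid_law p mu.
Local Notation encode := (encode_process code).
Local Notation decodeZ := (decode_process decode).
Implicit Types (x : seqsp A) (z : bitarray) (i : int).

Lemma measurable_coordinate i (B : set (borelT A)) : measurable B ->
  measurable ([set x | B (x i)] : set (seqT A)).
Proof. by move=> mB; apply: sub_sigma_algebra; exists i, B. Qed.

Lemma measurable_encode_process : measurable_bits (encode : seqT A -> bitarray).
Proof. by move=> i k; exact: (measurable_coordinate i (code_measurable tc k)). Qed.

Lemma measurable_process_in_regular : measurable (process_in regular : set (seqT A)).
Proof.
apply: (@measurable_forall _ (seqT A) int) => i.
exact: (measurable_coordinate i (code_regular_measurable tc)).
Qed.

Lemma process_in_regular_full : mu (process_in regular) = 1%E.
Proof.
apply: (@probability_forall1 _ _ (seqT A) mu int (fun i x => regular (x i))) => i.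
  exact: (measurable_coordinate i (code_regular_measurable tc)).
have := iid (s := [:: i]) (Bs := fun=> regular) isT (fun=> code_regular_measurable tc).
rewrite big_seq1 (code_regular_full tc) => <-; congr (mu _); apply/seteqP; split=> x /=.
  by move=> h j; rewrite inE => /eqP ->.
by apply; rewrite inE.
Qed.

Lemma has_law_encode_process : has_law (code_source p code) mu (encode : seqT A -> bitarray).
Proof.
move=> B c; rewrite mem_all_words => /andP[/eqP size_c /allP letters_c].
pose s := [seq - B%:Z + k%:Z | k <- iota 0 (B + B)].
pose letter (i : int) := nth [::] c (absz (i + B%:Z)%R).
have indexK k : absz (- B%:Z + k%:Z + B%:Z)%R = k by lia.
have us : uniq s by rewrite map_inj_uniq ?iota_uniq// => k k'; lia.
have := iid us (fun i => measurable_code_prefix (code_measurable tc) B (letter i)).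
have -> : [set x : seqT A | forall i, i \in s -> [set a | mkseq (code a) B = letter i] (x i)] =
    [set x : seqT A | window B (encode x) (- B%:Z) (B + B) = c].
  apply/seteqP; split=> x /=.
    move=> h; apply: (@eq_from_nth _ [::]); rewrite size_window ?size_c// => k hk.
    rewrite nth_window//; have := h (- B%:Z + k%:Z); rewrite /letter indexK => -> //.
    by apply/mapP; exists k => //; rewrite mem_iota.
  move=> e i /mapP[k]; rewrite mem_iota => /andP[_ hk] ->.
  by rewrite /letter indexK -e nth_window.
rewrite big_map => ->; rewrite (letter_wt_prod _ size_c) -prodEFin big_seq [RHS]big_seq.
apply: eq_bigr => k; rewrite mem_iota => /andP[_ hk]; rewrite /letter indexK.
apply: (code_sourceE _ (code_measurable tc)).
by apply/eqP/letters_c/mem_nth; rewrite size_c.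
Qed.

Lemma borel_process_in_range : borel_pred (process_in range).
Proof.
by move=> d T X mX; apply: (@measurable_forall _ _ int) => i; exact: (code_range_borel tc i mX).
Qed.

Lemma borel_decode_process (C : set (seqT A)) : measurable C ->
  borel_pred (fun z => process_in range z /\ C (decodeZ z)).
Proof.
move=> mC d T X mX; have m_range := borel_process_in_range mX.
apply: (@measurable_trace _ _ _ (@cyl_gen A) (fun t => decodeZ (X t)) _ m_range _ C mC).
move=> _ [i [B [mB ->]]].
apply: (@measurable_trace _ _ _ (@open A) (fun t => decodeZ (X t) i) _ m_range _ B mB) => U oU.
have [bits bitsP] := code_open tc oU.
rewrite (_ : [set t | _] = [set t | process_in range (X t) /\ exists k, bits k /\ X t i k]).
  apply: measurable_conj => //; apply: (@measurable_exists _ _ nat) => k.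
  by apply: measurable_conj; [exact: measurable_prop|exact: mX].
apply/seteqP; split=> t /= [in_range]; have [_ codeK] := code_decodeP tc (in_range i);
  by rewrite /decode_process bitsP codeK.
Qed.

Lemma encode_process_in_range x : process_in regular x -> process_in range (encode x).
Proof. by move=> h i; exact: (code_in_range tc (h i)). Qed.

Lemma encode_processK x : process_in regular x -> decodeZ (encode x) = x.
Proof.
move=> h; apply/funext => i; apply: (code_injective tc).
by case: (code_decodeP tc (code_in_range tc (h i))).
Qed.

Lemma decode_processP z : process_in range z ->
  process_in regular (decodeZ z) /\ encode (decodeZ z) = z.
Proof.
move=> h; split=> [i|]; first by case: (code_decodeP tc (h i)).
by apply/funext => i; case: (code_decodeP tc (h i)).
Qed.

Lemma agree_encode_process_near x m : process_in regular x ->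
  \forall x' \near x, agree_upto m (encode x) (encode x').
Proof.
move=> hx; pose L := [seq (j%:Z - m%:Z, k) | j <- iota 0 (m + m).+1, k <- iota 0 m].
have agree_L : \forall x' \near x, {in L, forall q, code (x' q.1) q.2 = code (x q.1) q.2}.
  apply: (@filter_in_seq _ _ (nbhs x) L
    (fun q => [set x' : seqsp A | code (x' q.1) q.2 = code (x q.1) q.2])) => q _.
  exact: (@proj_continuous int (fun=> A) q.1 x _ (code_continuous tc q.2 (hx q.1))).
apply: filterS agree_L => x' hx' i r hi hr; apply: (hx' (i, r)).
apply/allpairsP; exists (absz (i + m%:Z)%R, r).
by split; rewrite ?mem_iota /=; [lia|lia|congr pair; lia].
Qed.

End CodedProcess.

Section Transfer.
Context {R : realType} {A B : ptopologicalType}.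
Context {p : probability (borelT A) R} {q : probability (borelT B) R}.
Context {mu : probability (seqT A) R} {nu : probability (seqT B) R}.
Context {codeA : A -> nat -> bool} {decodeA : (nat -> bool) -> A} {regularA : set A}
  {rangeA : (nat -> bool) -> Prop}.
Context {codeB : B -> nat -> bool} {decodeB : (nat -> bool) -> B} {regularB : set B}
  {rangeB : (nat -> bool) -> Prop}.
Hypothesis tcA : topological_code p codeA decodeA regularA rangeA.
Hypothesis tcB : topological_code q codeB decodeB regularB rangeB.
Hypothesis iidA : iid_law p mu.
Hypothesis iidB : iid_law q nu.
Variables (F : bitarray -> bitarray) (D : bitarray -> Prop).
Hypothesis cF : coding (code_source p codeA) (code_source q codeB) F D.
Local Notation encodeA := (encode_process codeA).
Local Notation encodeB := (encode_process codeB).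
Implicit Types (x : seqsp A).

Definition transfer_domain : set (seqsp A) :=
  [set x | process_in regularA x /\ (D (encodeA x) /\ process_in rangeB (F (encodeA x)))].

Definition transfer x : seqsp B :=
  if `[< transfer_domain x >] then decode_process decodeB (F (encodeA x)) else (fun=> point).

Lemma transferE x : transfer_domain x -> transfer x = decode_process decodeB (F (encodeA x)).
Proof. by move=> h; rewrite /transfer asboolT. Qed.

Lemma transfer_out x : ~ transfer_domain x -> transfer x = (fun=> point).
Proof. by move=> h; rewrite /transfer asboolF. Qed.

Let m_encodeA : measurable_bits (encodeA : seqT A -> bitarray) := measurable_encode_process tcA.
Let m_encodeB : measurable_bits (encodeB : seqT B -> bitarray) := measurable_encode_process tcB.

Let m_image : measurable_bits (fun x : seqT A => F (encodeA x)).
Proof. by move=> i r; exact: (coding_borel cF i r m_encodeA). Qed.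

Let image_law : has_law (code_source q codeB) mu (fun x : seqT A => F (encodeA x)) :=
  coding_law cF m_encodeA (has_law_encode_process tcA iidA).

Lemma measurable_transfer_domain : measurable (transfer_domain : set (seqT A)).
Proof.
apply: (@measurable_conj _ (seqT A)); first exact: (measurable_process_in_regular tcA).
apply: (@measurable_conj _ (seqT A)); first exact: (coding_domain_borel cF m_encodeA).
exact: (borel_process_in_range tcB m_image).
Qed.

Lemma process_in_range_full : mu [set x | process_in rangeB (F (encodeA x))] = 1%E.
Proof.
rewrite (has_law_unique m_image m_encodeB image_law (has_law_encode_process tcB iidB)
  (borel_process_in_range tcB)).
rewrite -(probability_setT nu).
apply: (probability_eq_on (measurable_process_in_regular tcB)).
- exact: (borel_process_in_range tcB m_encodeB).
- by [].
- exact: (process_in_regular_full tcB iidB).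
by move=> y hy; split=> // _; exact: (encode_process_in_range tcB hy).
Qed.

Lemma transfer_domain_full : mu transfer_domain = 1%E.
Proof.
have m_D : measurable [set x : seqT A | D (encodeA x)].
  exact: (coding_domain_borel cF m_encodeA).
have m_range : measurable [set x : seqT A | process_in rangeB (F (encodeA x))].
  exact: (borel_process_in_range tcB m_image).
apply: (@probability_and1 R _ (seqT A)).
- exact: (measurable_process_in_regular tcA).
- exact: (@measurable_conj _ (seqT A)).
- exact: (process_in_regular_full tcA iidA).
apply: (@probability_and1 R _ (seqT A)) => //; last exact: process_in_range_full.
exact: (coding_full cF m_encodeA (has_law_encode_process tcA iidA)).
Qed.

Lemma measurable_transfer : measurable_fun setT (transfer : seqT A -> seqT B).
Proof.
move=> _ C mC; rewrite setTI; have m_dom := measurable_transfer_domain.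
have -> : transfer @^-1` C =
    [set x : seqT A | transfer_domain x /\ (process_in rangeB (F (encodeA x)) /\
       C (decode_process decodeB (F (encodeA x))))] `|`
    [set x : seqT A | ~ transfer_domain x /\ C (fun=> point)].
  apply/seteqP; split=> x /=.
    have [h|h] := pselect (transfer_domain x); last by rewrite transfer_out//; right.
    by rewrite transferE// => hC; left; split=> //; split=> //; case: h => _ [].
  by move=> [[h [_ hC]]|[h hC]]; [rewrite transferE|rewrite transfer_out].
apply: measurableU; apply: (@measurable_conj _ (seqT A)) => //.
- exact: (borel_decode_process tcB mC m_image).
- exact: measurable_not.
exact: measurable_prop.
Qed.

Lemma transfer_law (C : set (seqT B)) : measurable C -> mu (transfer @^-1` C) = nu C.
Proof.
move=> mC; pose decodes_in z := process_in rangeB z /\ C (decode_process decodeB z).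
have b_decodes : borel_pred decodes_in := borel_decode_process tcB mC.
transitivity (mu [set x : seqT A | decodes_in (F (encodeA x))]).
  apply: (probability_eq_on measurable_transfer_domain _ _ transfer_domain_full).
  - by rewrite -[_ @^-1` _]setTI; exact: measurable_transfer.
  - exact: (b_decodes _ _ _ m_image).
  move=> x hx /=; rewrite (transferE hx); split; last by case.
  by move=> h; split=> //; case: hx => _ [].
rewrite (has_law_unique m_image m_encodeB image_law (has_law_encode_process tcB iidB) b_decodes).
apply: (probability_eq_on (measurable_process_in_regular tcB) _ mC
  (process_in_regular_full tcB iidB)); first exact: (b_decodes _ _ _ m_encodeB).
move=> y hy /=; rewrite /decodes_in (encode_processK tcB hy).
by split=> [[]//|h]; split=> //; exact: (encode_process_in_range tcB hy).
Qed.

Lemma transfer_domain_shift x : transfer_domain (zshift x) <-> transfer_domain x.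
Proof.
rewrite /transfer_domain /= -[encodeA (zshift x)]/(bshift (encodeA x)).
rewrite (coding_domain_shift cF) (coding_shift cF).
have -> : process_in regularA (zshift x) = process_in regularA x.
  by apply/propext; exact: (forall_shift regularA x).
by have -> : process_in rangeB (bshift (F (encodeA x))) = process_in rangeB (F (encodeA x));
  first by apply/propext; exact: (forall_shift rangeB).
Qed.

Lemma transfer_shift x : transfer (zshift x) = zshift (transfer x).
Proof.
have [h|h] := pselect (transfer_domain x); last first.
  by rewrite !transfer_out// => /transfer_domain_shift.
rewrite !transferE//; last exact/transfer_domain_shift.
by rewrite -[encodeA (zshift x)]/(bshift (encodeA x)) (coding_shift cF).
Qed.

Lemma transfer_continuous : {within transfer_domain, continuous transfer}.
Proof.
apply/subspace_continuousP => x hx; have [reg_x [D_x range_x]] := hx.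
apply: cvg_ptws => i V hV; have near_V : nbhs (transfer x i) V := hV.
rewrite (transferE hx) in near_V.
have [r decode_V] := code_decode_continuous tcB (range_x i) near_V.
have [m F_agree] := local_on_agree (absz i + r).+1 (coding_local cF) D_x.
have near_x := agree_encode_process_near tcA m reg_x; rewrite /= /within /=.
apply: filterS near_x => x' agree hx'; have [_ [D_x' range_x']] := hx'.
change (V (transfer x' i)); rewrite (transferE hx'); apply: decode_V; first exact: range_x'.
apply/eq_in_map => k; rewrite mem_iota => /andP[_ hk].
by apply: (F_agree _ D_x' agree); lia.
Qed.

End Transfer.

Arguments transfer {A B} codeA regularA decodeB rangeB F D x.
Arguments transfer_domain {A} codeA regularA rangeB F D.

Lemma transfer_inverse (R : realType) (A B : ptopologicalType) (p : probability (borelT A) R)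
    (q : probability (borelT B) R) codeA decodeA regularA rangeA codeB decodeB regularB rangeB
    (F G : bitarray -> bitarray) (D E : bitarray -> Prop) :
  topological_code p codeA decodeA regularA rangeA ->
  topological_code q codeB decodeB regularB rangeB ->
  (forall x, D x -> E (F x) /\ G (F x) = x) ->
  forall x, transfer_domain codeA regularA rangeB F D x ->
    let y := transfer codeA regularA decodeB rangeB F D x in
    transfer_domain codeB regularB rangeA G E y /\
    transfer codeB regularB decodeA rangeA G E y = x.
Proof.
move=> tcA tcB DF x hx y; have [reg_x [D_x range_x]] := hx; have [E_Fx GF] := DF _ D_x.
have [reg_y encode_y] := decode_processP tcB range_x.
have yE : y = decode_process decodeB (F (encode_process codeA x)) := transferE hx.
have hy : transfer_domain codeB regularB rangeA G E y.
  rewrite yE; split=> //; rewrite encode_y; split=> //; rewrite GF.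
  exact: (encode_process_in_range tcA reg_x).
by split=> //; rewrite (transferE hy) yE encode_y GF; exact: (encode_processK tcA reg_x).
Qed.

Theorem theorem3p17 (R : realType) (A B : ptopologicalType)
  (p : probability (borelT A) R) (q : probability (borelT B) R)
  (mu : probability (seqT A) R) (nu : probability (seqT B) R) :
  polish R A -> polish R B ->
  iid_law p mu -> iid_law q nu ->
  iid_entropy p = iid_entropy q ->
  exists phi : seqsp A -> seqsp B,
    [/\ measurable_fun setT (phi : seqT A -> seqT B),
        (forall x : seqsp A, phi (zshift x) = zshift (phi x)),
        (forall F : set (seqT B), measurable F ->
           mu (phi @^-1` F) = nu F) &
        exists (E : set (seqT A)) (F : set (seqT B)) (psi : seqsp B -> seqsp A),
          [/\ measurable E /\ mu E = 1%E,
              measurable F /\ nu F = 1%E,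
              phi @` E = F /\ psi @` F = E,
              (forall x, E x -> psi (phi x) = x) /\ (forall y, F y -> phi (psi y) = y) &
              {within (E : set (seqsp A)), continuous phi} /\ {within (F : set (seqsp B)), continuous psi}]].
Proof.
move=> pA pB iidA iidB same_entropy.
have [codeA [decodeA [regA [rangeA tcA]]]] := topological_code_exists p pA.
have [codeB [decodeB [regB [rangeB tcB]]]] := topological_code_exists q pB.
have [mA mB] := (code_measurable tcA, code_measurable tcB).
have [injA injB] := (code_injective tcA, code_injective tcB).
have [F [G [D [E [cF cG DF EG]]]]] := process_iso_entropy
  (source_code_source p mA) (source_code_source q mB)
  (entropy_le_code_source mA injA mB injB same_entropy)
  (entropy_le_code_source mB injB mA injA (esym same_entropy)).
have inv_phi := transfer_inverse tcA tcB DF; have inv_psi := transfer_inverse tcB tcA EG.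
exists (transfer codeA regA decodeB rangeB F D); split.
- exact: (measurable_transfer tcA tcB cF).
- exact: (transfer_shift cF).
- exact: (transfer_law tcA tcB iidA iidB cF).
exists (transfer_domain codeA regA rangeB F D), (transfer_domain codeB regB rangeA G E).
exists (transfer codeB regB decodeA rangeA G E); split.
- split; first exact: (measurable_transfer_domain tcA tcB cF).
  exact: (transfer_domain_full tcA tcB iidA iidB cF).
- split; first exact: (measurable_transfer_domain tcB tcA cG).
  exact: (transfer_domain_full tcB tcA iidB iidA cG).
- split; first by apply: image_inverse inv_psi => x /inv_phi[].
  by apply: image_inverse inv_phi => y /inv_psi[].
- by split=> [x /inv_phi[]|y /inv_psi[]].
by split; [exact: (transfer_continuous tcA tcB cF)|exact: (transfer_continuous tcB tcA cG)].
Qed.
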